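(* Let $\mathcal K,\mathcal J$ be ideals in a right tensor $C^*$-precategory $\mathcal T$ with $\mathcal J\subset J(\mathcal K)$. Suppose that one of the following conditions holds: i) $\mathcal K\subset\mathcal J+\ker\otimes1$; ii) $\mathcal K$ admits a transfer homomorphism and $\mathcal J=J(\mathcal K)\cap(\ker\otimes1)^\perp$. Then every ideal in $\mathrm{Lat}_{\mathcal K_{\mathcal J}}(\mathcal K_{\mathcal J})$ has the form $\mathcal N_{\mathcal J}[\mathcal N]$ where $\mathcal N\in\mathrm{Lat}_{\mathcal J}(\mathcal K)$. As a consequence there are lattice isomorphisms $$\mathrm{Lat}_{\mathcal J}(\mathcal K)\cong\mathrm{Lat}_{\mathcal K_{\mathcal J}}(\mathcal K_{\mathcal J})\cong\mathrm{Lat}(\mathcal O_{\mathcal T}(\mathcal K,\mathcal J)).$$ Moreover, every gauge invariant ideal $P$ in $\mathcal O_{\mathcal T}(\mathcal K,\mathcal J)$ is generated by the image of a $\mathcal K$-invariant ideal $\mathcal N$ in $\mathcal K$, and $P\cong\mathcal O_{\mathcal T}(\mathcal N,\mathcal J\cap\mathcal N)$.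
   Context: $\mathbb N=\{0,1,2,\dots\}$. A $C^*$-precategory $\mathcal T$ with object set $\mathbb N$ consists of complex Banach spaces $\mathcal T(n,m)$, bilinear associative compositions $\mathcal T(n,m)\times\mathcal T(m,l)\to\mathcal T(n,l)$ with $\|ab\|\le\|a\|\|b\|$, and antilinear involutive maps $*:\mathcal T(n,m)\to\mathcal T(m,n)$ with $(ab)^*=b^*a^*$ and $\|a^*a\|=\|a\|^2$. An ideal $\mathcal K$ in $\mathcal T$ is a family of closed subspaces $\mathcal K(n,m)\subset\mathcal T(n,m)$ stable under left and right composition with morphisms of $\mathcal T$ (an ideal is determined by its diagonal entries $\mathcal K(n,n)$); inclusions, intersections, sums are entrywise; $q_{\mathcal J}:\mathcal T\to\mathcal T/\mathcal J$ is the entrywise quotient map. A right tensor $C^*$-precategory is such a $\mathcal T$ with linear maps $\otimes1:\mathcal T(n,m)\to\mathcal T(n+1,m+1)$ preserving composition and involution; $\otimes1^k$ is the $k$-th iterate; $(\otimes1)^{-1}(\mathcal N)(n,m)=\{a\in\mathcal T(n,m):a\otimes1\in\mathcal N(n+1,m+1)\}$; $\ker\otimes1=(\otimes1)^{-1}(\{0\})$; $J(\mathcal K)=\mathcal K\cap(\otimes1)^{-1}(\mathcal K)$. For an ideal $\mathcal I$, $\mathcal I^\perp$ is the unique ideal with $\mathcal I^\perp(n,n)=\{a\in\mathcal T(n,n):a\,\mathcal I(n,n)=0\}$. $\mathcal K$ admits a transfer homomorphism if $\otimes1$ maps $(J(\mathcal K)\cap(\ker\otimes1)^\perp)(n,m)$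 onto $\mathcal K(n+1,m+1)$ for all $n,m\in\mathbb N$. An ideal $\mathcal N$ is $\mathcal K$-invariant if $(\mathcal N(n,m)\otimes1)\mathcal K(m+1,l)\subset\mathcal N(n+1,l)$ for all $n,m,l\in\mathbb N$; it is $\mathcal J$-saturated if $\mathcal J\cap(\otimes1)^{-1}(\mathcal N)\subset\mathcal N$. $\mathrm{Lat}_{\mathcal J}(\mathcal K)$ is the lattice (under inclusion) of $\mathcal K$-invariant $\mathcal J$-saturated ideals in $\mathcal K$. A right tensor representation of $\mathcal K$ in a $C^*$-algebra $B$ is a family of linear maps $\pi_{n,m}:\mathcal K(n,m)\to B$ with $\pi_{n,m}(a)^*=\pi_{m,n}(a^* )$ and $\pi_{n,m}(a)\pi_{m+k,l}(b)=\pi_{n+k,l}((a\otimes1^k)b)$ for $a\in\mathcal K(n,m)$, $b\in\mathcal K(m+k,l)$; it is coisometric on $\mathcal J\subset J(\mathcal K)$ if $\pi_{n,m}(a)=\pi_{n+1,m+1}(a\otimes1)$ for $a\in\mathcal J(n,m)$. $\mathcal O_{\mathcal T}(\mathcal K,\mathcal J)$ is the universal $C^*$-algebra generated by the image of a universal right tensor representation $\iota$ of $\mathcal K$ coisometric on $\mathcal J$, with gauge action $\gamma_z(\iota_{n,m}(a))=z^{n-m}\iota_{n,m}(a)$; $\mathrm{Lat}(\mathcal O_{\mathcal T}(\mathcal K,\mathcal J))$ is the lattice of its gauge invariant ideals. $\mathcal K_{\mathcal J}$: let $\mathcal M_{\mathcal T}(\mathcal K)$ be the $*$-algebra of matrices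 $\{a_{n,m}\}$, $a_{n,m}\in\mathcal K(n,m)$, finitely many nonzero, with entrywise linear structure, $(a^* )_{n,m}=(a_{m,n})^*$ and bilinear product where, with $\iota^{\mathcal M}_{n,m}(a)$ the matrix with single entry $a$ at $(n,m)$, $\iota^{\mathcal M}_{n,m}(a)\star\iota^{\mathcal M}_{p,l}(b)$ is $\iota^{\mathcal M}_{n+p-m,l}((a\otimes1^{p-m})b)$ if $m\le p$ and $\iota^{\mathcal M}_{n,l+m-p}(a(b\otimes1^{m-p}))$ if $p<m$. $\mathcal M(r+k,r)$ is the set of matrices with $a_{n,m}\neq0\Rightarrow n-m=k,\ m\le r$, with seminorm $\|a\|^{\mathcal J}_{r+k,r}=\max\{\max_{s<r}\|q_{\mathcal J}(x_s)\|,\|x_r\|\}$, $x_s=\sum_{0\le i\le s,\,i+k\ge0}a_{i+k,i}\otimes1^{s-i}$, and $\mathcal K_{\mathcal J}(n,m)=\mathcal M(n,m)/\|\cdot\|^{\mathcal J}_{n,m}$ (quotient by zero-seminorm elements), a right tensor $C^*$-precategory with right tensoring $\otimes_{\mathcal J}1$ induced by the inclusions $\mathcal M(n,m)\subset\mathcal M(n+1,m+1)$. $\mathrm{Lat}_{\mathcal K_{\mathcal J}}(\mathcal K_{\mathcal J})$ is the lattice of ideals $\mathcal N'$ in $\mathcal K_{\mathcal J}$ with $\mathcal N'\otimes_{\mathcal J}1\subset\mathcal N'$ and $(\otimes_{\mathcal J}1)^{-1}(\mathcal N')\subset\mathcal N'$. For $\mathcal N\in\mathrm{Lat}_{\mathcal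 J}(\mathcal K)$, $\mathcal N_{\mathcal J}[\mathcal N]$ is the ideal in $\mathcal K_{\mathcal J}$ with $\mathcal N_{\mathcal J}[\mathcal N](r,r)=\{\sum_{j=0}^r\iota^{\mathcal M}_{j,j}(a_j):a_j\in\mathcal N(j,j)\}$ (classes in $\mathcal K_{\mathcal J}(r,r)$).
   Formalization: A C*-precategory is additionally required to satisfy positivity: for each a in T(n,m), a*a = b*b for some b in T(m,m); without it the claim fails (2×2 matrix units with e_01* = -e_10, ⊗1 = 0, K = T, J = 0). *)

(* Defs.v *)
From HB Require Import structures.
From mathcomp Require Import all_boot all_order all_algebra.
From mathcomp Require Import complex zify.
From mathcomp Require Import all_classical all_reals all_analysis.

Set Implicit Arguments.
Unset Strict Implicit.
Unset Printing Implicit Defensive.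

Import Order.TTheory GRing.Theory Num.Theory.
Import numFieldNormedType.Exports.

Local Open Scope classical_set_scope.
Local Open Scope ring_scope.

(* R[i] as a numClosedFieldType, without the reverse coercion that elaborating
   "normedModType R[i]" would insert *)
Notation Cx R := (complex_complex__canonical__Num_ClosedField R).

(* Operations only, no laws: the part of a right tensor C*-precategory on which
   ideals and their stability under right tensoring depend (the involution does
   not enter there).  It is shared by T and by K_J.                            *)
Record rtPrecat (R : realType) : Type := RtPrecat {
  hom :> nat -> nat -> normedModType (Cx R);
  acomp : forall n m l : nat, hom n m -> hom m l -> hom n l;
  tens : forall n m : nat, hom n m -> hom n.+1 m.+1 }.

Arguments acomp {R _ n m l} a b.
Arguments tens {R _ n m} a.

(* cp_pos is the positivity of a^* a in the C*-algebra T(m,m), part of the usual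
   (Ghez-Lima-Roberts) definition of a C*-(pre)category.  It does not follow from
   the C*-identity: the 2 x 2 matrix units with e_01^* = - e_10 satisfy all the
   other laws.                                                                  *)
Record is_rtCstarPrecat (R : realType) (T : rtPrecat R)
    (astar : forall n m : nat, T n m -> T m n) : Prop := IsRtCstarPrecat {
  cp_complete : forall (n m : nat) (F : set_system (T n m)),
    ProperFilter F -> cauchy F -> cvg F;
  cp_compDl : forall (n m l : nat) (c : R[i]) (a a' : T n m) (b : T m l),
    acomp (c *: a + a') b = c *: acomp a b + acomp a' b;
  cp_compDr : forall (n m l : nat) (c : R[i]) (a : T n m) (b b' : T m l),
    acomp a (c *: b + b') = c *: acomp a b + acomp a b';
  cp_compA : forall (n m l k : nat) (a : T n m) (b : T m l) (c : T l k),
    acomp a (acomp b c) = acomp (acomp a b) c;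
  cp_normM : forall (n m l : nat) (a : T n m) (b : T m l),
    `|acomp a b| <= `|a| * `|b|;
  cp_invD : forall (n m : nat) (c : R[i]) (a b : T n m),
    astar n m (c *: a + b) = c^* *: astar n m a + astar n m b;
  cp_invK : forall (n m : nat) (a : T n m), astar m n (astar n m a) = a;
  cp_invM : forall (n m l : nat) (a : T n m) (b : T m l),
    astar n l (acomp a b) = acomp (astar m l b) (astar n m a);
  cp_cstar : forall (n m : nat) (a : T n m),
    `|acomp (astar n m a) a| = `|a| ^+ 2;
  cp_pos : forall (n m : nat) (a : T n m),
    exists b : T m m, acomp (astar n m a) a = acomp (astar m m b) b;
  cp_tensD : forall (n m : nat) (c : R[i]) (a b : T n m),
    tens (c *: a + b) = c *: tens a + tens b;
  cp_tensM : forall (n m l : nat) (a : T n m) (b : T m l),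
    tens (acomp a b) = acomp (tens a) (tens b);
  cp_tens_inv : forall (n m : nat) (a : T n m),
    tens (astar n m a) = astar n.+1 m.+1 (tens a) }.

Record rtCstarPrecat (R : realType) : Type := RtCstarPrecat {
  rtp :> rtPrecat R;
  astar : forall n m : nat, rtp n m -> rtp m n;
  rtpP : is_rtCstarPrecat astar }.

Arguments astar {R _ n m} a.

(* a (x) 1^k; k + n is the ssrnat sum, which unfolds on k, so no cast is needed *)
Fixpoint tensn (R : realType) (T : rtPrecat R) (k n m : nat) (a : T n m) :
    T (k + n)%N (k + m)%N :=
  match k return T (k + n)%N (k + m)%N with
  | 0%N => a
  | k'.+1 => tens (tensn k' a)
  end.

Notation fam T := (forall n m : nat, set (T n m)).

Section Families.
Variables (R : realType) (T : rtPrecat R).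
Implicit Types N I K : fam T.

Definition fam_le N I : Prop := forall n m, N n m `<=` I n m.
Definition famI N I : fam T := fun n m => N n m `&` I n m.
Definition famD N I : fam T :=
  fun n m => [set a + b | a in N n m & b in I n m].
Arguments famI N I n m : clear implicits.
Arguments famD N I n m : clear implicits.

Record is_ideal N : Prop := IsIdeal {
  ideal_closed : forall n m, closed (N n m);
  ideal0 : forall n m, N n m 0;
  idealD : forall n m (c : R[i]) (a b : T n m),
    N n m a -> N n m b -> N n m (c *: a + b);
  idealMl : forall n m l (a : T n m) (b : T m l), N m l b -> N n l (acomp a b);
  idealMr : forall n m l (a : T n m) (b : T m l), N n m a -> N n l (acomp a b) }.

Definition tens_preim N : fam T := fun n m => [set a | N n.+1 m.+1 (tens a)].
Definition ker_tens : fam T := tens_preim (fun n m => [set 0]).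
Definition Jof K : fam T := famI K (tens_preim K).
Arguments tens_preim N n m : clear implicits.
Arguments ker_tens n m : clear implicits.
Arguments Jof K n m : clear implicits.

(* P is I^\perp: an ideal is determined by its diagonal entries *)
Definition is_annihilator I P : Prop :=
  is_ideal P /\
  forall n, P n n = [set a | forall b, I n n b -> acomp a b = 0].

Definition admits_transfer K : Prop :=
  exists2 P : fam T, is_annihilator ker_tens P &
    forall n m, tens @` (famI (Jof K) P n m) = K n.+1 m.+1.

Definition Kinvariant K N : Prop :=
  forall n m l (a : T n m) (b : T m.+1 l),
    N n m a -> K m.+1 l b -> N n.+1 l (acomp (tens a) b).

Definition Jsaturated J N : Prop := fam_le (famI J (tens_preim N)) N.

Definition Lat (J K : fam T) : set (fam T) :=
  [set N | [/\ is_ideal N, fam_le N K, Kinvariant K N & Jsaturated J N]].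

(* Lat_T(T), where being T-invariant means being stable under right tensoring *)
Definition Lat_self : set (fam T) :=
  [set N | [/\ is_ideal N,
               forall n m (a : T n m), N n m a -> N n.+1 m.+1 (tens a) &
               fam_le (tens_preim N) N]].

End Families.

Arguments famI {R T} N I n m.
Arguments famD {R T} N I n m.
Arguments tens_preim {R T} N n m.
Arguments ker_tens {R} T n m.
Arguments Jof {R T} K n m.

Record ideal (R : realType) (T : rtPrecat R) : Type := Ideal {
  ideal_fam :> fam T;
  idealP : is_ideal ideal_fam }.

Section Lattices.

Definition is_glb (A : Type) (le : A -> A -> Prop) (X : set A) (x y z : A) :=
  [/\ X z, le z x, le z y & forall w, X w -> le w x -> le w y -> le w z].

Definition is_lub (A : Type) (le : A -> A -> Prop) (X : set A) (x y z : A) :=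
  [/\ X z, le x z, le y z & forall w, X w -> le x w -> le y w -> le z w].

Definition is_lattice (A : Type) (le : A -> A -> Prop) (X : set A) : Prop :=
  forall x y, X x -> X y ->
    (exists z, is_glb le X x y z) /\ (exists z, is_lub le X x y z).

Definition lattice_iso (A B : Type) (leA : A -> A -> Prop)
    (leB : B -> B -> Prop) (X : set A) (Y : set B) (f : A -> B) : Prop :=
  [/\ is_lattice leA X, is_lattice leB Y, set_bij X Y f &
      forall x y z, X x -> X y ->
        (is_glb leA X x y z -> is_glb leB Y (f x) (f y) (f z)) /\
        (is_lub leA X x y z -> is_lub leB Y (f x) (f y) (f z))].

End Lattices.

Record cstarAlg (R : realType) : Type := CstarAlg {
  ca_space :> completeNormedModType (Cx R);
  ca_mul : ca_space -> ca_space -> ca_space;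
  ca_star : ca_space -> ca_space;
  ca_mulDl : forall (c : R[i]) (a a' b : ca_space),
    ca_mul (c *: a + a') b = c *: ca_mul a b + ca_mul a' b;
  ca_mulDr : forall (c : R[i]) (a b b' : ca_space),
    ca_mul a (c *: b + b') = c *: ca_mul a b + ca_mul a b';
  ca_mulA : forall a b c : ca_space, ca_mul a (ca_mul b c) = ca_mul (ca_mul a b) c;
  ca_normM : forall a b : ca_space, `|ca_mul a b| <= `|a| * `|b|;
  ca_starD : forall (c : R[i]) (a b : ca_space),
    ca_star (c *: a + b) = c^* *: ca_star a + ca_star b;
  ca_starK : forall a : ca_space, ca_star (ca_star a) = a;
  ca_starM : forall a b : ca_space,
    ca_star (ca_mul a b) = ca_mul (ca_star b) (ca_star a);
  ca_cstar : forall a : ca_space, `|ca_mul (ca_star a) a| = `|a| ^+ 2 }.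

Arguments ca_mul {R _} a b.
Arguments ca_star {R _} a.

Record is_starhom (R : realType) (A B : cstarAlg R) (f : A -> B) : Prop :=
  IsStarhom {
  starhomD : forall (c : R[i]) (a b : A), f (c *: a + b) = c *: f a + f b;
  starhomM : forall a b : A, f (ca_mul a b) = ca_mul (f a) (f b);
  starhom_star : forall a : A, f (ca_star a) = ca_star (f a) }.

Record is_subcstar (R : realType) (A : cstarAlg R) (S : set A) : Prop :=
  IsSubcstar {
  subcstar_closed : closed S;
  subcstar0 : S 0;
  subcstarD : forall (c : R[i]) (a b : A), S a -> S b -> S (c *: a + b);
  subcstarM : forall a b : A, S a -> S b -> S (ca_mul a b);
  subcstar_star : forall a : A, S a -> S (ca_star a) }.

Record is_cideal (R : realType) (A : cstarAlg R) (P : set A) : Prop :=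
  IsCideal {
  cideal_closed : closed P;
  cideal0 : P 0;
  cidealD : forall (c : R[i]) (a b : A), P a -> P b -> P (c *: a + b);
  cidealMl : forall a b : A, P b -> P (ca_mul a b);
  cidealMr : forall a b : A, P a -> P (ca_mul a b) }.

Definition cideal_gen (R : realType) (A : cstarAlg R) (S : set A) : set A :=
  \bigcap_(P in [set P | is_cideal P /\ S `<=` P]) P.

Section Representations.
Variables (R : realType) (T : rtCstarPrecat R).
Implicit Types K J : fam T.

(* Only the values of pi n m on K n m matter. *)
Record is_rep K (B : cstarAlg R) (pi : forall n m, T n m -> B) : Prop := IsRep {
  repD : forall n m (c : R[i]) (a b : T n m), K n m a -> K n m b ->
    pi n m (c *: a + b) = c *: pi n m a + pi n m b;
  rep_star : forall n m (a : T n m), K n m a ->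
    ca_star (pi n m a) = pi m n (astar a);
  repM : forall n m k l (a : T n m) (b : T (k + m)%N l),
    K n m a -> K (k + m)%N l b ->
    ca_mul (pi n m a) (pi (k + m)%N l b) = pi (k + n)%N l (acomp (tensn k a) b) }.

Definition coisometric J (B : cstarAlg R) (pi : forall n m, T n m -> B) : Prop :=
  forall n m (a : T n m), J n m a -> pi n m a = pi n.+1 m.+1 (tens a).

Definition rep_image K (B : cstarAlg R) (pi : forall n m, T n m -> B) : set B :=
  \bigcup_n \bigcup_m (pi n m @` K n m).

(* (O, iota) is O_T(K,J) with its universal representation *)
Record is_universal K J (O : cstarAlg R) (iota : forall n m, T n m -> O) : Prop :=
  IsUniversal {
  univ_rep : is_rep K iota;
  univ_coisometric : coisometric J iota;
  univ_generated : forall S : set O,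
    is_subcstar S -> rep_image K iota `<=` S -> S = setT;
  univ_factor : forall (B : cstarAlg R) (pi : forall n m, T n m -> B),
    is_rep K pi -> coisometric J pi ->
    exists2 phi : O -> B, is_starhom phi &
      forall n m (a : T n m), K n m a -> phi (iota n m a) = pi n m a }.

Definition is_gauge K (O : cstarAlg R) (iota : forall n m, T n m -> O)
    (gamma : R[i] -> O -> O) : Prop :=
  forall z : R[i], `|z| = 1 ->
    is_starhom (gamma z) /\
    forall n m (a : T n m), K n m a ->
      gamma z (iota n m a) = z ^ (n%:Z - m%:Z) *: iota n m a.

Definition Lat_gauge (O : cstarAlg R) (gamma : R[i] -> O -> O) : set (set O) :=
  [set P | is_cideal P /\
           forall z : R[i], `|z| = 1 -> gamma z @` P `<=` P].

Definition star_isomorphic (A B : cstarAlg R) (P : set B) : Prop :=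
  exists2 phi : A -> B, is_starhom phi & set_bij setT P phi.

End Representations.

Record seminorm (R : realType) (V : lmodType (Cx R)) : Type := Seminorm {
  sn_fun :> V -> R[i];
  sn_ler : forall x y : V, sn_fun (x + y) <= sn_fun x + sn_fun y;
  sn_scale : forall (c : R[i]) (x : V), sn_fun (c *: x) = `|c| * sn_fun x }.

Section SeminormQuotient.
Variables (R : realType) (V : lmodType (Cx R)) (p : seminorm V).

Lemma sn0 : p 0 = 0.
Proof. by rewrite -(scale0r 0) sn_scale normr0 mul0r. Qed.

Lemma snN x : p (- x) = p x.
Proof. by rewrite -scaleN1r sn_scale normrN normr1 mul1r. Qed.

Lemma sn_ge0 x : 0 <= p x.
Proof.
have := sn_ler p x (- x); rewrite subrr sn0 snN -mulr2n -mulr_natl.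
by rewrite pmulr_rge0 // ltr0n.
Qed.

Lemma sn_eq0D x y : p x = 0 -> p y = 0 -> p (x + y) = 0.
Proof.
move=> px py; apply/eqP; rewrite eq_le sn_ge0 andbT.
by rewrite (le_trans (sn_ler _ _ _)) // px py addr0.
Qed.

Lemma sn_distE x y : p (x - y) = 0 -> p x = p y.
Proof.
move=> pxy; apply/eqP; rewrite eq_le; apply/andP; split.
  by rewrite -{1}(subrK y x) (le_trans (sn_ler _ _ _)) // pxy add0r.
rewrite -{1}(subrK x y) (le_trans (sn_ler _ _ _)) //.
by rewrite -opprB snN pxy add0r.
Qed.

Definition sn_equiv (x y : V) : bool := p (x - y) == 0.

Lemma sn_equiv_is_equiv : equiv_class_of sn_equiv.
Proof.
split=> [x|x y|y x z]; first by rewrite /sn_equiv subrr sn0.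
  by rewrite /sn_equiv -opprB snN.
rewrite /sn_equiv => /eqP xy /eqP yz; apply/eqP.
by rewrite -(subrK y x) -addrA sn_eq0D.
Qed.

Canonical sn_equiv_rel := EquivRelPack sn_equiv_is_equiv.

Local Open Scope quotient_scope.

Definition sn_quot : Type := {eq_quot sn_equiv}.
HB.instance Definition _ := Choice.on sn_quot.
HB.instance Definition _ := EqQuotient.on sn_quot.

Definition sn_cls (x : V) : sn_quot := \pi_sn_quot x.
Definition sn_rep (x : sn_quot) : V := repr x.

Lemma sn_repK x : sn_cls (sn_rep x) = x. Proof. exact: reprK. Qed.

Lemma sn_clsP x y : sn_cls x = sn_cls y <-> p (x - y) = 0.
Proof. by split=> [/eqmodP/eqP|xy]; [|apply/eqmodP/eqP]. Qed.

Lemma sn_repP x : p (sn_rep (sn_cls x) - x) = 0.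
Proof. by apply/sn_clsP; rewrite sn_repK. Qed.

Definition sn_add (x y : sn_quot) := sn_cls (sn_rep x + sn_rep y).
Definition sn_opp (x : sn_quot) := sn_cls (- sn_rep x).
Definition sn_scl (c : R[i]) (x : sn_quot) := sn_cls (c *: sn_rep x).
Definition sn_norm (x : sn_quot) : R[i] := p (sn_rep x).

Lemma sn_addE x y : sn_add (sn_cls x) (sn_cls y) = sn_cls (x + y).
Proof. by apply/sn_clsP; rewrite opprD addrACA sn_eq0D ?sn_repP. Qed.

Lemma sn_oppE x : sn_opp (sn_cls x) = sn_cls (- x).
Proof. by apply/sn_clsP; rewrite -opprD snN sn_repP. Qed.

Lemma sn_sclE c x : sn_scl c (sn_cls x) = sn_cls (c *: x).
Proof. by apply/sn_clsP; rewrite -scalerBr sn_scale sn_repP mulr0. Qed.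

Lemma sn_normE x : sn_norm (sn_cls x) = p x.
Proof. exact/sn_distE/sn_repP. Qed.

Lemma sn_ind (P : sn_quot -> Prop) : (forall x, P (sn_cls x)) -> forall x, P x.
Proof. by move=> Pc x; rewrite -(sn_repK x). Qed.

Fact sn_addA : associative sn_add.
Proof.
by elim/sn_ind=> x; elim/sn_ind=> y; elim/sn_ind=> z; rewrite !sn_addE addrA.
Qed.

Fact sn_addC : commutative sn_add.
Proof. by move=> x y; rewrite /sn_add addrC. Qed.

Fact sn_add0 : left_id (sn_cls 0) sn_add.
Proof. by elim/sn_ind=> x; rewrite sn_addE add0r. Qed.

Fact sn_addN : left_inverse (sn_cls 0) sn_opp sn_add.
Proof. by elim/sn_ind=> x; rewrite sn_oppE sn_addE addNr. Qed.

HB.instance Definition _ :=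
  GRing.isZmodule.Build sn_quot sn_addA sn_addC sn_add0 sn_addN.

Fact sn_sclA a b x : sn_scl a (sn_scl b x) = sn_scl (a * b) x.
Proof. by elim/sn_ind: x => x; rewrite !sn_sclE scalerA. Qed.

Fact sn_scl1 : left_id 1 sn_scl.
Proof. by elim/sn_ind=> x; rewrite sn_sclE scale1r. Qed.

Fact sn_sclDr : right_distributive sn_scl +%R.
Proof.
move=> c; elim/sn_ind=> x; elim/sn_ind=> y.
have -> : sn_cls x + sn_cls y = sn_cls (x + y) by exact: sn_addE.
by rewrite !sn_sclE [RHS]sn_addE scalerDr.
Qed.

Fact sn_sclDl x : {morph sn_scl^~ x : a b / a + b}.
Proof.
by elim/sn_ind: x => x a b; rewrite !sn_sclE [RHS]sn_addE scalerDl.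
Qed.

HB.instance Definition _ := GRing.Zmodule_isLmodule.Build (Cx R) sn_quot
  sn_sclA sn_scl1 sn_sclDr sn_sclDl.

Fact sn_normD (x y : sn_quot) : sn_norm (x + y) <= sn_norm x + sn_norm y.
Proof.
elim/sn_ind: x => x; elim/sn_ind: y => y.
by rewrite [_ + _]sn_addE !sn_normE sn_ler.
Qed.

Fact sn_normZ (c : R[i]) (x : sn_quot) : sn_norm (c *: x) = `|c| * sn_norm x.
Proof. by elim/sn_ind: x => x; rewrite [c *: _]sn_sclE !sn_normE sn_scale. Qed.

Fact sn_norm0_eq0 (x : sn_quot) : sn_norm x = 0 -> x = 0.
Proof.
elim/sn_ind: x => x; rewrite sn_normE => px.
by apply/sn_clsP; rewrite subr0.
Qed.

HB.instance Definition _ := Lmodule_isNormed.Build (Cx R) sn_quot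
  sn_normD sn_normZ sn_norm0_eq0.

Lemma sn_cls_norm (x : V) : `|sn_cls x| = p x.
Proof. exact: sn_normE. Qed.

Lemma sn_cls_linear : linear sn_cls.
Proof.
by move=> c x y; rewrite [c *: sn_cls x]sn_sclE [RHS]sn_addE.
Qed.

End SeminormQuotient.

Definition mat (R : realType) (T : rtPrecat R) : Type :=
  forall i j : nat, T i j.

Section Matrices.
Variables (R : realType) (T : rtPrecat R).
Implicit Types a b : mat T.

(* the entries moved one step down the diagonal:
   (shift a)_{i+1,j+1} = a_{i,j} (x) 1, zeros in row 0 and in column 0 *)
Definition shift a : mat T := fun i j =>
  match i, j return T i j with
  | i'.+1, j'.+1 => tens (a i' j')
  | i', j' => 0
  end.

Lemma shiftE k a i j : iter k shift a (k + i)%N (k + j)%N = tensn k (a i j).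
Proof. by elim: k => //= k IHk; rewrite IHk. Qed.

(* the row-by-column product; \sum_(k \in setT) is a finitely supported sum *)
Definition mat_mul a b : mat T := fun i j =>
  \sum_(k \in [set: nat]) acomp (a i k) (b k j).

(* The product \star.  By shiftE the (n,m) entry a_{n,m} of a contributes
   a_{n,m} (x) 1^k at (k+n,k+m) to the k-th shift of a; it meets there the
   entries of b in row p = k + m.  Symmetrically for p < m, with k > 0.
   See star_iotaM_l and star_iotaM_r.  The sums stop at i and j because the k-th
   shift has zero rows and columns of index < k.                              *)
Definition mat_star a b : mat T := fun i j =>
  \sum_(0 <= k < i.+1) mat_mul (iter k shift a) b i j +
  \sum_(1 <= k < j.+1) mat_mul a (iter k shift b) i j.

(* x_s at its place (i,j) = (s+k,s) on the diagonal:
   sum over t <= min(i,j) of a_{i-t,j-t} (x) 1^t *)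
Definition diag_sum a : mat T := fun i j =>
  \sum_(0 <= t < (minn i j).+1) iter t shift a i j.

(* iota^M_{n,m}(x) *)
Definition iotaM n m (x : T n m) : mat T := fun i j =>
  match @eqP nat n i, @eqP nat m j with
  | ReflectT en, ReflectT em =>
      ecast m' (T i m') em (ecast n' (T n' m) en x)
  | _, _ => 0
  end.

Lemma iotaM_id n m (x : T n m) : iotaM x n m = x.
Proof.
rewrite /iotaM; case: eqP => [en|//]; case: eqP => [em|//].
by rewrite (eq_axiomK en) (eq_axiomK em).
Qed.

Lemma iotaM_out n m (x : T n m) i j : (n != i) || (m != j) -> iotaM x i j = 0.
Proof.
move=> nm; rewrite /iotaM; case: eqP => [en|//]; case: eqP => [em|//].
by exfalso; move: nm; rewrite en em !eqxx.
Qed.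

Fact mat_eqP a b : (forall i j, a i j = b i j) -> a = b.
Proof. by move=> ab; do 2!apply: functional_extensionality_dep => ?. Qed.

HB.instance Definition _ := gen_eqMixin (mat T).
HB.instance Definition _ := gen_choiceMixin (mat T).

Definition mat_add a b : mat T := fun i j => a i j + b i j.
Definition mat_opp a : mat T := fun i j => - a i j.
Definition mat_zero : mat T := fun i j => 0.
Definition mat_scale (c : R[i]) a : mat T := fun i j => c *: a i j.

Fact mat_addA : associative mat_add.
Proof. by move=> a b c; apply: mat_eqP => i j; apply: addrA. Qed.
Fact mat_addC : commutative mat_add.
Proof. by move=> a b; apply: mat_eqP => i j; apply: addrC. Qed.
Fact mat_add0 : left_id mat_zero mat_add.
Proof. by move=> a; apply: mat_eqP => i j; apply: add0r. Qed.
Fact mat_addN : left_inverse mat_zero mat_opp mat_add.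
Proof. by move=> a; apply: mat_eqP => i j; apply: addNr. Qed.

HB.instance Definition _ :=
  GRing.isZmodule.Build (mat T) mat_addA mat_addC mat_add0 mat_addN.

Fact mat_scaleA c d a : mat_scale c (mat_scale d a) = mat_scale (c * d) a.
Proof. by apply: mat_eqP => i j; apply: scalerA. Qed.
Fact mat_scale1 : left_id 1 mat_scale.
Proof. by move=> a; apply: mat_eqP => i j; apply: scale1r. Qed.
Fact mat_scaleDr : right_distributive mat_scale +%R.
Proof. by move=> c a b; apply: mat_eqP => i j; apply: scalerDr. Qed.
Fact mat_scaleDl a : {morph mat_scale^~ a : c d / c + d}.
Proof. by move=> c d; apply: mat_eqP => i j; apply: scalerDl. Qed.

HB.instance Definition _ := GRing.Zmodule_isLmodule.Build (Cx R) (mat T)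
  mat_scaleA mat_scale1 mat_scaleDr mat_scaleDl.

End Matrices.

Section StarProduct.
Variables (R : realType) (T : rtCstarPrecat R).

Fact acomp0l n m l (b : T m l) : acomp (0 : T n m) b = 0.
Proof.
by have := cp_compDl (rtpP T) (-1) (0 : T n m) 0 b; rewrite scaler0 addr0 scaleN1r addNr.
Qed.

Fact acomp0r n m l (a : T n m) : acomp a (0 : T m l) = 0.
Proof.
by have := cp_compDr (rtpP T) (-1) a (0 : T m l) 0; rewrite scaler0 addr0 scaleN1r addNr.
Qed.

Fact tens0 n m : tens (0 : T n m) = 0.
Proof.
by have := cp_tensD (rtpP T) (-1) (0 : T n m) 0; rewrite scaler0 addr0 scaleN1r addNr.
Qed.

Fact shift_iotaM k n m (a : T n m) : iter k (@shift _ T) (iotaM a) = iotaM (tensn k a).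
Proof.
elim: k => //= k ->; apply: mat_eqP => -[|i] [|j] /=.
- by rewrite iotaM_out.
- by rewrite iotaM_out.
- by rewrite iotaM_out ?orbT.
have [/andP[/eqP ei /eqP ej]|] := boolP ((k + n == i)%N && (k + m == j)%N).
  by case: _ / ei; case: _ / ej; rewrite !iotaM_id.
rewrite negb_and => nij.
by rewrite !iotaM_out ?eqSS // tens0.
Qed.

Fact mat_mul_iotaM n m l (a : T n m) (b : T m l) :
  mat_mul (iotaM a) (iotaM b) = iotaM (acomp a b).
Proof.
apply: mat_eqP => i j; rewrite /mat_mul.
rewrite -(@fsbig_widen _ _ _ _ [set m] setT) //; last first.
  move=> k [_ /= /eqP km].
  by rewrite /preimage /= [iotaM a i k]iotaM_out ?acomp0l // [m == k]eq_sym km orbT.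
rewrite fsbig_set1.
have [/andP[/eqP ei /eqP ej]|] := boolP ((n == i)%N && (l == j)%N).
  by case: _ / ei; case: _ / ej; rewrite !iotaM_id.
rewrite negb_and => /orP[ni|lj].
  by rewrite [iotaM a _ _]iotaM_out ?ni // acomp0l iotaM_out // ni.
by rewrite [iotaM b _ _]iotaM_out ?lj ?orbT // acomp0r iotaM_out // lj orbT.
Qed.

Fact mat_mul_iotaM0 n m p l (a : T n m) (b : T p l) : m != p ->
  mat_mul (iotaM a) (iotaM b) = (0 : mat T).
Proof.
move=> mp; apply: mat_eqP => i j; apply: fsbig1 => k _.
have [mk|mk] := eqVneq m k; last by rewrite iotaM_out ?mk ?orbT // acomp0l.
by rewrite [X in acomp _ X]iotaM_out ?acomp0r // -mk eq_sym mp.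
Qed.

(* m <= p *)
Lemma star_iotaM_l n m k l (a : T n m) (b : T (k + m)%N l) :
  mat_star (iotaM a) (iotaM b) = iotaM (acomp (tensn k a) b).
Proof.
apply: mat_eqP => i j; rewrite /mat_star [X in _ + X]big1_seq ?addr0; last first.
  move=> t /andP[_]; rewrite mem_index_iota => /andP[t0 _].
  by rewrite shift_iotaM mat_mul_iotaM0 // addnA -[X in X != _]add0n eqn_add2r; lia.
rewrite (eq_bigr (fun t => if t == k then iotaM (acomp (tensn k a) b) i j else 0)).
  rewrite -big_mkcond big_nat1_eq /=; case: ifP => // /negbT ki.
  by rewrite iotaM_out // ; lia.
move=> t _; rewrite shift_iotaM; case: eqP => [->|/eqP tk].
  by rewrite mat_mul_iotaM.
by rewrite mat_mul_iotaM0 // eqn_add2r.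
Qed.

(* p <= m; for p = m both formulas agree *)
Lemma star_iotaM_r n k p l (a : T n (k + p)%N) (b : T p l) :
  mat_star (iotaM a) (iotaM b) = iotaM (acomp a (tensn k b)).
Proof.
case: k a => [|k] a; first exact: (@star_iotaM_l n p 0 l).
apply: mat_eqP => i j; rewrite /mat_star [X in X + _]big1_seq ?add0r; last first.
  move=> t /andP[_ _].
  by rewrite shift_iotaM mat_mul_iotaM0 //; lia.
rewrite (eq_bigr (fun t => if t == k.+1 then iotaM (acomp a (tensn k.+1 b)) i j else 0)).
  rewrite -big_mkcond big_nat1_eq /=; case: ifP => // /negbT kj.
  by rewrite iotaM_out // ; lia.
move=> t _; rewrite shift_iotaM; case: eqP => [->|/eqP tk].
  by rewrite mat_mul_iotaM.
by rewrite mat_mul_iotaM0 // eqn_add2r eq_sym.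
Qed.

End StarProduct.

Section RealSeminorms.
Variables (R : realType).
Implicit Types V W : lmodType (Cx R).

Definition nrm (V : normedModType (Cx R)) (x : V) : R := complex.Re (`|x| : R[i]).

Lemma nrmE (V : normedModType (Cx R)) (x : V) : (nrm x)%:C%C = `|x|.
Proof. by rewrite /nrm RRe_real // realE normr_ge0. Qed.

(* the norm of the class of x in V/W *)
Definition qnorm (V : normedModType (Cx R)) (W : set V) (x : V) : R :=
  inf [set nrm (x - w) | w in W].

Definition is_rseminorm V (f : V -> R) : Prop :=
  [/\ forall x y, f (x + y) <= f x + f y,
      forall (c : R[i]) x, f (c *: x) = complex.Re (`|c| : R[i]) * f x &
      forall x, 0 <= f x].

Fact Renorm (c : R[i]) : (complex.Re (`|c| : R[i]))%:C%C = `|c|.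
Proof. by rewrite RRe_real // realE normr_ge0. Qed.

Fact Renorm_ge0 (c : R[i]) : 0 <= complex.Re (`|c| : R[i]).
Proof. by rewrite -lecR RRe_real ?realE normr_ge0. Qed.

Fact rseminorm_const0 V : is_rseminorm (fun _ : V => 0 : R).
Proof. by split=> *; rewrite ?addr0 ?mulr0. Qed.

Fact rseminorm_max V (f g : V -> R) : is_rseminorm f -> is_rseminorm g ->
  is_rseminorm (fun x => Num.max (f x) (g x)).
Proof.
move=> [fD fZ f0] [gD gZ g0]; split=> [x y|c x|x].
- rewrite ge_max; apply/andP; split.
    by rewrite (le_trans (fD _ _)) // lerD // le_max lexx.
  by rewrite (le_trans (gD _ _)) // lerD // le_max lexx orbT.
- by rewrite fZ gZ maxr_pMr // Renorm_ge0.
- by rewrite le_max f0.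
Qed.

Fact rseminorm_bigmax V (I : Type) (r : seq I) (F : I -> V -> R) :
  (forall i, is_rseminorm (F i)) ->
  is_rseminorm (fun x => \big[Num.max/0]_(i <- r) F i x).
Proof.
move=> Fs; elim: r => [|i r IHr].
  by have := rseminorm_const0 V; congr is_rseminorm;
    apply/funext => x; rewrite big_nil.
have := rseminorm_max (Fs i) IHr; congr is_rseminorm.
by apply/funext => x; rewrite big_cons.
Qed.

Fact rseminorm_comp V W (f : W -> R) (L : V -> W) :
  (forall (c : R[i]) x y, L (c *: x + y) = c *: L x + L y) ->
  is_rseminorm f -> is_rseminorm (f \o L).
Proof.
move=> Llin [fD fZ f0].
have L0 : L 0 = 0 by have := Llin (-1) 0 0; rewrite scaler0 addr0 scaleN1r addNr.
split=> [x y|c x|x] /=.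
- by rewrite -[x]scale1r Llin !scale1r.
- by rewrite -[c *: x]addr0 Llin L0 addr0.
- exact: f0.
Qed.

Fact rseminorm_nrm (V : normedModType (Cx R)) : is_rseminorm (@nrm V).
Proof.
split=> [x y|c x|x].
- by rewrite -lecR rmorphD /= !nrmE ler_normD.
- apply: (@complexI R); rewrite [RHS]rmorphM /= nrmE normrZ.
  by congr (_ * _); rewrite -?Renorm -?nrmE.
- by rewrite -lecR nrmE normr_ge0.
Qed.

Fact rseminorm_qnorm (V : normedModType (Cx R)) (W : set V) :
  W 0 -> (forall (c : R[i]) x y, W x -> W y -> W (c *: x + y)) ->
  is_rseminorm (qnorm W).
Proof.
move=> W0 Wlin; have [nD nZ n0] := rseminorm_nrm V.
pose S x := [set nrm (x - w) | w in W].
have Slb x : has_lbound (S x) by exists 0 => _ [w _ <-].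
have Sn0 x : S x !=set0 by apply: (ex_intro _ (nrm (x - 0))); exists 0.
have q0 x : 0 <= qnorm W x by apply: (lb_le_inf (Sn0 x)) => _ [w _ <-].
have qle x w : W w -> qnorm W x <= nrm (x - w).
  by move=> Ww; apply: (ge_inf (Slb x)); exists w.
have qZle (c : R[i]) x : c != 0 -> qnorm W (c *: x) <= complex.Re (`|c| : R[i]) * qnorm W x.
  move=> c0.
  have Rc0 : 0 < complex.Re (`|c| : R[i]).
    by rewrite -ltcR RRe_real ?realE ?normr_ge0 // normr_gt0.
  rewrite -ler_pdivrMl //; apply: (lb_le_inf (Sn0 x)) => _ [w Ww <-].
  rewrite ler_pdivrMl // -nZ scalerBr; apply: qle.
  by rewrite -[_ *: _]addr0; apply: Wlin.
split=> [x y|c x|//].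
- rewrite -lerBlDr; apply: (lb_le_inf (Sn0 x)) => _ [w Ww <-].
  rewrite lerBlDr -lerBlDl; apply: (lb_le_inf (Sn0 y)) => _ [v Wv <-].
  rewrite lerBlDl; apply: (@le_trans _ _ (nrm (x + y - (w + v)))).
    by apply: qle; rewrite -[w]scale1r; apply: Wlin.
  by rewrite opprD addrACA nD.
- have [->|c0] := eqVneq c 0.
    rewrite scale0r normr0 mul0r; apply/eqP; rewrite eq_le q0 andbT.
    rewrite (le_trans (qle _ 0 W0)) // subr0.
    by rewrite -(scale0r (0 : V)) nZ normr0 mul0r.
  apply/eqP; rewrite eq_le qZle //=.
  have Rc0 : 0 < complex.Re (`|c| : R[i]).
    by rewrite -ltcR RRe_real ?realE ?normr_ge0 // normr_gt0.
  rewrite -[x in leLHS](scalerK c0) -ler_pdivlMl //.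
  rewrite (le_trans (qZle _ _ _)) ?invr_eq0 //.
  suff -> : complex.Re (`|c^-1| : R[i]) = (complex.Re (`|c| : R[i]))^-1 by [].
  apply: (@complexI R); rewrite [RHS]fmorphV /=.
  by rewrite [LHS]Renorm normfV -[in LHS]Renorm.
Qed.

Fact rseminorm_leC V (f : V -> R) : is_rseminorm f -> forall x y,
  (f (x + y))%:C%C <= (f x)%:C%C + (f y)%:C%C.
Proof. by move=> [fD _ _] x y; rewrite -rmorphD lecR. Qed.

Fact rseminorm_scaleC V (f : V -> R) : is_rseminorm f -> forall (c : R[i]) x,
  (f (c *: x))%:C%C = `|c| * (f x)%:C%C.
Proof.
by move=> [_ fZ _] c x; rewrite fZ [LHS]rmorphM -Renorm.
Qed.

Definition seminorm_of V (f : V -> R) (fP : is_rseminorm f) : seminorm V :=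
  Seminorm (rseminorm_leC fP) (rseminorm_scaleC fP).

End RealSeminorms.

Section KJ.
Variables (R : realType) (T : rtCstarPrecat R).

Fact ideal_addr (N : ideal T) n m (a b : T n m) : N n m a -> N n m b -> N n m (a + b).
Proof. by move=> Na Nb; rewrite -[a]scale1r; apply: (idealD (idealP N)). Qed.

Fact ideal_sum (N : ideal T) n m (I : Type) (r : seq I) (F : I -> T n m) :
  (forall k, N n m (F k)) -> N n m (\sum_(k <- r) F k).
Proof.
move=> NF; apply: (big_ind (N n m)) => //; first exact: (ideal0 (idealP N)).
exact: ideal_addr.
Qed.

Fact shift_linear (c : R[i]) (a b : mat T) :
  shift (c *: a + b) = c *: shift a + shift b.
Proof.
apply: mat_eqP => -[|i] [|j] /=; first 3 last.
- exact: (cp_tensD (rtpP T)).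
all: by rewrite /GRing.add /GRing.scale /= /mat_add /mat_scale /= scaler0 addr0.
Qed.

Fact diag_sum_linear i j (c : R[i]) (a b : mat T) :
  diag_sum (c *: a + b) i j = c *: diag_sum a i j + diag_sum b i j.
Proof.
rewrite /diag_sum scaler_sumr -big_split /=; apply: eq_bigr => t _.
suff -> : iter t (@shift _ T) (c *: a + b) =
  c *: iter t (@shift _ T) a + iter t (@shift _ T) b by [].
by elim: t => //= t ->; rewrite shift_linear.
Qed.

Variables K J : ideal T.

(* M(n,m): entries in K, all on the diagonal of (n,m) and in columns j <= m, so
   that i - j = n - m and only finitely many of them are nonzero *)
Definition in_M (n m : nat) : {pred mat T} := fun a =>
  `[< (forall i j, K i j (a i j)) /\
      (forall i j, a i j != 0 -> (i + m = n + j)%N /\ (j <= m)%N) >].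

Fact in_M_submod n m : submod_closed (in_M n m).
Proof.
split=> [|c a b /asboolP[aK aM] /asboolP[bK bM]]; apply/asboolP; split=> i j.
- exact: (ideal0 (idealP K)).
- by rewrite eqxx.
- exact: (idealD (idealP K)).
- have [a0|/aM //] := eqVneq (a i j) 0; have [b0|/bM //] := eqVneq (b i j) 0.
  by rewrite [X in X != _](_ : _ = c *: a i j + b i j) // a0 b0 scaler0 addr0 eqxx.
Qed.

HB.instance Definition _ n m :=
  GRing.isSubmodClosed.Build (Cx R) (mat T) (in_M n m) (in_M_submod n m).

Record Mmat (n m : nat) : Type :=
  MkM { M_mat :> mat T; M_matP : M_mat \in in_M n m }.

HB.instance Definition _ n m := [isSub for @M_mat n m].
HB.instance Definition _ n m := [Choice of Mmat n m by <:].
HB.instance Definition _ n m := [SubChoice_isSubLmodule of Mmat n m by <:].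

(* ||a||^J_{n,m}: x_s sits at (n - k, m - k) with k = m - s, and 1 <= k <= minn n m
   runs through the s < m for which this place exists *)
Definition KJ_norm n m (a : Mmat n m) : R :=
  Num.max
    (\big[Num.max/0]_(1 <= k < (minn n m).+1)
        qnorm (J (n - k)%N (m - k)%N) (diag_sum a (n - k)%N (m - k)%N))
    (nrm (diag_sum a n m)).

Fact KJ_norm_rseminorm n m : is_rseminorm (@KJ_norm n m).
Proof.
have lin i j (c : R[i]) (a b : Mmat n m) :
    diag_sum (c *: a + b) i j = c *: diag_sum a i j + diag_sum b i j.
  exact: diag_sum_linear.
apply: rseminorm_max.
  apply: rseminorm_bigmax => k; apply: (rseminorm_comp (@lin _ _)).
  by apply: rseminorm_qnorm; [apply: (ideal0 (idealP J))|apply: (idealD (idealP J))].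
by apply: (rseminorm_comp (@lin _ _)); apply: rseminorm_nrm.
Qed.

Definition KJ_sn n m : seminorm (Mmat n m) := seminorm_of (@KJ_norm_rseminorm n m).

Definition KJ_hom (n m : nat) : normedModType (Cx R) := sn_quot (KJ_sn n m).

Definition KJ_cls n m (a : Mmat n m) : KJ_hom n m := sn_cls (KJ_sn n m) a.

Fact shift_supp n m k (a : mat T) :
  (forall i j, a i j != 0 -> (i + m = n + j)%N /\ (j <= m)%N) ->
  forall i j, iter k (@shift _ T) a i j != 0 -> (i + m = n + j)%N.
Proof.
move=> aM; elim: k => [i j /aM[]//|k IHk] [|i] [|j] /=; rewrite ?eqxx //.
move=> tn0; suff /IHk : iter k (@shift _ T) a i j != 0 by rewrite addSn addnS => ->.
by apply: contra_neq tn0 => ->; rewrite tens0.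
Qed.

Fact mat_star_in_M n m l (a : Mmat n m) (b : Mmat m l) :
  mat_star a b \in in_M n l.
Proof.
case: a b => [a /= /asboolP[aK aM]] [b /= /asboolP[bK bM]].
have idK := idealP K.
apply/asboolP; split=> i j.
  apply: ideal_addr; apply: ideal_sum => k; apply: ideal_sum => t.
    by apply: (idealMl idK).
  by apply: (idealMr idK).
apply: contraPP => nij; apply/negP; rewrite negbK; apply/eqP.
rewrite /mat_star !big1 ?addr0 // => k _; apply: fsbig1 => t _.
  have [a0|an0] := eqVneq (a i t) 0; first by rewrite a0 acomp0l.
  have [b0|bn0] := eqVneq (iter k (@shift _ T) b t j) 0; first by rewrite b0 acomp0r.
  have [? ?] := aM _ _ an0; have ? := shift_supp bM bn0.
  by exfalso; apply: nij; lia.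
have [a0|an0] := eqVneq (iter k (@shift _ T) a i t) 0; first by rewrite a0 acomp0l.
have [b0|bn0] := eqVneq (b t j) 0; first by rewrite b0 acomp0r.
have ? := shift_supp aM an0; have [? ?] := bM _ _ bn0.
by exfalso; apply: nij; lia.
Qed.

Definition M_star n m l (a : Mmat n m) (b : Mmat m l) : Mmat n l :=
  MkM (mat_star_in_M a b).

Fact M_incl_in_M n m (a : Mmat n m) : (a : mat T) \in in_M n.+1 m.+1.
Proof.
case: a => [a /= /asboolP[aK aM]]; apply/asboolP; split=> // i j /aM[? ?].
by split; lia.
Qed.

Definition M_incl n m (a : Mmat n m) : Mmat n.+1 m.+1 := MkM (M_incl_in_M a).

(* The operations induced on classes by \star and by M(n,m) <= M(n+1,m+1), on
   chosen representatives; classes of zero-seminorm matrices are respected.   *)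
Definition KJ_comp n m l (x : KJ_hom n m) (y : KJ_hom m l) : KJ_hom n l :=
  KJ_cls (M_star (sn_rep x) (sn_rep y)).

Definition KJ_tens n m (x : KJ_hom n m) : KJ_hom n.+1 m.+1 :=
  KJ_cls (M_incl (sn_rep x)).

Definition KJ : rtPrecat R := RtPrecat KJ_comp KJ_tens.

(* N' = N_J[N].  A matrix of M(r,r) is the sum over j <= r of iota^M_{j,j}(a_j)
   with a_j its (j,j) entry. *)
Definition is_NJ (N : fam T) (N' : fam KJ) : Prop :=
  is_ideal N' /\
  forall r, N' r r = [set KJ_cls a | a in [set a : Mmat r r | forall j, N j j (M_mat a j j)]].

End KJ.

(* Main.v *)
(* Both conditions have the same effect: either every a in K is j + c with j in J
   and c (x) 1 = 0, or every a in K(n+1,m+1) is j (x) 1 with j in J(n,m); so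
   modulo the ideals at hand everything reduces to diagonal entries of K.  For
   K_J this lets one peel off the entries of a matrix one by one, which shows
   that an invariant ideal N' is determined by {a : iota^M(a) in N'}.

   For O = O_T(K,J), Fejer means for the gauge action reduce P <= P0, for
   gauge-invariant P, to an inequality of quotient norms on the degree zero part.
   There a sum of elements of iota(K(r,r)) is, by the same reduction, either a
   single iota(a) or a sum of mutually orthogonal ones, and single elements are
   handled by the isometry of injective *-homomorphisms.  Hence P is generated by
   the N = {a : iota(a) in P}.

   That different N generate different ideals needs a representation of K,
   coisometric on J, which kills exactly N.  Elements a in K(n,m) act on columns
   with entries in K by the multiplications by a, a (x) 1, a (x) 1^2, ...; the
   norm of an operator is the maximum of its norm modulo J + N and of its
   asymptotic norm modulo N on columns supported far away.  The first kills the
   single entry a of W(a) - W(a (x) 1) for a in J, the second kills it because it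
   is finitely supported; faithfulness modulo N holds because on J the distance to
   N does not decrease under a |-> a (x) 1.  Applied to the kernel of
   O_T(N, J cap N) -> O this also identifies P with O_T(N, J cap N). *)

From HB Require Import structures.
Require Import Defs.
From mathcomp Require Import all_boot all_order all_algebra.
From mathcomp Require Import complex zify ring lra.
From mathcomp Require Import all_classical all_reals all_analysis.

Set Implicit Arguments.
Unset Strict Implicit.
Unset Printing Implicit Defensive.

Import Order.TTheory GRing.Theory Num.Theory.
Import numFieldNormedType.Exports.

Local Open Scope classical_set_scope.
Local Open Scope ring_scope.

(** * Real-valued norms *)

(** The obstacle throughout is that neither [K] nor an invariant [N] need be stable under right
    tensoring: for a in [N] only the products of a (x) 1 with entries of [K] are known to lie in
    [N]. Passage between levels therefore goes through [J], whose elements stay in [K] after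
    tensoring, and multiplication by morphisms of [T] goes through approximate units. The analytic
    input consists of norm inequalities instead of spectra: h is positive when |t - h| <= t for some
    t, and square roots come from an iteration. The main outcome is that A / ker f -> B is
    isometric; it turns statements about kernels, such as saturation or the equality of two
    preimages in [K], into comparisons of distances. Averages over the circle are finite averages
    over roots of unity of order 2^(s+1), exact for degrees that are small against this order. The
    asymptotic norm of the Fock operators is only a C*-seminorm, so the target algebra is a
    separated completion. *)

Section ComplexModulus.
Variable R : realType.
Implicit Types c d : R[i].

Definition cabs c : R := complex.Re (`|c| : R[i]).

Lemma cabsE c : (cabs c)%:C%C = `|c|. Proof. exact: Renorm. Qed.
Lemma cabs_ge0 c : 0 <= cabs c. Proof. exact: Renorm_ge0. Qed.
Lemma cabs0 : cabs 0 = 0. Proof. by rewrite /cabs normr0. Qed.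
Lemma cabs1 : cabs 1 = 1. Proof. by rewrite /cabs normr1. Qed.
Lemma cabsN c : cabs (- c) = cabs c. Proof. by rewrite /cabs normrN. Qed.

Lemma cabsM c d : cabs (c * d) = cabs c * cabs d.
Proof. by apply: (@complexI R); rewrite [RHS]rmorphM /= !cabsE normrM. Qed.

Lemma cabsD c d : cabs (c + d) <= cabs c + cabs d.
Proof. by rewrite -lecR rmorphD /= !cabsE ler_normD. Qed.

Lemma cabs_real (t : R) : cabs t%:C%C = `|t|.
Proof. by apply: (@complexI R); rewrite cabsE normc_def /= expr0n addr0 sqrtr_sqr. Qed.

Lemma cabs_conj c : cabs c^* = cabs c.
Proof. by rewrite /cabs norm_conjC. Qed.

Lemma conjC_ofreal (t : R) : (t%:C%C : R[i])^* = t%:C%C.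
Proof. by apply: conj_Creal; rewrite realE !lecR le_total. Qed.


Lemma cabs_eq0 c : cabs c = 0 -> c = 0.
Proof. by move=> c0; apply/eqP; rewrite -normr_eq0 -cabsE c0. Qed.

Lemma normC1_cabs c : `|c| = 1 -> cabs c = 1.
Proof. by rewrite /cabs => ->. Qed.

Lemma real_seq_complete (u : nat -> R) :
  (forall e : R, 0 < e -> exists M, forall n m, (M <= n)%N -> (M <= m)%N -> `|u n - u m| <= e) ->
  exists l, forall e : R, 0 < e -> exists M, forall n, (M <= n)%N -> `|u n - l| <= e.
Proof.
move=> uc; have : cauchy (u @ \oo).
  apply/cauchyP => e e0; have [|M uM] := uc (e / 2); first by rewrite divr_gt0.
  exists (u M); exists M => //= n /= Mn; rewrite -ball_normE /ball_ /=.
  by apply: le_lt_trans (uM _ _ _ _) _ => //; rewrite ltr_pdivrMr // ltr_pMr // ltr1n.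
move/cauchy_cvg => /cvg_ex[l ul]; exists l => e e0.
have /ul [M _ uM] : nbhs l [set y | `|l - y| < e].
  by rewrite -nbhs_ballE; exists e => //= y; rewrite -ball_normE.
by exists M => n Mn; rewrite distrC; apply/ltW/uM.
Qed.

Lemma cabs_ReIm c : [/\ `|complex.Re c| <= cabs c, `|complex.Im c| <= cabs c &
  cabs c <= `|complex.Re c| + `|complex.Im c|].
Proof.
case: c => x y; rewrite /cabs normc_def /=; split.
- by rewrite -sqrtr_sqr ler_wsqrtr // lerDl sqr_ge0.
- by rewrite -[in leLHS]sqrtr_sqr ler_wsqrtr // lerDr sqr_ge0.
- rewrite -(@ger0_norm _ (`|x| + `|y|)) ?addr_ge0 // -sqrtr_sqr ler_wsqrtr //.
  rewrite sqrrD !real_normK ?num_real // -addrA [_ *+ 2 + _]addrC addrA lerDl.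
  by rewrite mulrn_wge0 // mulr_ge0.
Qed.

Lemma cabs_seq_complete (c : nat -> R[i]) :
  (forall e : R, 0 < e -> exists M, forall n m, (M <= n)%N -> (M <= m)%N -> cabs (c n - c m) <= e) ->
  exists l, forall e : R, 0 < e -> exists M, forall n, (M <= n)%N -> cabs (c n - l) <= e.
Proof.
move=> cc.
have ReB (z w : R[i]) : complex.Re (z - w) = complex.Re z - complex.Re w by case: z w => [? ?] [].
have ImB (z w : R[i]) : complex.Im (z - w) = complex.Im z - complex.Im w by case: z w => [? ?] [].
have [|x cx] := @real_seq_complete (fun n => complex.Re (c n)).
  move=> e /cc[M cM]; exists M => n m nM mM; rewrite -ReB.
  by apply: le_trans (cM _ _ nM mM); have [] := cabs_ReIm (c n - c m).
have [|y cy] := @real_seq_complete (fun n => complex.Im (c n)).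
  move=> e /cc[M cM]; exists M => n m nM mM; rewrite -ImB.
  by apply: le_trans (cM _ _ nM mM); have [] := cabs_ReIm (c n - c m).
exists (x +i* y)%C => e e0; have e2 : 0 < e / 2 by rewrite divr_gt0.
have [M cM] := cx _ e2; have [M' cM'] := cy _ e2.
exists (maxn M M') => n; rewrite geq_max => /andP[nM nM'].
have [_ _ H] := cabs_ReIm (c n - (x +i* y)%C); apply: le_trans H _.
by rewrite ReB ImB [e]splitr lerD ?cM ?cM'.
Qed.

End ComplexModulus.

Section RealNorm.
Variables (R : realType) (V : normedModType (Cx R)).
Implicit Types x y z : V.

Lemma nrm_ge0 x : 0 <= nrm x. Proof. by have [_ _] := rseminorm_nrm V; apply. Qed.
Lemma nrmZ (c : R[i]) x : nrm (c *: x) = cabs c * nrm x.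
Proof. by have [_ + _] := rseminorm_nrm V; apply. Qed.
Lemma nrmD x y : nrm (x + y) <= nrm x + nrm y.
Proof. by have [+ _ _] := rseminorm_nrm V; apply. Qed.
Lemma nrm0 : nrm (0 : V) = 0. Proof. by rewrite -(scale0r 0) nrmZ cabs0 mul0r. Qed.
Lemma nrmN x : nrm (- x) = nrm x.
Proof. by rewrite -scaleN1r nrmZ cabsN cabs1 mul1r. Qed.
Lemma nrmC x y : nrm (x - y) = nrm (y - x). Proof. by rewrite -nrmN opprB. Qed.
Lemma nrmB x y : nrm (x - y) <= nrm x + nrm y.
Proof. by rewrite -(nrmN y) nrmD. Qed.
Lemma nrm_tri y x z : nrm (x - z) <= nrm (x - y) + nrm (y - z).
Proof. by rewrite -[x in nrm (x - z)](subrK y) -addrA nrmD. Qed.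
Lemma nrm_eq0 x : nrm x = 0 -> x = 0.
Proof. by move=> x0; apply/eqP; rewrite -normr_eq0 -nrmE x0. Qed.
Lemma nrm_real (t : R) x : nrm (t%:C%C *: x) = `|t| * nrm x.
Proof. by rewrite nrmZ cabs_real. Qed.

Lemma nrm_sum (I : Type) (r : seq I) (F : I -> V) :
  nrm (\sum_(i <- r) F i) <= \sum_(i <- r) nrm (F i).
Proof.
apply: (big_ind2 (fun x (t : R) => nrm x <= t)) => //; first by rewrite nrm0.
by move=> x1 t1 x2 t2 h1 h2; apply: le_trans (nrmD _ _) (lerD h1 h2).
Qed.

Definition seq_lim (u : nat -> V) x : Prop :=
  forall e : R, 0 < e -> exists M, forall n, (M <= n)%N -> nrm (u n - x) <= e.

Definition seq_cauchy (u : nat -> V) : Prop :=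
  forall e : R, 0 < e -> exists M, forall n m, (M <= n)%N -> (M <= m)%N -> nrm (u n - u m) <= e.

Lemma ball_nrm x y (e : R) : 0 < e -> ball x e%:C%C y <-> nrm (x - y) < e.
Proof. by move=> e0; rewrite -ball_normE /ball_ /= -nrmE ltcR. Qed.

Lemma posC_real (e : R[i]) : 0 < e -> exists2 t : R, 0 < t & e = t%:C%C.
Proof.
move=> e0; exists (complex.Re e); last by rewrite RRe_real // realE ltW.
by rewrite -ltcR RRe_real // realE ltW.
Qed.

Lemma nbhs_nrm x (U : set V) :
  nbhs x U <-> exists2 e : R, 0 < e & forall y, nrm (x - y) < e -> U y.
Proof.
rewrite -nbhs_ballE; split=> [[e /= e0 eU]|[e e0 eU]].
  have [t t0 et] := posC_real e0; exists t => // y xy; apply: eU.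
  by rewrite et; apply/ball_nrm.
exists e%:C%C => [|y]; first by rewrite /= ltcR.
by move/(ball_nrm _ _ e0); apply: eU.
Qed.

Lemma closed_nrm (S : set V) : closed S <->
  forall x, (forall e : R, 0 < e -> exists2 y, S y & nrm (x - y) <= e) -> S x.
Proof.
split=> [Sc x xS|Sc x xS]; last first.
  apply: Sc => e e0; have [|y [Sy yU]] := xS [set y | nrm (x - y) < e].
    by apply/nbhs_nrm; exists e.
  by exists y => //; apply: ltW.
apply: Sc => U /nbhs_nrm[e e0 eU].
have [|y Sy xy] := xS (e / 2); first by rewrite divr_gt0.
by exists y; split=> //; apply: eU; apply: le_lt_trans xy _; rewrite ltr_pdivrMr // ltr_pMr // ltr1n.
Qed.


(** The records state completeness by filters, the constructions below use sequences. A Cauchy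
    filter contains balls of radius 1/(k+1); their centres form a Cauchy sequence, and its limit is
    the limit of the filter. *)
Lemma seq_completeP :
  (forall u, seq_cauchy u -> exists x, seq_lim u x) ->
  forall F : set_system V, ProperFilter F -> cauchy F -> cvg F.
Proof.
move=> Vc F FF /cauchyP Fc.
have Fk k : exists x, F [set y | nrm (x - y) < k.+1%:R^-1].
  have k0 : 0 < k.+1%:R^-1 :> R by rewrite invr_gt0.
  have [|x Fx] := Fc (k.+1%:R^-1)%:C%C; first by rewrite ltcR.
  by exists x; apply: filterS Fx => y /(ball_nrm _ _ k0).
have [u Fu] := choice Fk.
have small (e : R) : 0 < e -> exists M, forall n, (M <= n)%N -> n.+1%:R^-1 <= e.
  move=> e0; have [M] := ltr_add_invr e0; rewrite add0r => Me.
  exists M => n Mn; apply: le_trans (ltW Me).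
  by rewrite lef_pV2 ?posrE // ler_nat.
have uc : seq_cauchy u.
  move=> e e0; have [|M Mn] := small (e / 2); first by rewrite divr_gt0.
  exists M => n m nM mM.
  have [z [/= zn zm]] := filter_ex (filterI (Fu n) (Fu m)).
  rewrite (le_trans (nrm_tri z _ _)) // [e]splitr lerD //.
    by rewrite ltW // (lt_le_trans zn) // Mn.
  by rewrite nrmC ltW // (lt_le_trans zm) // Mn.
have [x ux] := Vc _ uc; apply/cvg_ex; exists x => U /nbhs_nrm[e e0 eU].
have e2 : 0 < e / 2 by rewrite divr_gt0.
have [M uM] := ux _ e2; have [M' uM'] := small _ e2.
apply: filterS (Fu (maxn M M')) => z /= zn; apply: eU.
rewrite (le_lt_trans (nrm_tri (u (maxn M M')) _ _)) // [e]splitr ler_ltD //.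
  by rewrite nrmC; apply: uM; rewrite leq_maxl.
by apply: lt_le_trans zn _; apply: uM'; rewrite leq_maxr.
Qed.

Lemma complete_seq :
  (forall F : set_system V, ProperFilter F -> cauchy F -> cvg F) ->
  forall u, seq_cauchy u -> exists x, seq_lim u x.
Proof.
move=> Vc u uc; have : cauchy (u @ \oo).
  apply/cauchyP => e e0; have [t t0 ->] := posC_real e0.
  have [|M uM] := uc (t / 2); first by rewrite divr_gt0.
  exists (u M); exists M => //= n /= Mn; apply/ball_nrm => //.
  apply: le_lt_trans (uM _ _ _ _) _ => //.
  by rewrite ltr_pdivrMr // ltr_pMr // ltr1n.
move/Vc => /cvg_ex[x ux]; exists x => e e0.
have [|M _ uM] := ux [set y | nrm (x - y) < e]; first by apply/nbhs_nrm; exists e.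
by exists M => n Mn; rewrite nrmC; apply/ltW/uM.
Qed.

Lemma seq_lim_closed (S : set V) u x : closed S -> seq_lim u x -> (forall n, S (u n)) -> S x.
Proof.
move=> /closed_nrm Sc ux Su; apply: Sc => e e0; have [M uM] := ux _ e0.
by exists (u M) => //; rewrite nrmC uM.
Qed.


End RealNorm.

(** * Unitization and positive elements *)

Section CstarAlgebra.
Variables (R : realType) (A : cstarAlg R).
Implicit Types (a b c : A) (k : R[i]).

Lemma ca_mul0l b : ca_mul 0 b = 0.
Proof. by have := ca_mulDl (-1) 0 0 b; rewrite scaler0 addr0 scaleN1r addNr. Qed.
Lemma ca_mul0r a : ca_mul a 0 = 0.
Proof. by have := ca_mulDr (-1) a 0 0; rewrite scaler0 addr0 scaleN1r addNr. Qed.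
Lemma ca_mulZl k a b : ca_mul (k *: a) b = k *: ca_mul a b.
Proof. by have := ca_mulDl k a 0 b; rewrite addr0 ca_mul0l addr0. Qed.
Lemma ca_mulZr k a b : ca_mul a (k *: b) = k *: ca_mul a b.
Proof. by have := ca_mulDr k a b 0; rewrite addr0 ca_mul0r addr0. Qed.
Lemma ca_mulBDl a a' b : ca_mul (a + a') b = ca_mul a b + ca_mul a' b.
Proof. by have := ca_mulDl 1 a a' b; rewrite !scale1r. Qed.
Lemma ca_mulBDr a b b' : ca_mul a (b + b') = ca_mul a b + ca_mul a b'.
Proof. by have := ca_mulDr 1 a b b'; rewrite !scale1r. Qed.
Lemma ca_mulBl a a' b : ca_mul (a - a') b = ca_mul a b - ca_mul a' b.
Proof. by rewrite -scaleN1r addrC ca_mulDl addrC scaleN1r. Qed.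
Lemma ca_mulBr a b b' : ca_mul a (b - b') = ca_mul a b - ca_mul a b'.
Proof. by rewrite -scaleN1r addrC ca_mulDr addrC scaleN1r. Qed.
Lemma ca_star0 : ca_star (0 : A) = 0.
Proof.
by have := ca_starD (-1) (0 : A) 0; rewrite scaler0 addr0 rmorphN rmorph1 scaleN1r addNr.
Qed.
Lemma ca_starZ k a : ca_star (k *: a) = k^* *: ca_star a.
Proof. by have := ca_starD k a 0; rewrite ca_star0 !addr0. Qed.
Lemma ca_starBD a b : ca_star (a + b) = ca_star a + ca_star b.
Proof. by have := ca_starD 1 a b; rewrite rmorph1 !scale1r. Qed.
Lemma ca_starB a b : ca_star (a - b) = ca_star a - ca_star b.
Proof. by rewrite ca_starBD -scaleN1r ca_starZ rmorphN rmorph1 scaleN1r. Qed.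

Lemma ca_nrmM a b : nrm (ca_mul a b) <= nrm a * nrm b.
Proof. by rewrite -lecR rmorphM /= !nrmE ca_normM. Qed.
Lemma ca_nrm_cstar a : nrm (ca_mul (ca_star a) a) = nrm a ^+ 2.
Proof. by apply: (@complexI R); rewrite rmorphXn /= !nrmE ca_cstar. Qed.

Lemma sqr_le_mul (t s : R) : 0 <= t -> 0 <= s -> t ^+ 2 <= s * t -> t <= s.
Proof.
move=> t0 s0; rewrite expr2; have [->//|tn0] := eqVneq t 0.
by rewrite ler_pM2r // lt0r tn0.
Qed.

Lemma ca_nrm_star a : nrm (ca_star a) = nrm a.
Proof.
have H c : nrm c <= nrm (ca_star c).
  by apply: sqr_le_mul; rewrite ?nrm_ge0 // -ca_nrm_cstar ca_nrmM.
by apply/eqP; rewrite eq_le H -{2}(ca_starK a) H.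
Qed.

Lemma ca_nrm_cstar' a : nrm (ca_mul a (ca_star a)) = nrm a ^+ 2.
Proof. by rewrite -{1}(ca_starK a) ca_nrm_cstar ca_nrm_star. Qed.

Lemma ca_seq_complete (u : nat -> A) : seq_cauchy u -> exists x, seq_lim u x.
Proof. by apply: complete_seq => F; exact: cauchy_cvg. Qed.

Definition unitz : Type := ((Cx R)^o * A)%type.
HB.instance Definition _ := GRing.Lmodule.on unitz.
Implicit Types u v w : unitz.

Definition umul u v : unitz := (u.1 * v.1, u.1 *: v.2 + v.1 *: u.2 + ca_mul u.2 v.2).
Definition uone : unitz := (1, 0).
Definition ustar u : unitz := (u.1^*, ca_star u.2).
Definition uin a : unitz := (0, a).

Fact umulA : associative umul.
Proof.
move=> u v w; congr pair; rewrite /= ?mulrA //.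
rewrite !scalerDr !ca_mulBDl !ca_mulBDr !ca_mulZl !ca_mulZr !scalerA ca_mulA.
rewrite -!addrA; congr (_ + _); rewrite [w.1 * v.1]mulrC [w.1 * u.1]mulrC.
congr (_ + _); rewrite [LHS]addrCA; congr (_ + _).
by rewrite [RHS]addrCA; congr (_ + _); rewrite addrCA.
Qed.
Fact umul1l : left_id uone umul.
Proof. by case=> c a; rewrite /umul /= mul1r scale1r scaler0 addr0 ca_mul0l addr0. Qed.
Fact umul1r : right_id uone umul.
Proof. by case=> c a; rewrite /umul /= mulr1 scale1r scaler0 add0r ca_mul0r addr0. Qed.
Fact umulDl : left_distributive umul +%R.
Proof.
move=> u v w; congr pair; rewrite /= ?mulrDl //.
rewrite scalerDl scalerDr ca_mulBDl !addrA; congr (_ + _).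
by rewrite -!addrA; congr (_ + _); rewrite addrCA; congr (_ + _);
  rewrite [RHS]addrC -addrA.
Qed.
Fact umulDr : right_distributive umul +%R.
Proof.
move=> u v w; congr pair; rewrite /= ?mulrDr //.
rewrite scalerDl scalerDr ca_mulBDr !addrA; congr (_ + _).
by rewrite -!addrA; congr (_ + _); rewrite addrCA; congr (_ + _);
  rewrite [RHS]addrC -addrA.
Qed.
Fact uone_neq0 : uone != 0.
Proof. by apply/eqP => -[/eqP]; rewrite oner_eq0. Qed.

HB.instance Definition _ := GRing.Zmodule_isNzRing.Build unitz
  umulA umul1l umul1r umulDl umulDr uone_neq0.

Fact uscaleAl k u v : k *: (u * v) = (k *: u) * v.
Proof.
congr pair; rewrite /= ?scalerAl //.
by rewrite !scalerDr ca_mulZl !scalerA [v.1 * k]mulrC.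
Qed.
HB.instance Definition _ := GRing.Lmodule_isLalgebra.Build (Cx R) unitz uscaleAl.
Fact uscaleAr k u v : k *: (u * v) = u * (k *: v).
Proof.
congr pair; rewrite /= ?scalerAr //.
by rewrite !scalerDr ca_mulZr !scalerA [u.1 * k]mulrC.
Qed.
HB.instance Definition _ := GRing.Lalgebra_isAlgebra.Build (Cx R) unitz uscaleAr.

Lemma ustarK u : ustar (ustar u) = u.
Proof. by case: u => c a; rewrite /ustar /= conjCK ca_starK. Qed.
Lemma ustarD u v : ustar (u + v) = ustar u + ustar v.
Proof. by congr pair; rewrite /= ?rmorphD ?ca_starBD. Qed.
Lemma ustarZ k u : ustar (k *: u) = k^* *: ustar u.
Proof. by congr pair; rewrite /= ?rmorphM ?ca_starZ. Qed.
Lemma ustarN u : ustar (- u) = - ustar u.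
Proof. by rewrite -scaleN1r ustarZ rmorphN rmorph1 scaleN1r. Qed.
Lemma ustarB u v : ustar (u - v) = ustar u - ustar v.
Proof. by rewrite ustarD ustarN. Qed.
Lemma ustar1 : ustar 1 = 1.
Proof. by congr pair; rewrite /= ?rmorph1 ?ca_star0. Qed.
Lemma ustarM u v : ustar (u * v) = ustar v * ustar u.
Proof.
congr pair; rewrite /= ?rmorphM 1?mulrC //.
by rewrite !ca_starBD !ca_starZ ca_starM; congr (_ + _); rewrite addrC.
Qed.
Lemma ustarX u n : ustar (u ^+ n) = ustar u ^+ n.
Proof. by elim: n => [|n IHn]; rewrite ?expr0 ?ustar1 // exprS ustarM IHn exprSr. Qed.

Lemma uinM a b : uin (ca_mul a b) = uin a * uin b.
Proof. by congr pair; rewrite /= ?mul0r // !scale0r !add0r. Qed.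
Lemma uin_star a : ustar (uin a) = uin (ca_star a).
Proof. by congr pair; rewrite /= ?conjC0. Qed.
Lemma uinD a b : uin (a + b) = uin a + uin b.
Proof. by congr pair; rewrite /= ?addr0. Qed.
Lemma uinZ k a : uin (k *: a) = k *: uin a.
Proof. by congr pair; rewrite /= ?scaler0. Qed.
Lemma uinB a b : uin (a - b) = uin a - uin b.
Proof. by congr pair; rewrite /= ?subr0. Qed.
Lemma uin_inj a b : uin a = uin b -> a = b. Proof. by case. Qed.
Lemma uinK u : u.1 = 0 -> u = uin u.2.
Proof. by case: u => c a /= ->. Qed.

Definition uact u b : A := u.1 *: b + ca_mul u.2 b.

Lemma uactE u b : u * uin b = uin (uact u b).
Proof. by congr pair; rewrite /= ?mulr0 // scale0r addr0. Qed.

(* The scalar part keeps un a norm also when A already has a unit. *)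
Definition un u : R :=
  sup ([set cabs u.1] `|` [set nrm (uact u b) | b in [set b | nrm b <= 1]]).

Let S u := [set cabs u.1] `|` [set nrm (uact u b) | b in [set b | nrm b <= 1]].

Fact un_has_sup u : has_sup (S u).
Proof.
split; first by exists (cabs u.1); left.
exists (cabs u.1 + nrm u.2) => _ [->|[b /= b1 <-]].
  by rewrite lerDl nrm_ge0.
rewrite (le_trans (nrmD _ _)) // lerD //.
  by rewrite nrmZ ler_piMr ?cabs_ge0.
by rewrite (le_trans (ca_nrmM _ _)) // ler_piMr ?nrm_ge0.
Qed.

Lemma un_abs u : cabs u.1 <= un u.
Proof. by apply: ub_le_sup; [case: (un_has_sup u)|left]. Qed.

Lemma un_ge0 u : 0 <= un u.
Proof. exact: le_trans (cabs_ge0 _) (un_abs u). Qed.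

Lemma uactZ u k b : uact u (k *: b) = k *: uact u b.
Proof. by rewrite /uact ca_mulZr scalerDr !scalerA mulrC. Qed.

Lemma un_act u b : nrm (uact u b) <= un u * nrm b.
Proof.
have [b0|bn0] := eqVneq (nrm b) 0.
  by rewrite (nrm_eq0 b0) /uact scaler0 ca_mul0r addr0 nrm0 mulr0.
have bp : 0 < nrm b by rewrite lt0r bn0 nrm_ge0.
have bi : `|(nrm b)^-1| = (nrm b)^-1 by rewrite ger0_norm // invr_ge0 ltW.
rewrite -ler_pdivrMr // mulrC -bi -nrm_real -uactZ.
apply: ub_le_sup; first by case: (un_has_sup u).
by right; exists (((nrm b)^-1)%:C%C *: b) => //=; rewrite nrm_real bi mulVf.
Qed.

Lemma un_le u (t : R) : cabs u.1 <= t -> (forall b, nrm (uact u b) <= t * nrm b) -> un u <= t.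
Proof.
move=> ut bt; apply: ge_sup; first by case: (un_has_sup u).
move=> _ [->//|[b /= b1 <-]]; apply: le_trans (bt b) _.
by rewrite ler_piMr // (le_trans (cabs_ge0 _) ut).
Qed.

Lemma unD u v : un (u + v) <= un u + un v.
Proof.
apply: un_le => [|b]; first by rewrite (le_trans (cabsD _ _)) // lerD ?un_abs.
have -> : uact (u + v) b = uact u b + uact v b.
  by rewrite /uact /= scalerDl ca_mulBDl addrACA.
by rewrite (le_trans (nrmD _ _)) // mulrDl lerD ?un_act.
Qed.

Lemma unM u v : un (u * v) <= un u * un v.
Proof.
apply: un_le => [|b].
  by rewrite /= cabsM ler_pM ?cabs_ge0 ?un_abs.
have -> : uact (u * v) b = uact u (uact v b).
  by apply: uin_inj; rewrite -!uactE -mulrA.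
by rewrite (le_trans (un_act _ _)) // -mulrA ler_wpM2l ?un_ge0 ?un_act.
Qed.

Lemma unZ k u : un (k *: u) = cabs k * un u.
Proof.
have H (c : R[i]) v : un (c *: v) <= cabs c * un v.
  apply: un_le => [|b]; first by rewrite /= cabsM ler_wpM2l ?cabs_ge0 ?un_abs.
  have -> : uact (c *: v) b = c *: uact v b.
    by rewrite /uact /= scalerDr ca_mulZl !scalerA.
  by rewrite nrmZ -mulrA ler_wpM2l ?cabs_ge0 ?un_act.
apply/eqP; rewrite eq_le H /=; have [->|k0] := eqVneq k 0.
  by rewrite cabs0 mul0r un_ge0.
have ck : cabs k * cabs k^-1 = 1 by rewrite -cabsM mulfV ?cabs1.
rewrite -{1}[u](scalerK k0) (le_trans (ler_wpM2l _ (H _ _))) ?cabs_ge0 //.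
by rewrite mulrA ck mul1r.
Qed.

(** The C*-identity of [A] applied to [uact v b] gives |v b|^2 = |b^* (v^*v b)| <= |v^*v| |b|^2, so
    v is bounded by the root of the norm of v^*v; the scalar part satisfies the same bound
    directly. *)
Lemma un_cstar u : un (ustar u * u) = un u ^+ 2.
Proof.
have sq v : un v ^+ 2 <= un (ustar v * v).
  have m0 := un_ge0 (ustar v * v).
  suff : un v <= Num.sqrt (un (ustar v * v)).
    by move=> H; rewrite -(sqr_sqrtr m0) ler_sqr ?nnegrE ?un_ge0 ?sqrtr_ge0.
  apply: un_le => [|b].
    rewrite -(@ler_sqr _ (cabs v.1)) ?nnegrE ?cabs_ge0 ?sqrtr_ge0 // sqr_sqrtr //.
    by rewrite expr2 -{1}(cabs_conj v.1) -cabsM (un_abs (ustar v * v)).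
  rewrite -(@ler_sqr _ (nrm _)) ?nnegrE ?nrm_ge0 ?mulr_ge0 ?nrm_ge0 ?sqrtr_ge0 //.
  rewrite exprMn sqr_sqrtr // -ca_nrm_cstar.
  have -> : ca_mul (ca_star (uact v b)) (uact v b) = ca_mul (ca_star b) (uact (ustar v * v) b).
    apply: uin_inj; rewrite !uinM -!uin_star -!uactE ustarM.
    by rewrite !mulrA.
  rewrite (le_trans (ca_nrmM _ _)) // ca_nrm_star mulrC expr2 mulrA.
  by rewrite ler_wpM2r ?nrm_ge0 ?un_act.
have st v : un v <= un (ustar v).
  by apply: sqr_le_mul; rewrite ?un_ge0 // (le_trans (sq v)) ?unM.
apply/eqP; rewrite eq_le sq andbT (le_trans (unM _ _)) // expr2.
by rewrite ler_wpM2r ?un_ge0 // -{2}(ustarK u) st.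
Qed.

Lemma un_star u : un (ustar u) = un u.
Proof.
have H v : un v <= un (ustar v).
  by apply: sqr_le_mul; rewrite ?un_ge0 // -un_cstar unM.
by apply/eqP; rewrite eq_le H -{2}(ustarK u) H.
Qed.

(** The lower bound comes from letting a act on [ca_star a]: the product has norm |a|^2. *)
Lemma un_uin a : un (uin a) = nrm a.
Proof.
have E b : uact (uin a) b = ca_mul a b by rewrite /uact /= scale0r add0r.
apply/eqP; rewrite eq_le; apply/andP; split.
  by apply: un_le => [|b]; rewrite ?cabs0 ?nrm_ge0 // E ca_nrmM.
apply: sqr_le_mul; rewrite ?nrm_ge0 ?un_ge0 // -ca_nrm_cstar'.
by rewrite -(ca_nrm_star a) -E un_act.
Qed.

Lemma un1 : un 1 = 1.
Proof.
apply/eqP; rewrite eq_le; apply/andP; split; last by rewrite -(cabs1 R) (un_abs 1).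
apply: un_le => [|b]; first by rewrite cabs1.
by rewrite /uact /= scale1r ca_mul0l addr0 mul1r.
Qed.

Lemma un0 : un 0 = 0. Proof. by rewrite -(scale0r 0) unZ cabs0 mul0r. Qed.
Lemma unN u : un (- u) = un u. Proof. by rewrite -scaleN1r unZ cabsN cabs1 mul1r. Qed.
Lemma unC u v : un (u - v) = un (v - u). Proof. by rewrite -unN opprB. Qed.
Lemma unB u v : un (u - v) <= un u + un v. Proof. by rewrite -(unN v) unD. Qed.
Lemma un_tri v u w : un (u - w) <= un (u - v) + un (v - w).
Proof. by rewrite -[u in un (u - w)](subrK v) -addrA unD. Qed.
Lemma un_dist v u : un u <= un v + un (u - v).
Proof. by rewrite -[in leLHS](subrK v u) addrC unD. Qed.
Lemma un_real (t : R) u : un (t%:C%C *: u) = `|t| * un u.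
Proof. by rewrite unZ cabs_real. Qed.
Lemma unX u n : un (u ^+ n) <= un u ^+ n.
Proof.
elim: n => [|n IHn]; first by rewrite !expr0 un1.
by rewrite !exprS (le_trans (unM _ _)) // ler_wpM2l ?un_ge0.
Qed.

Lemma un_eq0 u : un u = 0 -> u = 0.
Proof.
move=> u0; have u10 : u.1 = 0.
  by apply/cabs_eq0/eqP; rewrite eq_le cabs_ge0 andbT -u0 un_abs.
move: u0; rewrite (uinK u10) un_uin => /nrm_eq0 ->.
by congr pair.
Qed.

Lemma un_complete (x : nat -> unitz) :
  (forall e : R, 0 < e -> exists M, forall n m, (M <= n)%N -> (M <= m)%N -> un (x n - x m) <= e) ->
  exists y, forall e : R, 0 < e -> exists M, forall n, (M <= n)%N -> un (x n - y) <= e.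
Proof.
move=> xc.
have [|c xc1] := @cabs_seq_complete R (fun n => (x n).1).
  move=> e e0; have [M xM] := xc _ e0; exists M => n m nM mM.
  exact: le_trans (un_abs (x n - x m)) (xM _ _ nM mM).
have uin1 u : nrm u.2 <= un u + cabs u.1.
  have -> : nrm u.2 = un (u - u.1 *: 1).
    rewrite -un_uin; congr un; congr pair; rewrite /= ?scaler0 ?subr0 //.
    by rewrite /GRing.scale /= mulr1 subrr.
  by rewrite (le_trans (unB _ _)) // lerD // unZ un1 mulr1.
have [|a xa] := @ca_seq_complete (fun n => (x n).2).
  move=> e e0; have [|M xM] := xc (e / 2); first by rewrite divr_gt0.
  exists M => n m nM mM; have H := xM _ _ nM mM.
  apply: le_trans (uin1 (x n - x m)) _.
  by rewrite [e]splitr lerD // (le_trans (un_abs _)).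
exists (c, a) => e e0; have e2 : 0 < e / 2 by rewrite divr_gt0.
have [M xM] := xc1 _ e2; have [M' xM'] := xa _ e2.
exists (maxn M M') => n; rewrite geq_max => /andP[nM nM'].
have -> : x n - (c, a) = ((x n).1 - c) *: 1 + uin ((x n).2 - a).
  congr pair; rewrite /= ?scaler0 ?add0r //.
  by rewrite addr0 /GRing.scale /= mulr1.
rewrite (le_trans (unD _ _)) // [e]splitr lerD //; last by rewrite un_uin xM'.
by rewrite unZ un1 mulr1; apply: xM.
Qed.

End CstarAlgebra.

(** * Square roots and the positive cone of the unitization *)

Section Positivity.
Variables (R : realType) (A : cstarAlg R).
Local Notation U := (unitz A).
Implicit Types (u v w x y z h a b : U) (s t e : R).

Definition rz t u : U := t%:C%C *: u.
Definition ur t : U := rz t 1.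

Lemma rzA s t u : rz s (rz t u) = rz (s * t) u.
Proof. by rewrite /rz scalerA -rmorphM. Qed.
Lemma rz1 u : rz 1 u = u. Proof. by rewrite /rz scale1r. Qed.
Lemma rz0 u : rz 0 u = 0. Proof. by rewrite /rz scale0r. Qed.
Lemma rzDl s t u : rz (s + t) u = rz s u + rz t u.
Proof. by rewrite /rz rmorphD scalerDl. Qed.
Lemma rzDr t u v : rz t (u + v) = rz t u + rz t v.
Proof. by rewrite /rz scalerDr. Qed.
Lemma rzN t u : rz t (- u) = - rz t u. Proof. by rewrite /rz scalerN. Qed.
Lemma rzBr t u v : rz t (u - v) = rz t u - rz t v.
Proof. by rewrite rzDr rzN. Qed.
Lemma rzBl s t u : rz (s - t) u = rz s u - rz t u.
Proof. by rewrite /rz rmorphB scalerBl. Qed.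
Lemma un_rz t u : un (rz t u) = `|t| * un u. Proof. exact: un_real. Qed.
Lemma rzMl t u v : rz t u * v = rz t (u * v). Proof. by rewrite /rz scalerAl. Qed.
Lemma rzMr t u v : u * rz t v = rz t (u * v). Proof. by rewrite /rz scalerAr. Qed.
Lemma urMl t u : ur t * u = rz t u. Proof. by rewrite rzMl mul1r. Qed.
Lemma urMr t u : u * ur t = rz t u. Proof. by rewrite rzMr mulr1. Qed.
Lemma un_ur t : un (ur t) = `|t|. Proof. by rewrite un_rz un1 mulr1. Qed.
Lemma ur1 : ur 1 = 1. Proof. exact: rz1. Qed.
Lemma rz_star t u : ustar (rz t u) = rz t (ustar u).
Proof. by rewrite /rz ustarZ conjC_ofreal. Qed.
Lemma ur_star t : ustar (ur t) = ur t. Proof. by rewrite rz_star ustar1. Qed.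
Lemma rz2 u : rz 2 u = u + u. Proof. by rewrite (rzDl 1 1) rz1. Qed.
Lemma rz_half u : rz 2^-1 u + rz 2^-1 u = u.
Proof. by rewrite -rz2 rzA mulfV ?rz1 // pnatr_eq0. Qed.

Lemma un_small_eq0 u (C : R) : (forall e, 0 < e -> un u <= C * e) -> u = 0.
Proof.
move=> uC; apply/un_eq0/eqP; rewrite eq_le un_ge0 andbT; apply/ler_addgt0Pr => e e0.
have C1 : 0 < `|C| + 1 by rewrite ltr_wpDl.
rewrite add0r; apply: le_trans (uC (e / (`|C| + 1)) _) _; first by rewrite divr_gt0.
rewrite mulrA ler_pdivrMr // mulrC ler_wpM2l ?(ltW e0) //.
by rewrite (le_trans (ler_norm _)) // lerDl.
Qed.

Definition sa u : Prop := ustar u = u.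

Lemma saD u v : sa u -> sa v -> sa (u + v).
Proof. by rewrite /sa ustarD => -> ->. Qed.
Lemma saN u : sa u -> sa (- u). Proof. by rewrite /sa ustarN => ->. Qed.
Lemma saB u v : sa u -> sa v -> sa (u - v).
Proof. by move=> su sv; apply/saD/saN. Qed.
Lemma sa_rz t u : sa u -> sa (rz t u). Proof. by rewrite /sa rz_star => ->. Qed.
Lemma sa_ur t : sa (ur t). Proof. exact: ur_star. Qed.
Lemma sa1 : sa 1. Proof. exact: ustar1. Qed.
#[local] Hint Resolve sa_ur sa1 : core.
Lemma sa0 : sa 0. Proof. by have := sa_ur 0; rewrite /ur rz0. Qed.
Lemma sa_mul u v : sa u -> sa v -> u * v = v * u -> sa (u * v).
Proof. by rewrite /sa ustarM => -> -> ->. Qed.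
Lemma sa_sq u : sa u -> sa (u * u). Proof. by move=> su; apply: sa_mul. Qed.
Lemma sa_star_mul u : sa (ustar u * u). Proof. by rewrite /sa ustarM ustarK. Qed.
Lemma sa_X u n : sa u -> sa (u ^+ n). Proof. by rewrite /sa ustarX => ->. Qed.
Lemma un_sa_sq u : sa u -> un (u * u) = un u ^+ 2.
Proof. by move=> su; rewrite -{1}su un_cstar. Qed.

(** A fixed point y of y = (x + y^2)/2 satisfies (1 - y)^2 = 1 - x. The iterates are polynomials in
    x with nonnegative coefficients, so the same iteration at the scalar x = 1, [sq_iterR],
    majorizes them in norm. *)
Fixpoint sq_iter x n : U := if n is n'.+1 then rz 2^-1 (x + sq_iter x n' * sq_iter x n') else 0.
Fixpoint sq_iterR n : R := if n is n'.+1 then 2^-1 * (1 + sq_iterR n' * sq_iterR n') else 0.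

Fact sq_iterR_ge0 n : 0 <= sq_iterR n.
Proof. by elim: n => //= n IHn; rewrite mulr_ge0 ?invr_ge0 // addr_ge0 // mulr_ge0. Qed.

(** At x = 1 convergence to 1 is only of order 1/n. The defect p = 1 - t obeys p' = p - p^2/2, and
    2/(n+2) is a supersolution of this recursion. *)
Fact sq_iterR_le n : 1 - 2 / (n.+2%:R) <= sq_iterR n <= 1.
Proof.
elim: n => [|n /andP[IH1 IH2]] /=; first by rewrite divff ?pnatr_eq0 // subrr lexx ler01.
have t0 := sq_iterR_ge0 n; set t := sq_iterR n in IH1 IH2 t0 *.
apply/andP; split; last by nra.
set p := 2 / n.+2%:R in IH1.
have n2 : 0 < n.+2%:R :> R by rewrite ltr0n.
have n3 : 0 < n.+3%:R :> R by rewrite ltr0n.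
have pn : p * n.+2%:R = 2 by rewrite /p mulfVK ?gt_eqF.
have pE : 2 / n.+3%:R >= p - p ^+ 2 / 2.
  have pn2 : p ^+ 2 * n.+2%:R = 2 * p by rewrite expr2 -mulrA pn mulrC.
  by rewrite ler_pdivlMr // -(natr1 n.+2); have := sqr_ge0 p; lra.
have p1 : p <= 1 by rewrite /p ler_pdivrMr // mul1r ler_nat.
have p0 : 0 <= p by rewrite /p divr_ge0 // ltW.
have tt : (1 - p) * (1 - p) <= t * t by rewrite ler_pM ?subr_ge0.
have {}tt : 1 - 2 * p + p ^+ 2 <= t * t by have -> : 1 - 2 * p + p ^+ 2 = (1 - p) * (1 - p) by ring.
set q := 2 / n.+3%:R in pE *; move: pE tt; move: (p ^+ 2) => pp.
move: (t * t) => tt; lra.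
Qed.

Fact sq_iter_le x n : un x <= 1 -> un (sq_iter x n) <= sq_iterR n.
Proof.
move=> x1; elim: n => [|n IHn] /=; first by rewrite un0.
rewrite un_rz ger0_norm ?invr_ge0 // ler_wpM2l ?invr_ge0 //.
rewrite (le_trans (unD _ _)) // lerD // (le_trans (unM _ _)) //.
by rewrite ler_pM ?un_ge0.
Qed.

(** The differences satisfy d_(n+1) = (y_(n+1) d_n + d_n y_n)/2, in the algebra as for the scalars.
    Domination by the convergent scalar sequence covers |x| = 1, where the iteration is no strict
    contraction. *)
Fact sq_iter_step x n : un x <= 1 ->
  un (sq_iter x n.+1 - sq_iter x n) <= sq_iterR n.+1 - sq_iterR n.
Proof.
move=> x1; elim: n => [|n IHn].
  rewrite /= !mul0r !addr0 !subr0 mulr1 un_rz ger0_norm ?invr_ge0 //.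
  by rewrite ler_piMr ?invr_ge0.
have E : sq_iter x n.+2 - sq_iter x n.+1 =
    rz 2^-1 (sq_iter x n.+1 * (sq_iter x n.+1 - sq_iter x n) +
             (sq_iter x n.+1 - sq_iter x n) * sq_iter x n).
  rewrite mulrBr mulrBl addrA subrK.
  rewrite -[LHS]/(rz 2^-1 (x + _) - rz 2^-1 (x + _)) -rzBr.
  by rewrite opprD addrACA subrr add0r.
have ER : sq_iterR n.+2 - sq_iterR n.+1 =
    2^-1 * (sq_iterR n.+1 * (sq_iterR n.+1 - sq_iterR n) +
             (sq_iterR n.+1 - sq_iterR n) * sq_iterR n).
  rewrite mulrBr mulrBl addrA subrK.
  rewrite -[LHS]/(2^-1 * (1 + _) - 2^-1 * (1 + _)) -mulrBr.
  by rewrite opprD addrACA subrr add0r.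
rewrite E ER un_rz ger0_norm ?invr_ge0 // ler_wpM2l ?invr_ge0 //.
rewrite (le_trans (unD _ _)) // lerD // (le_trans (unM _ _)) // ler_pM ?un_ge0 //;
  exact: sq_iter_le.
Qed.

Fact sq_iter_dist x n k : un x <= 1 ->
  un (sq_iter x (k + n) - sq_iter x n) <= sq_iterR (k + n) - sq_iterR n.
Proof.
move=> x1; elim: k => [|k IHk]; first by rewrite !subrr un0.
have T := un_tri (sq_iter x (k + n)) (sq_iter x (k + n).+1) (sq_iter x n).
have S := sq_iter_step (k + n)%N x1; rewrite addSn.
by move: T S IHk; lra.
Qed.

Lemma inv_small e : 0 < e -> exists M, forall n, (M <= n)%N -> n.+1%:R^-1 <= e :> R.
Proof.
move=> e0; have [M] := ltr_add_invr e0; rewrite add0r => Me.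
exists M => n Mn; apply: le_trans (ltW Me).
by rewrite lef_pV2 ?posrE // ler_nat.
Qed.

(** Everything passes to the limit of [sq_iter]; the commutation clause does because the iterates
    are polynomials in x. *)
Lemma sqrt_one_minus x : sa x -> un x <= 1 ->
  exists y, [/\ sa y, un y <= 1, rz 2 y = x + y * y & forall z, x * z = z * x -> y * z = z * y].
Proof.
move=> sx x1.
have cau e : 0 < e -> exists M, forall n m, (M <= n)%N -> (M <= m)%N ->
    un (sq_iter x n - sq_iter x m) <= e.
  move=> e0; have [|M Mn] := @inv_small (e / 2); first by rewrite divr_gt0.
  exists M => n m.
  have H i j : (M <= i)%N -> (i <= j)%N -> un (sq_iter x j - sq_iter x i) <= e.
    move=> Mi /subnK <-; apply: le_trans (sq_iter_dist _ _ x1) _.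
    have /andP[_ t1] := sq_iterR_le (j - i + i); have /andP[t2 _] := sq_iterR_le i.
    have : 2 / i.+2%:R <= e.
      rewrite mulrC -ler_pdivlMr //; apply: le_trans (Mn i.+1 _) => //.
      exact: leqW.
    by move: t1 t2; move: (2 / i.+2%:R) => q; lra.
  move=> nM mM; have [nm|/ltnW mn] := leqP n m; last exact: H.
  by rewrite unC; apply: H.
have [y yl] := un_complete cau.
have ys n : sa (sq_iter x n).
  elim: n => [|n IHn] /=; last by apply/sa_rz/saD/sa_sq.
  exact: sa0.
have comm z : x * z = z * x -> forall n, sq_iter x n * z = z * sq_iter x n.
  move=> xz; elim=> [|n IHn] /=; first by rewrite mul0r mulr0.
  by rewrite rzMl rzMr mulrDl mulrDr xz -mulrA IHn mulrA IHn mulrA.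
have y1 : un y <= 1.
  apply/ler_addgt0Pr => e /yl[M yM].
  rewrite (le_trans (un_dist (sq_iter x M) _)) // lerD //.
    by rewrite (le_trans (sq_iter_le _ x1)) //; have /andP[] := sq_iterR_le M.
  by rewrite unC yM.
exists y; split=> //.
- apply/eqP; rewrite -subr_eq0; apply/eqP; apply: (@un_small_eq0 _ 2) => e /yl[M yM].
  have -> : ustar y - y = ustar (y - sq_iter x M) - (y - sq_iter x M).
    by rewrite ustarB ys opprB addrA subrK.
  rewrite (le_trans (unB _ _)) // un_star (unC y) mulrDl mul1r.
  by rewrite lerD // yM.
- apply/eqP; rewrite -subr_eq0; apply/eqP; apply: (@un_small_eq0 _ 4) => e e0.
  have [M yM] := yl _ e0; set q := sq_iter x M.
  have -> : rz 2 y - (x + y * y) =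
      rz 2 (y - sq_iter x M.+1) + ((q - y) * q + y * (q - y)).
    rewrite /= -/q rzBr rzA mulfV ?pnatr_eq0 // rz1 mulrBl mulrBr.
    have -> : q * q - y * q + (y * q - y * y) = q * q - y * y by rewrite addrA subrK.
    by rewrite !opprD -!addrA addKr.
  have qy : un (q - y) <= e by rewrite yM.
  have q1 : un q <= 1.
    by rewrite (le_trans (sq_iter_le _ x1)) //; have /andP[] := sq_iterR_le M.
  have E1 : un (rz 2 (y - sq_iter x M.+1)) <= 2 * e.
    by rewrite un_rz ger0_norm // ler_wpM2l // unC yM.
  have E2 : un ((q - y) * q) <= e.
    by rewrite (le_trans (unM _ _)) // -[leRHS]mulr1 ler_pM ?un_ge0.
  have E3 : un (y * (q - y)) <= e.
    by rewrite (le_trans (unM _ _)) // -[leRHS]mul1r ler_pM ?un_ge0.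
  rewrite (le_trans (unD _ _)) // (le_trans (lerD E1 (le_trans (unD _ _) (lerD E2 E3)))) //.
  lra.
- move=> z xz; apply/eqP; rewrite -subr_eq0; apply/eqP.
  apply: (@un_small_eq0 _ (2 * un z)) => e /yl[M yM].
  have -> : y * z - z * y = (y - sq_iter x M) * z - z * (y - sq_iter x M).
    by rewrite mulrBl mulrBr (comm z xz) opprB addrA subrK.
  have Y : un (y - sq_iter x M) <= e by rewrite unC yM.
  rewrite (le_trans (unB _ _)) // -mulrA mulr_natl mulr2n lerD //.
    by rewrite (le_trans (unM _ _)) // mulrC ler_wpM2l ?un_ge0.
  by rewrite (le_trans (unM _ _)) // ler_wpM2l ?un_ge0.
Qed.

(** A spectrum-free form of positivity: for self-adjoint h the inequality says that the spectrum
    lies in [0, 2t]. Closure under sums is then the triangle inequality. *)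
Definition pos h : Prop := sa h /\ exists t, un (ur t - h) <= t.

Lemma pos_witness_ge0 h t : un (ur t - h) <= t -> 0 <= t.
Proof. exact: le_trans (un_ge0 _). Qed.

Lemma pos_mono h t s : un (ur t - h) <= t -> t <= s -> un (ur s - h) <= s.
Proof.
move=> ht ts; have -> : ur s - h = ur (s - t) + (ur t - h).
  by rewrite /ur rzBl addrA subrK.
rewrite (le_trans (unD _ _)) // un_ur ger0_norm ?subr_ge0 //.
by rewrite -lerBrDl subKr.
Qed.

Lemma posD a b : pos a -> pos b -> pos (a + b).
Proof.
move=> [sa_a [t ta]] [sa_b [s sb]]; split; first exact: saD.
exists (t + s); have -> : ur (t + s) - (a + b) = (ur t - a) + (ur s - b).
  by rewrite /ur rzDl opprD addrACA.
by rewrite (le_trans (unD _ _)) // lerD.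
Qed.

Lemma pos_rz t a : 0 <= t -> pos a -> pos (rz t a).
Proof.
move=> t0 [saa [s sb]]; split; first exact: sa_rz.
exists (t * s); rewrite /ur -rzA -rzBr un_rz ger0_norm //.
by rewrite ler_wpM2l.
Qed.

Lemma pos_ur t : 0 <= t -> pos (ur t).
Proof. by move=> t0; split; [exact: sa_ur|exists t; rewrite subrr un0]. Qed.

Lemma pos_ur_sub t b : sa b -> un b <= t -> pos (ur t - b).
Proof.
move=> sb bt; split; first by apply/saB.
by exists t; rewrite subKr.
Qed.

Lemma pos0 : pos 0. Proof. by have := pos_ur (lexx 0); rewrite /ur rz0. Qed.

Lemma one_minus_sq y : (1 - y) * (1 - y) = 1 - (rz 2 y - y * y).
Proof. by rewrite mulrBl mul1r mulrBr mulr1 rz2 -[y + y - _]addrA [in RHS]opprD [RHS]addrA. Qed.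

(** x = 1 - h/t has norm at most 1, and the y of [sqrt_one_minus] has (1 - y)^2 = 1 - x = h/t; the
    root of h is sqrt(t) (1 - y). The shift t = t0 + 1 keeps t away from 0. *)
Lemma pos_sqrt h : pos h -> exists z,
  [/\ sa z, pos z, z * z = h & forall w, h * w = w * h -> z * w = w * z].
Proof.
move=> [sh [t0 ht0]]; have t00 := pos_witness_ge0 ht0.
pose t := t0 + 1; have tp : 0 < t by rewrite ltr_wpDl.
have ht : un (ur t - h) <= t by apply: pos_mono ht0 _; rewrite lerDl.
pose x := rz t^-1 (ur t - h).
have sx : sa x by apply/sa_rz/saB.
have x1 : un x <= 1.
  by rewrite un_rz ger0_norm ?invr_ge0 ?(ltW tp) // ler_pdivrMl // mulr1.
have [y [sy y1 yE yc]] := sqrt_one_minus sx x1.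
have xE : x = 1 - rz t^-1 h by rewrite /x rzBr /ur rzA mulVf ?gt_eqF // rz1.
have kE : (1 - y) * (1 - y) = rz t^-1 h.
  by rewrite one_minus_sq yE addrK xE subKr.
exists (rz (Num.sqrt t) (1 - y)); split.
- by apply/sa_rz/saB => //; exact: sa1.
- apply: pos_rz; first exact: sqrtr_ge0.
  by rewrite -ur1; apply: pos_ur_sub.
- by rewrite rzMl rzMr rzA kE rzA -expr2 sqr_sqrtr ?(ltW tp) // mulfV ?gt_eqF // rz1.
- move=> w hw; rewrite rzMl rzMr; congr rz; rewrite mulrBl mulrBr mul1r mulr1 yc //.
  by rewrite xE mulrBl mulrBr mul1r mulr1 rzMl rzMr hw.
Qed.

Definition ui : R[i] := 'i%C.
Lemma ui_conj : ui^* = - ui.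
Proof. by rewrite /ui; apply/eqP; rewrite eq_complex /= oppr0 !eqxx. Qed.
Lemma ui_sq : ui * ui = -1. Proof. by rewrite -expr2 sqr_i. Qed.

(* (z + iw)^* (z + iw) = z^2 + w^2 for commuting self-adjoint z, w *)
Lemma cartesian z w : sa z -> sa w -> z * w = w * z ->
  ustar (z + ui *: w) * (z + ui *: w) = z * z + w * w.
Proof.
move=> sz sw zw; rewrite ustarD ustarZ ui_conj sz sw.
rewrite mulrDl !mulrDr -!scalerAl -!scalerAr scalerA mulNr ui_sq opprK scale1r.
by rewrite zw scaleNr addrA -[_ + _ - _]addrA subrr addr0.
Qed.

Lemma un_re z w : sa z -> sa w -> un z <= un (z + ui *: w).
Proof.
move=> sz sw; set c := z + _.
have -> : z = rz 2^-1 (c + ustar c).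
  rewrite /c ustarD ustarZ ui_conj sz sw scaleNr addrACA subrr addr0.
  by rewrite rzDr rz_half.
rewrite un_rz ger0_norm ?invr_ge0 // (le_trans (ler_wpM2l _ (unD _ _))) ?invr_ge0 //.
by rewrite un_star; lra.
Qed.


Lemma cartesian_le z w t : sa z -> sa w -> z * w = w * z -> 0 <= t ->
  z * z + w * w = ur t -> un (z * z) <= t.
Proof.
move=> sz sw zw t0 E; rewrite un_sa_sq //.
have H := un_re sz sw; apply: (@le_trans _ _ (un (z + ui *: w) ^+ 2)).
  by rewrite ler_sqr ?nnegrE ?un_ge0.
by rewrite -un_cstar cartesian // E un_ur ger0_norm.
Qed.

(** Write a = z^2 and t - a = w^2 with commuting self-adjoint roots. By [cartesian] the element z +
    iw has norm sqrt(t), and its real part z is no larger. *)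
Lemma pos_le a t : pos a -> pos (ur t - a) -> 0 <= t -> un a <= t.
Proof.
move=> pa pb t0; have [z [sz _ zE zc]] := pos_sqrt pa.
have [w [sw _ wE wc]] := pos_sqrt pb.
have aw : a * w = w * a.
  symmetry; apply: wc; by rewrite mulrBl mulrBr urMl urMr.
rewrite -zE; apply: (cartesian_le sz sw) => //; first exact: zc.
by rewrite zE wE addrC subrK.
Qed.

(** The root of 1 - z^2/t^2 shows that t^2 - z^2 is a square of an element commuting with z;
    [cartesian_le], applied with the roles exchanged, bounds it by the total t^2. This is what makes
    squares positive. *)
Lemma sq_bound z t : sa z -> un z <= t -> un (ur (t ^+ 2) - z * z) <= t ^+ 2.
Proof.
move=> sz zt; have t0 := le_trans (un_ge0 z) zt.
have [tE|tn0] := eqVneq t 0.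
  have -> : z = 0 by apply: un_eq0; apply/eqP; rewrite eq_le un_ge0 andbT -tE.
  by rewrite mulr0 subr0 un_ur ger0_norm ?sqr_ge0.
have tp : 0 < t by rewrite lt0r tn0.
pose x := rz (t^-1 ^+ 2) (z * z).
have sx : sa x by apply/sa_rz/sa_sq.
have x1 : un x <= 1.
  rewrite un_rz un_sa_sq // ger0_norm ?sqr_ge0 // exprVn.
  by rewrite ler_pdivrMl ?exprn_gt0 // mulr1 ler_sqr ?nnegrE ?un_ge0.
have [y [sy y1 yE yc]] := sqrt_one_minus sx x1.
have kE : (1 - y) * (1 - y) = 1 - x by rewrite one_minus_sq yE addrK.
have tE : t * t * (t^-1 ^+ 2) = 1 by rewrite -expr2 exprVn mulfV // sqrf_eq0.
have zy : rz t (1 - y) * z = z * rz t (1 - y).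
  by rewrite rzMl rzMr mulrBl mulrBr mul1r mulr1 yc // /x rzMl rzMr mulrA.
have -> : ur (t ^+ 2) - z * z = rz t (1 - y) * rz t (1 - y).
  by rewrite rzMl rzMr rzA kE rzBr /x rzA tE rz1 -expr2.
have sk : sa (rz t (1 - y)) by apply/sa_rz/saB => //; exact: sa1.
apply: (cartesian_le sk sz zy (sqr_ge0 t)).
by rewrite rzMl rzMr rzA kE rzBr /x rzA tE rz1 -expr2 subrK.
Qed.

Lemma pos_sq z : sa z -> pos (z * z).
Proof.
move=> sz; split; first exact: sa_sq.
by exists (un z ^+ 2); apply: sq_bound.
Qed.

(** Follows from [sq_bound] for the root of h. The witness in [pos] can thus be chosen uniformly on
    bounded families, as passing to limits in [pos_closed] requires. *)
Lemma pos_unE h t : pos h -> un h <= t -> un (ur t - h) <= t.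
Proof.
move=> ph ht; have t0 := le_trans (un_ge0 _) ht.
have [z [sz _ zE _]] := pos_sqrt ph.
rewrite -zE -(sqr_sqrtr t0); apply: sq_bound => //.
by rewrite -(@ler_sqr _ (un z)) ?nnegrE ?un_ge0 ?sqrtr_ge0 // -un_sa_sq // zE sqr_sqrtr.
Qed.

Lemma pos_le_un a b : pos a -> pos (b - a) -> un a <= un b.
Proof.
move=> pa pba; apply: pos_le => //; last exact: un_ge0.
have -> : ur (un b) - a = (ur (un b) - b) + (b - a) by rewrite addrA subrK.
apply: posD => //; apply: pos_ur_sub => //.
have [s1 _] := pba; have [s2 _] := pa.
by rewrite -[b](subrK a); apply: saD.
Qed.

Lemma pos_anti h : pos h -> pos (- h) -> h = 0.
Proof.
move=> ph pnh; apply/un_eq0/eqP; rewrite eq_le un_ge0 andbT.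
by apply: (pos_le ph) (lexx 0); rewrite /ur rz0 sub0r.
Qed.

Lemma pos_mul a b : pos a -> pos b -> a * b = b * a -> pos (a * b).
Proof.
move=> pa pb ab; have [z [sz _ zE zc]] := pos_sqrt pa.
have [w [sw _ wE wc]] := pos_sqrt pb.
have zb : z * b = b * z by apply: zc.
have wz : w * z = z * w by apply: wc; rewrite zb.
have -> : a * b = (z * w) * (z * w)
  by rewrite -zE -wE -!mulrA [w * (z * w)]mulrA wz -mulrA.
by apply: pos_sq; apply: sa_mul.
Qed.

Lemma pos_closed h : sa h ->
  (forall e, 0 < e -> exists2 h', pos h' & un (h - h') <= e) -> pos h.
Proof.
move=> sh hl; split=> //; exists (un h + 1).
apply/ler_addgt0Pr => e e0.
have [|h' ph' hh'] := hl (Num.min e 1); first by rewrite lt_min e0 ltr01.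
have [he h1] : un (h - h') <= e /\ un (h - h') <= 1.
  by split; apply: le_trans hh' _; rewrite ge_min lexx ?orbT.
rewrite (le_trans (un_tri h' _ _)) // lerD //; last by rewrite unC.
apply: pos_unE => //.
by rewrite (le_trans (un_dist h _)) // lerD // unC.
Qed.

Lemma comm_oneBX h m : h * (1 - h) ^+ m = (1 - h) ^+ m * h.
Proof.
apply: commrX; apply: commrB; [exact: commr1|by []].
Qed.

Lemma un_oneB h : pos h -> un h <= 1 -> un (1 - h) <= 1.
Proof. by move=> ph h1; have := pos_unE ph h1; rewrite ur1. Qed.

Lemma un_oneBX h m : pos h -> un h <= 1 -> un ((1 - h) ^+ m) <= 1.
Proof. by move=> ph h1; rewrite (le_trans (unX _ _)) // exprn_ile1 ?un_ge0 ?un_oneB. Qed.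

(** 1 - (1 - h)^(m+1) is the sum of h (1 - h)^i over i <= m. The terms decrease in i, so the sum
    dominates (m+1) h (1 - h)^m. *)
Lemma approx_unit_bound h m : pos h -> un h <= 1 ->
  un (h * (1 - h) ^+ m) <= m.+1%:R^-1.
Proof.
move=> ph h1; have sh := ph.1.
have p1 : pos (1 - h) by rewrite -ur1; apply: pos_ur_sub.
have pX i : pos ((1 - h) ^+ i).
  elim: i => [|i IHi]; first by rewrite expr0 -ur1; apply: pos_ur.
  by rewrite exprS; apply: pos_mul => //; rewrite -exprS exprSr.
have phX i : pos (h * (1 - h) ^+ i) by apply: pos_mul => //; exact: comm_oneBX.
have main : pos (ur 1 - rz m.+1%:R (h * (1 - h) ^+ m)).
  suff : pos (1 - (1 - h) ^+ m.+1 - rz m.+1%:R (h * (1 - h) ^+ m)).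
    move=> H; have := posD H (pX m.+1); rewrite addrAC subrK ur1; apply.
  elim: m => [|m IHm]; first by rewrite expr0 expr1 mulr1 rz1 subKr subrr; exact: pos0.
  have E : 1 - (1 - h) ^+ m.+2 = 1 - (1 - h) ^+ m.+1 + h * (1 - h) ^+ m.+1.
    by rewrite [_ ^+ m.+2]exprS mulrBl mul1r opprB addrA addrAC.
  have E2 : h * (1 - h) ^+ m.+1 = h * (1 - h) ^+ m - h * (h * (1 - h) ^+ m).
    by rewrite exprS mulrBl mul1r mulrBr.
  rewrite E -(natr1 m.+1) rzDl rz1 opprD addrACA subrr addr0.
  rewrite E2 rzBr opprB addrCA addrC; apply: posD => //.
  apply: pos_rz => //; apply: pos_mul => //.
  by rewrite -mulrA -comm_oneBX.
have := pos_le (pos_rz (ler0n R m.+1) (phX m)) main ler01.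
by rewrite un_rz normr_nat -ler_pdivlMl ?ltr0n // mulr1.
Qed.

End Positivity.

(** * Absolute values, positivity of x^*x and approximate units *)

Section AbsoluteValue.
Variables (R : realType) (A : cstarAlg R).
Local Notation U := (unitz A).
Implicit Types (u v w x y z h k a b f g : U) (s t e : R).

Lemma pos_oneBX h m : pos h -> un h <= 1 -> pos ((1 - h) ^+ m).
Proof.
move=> ph h1; have p1 : pos (1 - h) by rewrite -(ur1 A); apply: pos_ur_sub => //; exact: ph.1.
elim: m => [|i IHi]; first by rewrite expr0 -(ur1 A); apply: pos_ur.
by rewrite exprS; apply: pos_mul => //; rewrite -exprS exprSr.
Qed.

Lemma cube_eq0 g : sa g -> g * g * g = 0 -> g = 0.
Proof.
move=> sg g3; have : un (g * g * (g * g)) = 0 by rewrite mulrA g3 mul0r un0.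
rewrite (un_sa_sq (sa_sq sg)) un_sa_sq // => /eqP.
by rewrite !expf_eq0 /= => /eqP/un_eq0.
Qed.

(* With f = k + h one has f^2 = 2 k f, so f e >= 0 for the polynomials
   e = 1 - (1 - k/c)^m in k, and f (1 - e) tends to 0. *)
Lemma pos_absD h k : sa h -> pos k -> k * k = h * h -> k * h = h * k -> pos (k + h).
Proof.
move=> sh pk kk kh; set f := k + h; have sf : sa f by apply: saD => //; exact: pk.1.
have kf : k * f = f * k by rewrite mulrDl mulrDr kh.
have ff : f * f = rz 2 (k * f).
  by rewrite {1}/f mulrDl rz2; congr (_ + _); rewrite mulrDr mulrDr -kk kh addrC.
pose s := (un k + 1)^-1; have k1p : 0 < un k + 1 by rewrite ltr_wpDl ?un_ge0.
have sp : 0 < s by rewrite invr_gt0.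
pose l := rz s k; have pl : pos l by apply: pos_rz => //; exact: ltW.
have l1 : un l <= 1.
  by rewrite un_rz ger0_norm ?(ltW sp) // ler_pdivrMl // mulr1 lerDl.
have lf : l * f = f * l by rewrite rzMl rzMr kf.
have pfl : pos (f * l).
  rewrite -lf rzMl; apply: pos_rz; first exact: ltW.
  have -> : k * f = rz 2^-1 (f * f) by rewrite ff rzA mulVf ?rz1 // pnatr_eq0.
  by apply: pos_rz => //; apply: pos_sq.
pose q m := (1 - l) ^+ m.
have fq m : f * q m = q m * f.
  by apply: commrX; apply: commrB; [exact: commr1|rewrite /GRing.comm lf].
have lq m : l * q m = q m * l by exact: comm_oneBX.
have pq m : pos (q m) by exact: pos_oneBX.
have pfe m : pos (f * (1 - q m)).
  elim: m => [|m IHm]; first by rewrite /q expr0 subrr mulr0; exact: pos0.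
  have -> : f * (1 - q m.+1) = f * (1 - q m) + f * l * q m.
    by rewrite /q exprS -/(q m) mulrBl mul1r opprB addrCA addrC mulrDr mulrA.
  by apply: posD => //; apply: pos_mul => //; rewrite -[LHS]mulrA lq [LHS](mulrA f) fq -(mulrA (q m)).
apply: pos_closed => // e e0.
pose C := 2 * s^-1 * un f; have C0 : 0 <= C.
  by rewrite !mulr_ge0 ?un_ge0 // invr_ge0 ltW.
have [|M Mn] := @inv_small R (e ^+ 2 / (C + 1)).
  by rewrite divr_gt0 ?exprn_gt0 // ltr_wpDl.
exists (f * (1 - q M)) => //; rewrite mulrBr mulr1 subKr.
rewrite -(@ler_sqr _ (un _)) ?nnegrE ?un_ge0 ?(ltW e0) // -un_cstar ustarM sf.
rewrite (pq M).1 mulrA -[q M * f * f]mulrA ff rzMr rzMl un_rz ger0_norm //.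
have -> : q M * (k * f) * q M = rz s^-1 (f * (l * q M) * q M).
  rewrite /l !(rzMl, rzMr) rzA mulVf ?gt_eqF // rz1.
  have kq : k * q M = q M * k.
    by have := congr1 (rz s^-1) (lq M); rewrite /l rzMl rzMr !rzA mulVf ?gt_eqF // !rz1.
  by rewrite kf (mulrA (q M)) -fq -(mulrA f (q M) k) -kq.
have si : 0 <= s^-1 by rewrite invr_ge0 ltW.
have H : un (f * (l * q M) * q M) <= un f * M.+1%:R^-1.
  rewrite (le_trans (unM _ _)) // -[leRHS]mulr1 ler_pM ?un_ge0 //.
    rewrite (le_trans (unM _ _)) // ler_wpM2l ?un_ge0 //.
    exact: approx_unit_bound.
  exact: un_oneBX.
have := Mn M (leqnn M); rewrite ler_pdivlMr ?ltr_wpDl // => HM.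
rewrite un_rz (ger0_norm si) mulrA; apply: le_trans (ler_wpM2l (mulr_ge0 _ si) H) _ => //.
rewrite mulrA -/C (le_trans _ HM) // mulrC ler_wpM2l ?invr_ge0 ?ler0n // lerDl //.
Qed.

Lemma abs_exists h : sa h -> exists k,
  [/\ pos k, k * k = h * h, forall w, h * w = w * h -> k * w = w * k, pos (k + h) & pos (k - h)].
Proof.
move=> sh; have [k [_ pk kk kc]] := pos_sqrt (pos_sq sh).
have kc' w : h * w = w * h -> k * w = w * k.
  by move=> hw; apply: kc; rewrite -mulrA hw mulrA hw mulrA.
exists k; split=> //; first by apply: pos_absD => //; apply: kc'.
apply: pos_absD => //; first exact: saN.
  by rewrite mulrNN.
by rewrite mulrN mulNr; congr (- _); apply: kc'.
Qed.

Lemma un_mul_star y : un (y * ustar y) = un y ^+ 2.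
Proof. by rewrite -{1}(ustarK y) un_cstar un_star. Qed.

(** With y = a + ib for self-adjoint a and b, y^*y + yy^* = 2(a^2 + b^2); adding the positive
    element -y^*y leaves yy^* positive. *)
Lemma neg_star_mul y : pos (- (ustar y * y)) -> pos (y * ustar y).
Proof.
move=> py; pose a := rz 2^-1 (y + ustar y); pose b := (- ui R) *: rz 2^-1 (y - ustar y).
have sa_a : sa a by apply: sa_rz; rewrite /sa ustarD ustarK addrC.
have sa_b : sa b.
  rewrite /sa /b ustarZ rmorphN /= ui_conj opprK rz_star ustarB ustarK.
  by rewrite -opprB rzN scalerN scaleNr.
have yE : y = a + ui R *: b.
  by rewrite /a /b scalerA mulrN ui_sq opprK scale1r -rzDr addrACA subrr addr0 rzDr rz_half.
have ysE : ustar y = a - ui R *: b.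
  by rewrite [in LHS]yE ustarD ustarZ ui_conj sa_a sa_b scaleNr.
have E : ustar y * y + y * ustar y = rz 2 (a * a + b * b).
  set B := ui R *: b in yE ysE.
  have BB : - (B * B) = b * b.
    by rewrite /B -scalerAl -scalerAr scalerA ui_sq scaleN1r opprK.
  have -> : ustar y * y + y * ustar y = (a - B) * (a + B) + (a + B) * (a - B).
    by rewrite -ysE -yE.
  rewrite mulrBl mulrDr mulrDr mulrDl mulrBr mulrBr -BB addrACA rz2.
  have -> : a * a + a * B + (a * a - a * B) = a * a + a * a.
    by rewrite addrACA subrr addr0.
  have -> : - (B * a + B * B) + (B * a - B * B) = - (B * B) - B * B.
    by rewrite opprD addrACA addNr add0r.
  by rewrite addrACA.
have -> : y * ustar y = rz 2 (a * a + b * b) + - (ustar y * y) by rewrite -E addrC addKr.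
by apply: posD => //; apply: pos_rz => //; apply: posD; apply: pos_sq.
Qed.

(** Let -y^*y = d^2 and z = yd. Then z^*z is minus the square of d^2, so zz^* is positive by
    [neg_star_mul]; but zz^* is also minus the square of yy^*, so that square vanishes and y with
    it. *)
Lemma neg_star_mul_eq0 y : pos (- (ustar y * y)) -> y = 0.
Proof.
move=> py; have [d [sd pd dE _]] := pos_sqrt py.
pose z := y * d.
have zE : ustar z * z = - ((d * d) * (d * d)).
  have -> : ustar z * z = d * (ustar y * y) * d by rewrite ustarM sd !mulrA.
  by rewrite -[ustar y * y]opprK -dE mulrN mulNr !mulrA.
have pz : pos (z * ustar z).
  by apply: neg_star_mul; rewrite zE opprK; apply/pos_sq/sa_sq.
have pE : y * ustar y * (y * ustar y) = - (z * ustar z).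
  have -> : z * ustar z = y * (d * d) * ustar y by rewrite ustarM sd !mulrA.
  by rewrite dE mulrN mulNr opprK !mulrA.
have sy : sa (y * ustar y) by rewrite /sa ustarM ustarK.
have z0 : z * ustar z = 0 by apply: pos_anti => //; rewrite -pE; apply: pos_sq.
have : un (y * ustar y * (y * ustar y)) = 0 by rewrite pE z0 oppr0 un0.
rewrite un_sa_sq // un_mul_star => /eqP.
by rewrite !expf_eq0 /= => /eqP/un_eq0.
Qed.

(** For h = x^*x let g = |h| - h, twice the negative part. Since hg = -g^2/2, the element y = xg has
    y^*y = ghg = -g^3/2, so y = 0 by [neg_star_mul_eq0]; hence g^3 = 0 and h = |h|. *)
Lemma pos_star_mul x : pos (ustar x * x).
Proof.
set h := ustar x * x; have sh : sa h by exact: sa_star_mul.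
have [k [pk kk kc pf pg]] := abs_exists sh.
set f := k + h in pf; set g := k - h in pg; have sg := pg.1.
have hk : k * h = h * k by apply: kc.
have fg : f * g = 0.
  by rewrite mulrDl !mulrBr kk hk addrA subrK subrr.
have hg : rz 2 h * g = - (g * g).
  have -> : rz 2 h = f - g by rewrite /f /g opprB [k + h]addrC addrACA subrr addr0 rz2.
  by rewrite mulrBl fg sub0r.
have hgc : h * g = g * h by rewrite mulrBl mulrBr hk.
have yE : ustar (x * g) * (x * g) = rz 2^-1 (- (g * g * g)).
  have -> : ustar (x * g) * (x * g) = g * h * g by rewrite ustarM sg !mulrA.
  rewrite -hgc -mulNr -hg !rzMl rzA mulVf ?rz1 // pnatr_eq0 //.
have /neg_star_mul_eq0 xg0 : pos (- (ustar (x * g) * (x * g))).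
  rewrite yE -rzN opprK; apply: pos_rz; rewrite ?invr_ge0 //.
  by apply: pos_mul => //; [apply: pos_sq|rewrite mulrA].
have g3 : g * g * g = 0.
  apply/oppr_inj; rewrite oppr0 -[- _](rz1) -(@mulfV _ (2 : R)) ?pnatr_eq0 // -rzA -yE.
  by rewrite xg0 mulr0 /rz scaler0.
have g0 : g = 0 by exact: cube_eq0.
by have -> : h = k by apply/esym/eqP; rewrite -subr_eq0 -/g g0.
Qed.

Lemma pos_conj a x : pos a -> pos (ustar x * a * x).
Proof.
move=> pa; have [z [sz _ <- _]] := pos_sqrt pa.
have -> : ustar x * (z * z) * x = ustar (z * x) * (z * x) by rewrite ustarM sz !mulrA.
exact: pos_star_mul.
Qed.

(** With d = a - b, the positive elements a d^2 and b d^2 have sum (a^2 - b^2) d = 0, so both vanish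
    and d^3 = 0. *)
Lemma pos_sqrt_unique a b : pos a -> pos b -> a * b = b * a -> a * a = b * b -> a = b.
Proof.
move=> pa pb ab sq; set d := a - b; have sd : sa d by apply: saB; [exact: pa.1|exact: pb.1].
have ad : a * d = d * a by rewrite mulrBl mulrBr ab.
have bd : b * d = d * b by rewrite mulrBl mulrBr ab.
have pad : pos (a * (d * d)).
  by apply: pos_mul => //; [exact: pos_sq|rewrite mulrA ad -mulrA ad mulrA].
have pbd : pos (b * (d * d)).
  by apply: pos_mul => //; [exact: pos_sq|rewrite mulrA bd -mulrA bd mulrA].
have s0 : a * (d * d) + b * (d * d) = 0.
  have : (a + b) * d = 0 by rewrite mulrDl !mulrBr ab sq addrA subrK subrr.
  by rewrite -mulrDl mulrA => ->; rewrite mul0r.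
have a0 : a * (d * d) = 0.
  by apply: pos_anti => //; rewrite -(addr0 (- _)) -s0 addKr.
have b0 : b * (d * d) = 0 by rewrite -s0 a0 add0r.
apply/eqP; rewrite -subr_eq0 -/d; apply/eqP/cube_eq0 => //.
by rewrite -mulrA {1}/d mulrBl a0 b0 subrr.
Qed.

(** c = 1 - (1 - h)^M with h = b/(|b| + 1) is a polynomial in b without constant term. The last
    clause records this for every subspace P stable under left multiplication, so that it serves
    ideals of an algebra and of [T] alike. *)
Lemma approx_unit (b : A) e : pos (uin b) -> 0 < e -> exists c : A,
  [/\ ca_star c = c, nrm c <= 1, un (1 - uin c) <= 1,
      un ((1 - uin c) * uin b * (1 - uin c)) <= e &
      forall P : set A, P 0 -> (forall x y : A, P x -> P y -> P (x + y)) ->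
        (forall (r : R[i]) (x : A), P x -> P (r *: x)) -> (forall x y : A, P y -> P (ca_mul x y)) ->
        P b -> P c].
Proof.
move=> pb e0; pose s := (nrm b + 1)^-1.
have b1 : 0 < nrm b + 1 by rewrite ltr_wpDl ?nrm_ge0.
have sp : 0 < s by rewrite invr_gt0.
pose h := rz s (uin b); have hE : h = uin (s%:C%C *: b) by rewrite uinZ.
have ph : pos h by apply: pos_rz => //; exact: ltW.
have h1 : un h <= 1.
  by rewrite un_rz un_uin ger0_norm ?(ltW sp) // ler_pdivrMl // mulr1 lerDl.
have [M Mn] := @inv_small R (e * s) (mulr_gt0 e0 sp).
have ex m : exists2 c : A, 1 - (1 - h) ^+ m = uin c &
    forall P : set A, P 0 -> (forall x y : A, P x -> P y -> P (x + y)) ->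
        (forall (r : R[i]) (x : A), P x -> P (r *: x)) -> (forall x y : A, P y -> P (ca_mul x y)) ->
        P b -> P c.
  elim: m => [|m [c cE cP]]; first by exists 0; rewrite ?expr0 ?subrr.
  exists (c + uact ((1 - h) ^+ m) (s%:C%C *: b)).
    rewrite uinD -cE -uactE -hE exprSr mulrBr mulr1.
    by rewrite opprB addrA addrAC.
  move=> P P0 PD PZ PM Pb; have Psb := PZ s%:C%C _ Pb.
  exact: PD _ _ (cP P P0 PD PZ PM Pb) (PD _ _ (PZ _ _ Psb) (PM _ _ Psb)).
have [c cE cP] := ex M; have qE : 1 - uin c = (1 - h) ^+ M by rewrite -cE subKr.
exists c; split=> //.
- apply: uin_inj; rewrite -uin_star -cE.
  by apply: saB; [exact: sa1|apply: sa_X; apply: saB; [exact: sa1|exact: ph.1]].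
- rewrite -un_uin -cE; apply: un_oneB; [exact: pos_oneBX|exact: un_oneBX].
- by rewrite qE; apply: un_oneBX.
- have -> : uin b = rz s^-1 h by rewrite rzA mulVf ?gt_eqF // rz1.
  have si : 0 < s^-1 by rewrite invr_gt0.
  rewrite qE rzMr rzMl un_rz (gtr0_norm si) ler_pdivrMl // mulrC.
  rewrite -comm_oneBX (le_trans (unM _ _)) // -[leRHS]mulr1 ler_pM ?un_ge0 ?un_oneBX //.
  by rewrite (le_trans (approx_unit_bound _ ph h1)) // Mn.
Qed.

End AbsoluteValue.

(** * Quotients and completions *)

Section Distance.
Variables (R : realType) (V : normedModType (Cx R)) (W : set V).
Hypothesis W0 : W 0.
Hypothesis Wlin : forall (c : R[i]) x y, W x -> W y -> W (c *: x + y).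
Implicit Types x y w : V.

Lemma lin_add x y : W x -> W y -> W (x + y).
Proof. by move=> Wx Wy; rewrite -[x]scale1r; apply: Wlin. Qed.
Lemma lin_scale (c : R[i]) x : W x -> W (c *: x).
Proof. by move=> Wx; rewrite -[_ *: _]addr0; apply: Wlin. Qed.
Lemma lin_opp x : W x -> W (- x).
Proof. by move=> Wx; rewrite -scaleN1r; apply: lin_scale. Qed.

Lemma qnorm_le x w : W w -> qnorm W x <= nrm (x - w).
Proof.
move=> Ww; apply: ge_inf; last by exists w.
by exists 0 => _ [v _ <-]; exact: nrm_ge0.
Qed.

Lemma qnorm_ge0 x : 0 <= qnorm W x.
Proof. by have [_ _] := rseminorm_qnorm W0 Wlin; apply. Qed.

Lemma qnorm_ex x (e : R) : 0 < e -> exists2 w, W w & nrm (x - w) <= qnorm W x + e.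
Proof.
move=> e0; have : has_inf [set nrm (x - w) | w in W].
  split; first by exists (nrm (x - 0)); exists 0.
  by exists 0 => _ [v _ <-]; exact: nrm_ge0.
by move=> /(inf_adherent e0)[_ [w Ww <-]] /ltW; exists w.
Qed.

Lemma qnorm_le_nrm x : qnorm W x <= nrm x.
Proof. by rewrite (le_trans (qnorm_le x W0)) // subr0. Qed.

Lemma qnorm_in w : W w -> qnorm W w = 0.
Proof.
move=> Ww; apply/eqP; rewrite eq_le qnorm_ge0 andbT.
by rewrite (le_trans (qnorm_le w Ww)) // subrr nrm0.
Qed.

Lemma qnormD x y : qnorm W (x + y) <= qnorm W x + qnorm W y.
Proof. by have [+ _ _] := rseminorm_qnorm W0 Wlin; apply. Qed.
Lemma qnormZ (c : R[i]) x : qnorm W (c *: x) = cabs c * qnorm W x.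
Proof. by have [_ + _] := rseminorm_qnorm W0 Wlin; apply. Qed.
Lemma qnormN x : qnorm W (- x) = qnorm W x.
Proof. by rewrite -scaleN1r qnormZ cabsN cabs1 mul1r. Qed.

Lemma qnorm_congr x y : W (x - y) -> qnorm W x = qnorm W y.
Proof.
have H a b : W (a - b) -> qnorm W a <= qnorm W b.
  move=> Wab; rewrite -[a](subrK b) (le_trans (qnormD _ _)) //.
  by rewrite (qnorm_in Wab) add0r.
move=> Wxy; apply/eqP; rewrite eq_le !H //.
by rewrite -opprB; apply: lin_opp.
Qed.

Lemma qnorm_le_of x (t : R) :
  (forall e, 0 < e -> exists2 w, W w & nrm (x - w) <= t + e) -> qnorm W x <= t.
Proof.
move=> H; apply/ler_addgt0Pr => e e0; have [w Ww xw] := H e e0.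
exact: le_trans (qnorm_le x Ww) xw.
Qed.

Lemma qnorm_eq0 x : closed W -> qnorm W x = 0 -> W x.
Proof.
move=> /closed_nrm Wc x0; apply: Wc => e e0.
by have [w Ww] := qnorm_ex x e0; rewrite x0 add0r; exists w.
Qed.

End Distance.

Section Homomorphisms.
Variables (R : realType) (A B : cstarAlg R) (f : A -> B).
Hypothesis fH : is_starhom f.

Lemma starhom0 : f 0 = 0.
Proof. by have := starhomD fH (-1) 0 0; rewrite scaler0 addr0 scaleN1r addNr. Qed.
Lemma starhomZ (k : R[i]) a : f (k *: a) = k *: f a.
Proof. by have := starhomD fH k a 0; rewrite starhom0 !addr0. Qed.
Lemma starhomDD a b : f (a + b) = f a + f b.
Proof. by have := starhomD fH 1 a b; rewrite !scale1r. Qed.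
Lemma starhomN a : f (- a) = - f a.
Proof. by rewrite -scaleN1r starhomZ scaleN1r. Qed.
Lemma starhomB a b : f (a - b) = f a - f b.
Proof. by rewrite starhomDD starhomN. Qed.

Definition uhom (u : unitz A) : unitz B := (u.1, f u.2).

Lemma uhomD u v : uhom (u + v) = uhom u + uhom v.
Proof. by congr pair; rewrite /= starhomDD. Qed.
Lemma uhomZ (k : R[i]) u : uhom (k *: u) = k *: uhom u.
Proof. by congr pair; rewrite /= starhomZ. Qed.
Lemma uhomN u : uhom (- u) = - uhom u.
Proof. by rewrite -scaleN1r uhomZ scaleN1r. Qed.
Lemma uhomB u v : uhom (u - v) = uhom u - uhom v.
Proof. by rewrite uhomD uhomN. Qed.
Lemma uhomM u v : uhom (u * v) = uhom u * uhom v.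
Proof. by congr pair; rewrite /= !starhomDD !starhomZ (starhomM fH). Qed.
Lemma uhom1 : uhom 1 = 1. Proof. by congr pair; rewrite /= starhom0. Qed.
Lemma uhom_star u : uhom (ustar u) = ustar (uhom u).
Proof. by congr pair; rewrite /= (starhom_star fH). Qed.
Lemma uhom_ur t : uhom (ur A t) = ur B t.
Proof. by rewrite /ur /rz uhomZ uhom1. Qed.
Lemma uhom_rz t u : uhom (rz t u) = rz t (uhom u).
Proof. exact: uhomZ. Qed.
Lemma uhom_uin a : uhom (uin a) = uin (f a). Proof. by []. Qed.

Lemma uhom_sa u : sa u -> sa (uhom u).
Proof. by rewrite /sa -uhom_star => ->. Qed.

Lemma uhom_pos h : pos h -> pos (uhom h).
Proof.
move=> ph; have [z [sz _ <- _]] := pos_sqrt ph.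
by rewrite uhomM; apply/pos_sq/uhom_sa.
Qed.

(** |u|^2 - u^*u is positive, hence a square, and its image is again a square; [pos_le] turns this
    into a norm bound. *)
Lemma un_uhom u : un (uhom u) <= un u.
Proof.
rewrite -(@ler_sqr _ (un (uhom u))) ?nnegrE ?un_ge0 // -un_cstar.
apply: pos_le; [exact: pos_star_mul| |exact: sqr_ge0].
rewrite -uhom_star -uhomM -uhom_ur -uhomB; apply: uhom_pos.
by apply: pos_ur_sub; [exact: sa_star_mul|rewrite un_cstar].
Qed.

Lemma starhom_contr a : nrm (f a) <= nrm a.
Proof. by rewrite -!un_uin -uhom_uin un_uhom. Qed.

End Homomorphisms.

(** * Closed ideals, quotient norms and kernels *)

Section ClosedIdeals.
Variables (R : realType) (A : cstarAlg R) (P : set A).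
Hypothesis PI : is_cideal P.
Implicit Types (a b x y w : A).

Let P0 := cideal0 PI.
Let PL := cidealD PI.

Lemma pos_uin_star a : pos (uin (ca_mul (ca_star a) a)).
Proof. by rewrite uinM -uin_star; exact: pos_star_mul. Qed.

Lemma nrm_right_unit a c : ca_star c = c ->
  nrm (a - ca_mul a c) ^+ 2 = un ((1 - uin c) * uin (ca_mul (ca_star a) a) * (1 - uin c)).
Proof.
move=> sc; have E : uin (a - ca_mul a c) = uin a * (1 - uin c).
  by rewrite mulrBr mulr1 -uinM -uinB.
by rewrite -un_uin E -un_cstar ustarM ustarB ustar1 !uin_star sc uinM !mulrA.
Qed.

Lemma cideal_unit w e : P w -> 0 < e -> exists c,
  [/\ P c, ca_star c = c, nrm c <= 1, un (1 - uin c) <= 1 & nrm (w - ca_mul w c) <= e].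
Proof.
move=> Pw e0; have [|c [sc c1 c1' cb cP]] := approx_unit (pos_uin_star w) (_ : 0 < e ^+ 2).
  by rewrite exprn_gt0.
exists c; split=> //; last first.
  by rewrite -(@ler_sqr _ (nrm _)) ?nnegrE ?nrm_ge0 ?(ltW e0) // nrm_right_unit.
apply: cP => //; first exact: lin_add.
- by move=> r x; apply: lin_scale.
- by move=> x y; exact: cidealMl.
- exact: cidealMl.
Qed.

(** If wc is close to w for a self-adjoint c in P, then c w^* lies in P and is as close to w^*. *)
Lemma cideal_star w : P w -> P (ca_star w).
Proof.
move=> Pw; have /closed_nrm Pc := cideal_closed PI; apply: Pc => e e0.
have [c [Pc sc _ _ wc]] := cideal_unit Pw e0.
exists (ca_mul c (ca_star w)); first exact: cidealMr.
by rewrite -{1}sc -ca_starM -ca_starB ca_nrm_star.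
Qed.

Lemma qnorm_mul a b : qnorm P (ca_mul a b) <= qnorm P a * qnorm P b.
Proof.
have qa := qnorm_ge0 P0 PL a; have qb := qnorm_ge0 P0 PL b.
have H (e : R) : 0 < e -> e <= 1 -> qnorm P (ca_mul a b) <= qnorm P a * qnorm P b + e * (qnorm P a + qnorm P b + 1).
  move=> e0 e1.
  have [w Pw aw] := qnorm_ex P0 a e0; have [v Pv bv] := qnorm_ex P0 b e0.
  have Px : P (ca_mul a v + ca_mul w (b - v)).
    by apply: lin_add => //; [exact: cidealMl|exact: cidealMr].
  rewrite (le_trans (qnorm_le _ Px)) //.
  have -> : ca_mul a b - (ca_mul a v + ca_mul w (b - v)) = ca_mul (a - w) (b - v).
    by rewrite ca_mulBl !ca_mulBr opprD addrA.
  rewrite (le_trans (ca_nrmM _ _)) //.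
  rewrite (le_trans (ler_pM (nrm_ge0 _) (nrm_ge0 _) aw bv)) //.
  nra.
apply/ler_addgt0Pr => e e0; set C := qnorm P a + qnorm P b + 1.
have C1 : 1 <= C by rewrite /C lerDr addr_ge0.
have C0 : 0 < C by apply: lt_le_trans C1.
have m0 : 0 < Num.min 1 (e / C) by rewrite lt_min ltr01 divr_gt0.
apply: le_trans (H _ m0 _) _; first by rewrite ge_min lexx.
by rewrite lerD2l -ler_pdivlMr // ge_min lexx orbT.
Qed.

Lemma qnorm_star a : qnorm P (ca_star a) = qnorm P a.
Proof.
have H x : qnorm P (ca_star x) <= qnorm P x.
  apply: qnorm_le_of => // e e0; have [w Pw xw] := qnorm_ex P0 x e0.
  by exists (ca_star w); [exact: cideal_star|rewrite -ca_starB ca_nrm_star].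
by apply/eqP; rewrite eq_le H -{1}(ca_starK a) H.
Qed.

(** The content is q(a)^2 <= q(a^*a). For w in P nearly optimal for a^*a and an approximate unit c
    of w, a(1 - c) is congruent to a, and |a(1 - c)|^2 = |(1 - c) a^*a (1 - c)| is at most |a^*a -
    w| + |w(1 - c)|. *)
Lemma qnorm_cstar a : qnorm P (ca_mul (ca_star a) a) = qnorm P a ^+ 2.
Proof.
apply/eqP; rewrite eq_le; apply/andP; split.
  by rewrite (le_trans (qnorm_mul _ _)) // qnorm_star expr2.
apply/ler_addgt0Pr => e e0; have e2 : 0 < e / 2 by rewrite divr_gt0.
have [w Pw aw] := qnorm_ex P0 (ca_mul (ca_star a) a) e2.
have [c [Pc sc c1 c1' wc]] := cideal_unit Pw e2.
have H : qnorm P a <= nrm (a - ca_mul a c) by apply: qnorm_le; exact: cidealMl.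
apply: (@le_trans _ _ (nrm (a - ca_mul a c) ^+ 2)).
  by rewrite ler_sqr ?nnegrE ?nrm_ge0 ?qnorm_ge0.
rewrite nrm_right_unit //; set b := ca_mul _ a in aw *; set u := 1 - uin c.
have -> : u * uin b * u = u * uin (b - w) * u + u * (uin w * u).
  by rewrite mulrA -mulrDl -mulrDr -uinD subrK.
rewrite (le_trans (unD _ _)) // [e]splitr addrA lerD //.
  rewrite (le_trans (unM _ _)) // -[leRHS]mulr1 ler_pM ?un_ge0 //.
  rewrite (le_trans (unM _ _)) // -[leRHS]mul1r ler_pM ?un_ge0 //.
  by rewrite un_uin.
rewrite (le_trans (unM _ _)) // -[leRHS]mul1r ler_pM ?un_ge0 //.
by rewrite mulrBr mulr1 -uinM -uinB un_uin.
Qed.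

End ClosedIdeals.

Section Kernels.
Variables (R : realType) (A B : cstarAlg R) (f : A -> B).
Hypothesis fH : is_starhom f.

Lemma kernel_cideal : is_cideal [set a | f a = 0].
Proof.
split=> [|||a b /= b0|a b /= a0].
- apply/closed_nrm => x xl /=; apply/nrm_eq0/eqP; rewrite eq_le nrm_ge0 andbT.
  apply/ler_addgt0Pr => e e0; have [y /= y0 xy] := xl e e0.
  by rewrite add0r -[f x]subr0 -y0 -starhomB // (le_trans (starhom_contr fH _)).
- exact: starhom0.
- by move=> c a b /= a0 b0; rewrite (starhomD fH) a0 b0 scaler0 addr0.
- by rewrite (starhomM fH) b0 ca_mul0r.
- by rewrite (starhomM fH) a0 ca_mul0l.
Qed.

(* cut h = b^*b at the level c = |f b|^2: the part (h - c)_+ lies in the kernel *)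
Lemma truncate b : pos (uin b) -> exists2 w, f w = 0 & nrm (b - w) <= nrm (f b).
Proof.
move=> pb; set c := nrm (f b); set h := uin b; have c0 : 0 <= c by exact: nrm_ge0.
have [x x_def] : exists x, x = h - ur A c by exists (h - ur A c).
have sx : sa x by rewrite x_def; apply: saB; [exact: pb.1|exact: sa_ur].
have [k [pk kk kc pp pg]] := abs_exists sx.
have kx : k * x = x * k by apply: kc.
pose p := rz 2^-1 (k + x); pose g := rz 2^-1 (k - x).
have pos_g : pos g by apply: pos_rz => //; rewrite invr_ge0.
have xE : x = p - g.
  by rewrite /p /g -rzBr opprB [k + x]addrC addrACA subrr addr0 rzDr rz_half.
have hE : h = x + ur A c by rewrite x_def subrK.
have hpg : h - p = ur A c - g by rewrite hE xE addrAC [p - g - p]addrAC subrr sub0r addrC.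
have pg0 : p * g = 0.
  by rewrite rzMl rzMr mulrDl !mulrBr kk kx addrA subrK subrr /rz !scaler0.
have gp0 : g * p = 0.
  by rewrite rzMl rzMr mulrBl !mulrDr kk kx opprD addrA addrK subrr /rz !scaler0.
have gh : g * h = h * g.
  rewrite hE xE !mulrDl !mulrDr mulNr mulrN pg0 gp0.
  by rewrite urMl urMr.
have gc : un g <= c.
  apply: sqr_le_mul; rewrite ?un_ge0 // -un_sa_sq ?pos_g.1 //; last exact: pos_g.1.
  have -> : c * un g = un (rz c g) by rewrite un_rz ger0_norm.
  apply: pos_le_un.
    by apply: pos_sq; exact: pos_g.1.
  have -> : rz c g - g * g = g * h.
    by rewrite hE xE mulrDr mulrBr gp0 sub0r urMr addrC.
  exact: pos_mul.
have kernel_p : uhom f p = 0.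
  have pny : pos (- uhom f x).
    rewrite x_def uhomB // uhom_ur // opprB; apply: pos_ur_sub.
      exact: uhom_sa pb.1.
    by rewrite uhom_uin un_uin.
  have kkE : uhom f k = - uhom f x.
    apply: pos_sqrt_unique => //; first exact: uhom_pos.
      by rewrite mulrN mulNr -!uhomM // kx.
    by rewrite mulrNN -!uhomM // kk.
  by rewrite /p uhom_rz // uhomD // kkE addNr /rz scaler0.
have p1 : p.1 = 0 by have := congr1 fst kernel_p.
exists p.2; first by have := congr1 snd kernel_p.
by rewrite -un_uin uinB -(uinK p1) hpg; apply: pos_unE.
Qed.

(** [truncate] bounds the distance from a^*a to the kernel, and the C*-identity of the quotient norm
    carries the bound to a. The map induced on A / ker f is therefore isometric. *)
Lemma qnorm_kernel a : qnorm [set x | f x = 0] a <= nrm (f a).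
Proof.
have kI := kernel_cideal; have b0 := nrm_ge0 (f a).
rewrite -(@ler_sqr _ (qnorm _ _)) ?nnegrE ?(qnorm_ge0 (cideal0 kI) (cidealD kI)) //.
rewrite -(qnorm_cstar kI) -ca_nrm_cstar -(starhom_star fH) -(starhomM fH).
have [w fw] := truncate (pos_uin_star a).
by apply: le_trans; apply: qnorm_le.
Qed.

End Kernels.

(** Since p is only a seminorm, a single completion serves for quotients by closed ideals and for
    operators with an asymptotic norm, separating and completing at once. *)
Record is_precstar (R : realType) (V : lmodType (Cx R)) (mul : V -> V -> V)
    (star : V -> V) (p : V -> R) : Prop := IsPrecstar {
  pc_seminorm : is_rseminorm p;
  pc_mulDl : forall (c : R[i]) (a a' b : V), mul (c *: a + a') b = c *: mul a b + mul a' b;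
  pc_mulDr : forall (c : R[i]) (a b b' : V), mul a (c *: b + b') = c *: mul a b + mul a b';
  pc_mulA : forall a b c : V, mul a (mul b c) = mul (mul a b) c;
  pc_starD : forall (c : R[i]) (a b : V), star (c *: a + b) = c^* *: star a + star b;
  pc_starK : forall a : V, star (star a) = a;
  pc_starM : forall a b : V, star (mul a b) = mul (star b) (star a);
  pc_normM : forall a b : V, p (mul a b) <= p a * p b;
  pc_cstar : forall a : V, p (mul (star a) a) = p a ^+ 2 }.

Definition complete_normed (R : realType) (V : normedModType (Cx R))
    (H : forall F : set_system V, ProperFilter F -> cauchy F -> cvg F) :
    completeNormedModType (Cx R) :=
  HB.pack V (Uniform_isComplete.Build V H).

(** * Separated completion of a C*-seminorm *)

Section Completion.
Variables (R : realType) (V : lmodType (Cx R)) (mul : V -> V -> V) (star : V -> V) (p : V -> R).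
Hypothesis VP : is_precstar mul star p.
Implicit Types (x y a b : V).

Let pD : forall x y, p (x + y) <= p x + p y. Proof. by have [] := pc_seminorm VP. Qed.
Let pZ : forall (c : R[i]) x, p (c *: x) = cabs c * p x.
Proof. by have [] := pc_seminorm VP. Qed.
Let p0 : forall x, 0 <= p x. Proof. by have [] := pc_seminorm VP. Qed.
Let pN x : p (- x) = p x. Proof. by rewrite -scaleN1r pZ cabsN cabs1 mul1r. Qed.
Let pB x y : p (x - y) <= p x + p y. Proof. by rewrite -(pN y). Qed.
Let pC x y : p (x - y) = p (y - x). Proof. by rewrite -pN opprB. Qed.
Let pT y x z : p (x - z) <= p (x - y) + p (y - z).
Proof. by rewrite -[x in p (x - z)](subrK y) -addrA pD. Qed.
Let pdist x y : `|p x - p y| <= p (x - y).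
Proof.
have H u v : p u - p v <= p (u - v) by rewrite lerBlDr -{1}(subrK v u).
by rewrite ler_norml H andbT lerNl opprB pC.
Qed.

Let mu0l b : mul 0 b = 0.
Proof. by have := pc_mulDl VP (-1) 0 0 b; rewrite scaler0 addr0 scaleN1r addNr. Qed.
Let mu0r a : mul a 0 = 0.
Proof. by have := pc_mulDr VP (-1) a 0 0; rewrite scaler0 addr0 scaleN1r addNr. Qed.
Let muBl a a' b : mul (a - a') b = mul a b - mul a' b.
Proof. by rewrite -scaleN1r addrC (pc_mulDl VP) addrC scaleN1r. Qed.
Let muBr a b b' : mul a (b - b') = mul a b - mul a b'.
Proof. by rewrite -scaleN1r addrC (pc_mulDr VP) addrC scaleN1r. Qed.
Let starB a b : star (a - b) = star a - star b.
Proof. by rewrite -scaleN1r addrC (pc_starD VP) addrC rmorphN rmorph1 scaleN1r. Qed.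
Let p_star a : p (star a) = p a.
Proof.
have H x : p x <= p (star x).
  by apply: sqr_le_mul => //; rewrite -(pc_cstar VP) (pc_normM VP).
by apply/eqP; rewrite eq_le H andbT -{2}(pc_starK VP a) H.
Qed.

Definition cauchy_pred : {pred nat -> V} := fun u =>
  `[< forall e : R, 0 < e -> exists M, forall n m, (M <= n)%N -> (M <= m)%N -> p (u n - u m) <= e >].

Fact cauchy_submod : submod_closed cauchy_pred.
Proof.
split=> [|c u v /asboolP uc /asboolP vc]; apply/asboolP => e e0.
  by exists 0%N => n m _ _; rewrite subrr -(scale0r 0) pZ cabs0 mul0r ltW.
have c1 : 0 < cabs c + 1 by rewrite ltr_wpDl ?cabs_ge0.
have e2 : 0 < e / 2 by rewrite divr_gt0.
have [|M uM] := uc (e / 2 / (cabs c + 1)); first by rewrite divr_gt0.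
have [M' vM] := vc _ e2.
exists (maxn M M') => n m; rewrite !geq_max => /andP[nM nM'] /andP[mM mM'].
have -> : (c *: u + v) n - (c *: u + v) m = c *: (u n - u m) + (v n - v m).
  by rewrite scalerBr addrACA -opprD.
rewrite (le_trans (pD _ _)) // [e]splitr lerD //; last exact: vM.
rewrite pZ (le_trans (ler_wpM2l (cabs_ge0 c) (uM _ _ nM mM))) //.
by rewrite mulrA ler_pdivrMr // mulrC ler_wpM2l ?(ltW e2) // lerDl.
Qed.
HB.instance Definition _ := GRing.isSubmodClosed.Build (Cx R) (nat -> V) cauchy_pred cauchy_submod.

Record cseq : Type := MkCseq { cseq_val :> nat -> V; cseqP : cseq_val \in cauchy_pred }.
HB.instance Definition _ := [isSub for cseq_val].
HB.instance Definition _ := [Choice of cseq by <:].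
HB.instance Definition _ := [SubChoice_isSubLmodule of cseq by <:].

Implicit Types (u v : cseq).

Lemma cseq_cauchy (u : cseq) (e : R) : 0 < e ->
  exists M, forall n m, (M <= n)%N -> (M <= m)%N -> p (u n - u m) <= e.
Proof. by case: u => u /= /asboolP; apply. Qed.

Fact plim_ex (u : cseq) : exists l, forall e : R, 0 < e ->
  exists M, forall n, (M <= n)%N -> `|p (u n) - l| <= e.
Proof.
apply: real_seq_complete => e /(cseq_cauchy u)[M uM]; exists M => n m nM mM.
exact: le_trans (pdist _ _) (uM _ _ nM mM).
Qed.

Definition plim (u : cseq) : R := projT1 (cid (plim_ex u)).

Lemma plimP (u : cseq) : p (u n) @[n --> \oo] --> plim u.
Proof.
apply/cvgrPdist_le => e e0; have [M uM] := projT2 (cid (plim_ex u)) e e0.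
by exists M => // n /= nM; rewrite distrC; apply: uM.
Qed.

Arguments plimP : clear implicits.

Fact plim_seminorm : is_rseminorm plim.
Proof.
split=> [u v|c u|u].
- apply: (ler_cvg_to (plimP (u + v)) (cvgD (plimP u) (plimP v))).
  by exists 0%N => // n _; exact: pD.
- have H := plimP (c *: u).
  have H2 : p ((c *: u : cseq) n) @[n --> \oo] --> cabs c * plim u.
    have -> : (fun n => p ((c *: u : cseq) n)) = (fun n => cabs c * p (u n)).
      by apply/funext => n; rewrite -pZ.
    exact: cvgMr (plimP u).
  exact: (cvg_unique _ H H2).
- apply: (ler_cvg_to (@cvg_cst _ (0 : R) _ \oo _) (plimP u)).
  by exists 0%N => // n _; exact: p0.
Qed.

Definition completion_seminorm : seminorm cseq := seminorm_of plim_seminorm.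
Definition completion : Type := sn_quot completion_seminorm.
HB.instance Definition _ := NormedModule.on completion.

Definition ccls (u : cseq) : completion := sn_cls completion_seminorm u.

Lemma nrm_ccls (u : cseq) : nrm (ccls u) = plim u.
Proof. by apply: (@complexI R); rewrite nrmE; exact: sn_cls_norm. Qed.

Lemma ccls_linear c u v : ccls (c *: u + v) = c *: ccls u + ccls v.
Proof. exact: sn_cls_linear. Qed.

Lemma ccls_eq u v : plim (u - v) = 0 <-> ccls u = ccls v.
Proof.
split=> [uv|/sn_clsP /= uv]; last by apply: (@complexI R).
by apply/sn_clsP => /=; rewrite uv.
Qed.

Lemma plim_le u (t : R) : (exists M, forall n, (M <= n)%N -> p (u n) <= t) -> plim u <= t.
Proof.
move=> [M uM]; apply: (ler_cvg_to (plimP u) (@cvg_cst _ t _ \oo _)).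
by exists M.
Qed.

Lemma plim_eq0 u : (forall e : R, 0 < e -> exists M, forall n, (M <= n)%N -> p (u n) <= e) -> plim u = 0.
Proof.
move=> ue; apply/eqP; rewrite eq_le; apply/andP; split; last by have [_ _] := plim_seminorm; apply.
by apply/ler_addgt0Pr => e e0; rewrite add0r; apply/plim_le/ue.
Qed.

Lemma plim0P u (e : R) : plim u = 0 -> 0 < e -> exists M, forall n, (M <= n)%N -> p (u n) <= e.
Proof.
move=> u0 e0; have := projT2 (cid (plim_ex u)) e e0; rewrite -/(plim u) u0.
by move=> [M uM]; exists M => n /uM; rewrite subr0 ger0_norm.
Qed.

Lemma cseq_bounded u : exists2 C, 0 < C & exists M, forall n, (M <= n)%N -> p (u n) <= C.
Proof.
have [M uM] := cseq_cauchy u ltr01.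
exists (p (u M) + 1); first by rewrite ltr_wpDl.
exists M => n nM; have := uM _ _ nM (leqnn M).
by move=> H; rewrite -[u n](subrK (u M)) addrC (le_trans (pD _ _)) // lerD.
Qed.

Fact cmul_cauchy (u v : cseq) : (fun n => mul (u n) (v n)) \in cauchy_pred.
Proof.
apply/asboolP => e e0; have [C C0 [M uM]] := cseq_bounded u; have [D D0 [M' vM]] := cseq_bounded v.
have [|N uN] := @cseq_cauchy u (e / 2 / D); first by rewrite !divr_gt0.
have [|N' vN] := @cseq_cauchy v (e / 2 / C); first by rewrite !divr_gt0.
exists (maxn (maxn M M') (maxn N N')) => n m; rewrite !geq_max.
move=> /andP[/andP[n1 n2] /andP[n3 n4]] /andP[/andP[m1 m2] /andP[m3 m4]].
have -> : mul (u n) (v n) - mul (u m) (v m) = mul (u n) (v n - v m) + mul (u n - u m) (v m).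
  by rewrite muBr muBl addrA subrK.
rewrite (le_trans (pD _ _)) // [e]splitr lerD // (le_trans (pc_normM VP _ _)) //.
  have -> : e / 2 = C * (e / 2 / C) by rewrite [RHS]mulrC mulfVK ?gt_eqF.
  by rewrite ler_pM // ?uM ?vN.
have -> : e / 2 = e / 2 / D * D by rewrite mulfVK ?gt_eqF.
by rewrite ler_pM // ?uN ?vM.
Qed.
Definition cseq_mul u v : cseq := MkCseq (cmul_cauchy u v).

Fact cstar_cauchy (u : cseq) : (fun n => star (u n)) \in cauchy_pred.
Proof.
apply/asboolP => e e0; have [M uM] := cseq_cauchy u e0.
by exists M => n m nM mM; rewrite -starB p_star uM.
Qed.
Definition cseq_star u : cseq := MkCseq (cstar_cauchy u).

Fact cconst_cauchy x : (fun _ : nat => x) \in cauchy_pred.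
Proof.
by apply/asboolP => e e0; exists 0%N => n m _ _; rewrite subrr -(scale0r 0) pZ cabs0 mul0r ltW.
Qed.
Definition cconst x : cseq := MkCseq (cconst_cauchy x).

Definition cmul (x y : completion) : completion := ccls (cseq_mul (sn_rep x) (sn_rep y)).
Definition cstar (x : completion) : completion := ccls (cseq_star (sn_rep x)).


Lemma ccls_eqP u v : (forall e : R, 0 < e -> exists M, forall n, (M <= n)%N -> p (u n - v n) <= e) ->
  ccls u = ccls v.
Proof. by move=> uv; apply/ccls_eq/plim_eq0. Qed.

Lemma cseq_ext u v : (forall n, u n = v n) -> ccls u = ccls v.
Proof.
move=> uv; apply: ccls_eqP => e e0; exists 0%N => n _.
by rewrite uv subrr -(scale0r 0) pZ cabs0 mul0r ltW.
Qed.

Lemma crepP u (e : R) : 0 < e -> exists M, forall n, (M <= n)%N -> p ((sn_rep (ccls u) : cseq) n - u n) <= e.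
Proof.
move=> e0; have /ccls_eq H : ccls (sn_rep (ccls u)) = ccls u by exact: sn_repK.
exact: (plim0P H e0).
Qed.

Lemma cmulE u v : cmul (ccls u) (ccls v) = ccls (cseq_mul u v).
Proof.
apply: ccls_eqP => e e0; set u' := (sn_rep (ccls u) : cseq); set v' := (sn_rep (ccls v) : cseq).
have [C C0 [M uM]] := cseq_bounded u'; have [D D0 [M' vM]] := cseq_bounded v.
have [|N uN] := @crepP u (e / 2 / D); first by rewrite !divr_gt0.
have [|N' vN] := @crepP v (e / 2 / C); first by rewrite !divr_gt0.
exists (maxn (maxn M M') (maxn N N')) => n; rewrite !geq_max.
move=> /andP[/andP[n1 n2] /andP[n3 n4]] /=.
have -> : mul (u' n) (v' n) - mul (u n) (v n) = mul (u' n) (v' n - v n) + mul (u' n - u n) (v n).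
  by rewrite muBr muBl addrA subrK.
rewrite (le_trans (pD _ _)) // [e]splitr lerD // (le_trans (pc_normM VP _ _)) //.
  have -> : e / 2 = C * (e / 2 / C) by rewrite [RHS]mulrC mulfVK ?gt_eqF.
  by rewrite ler_pM // ?uM ?vN.
have -> : e / 2 = e / 2 / D * D by rewrite mulfVK ?gt_eqF.
by rewrite ler_pM // ?uN ?vM.
Qed.

Lemma cstarE u : cstar (ccls u) = ccls (cseq_star u).
Proof.
apply: ccls_eqP => e e0; have [M uM] := crepP u e0; exists M => n nM /=.
by rewrite -starB p_star uM.
Qed.

Lemma completion_ind (Q : completion -> Prop) : (forall u, Q (ccls u)) -> forall x : completion, Q x.
Proof. exact: sn_ind. Qed.

Lemma completion_dense (x : completion) (e : R) : 0 < e -> exists y, nrm (x - ccls (cconst y)) <= e.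
Proof.
move=> e0; elim/completion_ind: x => u; have [M uM] := cseq_cauchy u e0.
exists (u M); have -> : ccls u - ccls (cconst (u M)) = ccls (u - cconst (u M)).
  by rewrite -scaleN1r addrC -ccls_linear scaleN1r addrC.
by rewrite nrm_ccls; apply: plim_le; exists M => n nM; exact: uM.
Qed.

Lemma plim_const x : plim (cconst x) = p x.
Proof. exact: (cvg_unique _ (plimP (cconst x)) (@cvg_cst _ (p x) _ \oo _)). Qed.

Lemma ccls_sub u v : ccls u - ccls v = ccls (u - v).
Proof. by rewrite -scaleN1r addrC -ccls_linear scaleN1r addrC. Qed.

Fact completion_complete : forall F : set_system completion,
  ProperFilter F -> cauchy F -> cvg F.
Proof.
apply: seq_completeP => x xc.
have dx n : exists y, nrm (x n - ccls (cconst y)) <= n.+1%:R^-1.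
  by apply: completion_dense; rewrite invr_gt0.
have [y xy] := choice dx.
have yx n m : p (y n - y m) = nrm (ccls (cconst (y n)) - ccls (cconst (y m))).
  have E : cconst (y n) - cconst (y m) = cconst (y n - y m) by exact: val_inj.
  by rewrite ccls_sub nrm_ccls E plim_const.
have yc : y \in cauchy_pred.
  apply/asboolP => e e0; have e3 : 0 < e / 3 by rewrite divr_gt0.
  have [M xM] := xc _ e3; have [M' iM] := @inv_small R _ e3.
  exists (maxn M M') => n m; rewrite !geq_max => /andP[n1 n2] /andP[m1 m2].
  rewrite yx (le_trans (nrm_tri (x n) _ _)) //.
  have H1 := le_trans (xy n) (iM n n2); have H2 := le_trans (xy m) (iM m m2).
  have H3 := nrm_tri (x m) (x n) (ccls (cconst (y m))).
  rewrite nrmC; have := xM n m n1 m1; lra.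
exists (ccls (MkCseq yc)) => e e0; have e2 : 0 < e / 2 by rewrite divr_gt0.
have [M yM] := @cseq_cauchy (MkCseq yc) _ e2; have [M' iM] := @inv_small R _ e2.
exists (maxn M M') => n; rewrite !geq_max => /andP[n1 n2].
rewrite (le_trans (nrm_tri (ccls (cconst (y n))) _ _)) // [e]splitr lerD //.
  by rewrite (le_trans (xy n)) // iM.
by rewrite ccls_sub nrm_ccls; apply: plim_le; exists M => m m1; apply: yM.
Qed.

Definition completion_space : completeNormedModType (Cx R) := complete_normed completion_complete.

Fact cmulDl (c : R[i]) (a a' b : completion_space) : cmul (c *: a + a' : completion) b = c *: (cmul a b : completion) + cmul a' b.
Proof.
elim/completion_ind: a => a; elim/completion_ind: a' => a'; elim/completion_ind: b => b.
rewrite -ccls_linear !cmulE -ccls_linear; apply: cseq_ext => n.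
exact: (pc_mulDl VP).
Qed.
Fact cmulDr (c : R[i]) (a b b' : completion_space) : cmul a (c *: b + b' : completion) = c *: (cmul a b : completion) + cmul a b'.
Proof.
elim/completion_ind: a => a; elim/completion_ind: b => b; elim/completion_ind: b' => b'.
rewrite -ccls_linear !cmulE -ccls_linear; apply: cseq_ext => n.
exact: (pc_mulDr VP).
Qed.
Fact cmulA (a b c : completion_space) : cmul a (cmul b c) = cmul (cmul a b) c.
Proof.
elim/completion_ind: a => a; elim/completion_ind: b => b; elim/completion_ind: c => c.
by rewrite !cmulE; apply: cseq_ext => n; exact: (pc_mulA VP).
Qed.
Fact cnormM (a b : completion_space) : `|cmul a b : completion| <= `|a : completion| * `|b : completion|.
Proof.
elim/completion_ind: a => a; elim/completion_ind: b => b.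
rewrite cmulE -!nrmE -rmorphM lecR !nrm_ccls.
apply: (ler_cvg_to (plimP (cseq_mul a b)) (cvgM (plimP a) (plimP b))).
by exists 0%N => // n _; exact: (pc_normM VP).
Qed.
Fact cstarD (c : R[i]) (a b : completion_space) : cstar (c *: a + b : completion) = c^* *: (cstar a : completion) + cstar b.
Proof.
elim/completion_ind: a => a; elim/completion_ind: b => b.
rewrite -ccls_linear !cstarE -ccls_linear; apply: cseq_ext => n.
exact: (pc_starD VP).
Qed.
Fact cstarK (a : completion_space) : cstar (cstar a) = a.
Proof.
by elim/completion_ind: a => a; rewrite !cstarE; apply: cseq_ext => n; exact: (pc_starK VP).
Qed.
Fact cstarM (a b : completion_space) : cstar (cmul a b) = cmul (cstar b) (cstar a).
Proof.
elim/completion_ind: a => a; elim/completion_ind: b => b.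
by rewrite !(cmulE, cstarE); apply: cseq_ext => n; exact: (pc_starM VP).
Qed.
Fact ccstar (a : completion_space) : `|cmul (cstar a) a : completion| = `|a : completion| ^+ 2.
Proof.
elim/completion_ind: a => a; rewrite cstarE cmulE -!nrmE -rmorphXn; congr (_%:C%C).
rewrite !nrm_ccls expr2; have H := plimP (cseq_mul (cseq_star a) a).
suff E : (fun n => p (cseq_mul (cseq_star a) a n)) = (fun n => p (a n) * p (a n)).
  by rewrite E in H; exact: (cvg_unique _ H (cvgM (plimP a) (plimP a))).
by apply/funext => n; rewrite /= (pc_cstar VP) expr2.
Qed.

Definition completion_cstar : cstarAlg R :=
  @CstarAlg R completion_space cmul cstar cmulDl cmulDr cmulA cnormM cstarD cstarK cstarM ccstar.

Lemma completion_exists : exists (B : cstarAlg R) (k : V -> B),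
  [/\ forall (c : R[i]) x y, k (c *: x + y) = c *: k x + k y,
      forall x y, k (mul x y) = ca_mul (k x) (k y),
      forall x, k (star x) = ca_star (k x) & forall x, nrm (k x) = p x].
Proof.
exists completion_cstar, (fun x => ccls (cconst x)); split=> [c x y|x y|x|x].
- by rewrite -[RHS]ccls_linear; apply: cseq_ext.
- by rewrite -[RHS]/(cmul _ _) cmulE; apply: cseq_ext.
- by rewrite -[RHS]/(cstar _) cstarE; apply: cseq_ext.
- by rewrite -plim_const -nrm_ccls.
Qed.

End Completion.

(** * Ideals of a right tensor C*-precategory *)

Section GeometricSequences.
Variables (R : realType) (V : normedModType (Cx R)).

Lemma half_expS_sum (k : nat) : 2^-1 ^+ k.+1 + 2^-1 ^+ k.+1 = 2^-1 ^+ k :> R.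
Proof. by rewrite exprS; move: (2^-1 ^+ k) => x; lra. Qed.

Lemma half_exp_small (e : R) : 0 < e -> exists M, forall n, (M <= n)%N -> 2^-1 ^+ n <= e.
Proof.
move=> /inv_small[M Mn]; exists M => n nM; apply: le_trans (Mn n nM).
rewrite exprVn lef_pV2 ?posrE ?exprn_gt0 ?ltr0n // -natrX ler_nat.
exact: ltn_expl.
Qed.

Lemma geometric_cauchy (u : nat -> V) (C : R) :
  (forall k, nrm (u k.+1 - u k) <= C * 2^-1 ^+ k) -> seq_cauchy u.
Proof.
move=> uC; have C0 : 0 <= C.
  by have := le_trans (nrm_ge0 _) (uC 0%N); rewrite expr0 mulr1.
have H n k : nrm (u (k + n)%N - u n) <= 2 * C * (2^-1 ^+ n - 2^-1 ^+ (k + n)).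
  elim: k => [|k IHk]; first by rewrite !subrr nrm0 mulr0.
  have T := nrm_tri (u (k + n)%N) (u (k + n).+1) (u n).
  have S := uC (k + n)%N; have E := half_expS_sum (k + n).
  rewrite addSn; apply: le_trans T _; apply: le_trans (lerD S IHk) _.
  rewrite -E; nra.
move=> e e0; have [|M Mn] := @half_exp_small (e / (2 * C + 1)).
  by rewrite divr_gt0 // ltr_wpDl // mulr_ge0.
exists M => n m.
have main i j : (M <= i)%N -> (i <= j)%N -> nrm (u j - u i) <= e.
  move=> Mi /subnK <-; apply: le_trans (H _ _) _.
  have C1 : 0 < 2 * C + 1 by rewrite ltr_wpDl // mulr_ge0.
  have := Mn i Mi; rewrite ler_pdivlMr // => Hi.
  apply: le_trans Hi; rewrite mulrC ler_pM ?mulr_ge0 ?lerDl //.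
    by rewrite subr_ge0 ler_wiXn2l ?invr_ge0 ?invf_le1 ?ler1n ?leq_addl.
  by rewrite gerBl exprn_ge0 // invr_ge0.
move=> nM mM; have [nm|/ltnW mn] := leqP n m; last exact: main.
by rewrite nrmC main.
Qed.

End GeometricSequences.

Section Precategory.
Variables (R : realType) (T : rtCstarPrecat R).
Let TP := rtpP T.

(** Morphisms off the diagonal are studied through a^*a in these C*-algebras; [cp_pos] makes a^*a
    positive there. *)
Definition TA (n : nat) : cstarAlg R :=
  @CstarAlg R (complete_normed (@cp_complete R T _ TP n n))
    (fun a b : T n n => acomp a b) (fun a : T n n => astar a)
    (@cp_compDl _ _ _ TP n n n) (@cp_compDr _ _ _ TP n n n) (@cp_compA _ _ _ TP n n n n)
    (@cp_normM _ _ _ TP n n n) (@cp_invD _ _ _ TP n n) (@cp_invK _ _ _ TP n n)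
    (@cp_invM _ _ _ TP n n n) (@cp_cstar _ _ _ TP n n).

Lemma acompZl n m l (c : R[i]) (a : T n m) (b : T m l) : acomp (c *: a) b = c *: acomp a b.
Proof. by have := cp_compDl TP c a 0 b; rewrite addr0 acomp0l addr0. Qed.
Lemma acompZr n m l (c : R[i]) (a : T n m) (b : T m l) : acomp a (c *: b) = c *: acomp a b.
Proof. by have := cp_compDr TP c a b 0; rewrite addr0 acomp0r addr0. Qed.
Lemma acompDl n m l (a a' : T n m) (b : T m l) : acomp (a + a') b = acomp a b + acomp a' b.
Proof. by have := cp_compDl TP 1 a a' b; rewrite !scale1r. Qed.
Lemma acompDr n m l (a : T n m) (b b' : T m l) : acomp a (b + b') = acomp a b + acomp a b'.
Proof. by have := cp_compDr TP 1 a b b'; rewrite !scale1r. Qed.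
Lemma acompBl n m l (a a' : T n m) (b : T m l) : acomp (a - a') b = acomp a b - acomp a' b.
Proof. by rewrite -scaleN1r acompDl acompZl scaleN1r. Qed.
Lemma acompBr n m l (a : T n m) (b b' : T m l) : acomp a (b - b') = acomp a b - acomp a b'.
Proof. by rewrite -scaleN1r acompDr acompZr scaleN1r. Qed.
Lemma acompA n m l k (a : T n m) (b : T m l) (c : T l k) :
  acomp a (acomp b c) = acomp (acomp a b) c.
Proof. exact: (cp_compA TP). Qed.

Lemma tensZ n m (c : R[i]) (a : T n m) : tens (c *: a) = c *: tens a.
Proof. by have := cp_tensD TP c a 0; rewrite addr0 tens0 addr0. Qed.
Lemma tensD n m (a b : T n m) : tens (a + b) = tens a + tens b.
Proof. by have := cp_tensD TP 1 a b; rewrite !scale1r. Qed.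
Lemma tensB n m (a b : T n m) : tens (a - b) = tens a - tens b.
Proof. by rewrite -scaleN1r tensD tensZ scaleN1r. Qed.
Lemma tensM n m l (a : T n m) (b : T m l) : tens (acomp a b) = acomp (tens a) (tens b).
Proof. exact: (cp_tensM TP). Qed.
Lemma tens_star n m (a : T n m) : tens (astar a) = astar (tens a).
Proof. exact: (cp_tens_inv TP). Qed.

Lemma astarK n m (a : T n m) : astar (astar a) = a. Proof. exact: (cp_invK TP). Qed.
Lemma astarM n m l (a : T n m) (b : T m l) : astar (acomp a b) = acomp (astar b) (astar a).
Proof. exact: (cp_invM TP). Qed.
Lemma astar0 n m : astar (0 : T n m) = 0.
Proof.
by have := cp_invD TP (-1) (0 : T n m) 0; rewrite scaler0 addr0 rmorphN rmorph1 scaleN1r addNr.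
Qed.
Lemma astarZ n m (c : R[i]) (a : T n m) : astar (c *: a) = c^* *: astar a.
Proof. by have := cp_invD TP c a 0; rewrite astar0 !addr0. Qed.
Lemma astarD n m (a b : T n m) : astar (a + b) = astar a + astar b.
Proof. by have := cp_invD TP 1 a b; rewrite rmorph1 !scale1r. Qed.
Lemma astarB n m (a b : T n m) : astar (a - b) = astar a - astar b.
Proof. by rewrite -scaleN1r astarD astarZ rmorphN rmorph1 scaleN1r. Qed.

Lemma nrm_acomp n m l (a : T n m) (b : T m l) : nrm (acomp a b) <= nrm a * nrm b.
Proof. by rewrite -lecR rmorphM /= !nrmE (cp_normM TP). Qed.
Lemma nrm_acstar n m (a : T n m) : nrm (acomp (astar a) a) = nrm a ^+ 2.
Proof. by apply: (@complexI R); rewrite rmorphXn /= !nrmE (cp_cstar TP). Qed.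
Lemma nrm_astar n m (a : T n m) : nrm (astar a) = nrm a.
Proof.
have H i j (c : T i j) : nrm c <= nrm (astar c).
  by apply: sqr_le_mul; rewrite ?nrm_ge0 // -nrm_acstar nrm_acomp.
by apply/eqP; rewrite eq_le H -{2}(astarK a) H.
Qed.

Lemma pos_acstar n m (a : T n m) : pos (uin (acomp (astar a) a : TA m)).
Proof. by have [b ->] := cp_pos TP a; exact: (@pos_uin_star _ (TA m)). Qed.

Lemma tens_starhom n : @is_starhom R (TA n) (TA n.+1) (fun a : T n n => tens a).
Proof.
by split=> [c a b|a b|a]; [exact: (cp_tensD TP)|exact: (cp_tensM TP)|exact: (cp_tens_inv TP)].
Qed.

Lemma nrm_tens n m (a : T n m) : nrm (tens a) <= nrm a.
Proof.
rewrite -(@ler_sqr _ (nrm (tens a))) ?nnegrE ?nrm_ge0 // -!nrm_acstar -tens_star -tensM.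
exact: (starhom_contr (tens_starhom m)).
Qed.

Lemma un_uin_TA m (a : T m m) : un (uin (a : TA m)) = nrm a.
Proof. exact: (@un_uin _ (TA m)). Qed.

Lemma nrm_acomp_unit n m (x : T n m) (c : T m m) : astar c = c ->
  nrm (x - acomp x c) ^+ 2 =
  un ((1 - uin (c : TA m)) * uin (acomp (astar x) x : TA m) * (1 - uin (c : TA m))).
Proof.
move=> sc; rewrite -nrm_acstar -un_uin_TA; congr un.
rewrite mulrBr mulr1 mulrBl mul1r -!(@uinM _ (TA m)) -!(@uinB _ (TA m)) -!(@uinM _ (TA m)) -(@uinB _ (TA m)).
congr (uin _); rewrite /= astarB astarM sc acompBl !acompBr !acompA.
rewrite [in RHS]acompBl !opprB [X in _ + X = _]addrC addrACA; congr (_ + _).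
by rewrite addrC.
Qed.

Section Ideals.
Variable I : fam T.
Arguments I : clear implicits.
Hypothesis II : is_ideal I.

Lemma idealAdd n m (a b : T n m) : I n m a -> I n m b -> I n m (a + b).
Proof. by move=> Ia Ib; rewrite -[a]scale1r; apply: (idealD II). Qed.
Lemma idealZ n m (c : R[i]) (a : T n m) : I n m a -> I n m (c *: a).
Proof. by move=> Ia; rewrite -[_ *: _]addr0; apply: (idealD II) => //; exact: ideal0. Qed.
Lemma idealN n m (a : T n m) : I n m a -> I n m (- a).
Proof. by move=> Ia; rewrite -scaleN1r; apply: idealZ. Qed.
Lemma idealB n m (a b : T n m) : I n m a -> I n m b -> I n m (a - b).
Proof. by move=> Ia Ib; apply: idealAdd => //; apply: idealN. Qed.
Lemma ideal_lim n m (a : T n m) :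
  (forall e : R, 0 < e -> exists2 b, I n m b & nrm (a - b) <= e) -> I n m a.
Proof. by have /closed_nrm := @ideal_closed _ _ _ II n m; apply. Qed.

(** c is an approximate unit of a^*a, so only a^*a has to lie in I; this lets [ideal_diag] recover
    an ideal from its diagonal. The bound on x - xc holds for all x because 1 - c has norm at most
    1. *)
Lemma ideal_right_unit_of n m (a : T n m) (e : R) : I m m (acomp (astar a) a) -> 0 < e -> exists c : T m m,
  [/\ I m m c, astar c = c, nrm c <= 1,
      forall k (x : T k m), nrm (x - acomp x c) <= nrm x & nrm (a - acomp a c) <= e].
Proof.
move=> Iaa e0; have [|c [sc c1 c1' cb cP]] := approx_unit (pos_acstar a) (_ : 0 < e ^+ 2).
  by rewrite exprn_gt0.
exists c; split=> //.
- apply: cP => //; first exact: (ideal0 II).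
  + by move=> x y; exact: idealAdd.
  + by move=> r x; exact: idealZ.
  + by move=> x y; exact: (idealMl II).
- move=> k x; rewrite -(@ler_sqr _ (nrm (x - _))) ?nnegrE ?nrm_ge0 // nrm_acomp_unit //.
  rewrite (le_trans (unM _ _)) // -[leRHS]mulr1 ler_pM ?un_ge0 //.
  rewrite (le_trans (unM _ _)) // -[leRHS]mul1r ler_pM ?un_ge0 //.
  by rewrite un_uin_TA nrm_acstar.
- by rewrite -(@ler_sqr _ (nrm _)) ?nnegrE ?nrm_ge0 ?(ltW e0) // nrm_acomp_unit.
Qed.

Lemma ideal_right_unit n m (a : T n m) (e : R) : I n m a -> 0 < e -> exists c : T m m,
  [/\ I m m c, astar c = c, nrm c <= 1,
      forall k (x : T k m), nrm (x - acomp x c) <= nrm x & nrm (a - acomp a c) <= e].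
Proof. by move=> Ia; apply: ideal_right_unit_of; apply: (idealMl II). Qed.

Lemma ideal_star n m (a : T n m) : I n m a -> I m n (astar a).
Proof.
move=> Ia; apply: ideal_lim => e e0; have [c [Ic sc _ _ ac]] := ideal_right_unit Ia e0.
exists (acomp c (astar a)); first exact: (Defs.idealMr II).
by rewrite -{1}sc -astarM -astarB nrm_astar.
Qed.

Lemma ideal_left_unit n m (a : T n m) (e : R) : I n m a -> 0 < e -> exists c : T n n,
  [/\ I n n c, astar c = c, nrm c <= 1,
      forall k (x : T n k), nrm (x - acomp c x) <= nrm x & nrm (a - acomp c a) <= e].
Proof.
move=> Ia e0; have [c [Ic sc c1 cx ca]] := ideal_right_unit (ideal_star Ia) e0.
have H k (x : T n k) : nrm (x - acomp c x) = nrm (astar x - acomp (astar x) c).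
  by rewrite -nrm_astar astarB astarM sc.
exists c; split=> // [k x|]; first by rewrite H (le_trans (cx _ _)) // nrm_astar.
by rewrite H.
Qed.

Lemma ideal_diag n m (a : T n m) : I m m (acomp (astar a) a) -> I n m a.
Proof.
move=> Iaa; apply: ideal_lim => e e0.
have [c [Ic _ _ _ ac]] := ideal_right_unit_of Iaa e0.
by exists (acomp a c) => //; apply: (idealMl II).
Qed.

Lemma ideal_cideal n : @is_cideal R (TA n) (I n n).
Proof.
split=> [|||a b|a b]; [exact: (ideal_closed II)|exact: (ideal0 II)|exact: (idealD II)| |].
  exact: (idealMl II).
exact: (Defs.idealMr II).
Qed.

Let I0 n m : I n m 0. Proof. exact: (ideal0 II). Qed.
Let IL n m := @idealD _ _ _ II n m.

(** As for C*-algebras, except that 1 - c acts on morphisms, by x - xc on the right and, through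
    adjoints, by x - cx on the left. *)
Lemma iqnorm_cstar n m (a : T n m) :
  qnorm (I m m) (acomp (astar a) a) = qnorm (I n m) a ^+ 2.
Proof.
have qm := qnorm_ge0 (I0 m m) (@IL m m); have qn := qnorm_ge0 (I0 n m) (@IL n m).
apply/eqP; rewrite eq_le; apply/andP; split.
  have q_star : qnorm (I m n) (astar a) = qnorm (I n m) a.
    have H i j (x : T i j) : qnorm (I j i) (astar x) <= qnorm (I i j) x.
      apply: qnorm_le_of => // e e0; have [w Iw xw] := qnorm_ex (I0 i j) x e0.
      by exists (astar w); [exact: ideal_star|rewrite -astarB nrm_astar].
    by apply/eqP; rewrite eq_le H -{1}(astarK a) H.
  apply/ler_addgt0Pr => e e0; pose C := 2 * qnorm (I n m) a + 1.
  have C0 : 0 < C by rewrite ltr_wpDl // mulr_ge0.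
  pose d := Num.min 1 (e / C); have d0 : 0 < d by rewrite lt_min ltr01 divr_gt0.
  have d1 : d <= 1 by rewrite ge_min lexx.
  have dC : d * C <= e by rewrite -ler_pdivlMr // ge_min lexx orbT.
  have [w Iw aw] := qnorm_ex (I0 n m) a d0.
  have Ix : I m m (acomp (astar a) w + acomp (astar w) (a - w)).
    by apply: idealAdd; [exact: (idealMl II)|apply: (Defs.idealMr II); exact: ideal_star].
  rewrite (le_trans (qnorm_le _ Ix)) //.
  have -> : acomp (astar a) a - (acomp (astar a) w + acomp (astar w) (a - w)) = acomp (astar (a - w)) (a - w).
    by rewrite astarB acompBl !acompBr opprD addrA.
  rewrite nrm_acstar; apply: le_trans (_ : _ <= (qnorm (I n m) a + d) ^+ 2) _.
    by rewrite ler_sqr ?nnegrE ?nrm_ge0 ?addr_ge0 ?(ltW d0).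
  have := qn a; rewrite /C in dC *; nra.
apply/ler_addgt0Pr => e e0; have e2 : 0 < e / 2 by rewrite divr_gt0.
have [w Iw aw] := qnorm_ex (I0 m m) (acomp (astar a) a) e2.
have [c [Ic sc c1 cx wc]] := ideal_right_unit Iw e2.
have H : qnorm (I n m) a <= nrm (a - acomp a c) by apply: qnorm_le; exact: (idealMl II).
apply: (@le_trans _ _ (nrm (a - acomp a c) ^+ 2)).
  by rewrite ler_sqr ?nnegrE ?nrm_ge0.
have -> : nrm (a - acomp a c) ^+ 2 =
    nrm (acomp (astar (a - acomp a c)) (a - acomp a c)) by rewrite nrm_acstar.
set b := acomp (astar a) a in aw *.
have -> : acomp (astar (a - acomp a c)) (a - acomp a c) = (b - acomp b c) - acomp c (b - acomp b c).
  by rewrite /b astarB astarM sc acompBl !acompBr !acompA.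
have cx' (x : T m m) : nrm (x - acomp c x) <= nrm x.
  by rewrite -nrm_astar astarB astarM sc (le_trans (cx _ _)) // nrm_astar.
rewrite (le_trans (cx' _)) //.
have -> : b - acomp b c = (b - w - acomp (b - w) c) + (w - acomp w c).
  by rewrite acompBl addrACA subrK -opprD subrK.
rewrite (le_trans (nrmD _ _)) // [e]splitr addrA lerD //.
exact: le_trans (cx _ _) aw.
Qed.

End Ideals.

End Precategory.

(** * C*-subalgebras and homomorphisms defined on them *)

Section Subalgebra.
Variables (R : realType) (A : cstarAlg R) (S : set A).
Hypothesis SP : is_subcstar S.

Definition subc_pred : {pred A} := fun a => `[< S a >].

Fact subc_submod : submod_closed subc_pred.
Proof.
split=> [|c a b /asboolP Sa /asboolP Sb]; apply/asboolP; first exact: (subcstar0 SP).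
exact: (subcstarD SP).
Qed.
HB.instance Definition _ := GRing.isSubmodClosed.Build (Cx R) A subc_pred subc_submod.

Record subc : Type := MkSubc { subc_val :> A; subcP : subc_val \in subc_pred }.
HB.instance Definition _ := [isSub for subc_val].
HB.instance Definition _ := [Choice of subc by <:].
HB.instance Definition _ := [SubChoice_isSubLmodule of subc by <:].

Implicit Types x y z : subc.

Lemma subcE x : S x. Proof. by case: x => x /= /asboolP. Qed.

Definition subc_norm x : R[i] := `|subc_val x|.
Fact subc_normD x y : subc_norm (x + y) <= subc_norm x + subc_norm y.
Proof. exact: ler_normD. Qed.
Fact subc_normZ (c : R[i]) x : subc_norm (c *: x) = `|c| * subc_norm x.
Proof. exact: normrZ. Qed.
Fact subc_norm0_eq0 x : subc_norm x = 0 -> x = 0.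
Proof. by move/normr0_eq0 => x0; apply: val_inj. Qed.
HB.instance Definition _ := Lmodule_isNormed.Build (Cx R) subc
  subc_normD subc_normZ subc_norm0_eq0.


Fact subc_complete : forall F : set_system subc, ProperFilter F -> cauchy F -> cvg F.
Proof.
apply: seq_completeP => u uc.
have [x ux] := @ca_seq_complete _ A (fun n => subc_val (u n)) uc.
have Sx : S x by apply: (seq_lim_closed (subcstar_closed SP) ux) => n; exact: subcE.
by exists (MkSubc (asboolT Sx)).
Qed.

Definition mk_subc a (Sa : S a) : subc := MkSubc (asboolT Sa).

Definition subc_mul x y : subc := mk_subc (subcstarM SP (subcE x) (subcE y)).
Definition subc_star x : subc := mk_subc (subcstar_star SP (subcE x)).

Definition subc_cstar : cstarAlg R.
Proof.
apply: (@CstarAlg R (complete_normed subc_complete) subc_mul subc_star).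
- by move=> c a a' b; apply: val_inj; exact: ca_mulDl.
- by move=> c a b b'; apply: val_inj; exact: ca_mulDr.
- by move=> a b c; apply: val_inj; exact: ca_mulA.
- by move=> a b; exact: ca_normM.
- by move=> c a b; apply: val_inj; exact: ca_starD.
- by move=> a; apply: val_inj; exact: ca_starK.
- by move=> a b; apply: val_inj; exact: ca_starM.
- by move=> a; exact: (ca_cstar (subc_val a)).
Defined.

End Subalgebra.

(** A representation is constrained only on the entries of [K]; its diagonal components are
    homomorphisms in this restricted sense. *)
Record is_starhom_on (R : realType) (A B : cstarAlg R) (S : set A) (f : A -> B) : Prop :=
  IsStarhomOn {
  on_homD : forall (c : R[i]) (a b : A), S a -> S b -> f (c *: a + b) = c *: f a + f b;
  on_homM : forall a b : A, S a -> S b -> f (ca_mul a b) = ca_mul (f a) (f b);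
  on_hom_star : forall a : A, S a -> f (ca_star a) = ca_star (f a) }.

Section Quotients.
Variables (R : realType) (A B : cstarAlg R).

Lemma quotient_exists (P : set B) : is_cideal P ->
  exists (Q : cstarAlg R) (q : B -> Q), is_starhom q /\ forall b, nrm (q b) = qnorm P b.
Proof.
move=> PI.
have H : is_precstar (@ca_mul R B) (@ca_star R B) (qnorm P).
  split; [|exact: ca_mulDl|exact: ca_mulDr|exact: ca_mulA|exact: ca_starD|
    exact: ca_starK|exact: ca_starM|exact: qnorm_mul|exact: qnorm_cstar].
  by apply: rseminorm_qnorm; [exact: cideal0|exact: cidealD].
have [Q [q [qD qM qs qn]]] := completion_exists H.
by exists Q, q; split=> //; split.
Qed.

Variables (S : set A) (f : A -> B).
Hypothesis SP : is_subcstar S.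
Hypothesis fH : is_starhom_on S f.

Let g (x : subc_cstar SP) : B := f (subc_val x).
Let gH : is_starhom g.
Proof.
split=> [c a b|a b|a].
- by apply: (on_homD fH); exact: subcE.
- by apply: (on_homM fH); exact: subcE.
- by apply: (on_hom_star fH); exact: subcE.
Qed.

Lemma starhom_on_contr a : S a -> nrm (f a) <= nrm a.
Proof. by move=> Sa; exact: (starhom_contr gH (mk_subc Sa)). Qed.

(** The induced map from S / f^-1(P) to B / P is injective, hence isometric. The comparisons of
    distances for saturated ideals and for representations are instances of this. *)
Lemma starhom_on_kernel (P : set B) a (e : R) : is_cideal P -> S a -> 0 < e ->
  exists w, [/\ S w, P (f w) & nrm (a - w) <= qnorm P (f a) + e].
Proof.
move=> PI Sa e0; have [Q [q [qH qn]]] := quotient_exists PI.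
have hH : is_starhom (q \o g).
  split=> [c x y|x y|x] /=.
  - by rewrite (starhomD gH) (starhomD qH).
  - by rewrite (starhomM gH) (starhomM qH).
  - by rewrite (starhom_star gH) (starhom_star qH).
have kI := kernel_cideal hH.
have [w /= w0 aw] := qnorm_ex (cideal0 kI) (mk_subc Sa : subc_cstar SP) e0.
exists (subc_val w); split; first exact: subcE.
  apply: (qnorm_eq0 (cideal0 PI) (cideal_closed PI)).
  by rewrite -qn w0 nrm0.
apply: le_trans aw _; rewrite lerD2r -qn.
exact: (qnorm_kernel hH).
Qed.

End Quotients.

(** * Intersections and sums of closed ideals *)

Section IdealLattice.
Variables (R : realType) (T : rtCstarPrecat R).
Implicit Types I J K N : fam T.

Lemma famI_ideal I J : is_ideal I -> is_ideal J -> is_ideal (famI I J).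
Proof.
move=> II IJ; split=> [n m|n m|n m c a b [Ia Ja] [Ib Jb]|n m l a b [Ib Jb]|n m l a b [Ia Ja]].
- by apply: closedI; [exact: (ideal_closed II)|exact: (ideal_closed IJ)].
- by split; exact: ideal0.
- by split; exact: idealD.
- by split; exact: idealMl.
- by split; exact: Defs.idealMr.
Qed.

Lemma tens_preim_ideal N : is_ideal N -> is_ideal (tens_preim N).
Proof.
move=> IN; split=> [n m|n m|n m c a b Na Nb|n m l a b Nb|n m l a b Na]; rewrite /tens_preim /=.
- apply/closed_nrm => x xl; apply: (ideal_lim IN) => e e0.
  have [y Ny xy] := xl e e0; exists (tens y) => //.
  by rewrite -tensB (le_trans (nrm_tens _)).
- by rewrite tens0; exact: ideal0.
- by rewrite tensD tensZ; exact: idealD.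
- by rewrite tensM; exact: idealMl.
- by rewrite tensM; exact: Defs.idealMr.
Qed.

Lemma zero_ideal : is_ideal (fun n m => [set 0] : set (T n m)).
Proof.
split=> [n m|n m|n m c a b /= -> ->|n m l a b /= ->|n m l a b /= ->] //.
- apply/closed_nrm => x xl /=; apply/nrm_eq0/eqP; rewrite eq_le nrm_ge0 andbT.
  by apply/ler_addgt0Pr => e /xl[y /= ->]; rewrite subr0 add0r.
- by rewrite /= scaler0 addr0.
- by rewrite /= acomp0r.
- by rewrite /= acomp0l.
Qed.

Lemma ker_tens_ideal : is_ideal (ker_tens T).
Proof. exact: tens_preim_ideal zero_ideal. Qed.

Lemma ideal_subcstar I n : is_ideal I -> @is_subcstar R (TA T n) (I n n).
Proof.
move=> II; split; [exact: (ideal_closed II)|exact: (ideal0 II)|exact: (idealD II)| |].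
  by move=> a b Ia _; exact: (Defs.idealMr II).
by move=> a; exact: (ideal_star II).
Qed.

(** If w in J is close to a and c in I is an approximate left unit of a, then cw lies in both
    ideals, and a - cw = (a - ca) + c(a - w). *)
Lemma qnorm_inter I J n m (a : T n m) : is_ideal I -> is_ideal J -> I n m a ->
  qnorm (famI I J n m) a <= qnorm (J n m) a.
Proof.
move=> II IJ Ia; apply: (qnorm_le_of (W := famI I J n m)) => e e0.
have e2 : 0 < e / 2 by rewrite divr_gt0.
have [w Jw aw] := qnorm_ex (ideal0 IJ n m) a e2.
have [c [Ic _ c1 _ ac]] := ideal_left_unit II Ia e2.
exists (acomp c w); first by split; [exact: (Defs.idealMr II)|exact: (idealMl IJ)].
have -> : a - acomp c w = (a - acomp c a) + acomp c (a - w) by rewrite acompBr addrA subrK.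
rewrite (le_trans (nrmD _ _)) // [e]splitr addrCA lerD //.
rewrite (le_trans (nrm_acomp _ _)) // -[leRHS]mul1r ler_pM ?nrm_ge0 //.
Qed.

(** One step of the successive approximation in [famD_ideal]. Replacing i by i - w with w in both
    ideals changes nothing modulo J and brings its norm down to the distance from x to J. *)
Lemma near_sum I J n m (x : T n m) (d : R) : is_ideal I -> is_ideal J -> 0 < d ->
  (forall e : R, 0 < e -> exists2 u, famD I J n m u & nrm (x - u) <= e) ->
  exists i, [/\ I n m i, nrm i <= qnorm (J n m) x + d & qnorm (J n m) (x - i) <= d].
Proof.
move=> II IJ d0 xl; have d4 : 0 < d / 4 by rewrite divr_gt0.
have J0 := ideal0 IJ n m; have JL := @idealD _ _ _ IJ n m.
have [u [i Ii [j Jj <-]] xu] := xl _ d4.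
have xi : qnorm (J n m) (x - i) <= d / 4.
  by rewrite (le_trans (qnorm_le _ Jj)) // -addrA -opprD.
have qi : qnorm (J n m) i <= qnorm (J n m) x + d / 4.
  have -> : i = x - (x - i) by rewrite subKr.
  by rewrite (le_trans (qnormD J0 JL _ _)) // lerD // qnormN.
have IIJ := famI_ideal II IJ.
have [w [Iw Jw] iw] := qnorm_ex (ideal0 IIJ n m) i d4.
exists (i - w); split; first exact: idealB.
  have := qnorm_inter II IJ Ii; move: iw qi; set q := qnorm (famI _ _ _ _) _; lra.
have -> : qnorm (J n m) (x - (i - w)) = qnorm (J n m) (x - i).
  by apply: qnorm_congr => //; rewrite opprB addrCA addrK -?addrA ?subrr ?addr0 // opprB addrA subrK.
lra.
Qed.

(** Closedness is the point: by [near_sum] the components in I can be chosen with geometrically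
    small increments, so they converge to some y in I, and x - y has distance 0 from J. *)
Lemma famD_ideal I J : is_ideal I -> is_ideal J -> is_ideal (famD I J).
Proof.
move=> II IJ; split=> [n m|n m|n m c _ _ [i Ii [j Jj <-]] [i' Ii' [j' Jj' <-]]|
    n m l a _ [i Ii [j Jj <-]]|n m l _ b [i Ii [j Jj <-]]].
- apply/closed_nrm => x xl; have J0 := ideal0 IJ n m; have JL := @idealD _ _ _ IJ n m.
  pose d k : R := 2^-1 ^+ k; have d0 k : 0 < d k by rewrite exprn_gt0 // invr_gt0.
  pose near y := forall e : R, 0 < e -> exists2 u, famD I J n m u & nrm (y - u) <= e.
  have step (s : {s : T n m | I n m s /\ near (x - s)}) k : exists s' : {s : T n m | I n m s /\ near (x - s)},
      nrm (sval s' - sval s) <= qnorm (J n m) (x - sval s) + d k /\ qnorm (J n m) (x - sval s') <= d k.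
    case: s => s [Is ns] /=; have [i [Ii i1 i2]] := near_sum II IJ (d0 k) ns.
    have Isi : I n m (s + i) by exact: idealAdd.
    have nsi : near (x - (s + i)).
      move=> e e0; have [u [i' Ii' [j' Jj' <-]] xu] := ns e e0.
      exists (i' - i + j'); first by exists (i' - i); [exact: idealB|exists j'].
      by rewrite (addrAC i') opprB opprD !addrA subrK.
    by exists (exist _ (s + i) (conj Isi nsi)); rewrite /= addrC addKr opprD addrA.
  have s0 : {s : T n m | I n m s /\ near (x - s)}.
    by exists 0; split; [exact: ideal0|rewrite subr0].
  pose F s k := projT1 (cid (step s k)).
  have FP s k : nrm (sval (F s k) - sval s) <= qnorm (J n m) (x - sval s) + d k /\
      qnorm (J n m) (x - sval (F s k)) <= d k by exact: (projT2 (cid (step s k))).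
  pose u := fix u k := if k is k'.+1 then F (u k') k' else s0.
  (* An increment is bounded by the residual left by the preceding step; the first one has no such
     bound, so the sequence starts at [u 1]. *)
  pose v k : T n m := sval (u k.+1).
  have vI k : I n m (v k) by exact: (svalP (u k.+1)).1.
  have vx k : qnorm (J n m) (x - v k) <= d k by exact: (FP (u k) k).2.
  have vc : seq_cauchy v.
    apply: (@geometric_cauchy _ _ _ 2) => k.
    apply: le_trans (FP (u k.+1) k.+1).1 _; have := vx k; rewrite /v => vk.
    have := half_expS_sum R k; rewrite -/(d k.+1) -/(d k) => dk.
    have dp := d0 k.+1; apply: le_trans (lerD vk (lexx _)) _; lra.
  have [y vy] := complete_seq (@cp_complete _ _ _ (rtpP T) n m) vc.
  have Iy : I n m y by exact: (seq_lim_closed (ideal_closed II (n:=n) (m:=m)) vy).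
  exists y => //; exists (x - y); last by rewrite addrC subrK.
  apply: (qnorm_eq0 J0 (ideal_closed IJ (n:=n) (m:=m))).
  apply/eqP; rewrite eq_le (qnorm_ge0 J0 JL) andbT; apply/ler_addgt0Pr => e e0.
  have e2 : 0 < e / 2 by rewrite divr_gt0.
  have [M vM] := vy _ e2; have [M' dM] := half_exp_small e2.
  set k := maxn M M'; have -> : x - y = (x - v k) + (v k - y) by rewrite addrA subrK.
  rewrite add0r (le_trans (qnormD J0 JL _ _)) // [e]splitr lerD //.
    by apply: le_trans (vx k) (dM _ _); rewrite leq_maxr.
  by apply: le_trans (qnorm_le_nrm J0 _) (vM _ _); rewrite leq_maxl.
- by exists 0; [exact: ideal0|exists 0; [exact: ideal0|rewrite addr0]].
- exists (c *: i + i'); first exact: idealD.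
  by exists (c *: j + j'); [exact: idealD|rewrite scalerDr addrACA].
- by exists (acomp a i); [exact: idealMl|exists (acomp a j); [exact: idealMl|rewrite acompDr]].
- by exists (acomp i b); [exact: Defs.idealMr|exists (acomp j b); [exact: Defs.idealMr|rewrite acompDl]].
Qed.

End IdealLattice.

(** * Invariant saturated ideals *)

Section Invariance.
Variables (R : realType) (T : rtCstarPrecat R).
Implicit Types K J N : fam T.

(** Condition ii) in the form used below: every entry of [K] at positive indices is the tensor of an
    element of [J], and tensoring is injective on [J] because [J] annihilates its kernel. *)
Definition pulls_down K J : Prop :=
  (forall n m (a : T n.+1 m.+1), K n.+1 m.+1 a -> exists2 b, J n m b & tens b = a) /\
  (forall n m (a : T n m), J n m a -> tens a = 0 -> a = 0).

Definition reducible K J : Prop := fam_le K (famD J (ker_tens T)) \/ pulls_down K J.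

(** The two annihilators occurring in condition ii) are given independently. They agree on the
    diagonal, and a^*a carries this to all entries. *)
Lemma annihilator_unique (P P' : fam T) : is_annihilator (ker_tens T) P ->
  is_annihilator (ker_tens T) P' -> fam_le P P'.
Proof.
move=> [IP Pd] [IP' Pd'] n m a Pa; apply: (ideal_diag IP').
by rewrite Pd' -Pd; apply: (idealMl IP).
Qed.

(** For injectivity: a in [J] with a (x) 1 = 0 has a^*a both in the kernel and in its annihilator,
    so the square of a^*a is 0. *)
Lemma reducible_of K J : is_ideal K -> is_ideal J ->
  (fam_le K (famD J (ker_tens T)) \/
   (admits_transfer K /\
    exists2 P : fam T, is_annihilator (ker_tens T) P &
      forall n m, J n m = famI (Jof K) P n m)) -> reducible K J.
Proof.
move=> IK IJ [H|[[P' AP' tE] [P AP JE]]]; [by left|right; split].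
- move=> n m a; rewrite -tE => -[b [Kb Pb] <-]; exists b => //.
  by rewrite JE; split=> //; apply: (annihilator_unique AP' AP).
- move=> n m a; rewrite JE => -[_ Pa] ta0; have [IP Pd] := AP.
  have kaa : ker_tens T m m (acomp (astar a) a).
    by rewrite /ker_tens /tens_preim /= tensM ta0 acomp0r.
  have Paa : P m m (acomp (astar a) a) by apply: (idealMl IP).
  move: Paa; rewrite Pd => /(_ _ kaa) aa0.
  have : (nrm a ^+ 2) ^+ 2 = 0.
    by rewrite -(nrm_acstar a) -nrm_acstar astarM astarK aa0 nrm0.
  by move/eqP; rewrite !expf_eq0 /= => /eqP/nrm_eq0.
Qed.

Section Fixed.
Variables (K J N : fam T).
Arguments K : clear implicits.
Arguments J : clear implicits.
Arguments N : clear implicits.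
Hypotheses (IK : is_ideal K) (IJ : is_ideal J) (JK : fam_le J (Jof K)).
Hypothesis NL : Lat J K N.

Let IN : is_ideal N. Proof. by case: NL. Qed.
Let NK : fam_le N K. Proof. by case: NL. Qed.
Let Ninv : Kinvariant K N. Proof. by case: NL. Qed.
Let Nsat : Jsaturated J N. Proof. by case: NL. Qed.


(** Invariance yields only products of a (x) 1 with elements of [K]; an approximate unit in [K] of a
    (x) 1 removes the extra factor. *)
Lemma tens_in_N n m (a : T n m) : N n m a -> K n.+1 m.+1 (tens a) -> N n.+1 m.+1 (tens a).
Proof.
move=> Na Kta; apply: (ideal_lim IN) => e e0.
have [c [Kc _ _ _ ac]] := ideal_right_unit IK Kta e0.
by exists (acomp (tens a) c) => //; apply: Ninv.
Qed.

(** By saturation tensoring induces an injective, hence isometric, map on the diagonal of [J] modulo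
    [N]; off the diagonal j^*j is used. *)
Lemma qnorm_tens n m (j : T n m) : J n m j -> qnorm (N n m) j <= qnorm (N n.+1 m.+1) (tens j).
Proof.
move=> Jj; have q2 := qnorm_ge0 (ideal0 IN n.+1 m.+1) (@idealD _ _ _ IN n.+1 m.+1) (tens j).
rewrite -(@ler_sqr _ (qnorm _ _)) ?nnegrE //; last exact: (qnorm_ge0 (ideal0 IN n m) (@idealD _ _ _ IN n m)).
rewrite -!(iqnorm_cstar IN) -tens_star -tensM.
apply/ler_addgt0Pr => e e0.
have tH : @is_starhom_on R (TA T m) (TA T m.+1) (J m m) (fun a : T m m => tens a).
  have tH := tens_starhom T m.
  by split=> [c a b _ _|a b _ _|a _]; [exact: (starhomD tH)|exact: (starhomM tH)|exact: (starhom_star tH)].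
have Jjj : J m m (acomp (astar j) j) by apply: (idealMl IJ).
have [w [Jw Nw jw]] := starhom_on_kernel (ideal_subcstar m IJ) tH (ideal_cideal IN m.+1) Jjj e0.
by apply: le_trans jw; apply: qnorm_le; apply: Nsat.
Qed.

Hypothesis red : reducible K J.

Lemma K_tens_stable : fam_le K (famD J (ker_tens T)) ->
  forall n m (a : T n m), K n m a -> K n.+1 m.+1 (tens a).
Proof.
move=> Ki n m a /Ki[j Jj [c kc <-]]; rewrite tensD [tens c]kc addr0.
by have [] := JK Jj.
Qed.

(** In case i) [K] is stable under tensoring, so the shifted entries themselves lie in [N]. In case
    ii) the right factor is approximated by its product with some f (x) 1, f in [J], and (s (x) 1)(f
    (x) 1) = (sf) (x) 1 reduces to the previous shift. *)
Lemma shift_right (b : mat T) k i j l (x : T j l) : (forall i j, N i j (b i j)) ->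
  K j l x -> N i l (acomp (iter k (@Defs.shift R T) b i j) x).
Proof.
move=> Nb Kx; case: red => [Ki|[pull _]].
  apply: (Defs.idealMr IN); clear x Kx l; elim: k i j => [//|k IHk] [|i] [|j] /=; try exact: (ideal0 IN).
  by apply: tens_in_N => //; apply: (K_tens_stable Ki); apply: NK.
elim: k i j l x Kx => [i j l x Kx|k IHk i j l x Kx]; first exact: (Defs.idealMr IN).
move: i j x Kx => [|i] [|j] x Kx /=; try by rewrite acomp0l; exact: (ideal0 IN).
apply: (ideal_lim IN) => e e0; set s := iter k _ b i j.
have s1 : 0 < nrm s + 1 by rewrite ltr_wpDl ?nrm_ge0.
have [|c [Kc _ _ _ xc]] := ideal_left_unit IK Kx (_ : 0 < e / (nrm s + 1)); first by rewrite divr_gt0.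
have [f Jf fE] := pull _ _ _ Kc.
exists (acomp (tens s) (acomp c x)).
  by rewrite -fE acompA -tensM; apply: Ninv => //; apply: IHk; have [] := JK Jf.
rewrite -acompBr (le_trans (nrm_acomp _ _)) //.
rewrite (le_trans (ler_pM (nrm_ge0 _) (nrm_ge0 _) (nrm_tens s) xc)) //.
by rewrite mulrA ler_pdivrMr // mulrC ler_wpM2l ?(ltW e0) // lerDl.
Qed.

Lemma shift_left (b : mat T) k i j l (x : T l i) : (forall i j, N i j (b i j)) ->
  K l i x -> N l j (acomp x (iter k (@Defs.shift R T) b i j)).
Proof.
move=> Nb Kx; pose b' : mat T := fun i j => astar (b j i).
have E k' i' j' : astar (iter k' (@Defs.shift R T) b i' j') = iter k' (@Defs.shift R T) b' j' i'.
  elim: k' i' j' => [//|k' IHk] [|i'] [|j'] /=; rewrite ?astar0 //.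
  by rewrite -tens_star IHk.
rewrite -[acomp _ _]astarK astarM E; apply: (ideal_star IN); apply: shift_right.
  by move=> i' j'; exact: (ideal_star IN).
exact: (ideal_star IK).
Qed.

End Fixed.
End Invariance.

(** * The precategory K_J and its invariant ideals *)

Section DiagonalSums.
Variables (R : realType) (T : rtCstarPrecat R).
Implicit Types a b c : mat T.

Lemma mat_addE a b i j : (a + b) i j = a i j + b i j. Proof. by []. Qed.
Lemma mat_subE a b i j : (a - b) i j = a i j - b i j. Proof. by []. Qed.
Lemma mat_scaleE (k : R[i]) a i j : (k *: a) i j = k *: a i j. Proof. by []. Qed.

Lemma diag_sum0l a j : diag_sum a 0%N j = a 0%N j.
Proof. by rewrite /diag_sum min0n big_nat1. Qed.
Lemma diag_sum0r a i : diag_sum a i 0%N = a i 0%N.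
Proof. by rewrite /diag_sum minn0 big_nat1. Qed.
Lemma diag_sumS a i j : diag_sum a i.+1 j.+1 = a i.+1 j.+1 + tens (diag_sum a i j).
Proof.
rewrite /diag_sum minnSS big_nat_recl //=; congr (_ + _).
elim: (minn i j).+1 => [|n IHn]; first by rewrite !big_geq // tens0.
by rewrite !big_nat_recr //= IHn tensD.
Qed.

Lemma diag_sumD a b i j : diag_sum (a + b) i j = diag_sum a i j + diag_sum b i j.
Proof. by have := diag_sum_linear i j 1 a b; rewrite !scale1r. Qed.
Lemma diag_sumB a b i j : diag_sum (a - b) i j = diag_sum a i j - diag_sum b i j.
Proof. by rewrite -scaleN1r addrC diag_sum_linear scaleN1r addrC. Qed.

Lemma diag_sum_iota_out n m (x : T n m) i j : (i < n)%N || (j < m)%N -> diag_sum (iotaM x) i j = 0.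
Proof.
elim: i j => [|i IHi] [|j] ij; rewrite ?diag_sum0l ?diag_sum0r ?diag_sumS ?iotaM_out //; try lia.
by rewrite IHi ?tens0 ?addr0 //; lia.
Qed.

Lemma diag_sum_iota n m (x : T n m) : diag_sum (iotaM x) n m = x.
Proof.
case: n m x => [|n] [|m] x; rewrite ?diag_sum0l ?diag_sum0r ?diag_sumS ?iotaM_id //.
by rewrite diag_sum_iota_out ?tens0 ?addr0 //; lia.
Qed.

Lemma diag_sum_iotaS n m (x : T n m) : diag_sum (iotaM x) n.+1 m.+1 = tens x.
Proof. by rewrite diag_sumS iotaM_out ?add0r ?diag_sum_iota //; lia. Qed.

Definition on_diag n m a : Prop := forall i j, a i j != 0 -> (i + m = n + j)%N.

Lemma on_diag_shift n m a k : on_diag n m a -> on_diag n m (iter k (@Defs.shift R T) a).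
Proof.
move=> am; elim: k => [//|k IHk] [|i] [|j] /=; rewrite ?eqxx //.
move=> tn0; suff /IHk : iter k (@Defs.shift R T) a i j != 0 by rewrite addSn addnS => ->.
by apply: contra_neq tn0 => ->; rewrite tens0.
Qed.

Lemma mat_mul_diag n m a b i t j : on_diag n m a -> (i + m = n + t)%N ->
  mat_mul a b i j = acomp (a i t) (b t j).
Proof.
move=> am it; rewrite /mat_mul -(@fsbig_widen _ _ _ _ [set t] setT) ?fsbig_set1 //.
move=> k [_ /= kt]; rewrite /preimage /=; have [->|/am ik] := eqVneq (a i k) 0; first by rewrite acomp0l.
by case: kt; lia.
Qed.

Lemma mat_mul_diag0 n m a b i j : on_diag n m a -> (i + m < n)%N -> mat_mul a b i j = 0.
Proof.
move=> am im; apply: fsbig1 => k _.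
by have [->|/am ik] := eqVneq (a i k) 0; [rewrite acomp0l|lia].
Qed.

Lemma iter_shift_out a k i j : (i < k)%N || (j < k)%N -> iter k (@Defs.shift R T) a i j = 0.
Proof.
elim: k i j => [//|k IHk] [|i] [|j] //= ij.
by rewrite IHk ?tens0 //; lia.
Qed.

Lemma diag_sum_long a i j n : (minn i j < n)%N ->
  diag_sum a i j = \sum_(0 <= t < n) iter t (@Defs.shift R T) a i j.
Proof.
move=> ijn; rewrite /diag_sum [RHS](big_cat_nat (n := (minn i j).+1)) //=.
rewrite [X in _ = _ + X]big_nat [X in _ = _ + X]big1 ?addr0 // => k /andP[ik _].
by apply: iter_shift_out; lia.
Qed.

(** The unshifted term is counted in the first sum only, which is why the entry of b is subtracted
    from its diagonal sum in the second. *)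
Lemma star_entry n m l a b i t j : on_diag n m a -> on_diag m l b -> (i + m = n + t)%N ->
  mat_star a b i j = acomp (diag_sum a i t) (b t j) + acomp (a i t) (diag_sum b t j - b t j).
Proof.
move=> am bl it; rewrite /mat_star; congr (_ + _).
  rewrite (@diag_sum_long a i t i.+1) ?ltnS ?geq_minl //.
  rewrite (big_morph (fun x => acomp x (b t j)) (fun x y => acompDl x y _) (acomp0l _ _)).
  by apply: eq_bigr => k _; apply: mat_mul_diag it; exact: on_diag_shift.
rewrite (@diag_sum_long b t j j.+1) ?ltnS ?geq_minr //.
rewrite [in RHS]big_nat_recl //= [X in acomp _ X]addrC addKr big_add1 /=.
rewrite (big_morph (fun x => acomp (a i t) x) (fun x y => acompDr _ x y) (acomp0r _ _)).
by apply: eq_bigr => k _; exact: mat_mul_diag it.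
Qed.

Lemma star_entry0 n m l a b i j : on_diag n m a -> on_diag m l b -> (i + m < n)%N ->
  mat_star a b i j = 0.
Proof.
move=> am bl im; rewrite /mat_star !big1 ?addr0 // => k _; apply: mat_mul_diag0 im => //.
exact: on_diag_shift.
Qed.

Lemma diag_sum_star0 n m l a b i j : on_diag n m a -> on_diag m l b -> (i + m < n)%N ->
  diag_sum (mat_star a b) i j = 0.
Proof.
move=> am bl; elim: i j => [|i IHi] [|j] im;
  rewrite ?diag_sum0l ?diag_sum0r ?diag_sumS (star_entry0 _ am bl) //.
by rewrite IHi ?tens0 ?addr0 //; lia.
Qed.

(** Each map a |-> x_s is multiplicative for the star product. As the seminorm of K_J is a maximum
    of norms of the x_s, computations in K_J become products of diagonal sums. *)
Lemma diag_sum_star n m l a b i t j : on_diag n m a -> on_diag m l b -> (i + m = n + t)%N ->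
  diag_sum (mat_star a b) i j = acomp (diag_sum a i t) (diag_sum b t j).
Proof.
move=> am bl; elim: i t j => [|i IHi] t j it.
  rewrite !diag_sum0l (star_entry _ am bl it) diag_sum0l -acompDr.
  by rewrite addrC subrK.
case: j => [|j]; first by rewrite !diag_sum0r (star_entry _ am bl it) diag_sum0r subrr acomp0r addr0.
rewrite diag_sumS; case: t it => [|t] it.
  rewrite (diag_sum_star0 _ am bl) ?tens0 ?addr0; last by lia.
  by rewrite (star_entry _ am bl it) !diag_sum0r !diag_sum0l subrr acomp0r addr0.
rewrite (star_entry _ am bl it) (IHi t j); last by lia.
rewrite tensM !diag_sumS; set A := a _ _; set B := b _ _.
set X := tens (diag_sum a i t); set Y := tens (diag_sum b t j).
by rewrite [B + Y - B]addrC addKr -addrA -acompDl [RHS]acompDr.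
Qed.

End DiagonalSums.

(** * Classes in K_J through their diagonal sums *)

Section KJCalculus.
Variables (R : realType) (T : rtCstarPrecat R) (K J : ideal T).
Hypothesis JK : fam_le J (Jof K).
Implicit Types (a b c : mat T) (e : R).

Let IK := idealP K.
Let IJ := idealP J.
Let J0 n m : J n m 0. Proof. exact: ideal0. Qed.
Let JL n m := @idealD _ _ _ IJ n m.

(** The seminorm of K_J takes the top sum in [T] and the lower ones modulo [J]. [below_le] is its
    lower part; one level higher the former top sum joins the lower ones, which gives [mod_J_le]. *)
Definition mod_J_le n m c e : Prop := forall k, (k <= minn n m)%N ->
  qnorm (J (n - k)%N (m - k)%N) (diag_sum c (n - k)%N (m - k)%N) <= e.

Definition below_le n m c e : Prop := forall k, (0 < k)%N -> (k <= minn n m)%N ->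
  qnorm (J (n - k)%N (m - k)%N) (diag_sum c (n - k)%N (m - k)%N) <= e.

Lemma mod_J_le_S n m c e : mod_J_le n.+1 m.+1 c e <->
  qnorm (J n.+1 m.+1) (diag_sum c n.+1 m.+1) <= e /\ mod_J_le n m c e.
Proof.
split=> [H|[H1 H2]]; last by move=> [|k] km; [exact: H1|apply: H2; lia].
by split=> [|k km]; [exact: (H 0%N)|apply: (H k.+1); lia].
Qed.

Lemma below_le_S n m c e : below_le n.+1 m.+1 c e <-> mod_J_le n m c e.
Proof.
split=> [H k km|H [|k] // _ km]; last by apply: H; lia.
by apply: (H k.+1) => //; lia.
Qed.

Lemma KJ_norm_le n m (a : Mmat K n m) e : 0 <= e ->
  (KJ_norm J a <= e) <-> (nrm (diag_sum a n m) <= e /\ below_le n m a e).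
Proof.
move=> e0; rewrite /KJ_norm ge_max; split.
  move=> /andP[H ->]; split=> // k k0 km; apply: le_trans H.
  apply: (le_bigmax_seq _ k (fun _ => true)
    (fun k => qnorm (J (n - k)%N (m - k)%N) (diag_sum a (n - k)%N (m - k)%N))) => //.
  by rewrite mem_index_iota; lia.
move=> [-> H]; rewrite andbT big_seq; apply: bigmax_le => // k.
by rewrite mem_index_iota => /andP[k0 km]; apply: H.
Qed.

Lemma nrm_KJ_cls n m (a : Mmat K n m) : nrm (KJ_cls J a) = KJ_norm J a.
Proof. by apply: (@complexI R); rewrite nrmE; exact: sn_cls_norm. Qed.

Lemma KJ_cls_linear n m (c : R[i]) (a b : Mmat K n m) :
  KJ_cls J (c *: a + b) = c *: KJ_cls J a + KJ_cls J b.
Proof. exact: sn_cls_linear. Qed.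

Lemma KJ_clsB n m (a b : Mmat K n m) : KJ_cls J (a - b) = KJ_cls J a - KJ_cls J b.
Proof. by rewrite -scaleN1r addrC KJ_cls_linear scaleN1r addrC. Qed.

Lemma KJ_cls_ind n m (P : KJ_hom K J n m -> Prop) : (forall a : Mmat K n m, P (KJ_cls J a)) -> forall x, P x.
Proof. exact: sn_ind. Qed.

Definition null n m c : Prop := diag_sum c n m = 0 /\ below_le n m c 0.

Lemma KJ_cls_eq n m (a b : Mmat K n m) : KJ_cls J a = KJ_cls J b <-> null n m (M_mat a - M_mat b).
Proof.
have E : KJ_cls J a = KJ_cls J b <-> KJ_norm J (a - b) <= 0.
  rewrite -nrm_KJ_cls KJ_clsB; split=> [->|H]; first by rewrite subrr nrm0.
  by apply/eqP; rewrite -subr_eq0; apply/eqP/nrm_eq0/eqP; rewrite eq_le H nrm_ge0.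
rewrite E KJ_norm_le // /null; split=> -[H1 H2]; split=> //.
  by apply/nrm_eq0/eqP; rewrite eq_le H1 nrm_ge0.
by rewrite -[M_mat (a - b)]/(M_mat a - M_mat b) H1 nrm0.
Qed.

Lemma below0P n m c : below_le n m c 0 <-> forall k, (0 < k)%N -> (k <= minn n m)%N ->
  J (n - k)%N (m - k)%N (diag_sum c (n - k)%N (m - k)%N).
Proof.
split=> H k k0 km; last by rewrite (qnorm_in (J0 _ _) (@JL _ _)) //; apply: H.
apply: (qnorm_eq0 (J0 _ _) (@ideal_closed _ _ _ IJ (n - k)%N (m - k)%N)).
by apply/eqP; rewrite eq_le H //= (qnorm_ge0 (J0 _ _) (@JL _ _)).
Qed.

Lemma mod0P n m c : mod_J_le n m c 0 <-> forall k, (k <= minn n m)%N ->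
  J (n - k)%N (m - k)%N (diag_sum c (n - k)%N (m - k)%N).
Proof.
split=> H k km; last by rewrite (qnorm_in (J0 _ _) (@JL _ _)) //; apply: H.
apply: (qnorm_eq0 (J0 _ _) (@ideal_closed _ _ _ IJ (n - k)%N (m - k)%N)).
by apply/eqP; rewrite eq_le H //= (qnorm_ge0 (J0 _ _) (@JL _ _)).
Qed.

Lemma Mmat_K n m (a : Mmat K n m) i j : K i j (M_mat a i j).
Proof. by case: a => a /= /asboolP[]. Qed.
Lemma Mmat_supp n m (a : Mmat K n m) i j : M_mat a i j != 0 -> (i + m = n + j)%N /\ (j <= m)%N.
Proof. by case: a => a /= /asboolP[_]; apply. Qed.
Lemma Mmat_diag n m (a : Mmat K n m) : on_diag n m a.
Proof. by move=> i j /Mmat_supp[]. Qed.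

Lemma null_star_l n m l a a' b : on_diag n m a -> on_diag n m a' -> on_diag m l b ->
  null n m (a - a') -> null n l (mat_star a b - mat_star a' b).
Proof.
move=> am a'm bl [N0 /below0P NJ]; split.
  rewrite diag_sumB !(@diag_sum_star _ _ n m l _ _ n m) // -acompBl -diag_sumB.
  by rewrite N0 acomp0l.
apply/below0P => k k0 kl; rewrite diag_sumB.
have [km|mk] := leqP k m; last first.
  by rewrite !(@diag_sum_star0 _ _ n m l) ?subrr //; try exact: J0; lia.
rewrite !(@diag_sum_star _ _ n m l _ _ (n - k) (m - k)) //; try lia.
rewrite -acompBl -diag_sumB; apply: (Defs.idealMr IJ); apply: NJ => //; lia.
Qed.

Lemma null_star_r n m l a b b' : on_diag n m a -> on_diag m l b -> on_diag m l b' ->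
  null m l (b - b') -> null n l (mat_star a b - mat_star a b').
Proof.
move=> am bl b'l [N0 /below0P NJ]; split.
  rewrite diag_sumB !(@diag_sum_star _ _ n m l _ _ n m) // -acompBr -diag_sumB.
  by rewrite N0 acomp0r.
apply/below0P => k k0 kl; rewrite diag_sumB.
have [km|mk] := leqP k m; last first.
  by rewrite !(@diag_sum_star0 _ _ n m l) ?subrr //; try exact: J0; lia.
rewrite !(@diag_sum_star _ _ n m l _ _ (n - k) (m - k)) //; try lia.
rewrite -acompBr -diag_sumB; apply: (idealMl IJ); apply: NJ => //; lia.
Qed.

Lemma KJ_compE n m l (a : Mmat K n m) (b : Mmat K m l) :
  KJ_comp (KJ_cls J a) (KJ_cls J b) = KJ_cls J (M_star a b).
Proof.
rewrite /KJ_comp; set a' := sn_rep _; set b' := sn_rep _.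
have na : null n m (M_mat a' - M_mat a) by apply/KJ_cls_eq; exact: sn_repK.
have nb : null m l (M_mat b' - M_mat b) by apply/KJ_cls_eq; exact: sn_repK.
apply: (@etrans _ _ (KJ_cls J (M_star a b'))); apply/KJ_cls_eq.
  exact: (null_star_l (@Mmat_diag _ _ a') (@Mmat_diag _ _ a) (@Mmat_diag _ _ b') na).
exact: (null_star_r (@Mmat_diag _ _ a) (@Mmat_diag _ _ b') (@Mmat_diag _ _ b) nb).
Qed.

Lemma null_incl n m c : null n m c -> c n.+1 m.+1 = 0 -> null n.+1 m.+1 c.
Proof.
move=> [N0 /below0P NJ] c0; split; first by rewrite diag_sumS c0 add0r N0 tens0.
apply/below_le_S/mod0P => -[|k] km; first by rewrite !subn0 N0; exact: J0.
exact: NJ.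
Qed.

Lemma Mmat_out n m (a : Mmat K n m) : M_mat a n.+1 m.+1 = 0.
Proof. by have [//|/Mmat_supp[_]] := eqVneq (M_mat a n.+1 m.+1) 0; rewrite ltnn. Qed.

Lemma KJ_tensE n m (a : Mmat K n m) : KJ_tens (KJ_cls J a) = KJ_cls J (M_incl a).
Proof.
rewrite /KJ_tens; set a' := sn_rep _.
have na : null n m (M_mat a' - M_mat a) by apply/KJ_cls_eq; exact: sn_repK.
apply/KJ_cls_eq/null_incl => //.
exact: etrans (congr2 (fun x y => x - y) (Mmat_out a') (Mmat_out a)) (subrr 0).
Qed.

Lemma iota_in_M n m (x : T n m) : K n m x -> iotaM x \in in_M K n m.
Proof.
move=> Kx; apply/asboolP; split=> i j.
  have [/andP[/eqP ei /eqP ej]|] := boolP ((n == i) && (m == j)).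
    by case: _ / ei; case: _ / ej; rewrite iotaM_id.
  by rewrite negb_and => nm; rewrite iotaM_out //; exact: ideal0.
have [/andP[/eqP <- /eqP <-]|] := boolP ((n == i) && (m == j)); first by split; lia.
by rewrite negb_and => nm; rewrite iotaM_out // eqxx.
Qed.

(** Total on matrices, with value 0 outside M(n,m), so that membership proofs stay out of the terms
    being rewritten. *)
Definition kcls n m a : KJ_hom K J n m :=
  if pselect (a \in in_M K n m) is left aM then KJ_cls J (MkM aM) else 0.

Lemma kclsE n m (a : Mmat K n m) : kcls n m a = KJ_cls J a.
Proof.
rewrite /kcls; case: pselect => [aM|]; last by case; case: a.
by congr KJ_cls; apply: val_inj.
Qed.

Lemma kcls_ex n m (x : KJ_hom K J n m) : exists2 a, a \in in_M K n m & x = kcls n m a.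
Proof. by elim/KJ_cls_ind: x => a; exists a; [case: a|rewrite kclsE]. Qed.

Lemma kclsM n m a (aM : a \in in_M K n m) : kcls n m a = KJ_cls J (MkM aM).
Proof. by rewrite -kclsE. Qed.

Lemma kcls_eq n m a b : a \in in_M K n m -> b \in in_M K n m ->
  kcls n m a = kcls n m b <-> null n m (a - b).
Proof. by move=> aM bM; rewrite (kclsM aM) (kclsM bM) KJ_cls_eq. Qed.

Lemma kcls_linear n m (c : R[i]) a b : a \in in_M K n m -> b \in in_M K n m ->
  kcls n m (c *: a + b) = c *: kcls n m a + kcls n m b.
Proof. by move=> aM bM; rewrite (kclsM aM) (kclsM bM) -KJ_cls_linear -kclsE. Qed.

Lemma kclsD n m a b : a \in in_M K n m -> b \in in_M K n m ->
  kcls n m (a + b) = kcls n m a + kcls n m b.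
Proof. by move=> aM bM; have := kcls_linear 1 aM bM; rewrite !scale1r. Qed.

Lemma kclsB n m a b : a \in in_M K n m -> b \in in_M K n m ->
  kcls n m (a - b) = kcls n m a - kcls n m b.
Proof. by move=> aM bM; rewrite -scaleN1r addrC kcls_linear // scaleN1r addrC. Qed.

Lemma kcls_le n m a e : a \in in_M K n m -> 0 <= e ->
  nrm (kcls n m a) <= e <-> (nrm (diag_sum a n m) <= e /\ below_le n m a e).
Proof. by move=> aM e0; rewrite (kclsM aM) nrm_KJ_cls KJ_norm_le. Qed.

Lemma star_in_M n m l a b : a \in in_M K n m -> b \in in_M K m l -> mat_star a b \in in_M K n l.
Proof. by move=> aM bM; exact: (mat_star_in_M (MkM aM) (MkM bM)). Qed.

Lemma kcls_comp n m l a b : a \in in_M K n m -> b \in in_M K m l ->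
  KJ_comp (kcls n m a) (kcls m l b) = kcls n l (mat_star a b).
Proof. by move=> aM bM; rewrite (kclsM aM) (kclsM bM) KJ_compE -kclsE. Qed.

Lemma incl_in_M n m a : a \in in_M K n m -> a \in in_M K n.+1 m.+1.
Proof. by move=> aM; exact: (M_incl_in_M (MkM aM)). Qed.

Lemma kcls_tens n m a : a \in in_M K n m -> KJ_tens (kcls n m a) = kcls n.+1 m.+1 a.
Proof. by move=> aM; rewrite (kclsM aM) KJ_tensE -kclsE. Qed.

Lemma in_M_diag n m a : a \in in_M K n m -> on_diag n m a.
Proof. by move=> aM; exact: (@Mmat_diag _ _ (MkM aM)). Qed.

Lemma in_M_K n m a i j : a \in in_M K n m -> K i j (a i j).
Proof. by move=> aM; exact: (@Mmat_K _ _ (MkM aM)). Qed.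

Lemma in_M_rightmost n m a : a \in in_M K n m -> a n.+1 m.+1 = 0.
Proof. by move=> aM; exact: (@Mmat_out _ _ (MkM aM)). Qed.

Lemma in_M_D n m a b : a \in in_M K n m -> b \in in_M K n m -> a + b \in in_M K n m.
Proof. exact: rpredD. Qed.
Lemma in_M_B n m a b : a \in in_M K n m -> b \in in_M K n m -> a - b \in in_M K n m.
Proof. exact: rpredB. Qed.

(** Removing the corner entry leads from M(n+1,m+1) to M(n,m) and leaves all lower diagonal sums
    unchanged; the inductions on the level run along it. *)
Definition cut n m a : mat T := locked (a - iotaM (a n m)).

Lemma cutE n m a : cut n m a = a - iotaM (a n m).
Proof. by rewrite /cut -lock. Qed.

Lemma cutK n m a : cut n m a + iotaM (a n m) = a.
Proof. by rewrite cutE subrK. Qed.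


Lemma cut_in_M n m a : a \in in_M K n.+1 m.+1 -> cut n.+1 m.+1 a \in in_M K n m.
Proof.
move=> aM; have iM := iota_in_M (in_M_K n.+1 m.+1 aM).
have := in_M_B aM iM; rewrite -cutE => /asboolP[cK cM]; apply/asboolP; split=> // i j cij.
have [d jm] := cM i j cij; split; first by lia.
rewrite -ltnS ltn_neqAle jm andbT; apply: contra_neq cij => ej.
rewrite ej in d *; have -> : i = n.+1 by lia.
by rewrite cutE mat_subE iotaM_id subrr.
Qed.

Lemma in_M_corner n m a : a \in in_M K n m -> (n == 0%N) || (m == 0%N) -> a = iotaM (a n m).
Proof.
move=> aM nm; have aK := in_M_K n m aM; apply: mat_eqP => i j.
have [/andP[/eqP ei /eqP ej]|] := boolP ((n == i) && (m == j)).
  by case: _ / ei; case: _ / ej; rewrite iotaM_id.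
rewrite negb_and => ij; rewrite iotaM_out //.
have [//|/(@Mmat_supp _ _ (MkM aM) _ _)[/= d jm]] := eqVneq (a i j) 0.
by exfalso; move: ij nm; lia.
Qed.

Lemma diag_sum_cut n m a i j : (i < n)%N || (j < m)%N -> diag_sum (cut n m a) i j = diag_sum a i j.
Proof. by move=> ij; rewrite cutE diag_sumB diag_sum_iota_out // subr0. Qed.

Lemma eq_below n m a b : (forall i j, (i < n)%N -> (j < m)%N -> diag_sum a i j = diag_sum b i j) ->
  forall e, below_le n m a e -> below_le n m b e.
Proof. by move=> ab e H k k0 km; rewrite -ab; [exact: H|lia|lia]. Qed.

Lemma below_corner n m a e : (n == 0%N) || (m == 0%N) -> below_le n m a e.
Proof. by move=> nm k k0 km; exfalso; move: nm; lia. Qed.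

End KJCalculus.

(** * Correspondence between invariant ideals of K_J and of K *)

Section KJIdeals.
Variables (R : realType) (T : rtCstarPrecat R) (K J : ideal T).
Hypothesis JK : fam_le J (Jof K).
Implicit Types (a b c : mat T) (e : R) (N : fam T).

Let IK := idealP K.
Let IJ := idealP J.

Definition NJ N : fam (KJ K J) := fun n m =>
  [set kcls K J n m a | a in [set a | a \in in_M K n m /\ forall i j, N i j (a i j)]].

(** The inverse of [NJ]. The clause [K n m x] excludes those x for which [kcls] would return its
    default 0. *)
Definition diag_part (N' : fam (KJ K J)) : fam T := fun n m =>
  [set x | K n m x /\ N' n m (kcls K J n m (iotaM x))].

Arguments NJ N n m : clear implicits.
Arguments diag_part N' n m : clear implicits.

Lemma iota_entries N n m (x : T n m) : is_ideal N -> N n m x -> forall i j, N i j (iotaM x i j).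
Proof.
move=> IN Nx i j; have [/andP[/eqP ei /eqP ej]|] := boolP ((n == i) && (m == j)).
  by case: _ / ei; case: _ / ej; rewrite iotaM_id.
by rewrite negb_and => nm; rewrite iotaM_out //; exact: ideal0.
Qed.

Lemma cut_entries N n m a : is_ideal N -> (forall i j, N i j (a i j)) ->
  forall i j, N i j (cut n m a i j).
Proof.
move=> IN Na i j; rewrite cutE mat_subE; apply: idealB => //.
exact: iota_entries.
Qed.

(** The diagonal sums of [iotaM y] below the corner vanish, so only the top sum of a survives: the
    single-entry matrices at the corner form an ideal of K_J. *)
Lemma kcls_iota_comp n m l a (y : T m l) : a \in in_M K n m -> K m l y ->
  KJ_comp (kcls K J n m a) (kcls K J m l (iotaM y)) =
  kcls K J n l (iotaM (acomp (diag_sum a n m) y)) /\ K n l (acomp (diag_sum a n m) y).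
Proof.
move=> aM Ky; have yM := iota_in_M Ky.
have Kp : K n l (acomp (diag_sum a n m) y) by apply: (idealMl IK).
split=> //; rewrite kcls_comp //; apply/(kcls_eq J (star_in_M aM yM) (iota_in_M Kp)).
have am := in_M_diag aM; have ym := in_M_diag yM.
split; first by rewrite diag_sumB (@diag_sum_star _ _ n m l _ _ n m) // !diag_sum_iota subrr.
apply/below0P => k k0 kl; rewrite diag_sumB [X in _ - X]diag_sum_iota_out; last by lia.
rewrite subr0; have [km|mk] := leqP k m.
  rewrite (@diag_sum_star _ _ n m l _ _ (n - k) (m - k)) //; last by lia.
  by rewrite [X in acomp _ X]diag_sum_iota_out ?acomp0r; [exact: (ideal0 IJ)|lia].
by rewrite (@diag_sum_star0 _ _ n m l) //; [exact: (ideal0 IJ)|lia].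
Qed.

Lemma kcls_iota_ge n m (x : T n m) e : K n m x -> 0 <= e -> nrm x <= e ->
  nrm (kcls K J n m (iotaM x)) <= e.
Proof.
move=> Kx e0 xe; apply/(kcls_le J (iota_in_M Kx) e0); split; first by rewrite diag_sum_iota.
move=> k k0 km; rewrite diag_sum_iota_out; last by lia.
by rewrite (qnorm_in (ideal0 IJ _ _) (@idealD _ _ _ IJ _ _)) //; exact: ideal0.
Qed.

Lemma kcls_iotaB n m (x y : T n m) : K n m x -> K n m y ->
  kcls K J n m (iotaM (x - y)) = kcls K J n m (iotaM x) - kcls K J n m (iotaM y).
Proof.
move=> Kx Ky; rewrite -kclsB ?iota_in_M //.
apply/(kcls_eq J (iota_in_M (idealB IK Kx Ky)) (in_M_B (iota_in_M Kx) (iota_in_M Ky))).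
have -> : iotaM (x - y) - (iotaM x - iotaM y) = 0 :> mat T.
  apply: mat_eqP => i j; rewrite !mat_subE.
  have [/andP[/eqP ei /eqP ej]|] := boolP ((n == i) && (m == j)).
    by case: _ / ei; case: _ / ej; rewrite !iotaM_id subrr.
  by rewrite negb_and => nm; rewrite !iotaM_out // subr0 subrr.
have D0 i j : diag_sum (0 : mat T) i j = 0.
  by rewrite -(subrr (0 : mat T)) diag_sumB subrr.
split; first by rewrite D0.
by apply/below0P => k _ _; rewrite D0; exact: ideal0.
Qed.

Lemma kcls_iota_linear n m (r : R[i]) (x y : T n m) : K n m x -> K n m y ->
  kcls K J n m (iotaM (r *: x + y)) = r *: kcls K J n m (iotaM x) + kcls K J n m (iotaM y).
Proof.
move=> Kx Ky; rewrite -kcls_linear ?iota_in_M //; congr kcls.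
apply: mat_eqP => i j; rewrite mat_addE mat_scaleE.
have [/andP[/eqP ei /eqP ej]|] := boolP ((n == i) && (m == j)).
  by case: _ / ei; case: _ / ej; rewrite !iotaM_id.
by rewrite negb_and => nm; rewrite !iotaM_out // scaler0 addr0.
Qed.

Lemma zero_in_M n m : (0 : mat T) \in in_M K n m.
Proof. exact: rpred0. Qed.

Lemma kcls0 n m : kcls K J n m 0 = 0.
Proof. by rewrite -[in LHS](subrr (0 : mat T)) kclsB ?zero_in_M // subrr. Qed.

Lemma iotaM0 n m : iotaM (0 : T n m) = 0.
Proof.
apply: mat_eqP => i j.
have [/andP[/eqP ei /eqP ej]|] := boolP ((n == i) && (m == j)).
  by case: _ / ei; case: _ / ej; rewrite iotaM_id.
by rewrite negb_and => nm; rewrite iotaM_out.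
Qed.

(** Both matrices have top sum x (x) 1, and one level lower they differ by x, which is 0 modulo [J].
    This is how coisometry on [J] is built into K_J. *)
Lemma null_iota_tens n m (x : T n m) : J n m x ->
  kcls K J n.+1 m.+1 (iotaM x) = kcls K J n.+1 m.+1 (iotaM (tens x)).
Proof.
move=> Jx; have [Kx Kt] := JK Jx; rewrite /tens_preim /= in Kt.
apply/(kcls_eq J (incl_in_M (iota_in_M Kx)) (iota_in_M Kt)).
split; first by rewrite diag_sumB diag_sum_iotaS diag_sum_iota subrr.
apply/below_le_S/mod0P => k km; rewrite diag_sumB [X in _ - X]diag_sum_iota_out; last by lia.
rewrite subr0; case: k km => [|k] km; first by rewrite !subn0 diag_sum_iota.
by rewrite diag_sum_iota_out; [exact: (ideal0 IJ)|lia].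
Qed.

(** K_J composes only with entries of [K]. For a factor in [T] an approximate unit c in [K] is
    inserted, xy being close to (xc)y. *)
Lemma diag_part_Lat (N' : fam (KJ K J)) : Lat_self N' -> Lat J K (diag_part N').
Proof.
move=> [IN tN sN].
have dp_ind n m (x : T n m) : K n m x -> (forall e, 0 < e -> exists2 y, diag_part N' n m y & nrm (x - y) <= e) ->
    diag_part N' n m x.
  move=> Kx xl; split=> //; have /closed_nrm H := ideal_closed IN (n:=n) (m:=m); apply: H => e e0.
  have [y [Ky N'y] xy] := xl e e0; exists (kcls K J n m (iotaM y)) => //.
  by rewrite -kcls_iotaB //; apply: kcls_iota_ge => //; [exact: (idealB IK)|exact: ltW].
have dp_comp n m l (x : T n m) (y : T m l) : K n m x -> K m l y ->
    diag_part N' n m x \/ diag_part N' m l y -> diag_part N' n l (acomp x y).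
  move=> Kx Ky H; have [E Kp] := kcls_iota_comp (iota_in_M Kx) Ky.
  rewrite !diag_sum_iota in E Kp; split=> //; rewrite -E.
  case: H => -[_ H]; first exact: (Defs.idealMr IN).
  exact: (idealMl IN).
split.
- split=> [n m|n m|n m c x y [Kx Nx] [Ky Ny]|n m l x y [Ky Ny]|n m l x y [Kx Nx]].
  + apply/closed_nrm => x xl; apply: dp_ind => //.
    apply: (ideal_lim IK) => e e0; have [y [Ky _] xy] := xl e e0; by exists y.
  + split; first exact: ideal0.
    by rewrite iotaM0 kcls0; exact: (ideal0 IN).
  + split; first exact: (idealD IK).
    by rewrite kcls_iota_linear //; exact: (idealD IN).
  + apply: dp_ind => [|e e0]; first exact: (idealMl IK).
    have x1 : 0 < nrm x + 1 by rewrite ltr_wpDl ?nrm_ge0.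
    have [|c [Kc _ _ _ yc]] := ideal_left_unit IK Ky (_ : 0 < e / (nrm x + 1)); first by rewrite divr_gt0.
    exists (acomp (acomp x c) y).
      by apply: dp_comp => //; [exact: (idealMl IK)|right; split].
    rewrite -acompA -acompBr (le_trans (nrm_acomp _ _)) //.
    rewrite (le_trans (ler_wpM2l (nrm_ge0 _) yc)) // mulrA ler_pdivrMr // mulrC.
    by rewrite ler_wpM2l ?(ltW e0) // lerDl.
  + apply: dp_ind => [|e e0]; first exact: (Defs.idealMr IK).
    have y1 : 0 < nrm y + 1 by rewrite ltr_wpDl ?nrm_ge0.
    have [|c [Kc _ _ _ xc]] := ideal_right_unit IK Kx (_ : 0 < e / (nrm y + 1)); first by rewrite divr_gt0.
    exists (acomp x (acomp c y)).
      by apply: dp_comp => //; [exact: (Defs.idealMr IK)|left; split].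
    rewrite acompA -acompBl (le_trans (nrm_acomp _ _)) //.
    rewrite (le_trans (ler_wpM2r (nrm_ge0 _) xc)) // mulrAC ler_pdivrMr //.
    by rewrite ler_wpM2l ?(ltW e0) // lerDl.
- by move=> n m x [].
- move=> n m l x y [Kx Nx] Ky.
  have [E Kp] := kcls_iota_comp (incl_in_M (iota_in_M Kx)) Ky.
  rewrite diag_sum_iotaS in E Kp; split=> //; rewrite -E; apply: (Defs.idealMr IN).
  by rewrite -kcls_tens ?iota_in_M //; exact: tN.
- move=> n m x [Jx [Kt Nt]]; have [Kx _] := JK Jx; split=> //.
  apply: sN; rewrite /tens_preim /=; change (N' n.+1 m.+1 (KJ_tens (kcls K J n m (iotaM x)))).
  by rewrite kcls_tens ?iota_in_M // null_iota_tens.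
Qed.

Section FixedLat.
Variable N : fam T.
Arguments N : clear implicits.
Hypothesis NL : Lat J K N.

Let IN : is_ideal N. Proof. by case: NL. Qed.
Let NK : fam_le N K. Proof. by case: NL. Qed.

Definition in_N n m b : Prop := b \in in_M K n m /\ forall i j, N i j (b i j).

Lemma in_N_iota n m (x : T n m) : N n m x -> in_N n m (iotaM x).
Proof. by move=> Nx; split; [apply/iota_in_M/NK|exact: iota_entries]. Qed.
Lemma in_N_D n m a b : in_N n m a -> in_N n m b -> in_N n m (a + b).
Proof.
move=> [aM aN] [bM bN]; split; first exact: in_M_D.
by move=> i j; rewrite mat_addE; exact: (idealAdd IN).
Qed.
Lemma in_N_B n m a b : in_N n m a -> in_N n m b -> in_N n m (a - b).
Proof.
move=> [aM aN] [bM bN]; split; first exact: in_M_B.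
by move=> i j; rewrite mat_subE; exact: (idealB IN).
Qed.
Lemma in_N_incl n m b : in_N n m b -> in_N n.+1 m.+1 b.
Proof. by move=> [bM bN]; split=> //; exact: incl_in_M. Qed.
Lemma in_N_cut n m b : in_N n.+1 m.+1 b -> in_N n m (cut n.+1 m.+1 b).
Proof. by move=> [bM bN]; split; [exact: cut_in_M|exact: cut_entries]. Qed.

Lemma tens_JN n m (w : T n m) : J n m w -> N n m w -> N n.+1 m.+1 (tens w).
Proof. by move=> /JK[_ Kt] Nw; exact: (tens_in_N IK NL). Qed.

Lemma diag_sum_in_N n m b : (forall i j, N i j (b i j)) -> below_le J n m b 0 -> N n m (diag_sum b n m).
Proof.
move=> bN; elim: n m => [|n IHn] [|m] H; rewrite ?diag_sum0l ?diag_sum0r //.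
move/below_le_S/mod0P: H => H; rewrite diag_sumS; apply: (idealAdd IN) => //.
apply: tens_JN; first by have := H 0%N (leq0n _); rewrite !subn0.
apply: IHn; apply/below0P => k _ km; exact: H.
Qed.

Lemma diag_part_NJ : diag_part (NJ N) = N.
Proof.
apply: functional_extensionality_dep => n; apply: functional_extensionality_dep => m; apply/seteqP; split=> [x [Kx [b [bM bN]]]|x Nx].
  move/(kcls_eq J bM (iota_in_M Kx)) => [E H].
  have <- : diag_sum b n m = x.
    by apply/eqP; rewrite -subr_eq0 -[X in _ - X](diag_sum_iota x) -diag_sumB E.
  apply: diag_sum_in_N => //; apply: eq_below H => i j ij ij'.
  by rewrite diag_sumB diag_sum_iota_out ?subr0 // ij.
by split; [exact: NK|exists (iotaM x) => //; exact: in_N_iota].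
Qed.

Let J0 n m : J n m 0. Proof. exact: ideal0. Qed.
Let JL n m := @idealD _ _ _ IJ n m.

(** The error factor of [diag_sum_near]: each level doubles the accumulated error and adds e twice,
    once for the distance of the new sum to [J] and once for choosing w'. *)
Fixpoint spread (n : nat) : R := if n is n'.+1 then 2 * spread n' + 2 else 2.

Lemma spread_ge2 n : 2 <= spread n.
Proof. by elim: n => //= n IHn; lra. Qed.

Lemma near_JN n m (y : T n m) (e d : R) : N n m y -> 0 < d -> qnorm (J n m) y <= e ->
  exists w, [/\ J n m w, N n m w & nrm (y - w) <= e + d].
Proof.
move=> Ny d0 ye; have IJN := famI_ideal IN IJ.
have [w [Nw Jw] yw] := qnorm_ex (ideal0 IJN n m) y d0.
exists w; split=> //; apply: le_trans yw _; rewrite lerD2r.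
exact: le_trans (qnorm_inter IN IJ Ny) ye.
Qed.

(** Quantitative form of [diag_sum_in_N]. The lower sum is replaced by a nearby w in [J] and [N],
    for which w (x) 1 stays in [N]; the resulting y lies in [N] and is close to [J], so it is close
    to an element of both. *)
Lemma diag_sum_near n m c e : 0 < e -> in_N n m c -> mod_J_le J n m c e ->
  exists w, [/\ J n m w, N n m w & nrm (diag_sum c n m - w) <= spread n * e].
Proof.
move=> e0; have base i j b : in_N i j b -> mod_J_le J i j b e -> diag_sum b i j = b i j ->
    exists w, [/\ J i j w, N i j w & nrm (diag_sum b i j - w) <= spread i * e].
  move=> [_ bN] /(_ 0%N (leq0n _)); rewrite !subn0 => H E.
  have [|w [Jw Nw bw]] := near_JN _ e0 H; first by rewrite E.
  exists w; split=> //; rewrite (le_trans bw) // -mulr2n -mulr_natl.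
  by rewrite ler_wpM2r ?(ltW e0) // spread_ge2.
elim: n m c => [|n IHn] [|m] c cN cJ; try by apply: base; rewrite ?diag_sum0l ?diag_sum0r.
have [H1 H2] := (mod_J_le_S J n m c e).1 cJ.
have [|w [Jw Nw cw]] := IHn m (cut n.+1 m.+1 c) (in_N_cut cN).
  by move=> k km; rewrite diag_sum_cut; [exact: H2|lia].
rewrite diag_sum_cut ?ltnSn // in cw.
set y := c n.+1 m.+1 + tens w; set z := diag_sum c n.+1 m.+1 in H1 *.
have zy : nrm (z - y) <= spread n * e.
  rewrite /z diag_sumS /y opprD addrACA subrr add0r -tensB.
  exact: le_trans (nrm_tens _) cw.
have Ny : N n.+1 m.+1 y by apply: (idealAdd IN); [exact: cN.2|exact: tens_JN].
have yJ : qnorm (J n.+1 m.+1) y <= e + spread n * e.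
  have -> : y = z - (z - y) by rewrite subKr.
  rewrite (le_trans (qnormD (J0 _ _) (@JL _ _) _ _)) // lerD // qnormN ?J0 //; last exact: JL.
  by apply: le_trans zy; exact: qnorm_le_nrm.
have [w' [Jw' Nw' yw']] := near_JN Ny e0 yJ.
exists w'; split=> //; rewrite (le_trans (nrm_tri y _ _)) //.
apply: le_trans (lerD zy yw') _; rewrite /=; lra.
Qed.

(** X measures the top sum: X = 0 gives the seminorm of K_J, X = [J] the condition imposed on the
    same sum one level higher. *)
Definition approximable (X : fam T) n m a : Prop := forall e, 0 < e ->
  exists b, [/\ in_N n m b, qnorm (X n m) (diag_sum (a - b) n m) <= e & below_le J n m (a - b) e].
Definition represented (X : fam T) n m a : Prop :=
  exists b, [/\ in_N n m b, X n m (diag_sum (a - b) n m) & below_le J n m (a - b) 0].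

(** By induction the lower part has an exact representative b1. Completing it takes one corner
    entry, whose existence is a membership in N + X, and this ideal is closed. *)
Lemma represent_step (X : fam T) n m a : is_ideal X ->
  (forall n' m' a', n = n'.+1 -> m = m'.+1 -> a' \in in_M K n' m' ->
    approximable J n' m' a' -> represented J n' m' a') ->
  a \in in_M K n m -> approximable X n m a -> represented X n m a.
Proof.
move=> IX IH aM ap; have INX := famD_ideal IN IX.
have corner : (n == 0%N) || (m == 0%N) -> represented X n m a.
  move=> nm; have D c : diag_sum c n m = c n m.
    by case/orP: nm => /eqP ->; rewrite ?diag_sum0l ?diag_sum0r.
  have [v Nv [x Xx vx]] : famD N X n m (a n m).
    apply: (ideal_lim INX) => e e0; have e2 : 0 < e / 2 by rewrite divr_gt0.
    have [b [[_ bN] ab _]] := ap _ e2.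
    have [x Xx abx] := qnorm_ex (ideal0 IX n m) (diag_sum (a - b) n m) e2.
    exists (b n m + x); first by exists (b n m) => //; exists x.
    rewrite opprD addrA; rewrite D mat_subE in abx ab.
    by apply: le_trans abx _; move: ab; lra.
  exists (iotaM v); split; [exact: in_N_iota| |exact: below_corner].
  by rewrite D mat_subE iotaM_id -vx addrC addKr.
case: n m a aM ap IH INX corner => [|n] [|m] a aM ap IH INX corner; try exact: corner.
have [b1 [b1N b1J /below0P b1B]] : represented J n m (cut n.+1 m.+1 a).
  apply: IH => //; first exact: cut_in_M.
  move=> e e0; have [b [bN _ /below_le_S ab]] := ap e e0; exists (cut n.+1 m.+1 b).
  have D i j : (i < n.+1)%N -> diag_sum (cut n.+1 m.+1 a - cut n.+1 m.+1 b) i j = diag_sum (a - b) i j.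
    by move=> ij; rewrite !diag_sumB !diag_sum_cut // ij.
  split; first exact: in_N_cut.
    by rewrite D //; have := ab 0%N (leq0n _); rewrite !subn0.
  by move=> k k0 km; rewrite D; [exact: ab|lia].
have b1J' k : (k <= minn n m)%N -> J (n - k)%N (m - k)%N (diag_sum (a - b1) (n - k)%N (m - k)%N).
  move=> km; have <- : diag_sum (cut n.+1 m.+1 a - b1) (n - k)%N (m - k)%N = diag_sum (a - b1) (n - k)%N (m - k)%N.
    by rewrite !diag_sumB diag_sum_cut //; lia.
  by case: k km => [|k] km; [rewrite !subn0|apply: b1B].
set d := diag_sum (a - b1) n.+1 m.+1.
have [v Nv [x Xx vx]] : famD N X n.+1 m.+1 d.
  (* Two parts e/C come from the distance of the top sum to X, and spread n parts from
     [diag_sum_near]. *)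
  apply: (ideal_lim INX) => e e0; pose C := spread n + 2.
  have C0 : 0 < C by rewrite /C; have := spread_ge2 n; lra.
  have eC : 0 < e / C by rewrite divr_gt0.
  have [b [bN abX /below_le_S abJ]] := ap _ eC.
  (* The exact and the approximate representative differ by c, whose entries lie in [N] and whose
     sums are nearly in [J]; its top sum is thus near some w with w (x) 1 in [N]. *)
  pose c := b1 - cut n.+1 m.+1 b.
  have cN : in_N n m c by apply: in_N_B => //; exact: in_N_cut.
  have cE k : (k <= minn n m)%N -> diag_sum c (n - k)%N (m - k)%N =
      diag_sum (a - b) (n - k)%N (m - k)%N - diag_sum (a - b1) (n - k)%N (m - k)%N.
    move=> km; rewrite /c !diag_sumB diag_sum_cut; last by lia.
    by rewrite opprB addrACA [_ + diag_sum b1 _ _]addrC addrACA subrr addr0 addrC.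
  have [|w [Jw Nw cw]] := diag_sum_near eC cN _.
    move=> k km; have := abJ k km; congr (_ <= _); apply: qnorm_congr; [exact: J0|exact: JL|].
    by rewrite cE // opprB addrC subrK; exact: b1J'.
  have [y Xy aby] := qnorm_ex (ideal0 IX n.+1 m.+1) (diag_sum (a - b) n.+1 m.+1) eC.
  exists (b n.+1 m.+1 - tens w + y).
    by exists (b n.+1 m.+1 - tens w); [apply: (idealB IN); [exact: bN.2|exact: tens_JN]|exists y].
  have E : d - (b n.+1 m.+1 - tens w + y) =
      (diag_sum (a - b) n.+1 m.+1 - y) - tens (diag_sum c n m - w).
    have b10 : b1 n.+1 m.+1 = 0 by apply: in_M_rightmost b1N.1.
    have := cE 0%N (leq0n _); rewrite !subn0 => ->.
    rewrite /d !diag_sumS !mat_subE b10 !tensB subr0; set A := a _ _; set B := b _ _.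
    set p := tens (diag_sum (a - b1) n m); set q := tens (diag_sum (a - b) n m); set W := tens w.
    rewrite !opprD !opprK !addrA.
    by rewrite [RHS](AC 7 ((1*6*2*7*4)*(3*5))) /= subrr addr0.
  rewrite E (le_trans (nrmB _ _)) //.
  apply: le_trans (lerD aby (le_trans (nrm_tens _) cw)) _.
  have CE : C * (e / C) = e by rewrite mulrC mulfVK // gt_eqF.
  rewrite -[leRHS]CE /C; move: abX; move: (e / C) => eC'; lra.
exists (b1 + iotaM v); have b1N' := in_N_incl b1N; split.
- by apply: in_N_D => //; exact: in_N_iota.
- by rewrite opprD addrA diag_sumB -/d diag_sum_iota -vx addrC addKr.
- apply/below_le_S/mod0P => k km.
  by rewrite opprD addrA diag_sumB diag_sum_iota_out ?subr0; [exact: b1J'|lia].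
Qed.

Lemma represent_J n m a : a \in in_M K n m -> approximable J n m a -> represented J n m a.
Proof.
elim: n m a => [|n IHn] m a aM; first by apply: represent_step.
by apply: represent_step => // n' m' a' [<-] _; exact: IHn.
Qed.

Lemma NJ_closed n m : closed (NJ N n m).
Proof.
apply/closed_nrm => x; have [a aM ->] := kcls_ex x => xl.
have IH n' m' a' : n = n'.+1 -> m = m'.+1 -> a' \in in_M K n' m' ->
    approximable J n' m' a' -> represented J n' m' a'.
  by move=> _ _; exact: represent_J.
have ap : approximable (fun n m => [set 0]) n m a.
  move=> e e0; have [_ [b [bM bN] <-] ab] := xl e e0.
  rewrite -kclsB // in ab; have [ab0 abB] := (kcls_le J (in_M_B aM bM) (ltW e0)).1 ab.
  by exists b; split=> //; apply: le_trans ab0; exact: qnorm_le_nrm.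
have [b [[bM bN] ab0 ab]] := represent_step (zero_ideal T) IH aM ap.
exists b => //; apply/(kcls_eq J bM aM); split.
  by rewrite diag_sumB -opprB -diag_sumB [diag_sum (a - b) _ _]ab0 oppr0.
apply/below0P => k k0 km; rewrite diag_sumB -opprB -diag_sumB.
by apply: (idealN IJ); move/below0P: ab; apply.
Qed.

Hypothesis red : reducible K J.

Lemma star_entries_l a b : (forall i j, N i j (a i j)) -> (forall i j, K i j (b i j)) ->
  forall i j, N i j (mat_star a b i j).
Proof.
move=> Na Kb i j; rewrite /mat_star; pose IN' := Ideal IN.
apply: (ideal_addr (N := IN')); apply: (ideal_sum (N := IN')) => k; apply: (ideal_sum (N := IN')) => t /=.
  exact: (shift_right IK JK NL red).
exact: (Defs.idealMr IN).
Qed.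

Lemma star_entries_r a b : (forall i j, K i j (a i j)) -> (forall i j, N i j (b i j)) ->
  forall i j, N i j (mat_star a b i j).
Proof.
move=> Ka Nb i j; rewrite /mat_star; pose IN' := Ideal IN.
apply: (ideal_addr (N := IN')); apply: (ideal_sum (N := IN')) => k; apply: (ideal_sum (N := IN')) => t /=.
  exact: (idealMl IN).
exact: (shift_left IK JK NL red).
Qed.

Lemma NJ_Lat_self : Lat_self (NJ N).
Proof.
split.
- split=> [n m|n m|n m c _ _ [a [aM aN] <-] [b [bM bN] <-]|n m l x _ [b [bM bN] <-]|n m l _ y [a [aM aN] <-]].
  + exact: NJ_closed.
  + exists 0; last exact: kcls0.
    by split; [exact: zero_in_M|move=> i j; exact: (ideal0 IN)].
  + exists (c *: a + b); last by rewrite kcls_linear.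
    split; first by apply: rpredD => //; exact: rpredZ.
    by move=> i j; exact: (idealD IN).
  + have [a aM ->] := kcls_ex x; exists (mat_star a b).
      split; first exact: (star_in_M aM bM).
      by apply: star_entries_r => // i j; exact: (in_M_K i j aM).
    by rewrite -(kcls_comp J aM bM).
  + have [b bM ->] := kcls_ex y; exists (mat_star a b).
      split; first exact: (star_in_M aM bM).
      by apply: star_entries_l => // i j; exact: (in_M_K i j bM).
    by rewrite -(kcls_comp J aM bM).
- move=> n m _ [a [aM aN] <-]; exists a; first by split=> //; exact: incl_in_M.
  by rewrite -kcls_tens.
- move=> n m x; have [a aM ->] := kcls_ex x.
  change (NJ N n.+1 m.+1 (KJ_tens (kcls K J n m a)) -> NJ N n m (kcls K J n m a)).
  rewrite kcls_tens // => -[b [bM bN]].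
  move/(kcls_eq J bM (incl_in_M aM)) => [ba0 /below_le_S/mod0P baB].
  (* The top sum of the defect after dropping the last entry of b. It lies in [J] and c (x) 1 is
     that entry, so saturation puts c in [N], and adding it corrects b one level lower. *)
  pose c := diag_sum (a - cut n.+1 m.+1 b) n m.
  have lowJ k : (k <= minn n m)%N -> J (n - k)%N (m - k)%N (diag_sum (a - cut n.+1 m.+1 b) (n - k)%N (m - k)%N).
    move=> km; have := idealN IJ (baB k km).
    by rewrite !diag_sumB diag_sum_cut ?opprB //; lia.
  have Jc : J n m c by have := lowJ 0%N (leq0n _); rewrite !subn0.
  have tc : tens c = b n.+1 m.+1.
    move: ba0; rewrite diag_sumS mat_subE (in_M_rightmost aM) subr0 => /eqP.
    rewrite addr_eq0 => /eqP ->; rewrite /c !diag_sumB diag_sum_cut ?ltnSn //.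
    by rewrite -[tens _]opprK -[- tens _]sub0r -(tens0 T n m) -tensB sub0r opprB.
  have Nc : N n m c.
    have [_ _ _ sat] := NL; apply: sat; split=> //.
    by rewrite /tens_preim /= tc.
  exists (cut n.+1 m.+1 b + iotaM c).
    by apply: in_N_D; [exact: in_N_cut|exact: in_N_iota].
  have bN' := in_N_cut (conj bM bN).
  apply/(kcls_eq J (in_M_D bN'.1 (in_N_iota Nc).1) aM); split.
    by rewrite diag_sumB diag_sumD diag_sum_iota /c diag_sumB addrCA subrr addr0 subrr.
  apply/below0P => k k0 km; have := idealN IJ (lowJ k km).
  rewrite !diag_sumB diag_sumD [X in _ + X - _]diag_sum_iota_out; last by lia.
  by rewrite addr0 opprB.
Qed.

Lemma is_NJ_NJ : is_NJ N (NJ N).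
Proof.
split; first by have [] := NJ_Lat_self.
move=> r; apply/seteqP; split=> [_ [a [aM aN] <-]|_ [a /= aN <-]].
  by exists (MkM aM) => //=; rewrite -kclsE.
exists (M_mat a); last by rewrite kclsE.
split; first by case: a aN.
move=> i j; have [->|/Mmat_supp[ij _]] := eqVneq (M_mat a i j) 0; first exact: (ideal0 IN).
by have -> : i = j by lia.
Qed.

End FixedLat.
Lemma diag_sum_in_K : fam_le K (famD J (ker_tens T)) ->
  forall a, (forall i j, K i j (a i j)) -> forall i j, K i j (diag_sum a i j).
Proof.
move=> Ki a Ka; elim=> [|i IHi] [|j]; rewrite ?diag_sum0l ?diag_sum0r ?diag_sumS //.
by apply: (idealAdd IK) => //; exact: (K_tens_stable JK Ki).
Qed.

(** In case ii) the corner entry is b (x) 1 with b in [J] and moves down by [null_iota_tens], so the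
    whole class comes from the level below. In case i) the top sum t splits off as a single-entry
    matrix, and the remainder comes from the level below. *)
Lemma NJ_diag_part (N' : fam (KJ K J)) : reducible K J -> Lat_self N' -> NJ (diag_part N') = N'.
Proof.
move=> red LN'; have NL := diag_part_Lat LN'; have [IN' tN' sN'] := LN'.
have [IN NK _ _] := NL.
suff H n m a : a \in in_M K n m -> NJ (diag_part N') n m (kcls K J n m a) <-> N' n m (kcls K J n m a).
  apply: functional_extensionality_dep => n; apply: functional_extensionality_dep => m.
  by apply/seteqP; split=> x; have [a aM ->] := kcls_ex x => /(H n m a aM).
have corner n' m' a' : (n' == 0%N) || (m' == 0%N) -> a' \in in_M K n' m' ->
    NJ (diag_part N') n' m' (kcls K J n' m' a') <-> N' n' m' (kcls K J n' m' a').
  move=> nm aM; rewrite (in_M_corner aM nm); have Kx := in_M_K n' m' aM; set x := a' n' m' in Kx *.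
  split=> [[b [bM bN] <-]|N'x].
    by rewrite (in_M_corner bM nm); have [] := bN n' m'.
  exists (iotaM x) => //; split; first exact: iota_in_M.
  by apply: iota_entries => //; split.
elim: n m a => [|n IHn] [|m] a aM; try exact: corner.
have LNJ : Lat_self (NJ (diag_part N')) by exact: NJ_Lat_self.
have addN (N'' : fam (KJ K J)) i j (x y : KJ K J i j) : Lat_self N'' -> N'' i j x -> N'' i j y -> N'' i j (x + y).
  by move=> [IN'' _ _] Nx Ny; rewrite -[x]scale1r; exact: (idealD IN'').
have tE (N'' : fam (KJ K J)) c : Lat_self N'' -> c \in in_M K n m ->
    N'' n m (kcls K J n m c) <-> N'' n.+1 m.+1 (kcls K J n.+1 m.+1 c).
  move=> [_ tN'' sN''] cM; rewrite -kcls_tens //; split; first exact: tN''.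
  by move=> H; apply: sN''.
split=> [[b [bM bN] <-]|N'a].
  have cM := cut_in_M bM; have Kb := in_M_K n.+1 m.+1 bM.
  rewrite -(cutK n.+1 m.+1 b) (kclsD J (incl_in_M cM) (iota_in_M Kb)).
  have N'c : N' n.+1 m.+1 (kcls K J n.+1 m.+1 (cut n.+1 m.+1 b)).
    by apply/(tE _ _ LN' cM)/(IHn m _ cM); exists (cut n.+1 m.+1 b) => //; split=> //; exact: cut_entries.
  by have [_ N'b] := bN n.+1 m.+1; exact: (addN _ _ _ _ _ LN' N'c N'b).
have aT := in_M_K n.+1 m.+1 aM; have cM := cut_in_M aM.
case: red => [Ki|[pull _]]; last first.
  have [b Jb bE] := pull _ _ _ aT; have [Kb _] := JK Jb; have bM := iota_in_M Kb.
  have E : kcls K J n.+1 m.+1 a = kcls K J n.+1 m.+1 (cut n.+1 m.+1 a + iotaM b).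
    rewrite -[in LHS](cutK n.+1 m.+1 a) (kclsD J (incl_in_M cM) (iota_in_M aT)).
    by rewrite (kclsD J (incl_in_M cM) (incl_in_M bM)) (null_iota_tens Jb) bE.
  have sM := in_M_D cM bM; rewrite E; rewrite E in N'a.
  by apply/(tE _ _ LNJ sM)/(IHn m _ sM)/(tE _ _ LN' sM).
have Kd : K n m (diag_sum a n m) by apply: diag_sum_in_K => // i j; exact: (in_M_K i j aM).
(* As c (x) 1 = 0, only j contributes to the sum above: t is the corner entry plus j (x) 1, and
   subtracting j one level lower compensates the second term. *)
have [j Jj [c kc jc]] := Ki _ _ _ Kd; have [Kj Ktj] := JK Jj.
set t := diag_sum a n.+1 m.+1.
have tE' : t = a n.+1 m.+1 + tens j.
  by rewrite /t diag_sumS -jc tensD [tens c]kc addr0.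
have Kt : K n.+1 m.+1 t by rewrite tE'; apply: (idealAdd IK).
have jM := iota_in_M Kj; have bM := in_M_B cM jM.
have E : kcls K J n.+1 m.+1 a = kcls K J n.+1 m.+1 (cut n.+1 m.+1 a - iotaM j) + kcls K J n.+1 m.+1 (iotaM t).
  have -> : t = 1 *: a n.+1 m.+1 + tens j by rewrite scale1r.
  rewrite kcls_iota_linear // scale1r (kclsB J (incl_in_M cM) (incl_in_M jM)) (null_iota_tens Jj).
  rewrite -addrA [- _ + _]addrC addrK.
  by rewrite -(kclsD J (incl_in_M cM) (iota_in_M aT)) cutK.
(* The class of a times the single entry y is the single entry ty, hence lies in N'; y runs through
   approximate units of t. *)
have Nt : diag_part N' n.+1 m.+1 t.
  apply: (ideal_lim IN) => e e0; have [y [Ky _ _ _ ty]] := ideal_right_unit IK Kt e0.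
  exists (acomp t y) => //; have [E' Kty] := kcls_iota_comp aM Ky; split=> //.
  by rewrite -E'; exact: (Defs.idealMr IN').
have Nit : NJ (diag_part N') n.+1 m.+1 (kcls K J n.+1 m.+1 (iotaM t)).
  by exists (iotaM t) => //; split; [exact: iota_in_M|exact: iota_entries].
rewrite E; suff Nc : NJ (diag_part N') n.+1 m.+1 (kcls K J n.+1 m.+1 (cut n.+1 m.+1 a - iotaM j)).
  exact: (addN _ _ _ _ _ LNJ Nc Nit).
apply/(tE _ _ LNJ bM)/(IHn m _ bM)/(tE _ _ LN' bM).
have -> : kcls K J n.+1 m.+1 (cut n.+1 m.+1 a - iotaM j) = (-1) *: kcls K J n.+1 m.+1 (iotaM t) + kcls K J n.+1 m.+1 a.
  by rewrite E scaleN1r [RHS]addrCA addNr addr0.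
by apply: (idealD IN'); [exact: Nt.2|].
Qed.

End KJIdeals.

(** * Representations and the gauge action *)

Section OrthogonalSums.
Variables (R : realType) (B : cstarAlg R).
Implicit Types x y : B.

(** For h = x^*x and k = y^*y with hk = 0, t^2 (t^2 - h - k) is the product of the commuting
    positive elements t^2 - h and t^2 - k. *)
Lemma nrm_orth_max x y (t : R) : ca_mul (ca_star x) y = 0 -> ca_mul x (ca_star y) = 0 ->
  nrm x <= t -> nrm y <= t -> nrm (x + y) <= t.
Proof.
move=> xy0 xy0' xt yt; have t0 := le_trans (nrm_ge0 x) xt.
have yx0 : ca_mul (ca_star y) x = 0 by rewrite -[LHS]ca_starK ca_starM ca_starK xy0 ca_star0.
rewrite -(@ler_sqr _ (nrm _)) ?nnegrE ?nrm_ge0 // -ca_nrm_cstar.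
rewrite ca_starBD ca_mulBDl !ca_mulBDr xy0 yx0 addr0 add0r.
set h := ca_mul _ x; set k := ca_mul _ y.
have hk : ca_mul h k = 0.
  by rewrite /h /k ca_mulA -(ca_mulA (ca_star x)) xy0' ca_mul0r ca_mul0l.
have kh : ca_mul k h = 0.
  have sh : ca_star h = h by rewrite /h ca_starM ca_starK.
  have sk : ca_star k = k by rewrite /k ca_starM ca_starK.
  by rewrite -[LHS]ca_starK ca_starM sh sk hk ca_star0.
have ph : pos (uin h) := pos_uin_star x; have pk : pos (uin k) := pos_uin_star y.
rewrite -un_uin uinD; apply: pos_le; [exact: posD| |exact: sqr_ge0].
have [t2|t20] := eqVneq (t ^+ 2) 0.
  have h0 : h = 0 by apply: nrm_eq0; apply/eqP; rewrite eq_le nrm_ge0 andbT /h ca_nrm_cstar -t2 ler_sqr ?nnegrE ?nrm_ge0.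
  have k0 : k = 0 by apply: nrm_eq0; apply/eqP; rewrite eq_le nrm_ge0 andbT /k ca_nrm_cstar -t2 ler_sqr ?nnegrE ?nrm_ge0.
  rewrite h0 k0 -uinD addr0 t2 -[uin 0](subrr (uin (0 : B))) subrr subr0.
  exact: pos_ur.
have t2p : 0 < t ^+ 2 by rewrite lt0r t20 sqr_ge0.
have ch : pos (ur B (t ^+ 2) - uin h).
  by apply: pos_ur_sub; [exact: ph.1|rewrite un_uin ca_nrm_cstar ler_sqr ?nnegrE ?nrm_ge0].
have ck : pos (ur B (t ^+ 2) - uin k).
  by apply: pos_ur_sub; [exact: pk.1|rewrite un_uin ca_nrm_cstar ler_sqr ?nnegrE ?nrm_ge0].
have hkU : uin h * uin k = 0 by rewrite -uinM hk; congr pair.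
have khU : uin k * uin h = 0 by rewrite -uinM kh; congr pair.
have E : (ur B (t ^+ 2) - uin h) * (ur B (t ^+ 2) - uin k) = rz (t ^+ 2) (ur B (t ^+ 2) - (uin h + uin k)).
  by rewrite mulrBl !mulrBr hkU subr0 !urMl urMr rzBr rzDr opprD addrA addrAC.
have -> : ur B (t ^+ 2) - (uin h + uin k) = rz (t ^+ 2)^-1 ((ur B (t ^+ 2) - uin h) * (ur B (t ^+ 2) - uin k)).
  by rewrite E rzA mulVf // rz1.
apply: pos_rz; first by rewrite invr_ge0 ltW.
apply: pos_mul => //; rewrite !mulrBl !mulrBr hkU khU !subr0 !urMl !urMr.
by rewrite addrAC.
Qed.

Lemma nrm_orth_ge x y : ca_mul (ca_star x) y = 0 -> nrm x <= nrm (x + y).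
Proof.
move=> xy0; apply: sqr_le_mul; rewrite ?nrm_ge0 // -ca_nrm_cstar.
have -> : ca_mul (ca_star x) x = ca_mul (ca_star x) (x + y) by rewrite ca_mulBDr xy0 addr0.
by rewrite (le_trans (ca_nrmM _ _)) // ca_nrm_star mulrC.
Qed.

End OrthogonalSums.

Section RootsOfUnity.
Variable R : realType.

(** Iterated square roots of -1 are primitive roots of unity of order 2^(s+1). *)
Fixpoint droot (s : nat) : R[i] := if s is s'.+1 then sqrtC (droot s') else -1.

Lemma droot_half s : droot s ^+ (2 ^ s) = -1.
Proof. by elim: s => [|s IHs]; rewrite ?expr1 // expnS exprM /= sqrtCK. Qed.

Lemma droot_one s : droot s ^+ (2 ^ s.+1) = 1.
Proof. by rewrite expnSr exprM droot_half sqrrN expr1n. Qed.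

Lemma droot_norm s : `|droot s| = 1.
Proof.
apply/eqP; rewrite -(@pexpr_eq1 _ _ (2 ^ s.+1)) ?expn_gt0 //.
by rewrite -normrX droot_one normr1.
Qed.

Lemma droot_order s k : (0 < k)%N -> (k < 2 ^ s.+1)%N -> droot s ^+ k != 1.
Proof.
move=> k0 ks; have [|m mp md] := @prim_order_exists _ (2 ^ s.+1) (droot s) _ (droot_one s).
  by rewrite expn_gt0.
have [i is1 mE] := (dvdn_pfactor m s.+1 (isT : prime 2)) md.
apply/negP => /eqP k1.
have mk : (m %| k)%N by rewrite (prim_order_dvd mp) k1.
have [iS|iS] := eqVneq i s.+1.
  by have := dvdn_leq k0 mk; rewrite mE iS leqNgt ks.
have : droot s ^+ (2 ^ s) == 1.
  rewrite -(prim_order_dvd mp) mE dvdn_Pexp2l //.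
  by rewrite -ltnS ltn_neqAle iS.
by rewrite droot_half -subr_eq0 -opprD oppr_eq0 (_ : 1 + 1 = 2%:R) // pnatr_eq0.
Qed.

End RootsOfUnity.

Section Representation.
Variables (R : realType) (T : rtCstarPrecat R) (K : fam T).
Arguments K : clear implicits.
Hypothesis IK : is_ideal K.
Variables (O : cstarAlg R) (pi : forall n m, T n m -> O).
Arguments pi : clear implicits.
Hypothesis piK : is_rep K pi.

Lemma rep0 n m : pi n m 0 = 0.
Proof.
have := repD piK (-1) (ideal0 IK n m) (ideal0 IK n m).
by rewrite scaler0 addr0 scaleN1r addNr.
Qed.
Lemma repZ n m (c : R[i]) (a : T n m) : K n m a -> pi n m (c *: a) = c *: pi n m a.
Proof. by move=> Ka; have := repD piK c Ka (ideal0 IK n m); rewrite rep0 !addr0. Qed.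
Lemma repDD n m (a b : T n m) : K n m a -> K n m b -> pi n m (a + b) = pi n m a + pi n m b.
Proof. by move=> Ka Kb; have := repD piK 1 Ka Kb; rewrite !scale1r. Qed.
Lemma repB n m (a b : T n m) : K n m a -> K n m b -> pi n m (a - b) = pi n m a - pi n m b.
Proof. by move=> Ka Kb; have := repD piK (-1) Kb Ka; rewrite !scaleN1r addrC => ->; rewrite addrC. Qed.

Lemma repM0 n m l (a : T n m) (b : T m l) : K n m a -> K m l b ->
  ca_mul (pi n m a) (pi m l b) = pi n l (acomp a b).
Proof. exact: (@repM _ _ _ _ _ piK n m 0 l a b). Qed.

Lemma rep_starhom_on n : @is_starhom_on R (TA T n) O (K n n) (pi n n).
Proof.
split=> [c a b Ka Kb|a b Ka Kb|a Ka]; first exact: (repD piK).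
  by rewrite repM0.
by rewrite (rep_star piK).
Qed.

Lemma rep_contr n m (a : T n m) : K n m a -> nrm (pi n m a) <= nrm a.
Proof.
move=> Ka; rewrite -(@ler_sqr _ (nrm (pi n m a))) ?nnegrE ?nrm_ge0 // -ca_nrm_cstar.
rewrite (rep_star piK) // repM0 //; last exact: (ideal_star IK).
rewrite -nrm_acstar; apply: (starhom_on_contr (ideal_subcstar m IK) (rep_starhom_on m)).
exact: (idealMl IK).
Qed.

(** The product rule covers m <= p; the other case follows by adjoints. The equation says that
    degrees add, written without subtraction. *)
Lemma rep_mul n m p l (a : T n m) (b : T p l) : K n m a -> K p l b ->
  exists r s (c : T r s), [/\ K r s c, ca_mul (pi n m a) (pi p l b) = pi r s c &
    (r + m + l = s + n + p)%N].
Proof.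
have H i j q u (x : T i j) (y : T q u) : (j <= q)%N -> K i j x -> K q u y ->
    exists r s (c : T r s), [/\ K r s c, ca_mul (pi i j x) (pi q u y) = pi r s c &
    (r + j + u = s + i + q)%N].
  move=> jq Kx; move: y; rewrite -(subnK jq) => y Ky.
  exists (q - j + i)%N, u, (acomp (tensn (q - j) x) y); split; last by lia.
    exact: (idealMl IK).
  by rewrite (repM piK).
move=> Ka Kb; have [mp|/ltnW pm] := leqP m p; first exact: H.
have [r [s [c [Kc cE d]]]] := H _ _ _ _ _ _ pm (ideal_star IK Kb) (ideal_star IK Ka).
exists s, r, (astar c); split; [exact: (ideal_star IK)| |by lia].
by rewrite -(rep_star piK) // -cE ca_starM !(rep_star piK) ?astarK //; exact: ideal_star.
Qed.

(** The spectral subspace of degree d = n - m of the gauge action, before closure. *)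
Inductive hspan (d : int) : O -> Prop :=
| hspan0 : hspan d 0
| hspanD n m (a : T n m) y : K n m a -> n%:Z - m%:Z = d -> hspan d y -> hspan d (pi n m a + y).

Inductive gspan : O -> Prop :=
| gspan0 : gspan 0
| gspanD n m (a : T n m) y : K n m a -> gspan y -> gspan (pi n m a + y).

Lemma hspan_rep n m (a : T n m) : K n m a -> hspan (n%:Z - m%:Z) (pi n m a).
Proof. by move=> Ka; rewrite -[pi n m a]addr0; apply: hspanD => //; exact: hspan0. Qed.

Lemma hspan_add d x y : hspan d x -> hspan d y -> hspan d (x + y).
Proof.
by elim=> [|n m a x' Ka nm _ IH] hy; rewrite ?add0r // -addrA; apply: hspanD => //; exact: IH.
Qed.


Lemma hspan_star d x : hspan d x -> hspan (- d) (ca_star x).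
Proof.
elim=> [|n m a x' Ka nm _ IH]; first by rewrite ca_star0; exact: hspan0.
rewrite ca_starBD (rep_star piK) //; apply: hspanD => //; first exact: (ideal_star IK).
by rewrite -nm opprB.
Qed.

Lemma hspan_mul d d' x y : hspan d x -> hspan d' y -> hspan (d + d') (ca_mul x y).
Proof.
move=> hx hy; elim: hx => [|n m a x' Ka nm _ IH]; first by rewrite ca_mul0l; exact: hspan0.
rewrite ca_mulBDl; apply: hspan_add => // {IH}.
elim: hy => [|p l b y' Kb pl _ IH]; first by rewrite ca_mul0r; exact: hspan0.
rewrite ca_mulBDr; apply: hspan_add => //.
have [r [s [c [Kc -> rs]]]] := rep_mul Ka Kb.
have -> : d + d' = r%:Z - s%:Z by move: nm pl rs; clear; lia.
exact: hspan_rep.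
Qed.

Lemma gspan_rep n m (a : T n m) : K n m a -> gspan (pi n m a).
Proof. by move=> Ka; rewrite -[pi n m a]addr0; apply: gspanD => //; exact: gspan0. Qed.

Lemma gspan_add x y : gspan x -> gspan y -> gspan (x + y).
Proof.
by elim=> [|n m a x' Ka _ IH] hy; rewrite ?add0r // -addrA; apply: gspanD => //; exact: IH.
Qed.

Lemma gspan_scale (c : R[i]) x : gspan x -> gspan (c *: x).
Proof.
elim=> [|n m a x' Ka _ IH]; first by rewrite scaler0; exact: gspan0.
by rewrite scalerDr -repZ //; apply: gspanD => //; exact: (idealZ IK).
Qed.

Lemma gspan_star x : gspan x -> gspan (ca_star x).
Proof.
elim=> [|n m a x' Ka _ IH]; first by rewrite ca_star0; exact: gspan0.
by rewrite ca_starBD (rep_star piK) //; apply: gspanD => //; exact: (ideal_star IK).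
Qed.

Lemma gspan_mul x y : gspan x -> gspan y -> gspan (ca_mul x y).
Proof.
move=> hx hy; elim: hx => [|n m a x' Ka _ IH]; first by rewrite ca_mul0l; exact: gspan0.
rewrite ca_mulBDl; apply: gspan_add => // {IH}.
elim: hy => [|p l b y' Kb _ IH]; first by rewrite ca_mul0r; exact: gspan0.
rewrite ca_mulBDr; apply: gspan_add => //.
by have [r [s [c [Kc -> _]]]] := rep_mul Ka Kb; exact: gspan_rep.
Qed.

Hypothesis gen : forall S : set O, is_subcstar S -> rep_image K pi `<=` S -> S = setT.

Lemma gspan_dense x (e : R) : 0 < e -> exists2 y, gspan y & nrm (x - y) <= e.
Proof.
pose S := [set x | forall e : R, 0 < e -> exists2 y, gspan y & nrm (x - y) <= e].
have imS : rep_image K pi `<=` S.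
  move=> _ [n _ [m _ [a Ka <-]]] d d0; exists (pi n m a); first exact: gspan_rep.
  by rewrite subrr nrm0 ltW.
suff SP : is_subcstar S by move=> e0; have Sx : S x by [rewrite (gen SP imS)]; exact: Sx.
split.
- apply/closed_nrm => z zl d d0; have d2 : 0 < d / 2 by rewrite divr_gt0.
  have [y Sy zy] := zl _ d2; have [w gw yw] := Sy _ d2.
  exists w => //; apply: le_trans (nrm_tri y _ _) _; move: zy yw; lra.
- by move=> d d0; exists 0; [exact: gspan0|rewrite subrr nrm0 ltW].
- move=> c y z Sy Sz d d0; have c1 : 0 < cabs c + 1 by rewrite ltr_wpDl ?cabs_ge0.
  have [|y' gy yy'] := Sy (d / 2 / (cabs c + 1)); first by rewrite !divr_gt0.
  have [|z' gz zz'] := Sz (d / 2); first by rewrite divr_gt0.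
  exists (c *: y' + z'); first by apply: gspan_add => //; exact: gspan_scale.
  rewrite opprD addrACA -scalerBr (le_trans (nrmD _ _)) // nrmZ.
  have H : cabs c * nrm (y - y') <= d / 2.
    apply: le_trans (ler_wpM2l (cabs_ge0 c) yy') _.
    by rewrite mulrA ler_pdivrMr // mulrC ler_wpM2l ?lerDl // divr_ge0 // ltW.
  by move: H zz'; lra.
- move=> y z Sy Sz d d0.
  have y1 : 0 < nrm y + 1 by rewrite ltr_wpDl ?nrm_ge0.
  have [|z' gz zz'] := Sz (d / 2 / (nrm y + 1)); first by rewrite !divr_gt0.
  have z1 : 0 < nrm z' + 1 by rewrite ltr_wpDl ?nrm_ge0.
  have [|y' gy yy'] := Sy (d / 2 / (nrm z' + 1)); first by rewrite !divr_gt0.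
  exists (ca_mul y' z'); first exact: gspan_mul.
  have -> : ca_mul y z - ca_mul y' z' = ca_mul y (z - z') + ca_mul (y - y') z'.
    by rewrite ca_mulBr ca_mulBl addrA subrK.
  have H1 : nrm (ca_mul y (z - z')) <= d / 2.
    apply: le_trans (ca_nrmM _ _) _; apply: le_trans (ler_wpM2l (nrm_ge0 _) zz') _.
    by rewrite mulrA ler_pdivrMr // mulrC ler_wpM2l ?lerDl // divr_ge0 // ltW.
  have H2 : nrm (ca_mul (y - y') z') <= d / 2.
    apply: le_trans (ca_nrmM _ _) _; apply: le_trans (ler_wpM2r (nrm_ge0 _) yy') _.
    by rewrite mulrAC ler_pdivrMr // ler_wpM2l ?lerDl // divr_ge0 // ltW.
  by rewrite (le_trans (nrmD _ _)) //; move: H1 H2; lra.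
- move=> y Sy d d0; have [y' gy yy'] := Sy d d0.
  by exists (ca_star y'); [exact: gspan_star|rewrite -ca_starB ca_nrm_star].
Qed.

End Representation.

Section RootSums.
Variable R : realType.
Implicit Types (z : R[i]) (d k : int).

Lemma norm1_exprz z d : `|z| = 1 -> `|z ^ d| = 1.
Proof.
move=> z1; case: d => n; first by rewrite -exprnP normrX z1 expr1n.
by rewrite NegzE -exprnN normfV normrX z1 expr1n invr1.
Qed.

Lemma norm1_neq0 z : `|z| = 1 -> z != 0.
Proof. by move=> z1; rewrite -normr_eq0 z1 oner_eq0. Qed.

Lemma norm1_conj z : `|z| = 1 -> z^* = z^-1.
Proof.
move=> z1; have z0 := norm1_neq0 z1; apply: (mulfI z0).
by rewrite mulfV // -normCK z1 expr1n.
Qed.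

Lemma norm1_conj_exprz z d : `|z| = 1 -> (z ^ d)^* = z ^ (- d).
Proof. by move=> z1; rewrite norm1_conj ?norm1_exprz // invr_expz. Qed.

Definition rootsum (s : nat) d : R[i] := \sum_(i < 2 ^ s.+1) (droot R s ^+ i) ^ d.

Lemma droot_exprz s (i : nat) d : (droot R s ^+ i) ^ d = (droot R s ^ d) ^+ i.
Proof. by rewrite exprnP exprzAC. Qed.

Lemma rootsum0 s : rootsum s 0 = (2 ^ s.+1)%:R.
Proof.
rewrite /rootsum; under eq_bigr => i _ do rewrite expr0z.
by rewrite sumr_const card_ord.
Qed.

Lemma rootsum_neq0 s d : d != 0 -> (`|d| < 2 ^ s.+1)%N -> rootsum s d = 0.
Proof.
move=> d0 ds; set u := droot R s ^ d.
have u1 : u != 1.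
  have k0 : (0 < `|d|)%N by rewrite absz_gt0.
  have := droot_order R k0 ds; apply: contra => /eqP ud; move: ud; rewrite /u; case: (intP d) => [|n|n].
  - by rewrite expr0z => _; rewrite expr0.
  - by rewrite -exprnP => ->.
  - rewrite -exprnN => /(congr1 (@GRing.inv _)); rewrite invrK invr1 => E.
    by rewrite abszN absz_nat E.
have : (u - 1) * rootsum s d = 0.
  rewrite /rootsum; under eq_bigr => i _ do rewrite droot_exprz -/u.
  rewrite -subrX1 /u -droot_exprz droot_one exp1rz subrr //.
by move/eqP; rewrite mulf_eq0 subr_eq0 (negbTE u1) => /eqP.
Qed.

Lemma count_lt (q L : nat) : (\sum_(j < L) (j < q) = minn q L)%N.
Proof.
elim: L => [|L IHL]; first by rewrite big_ord0 minn0.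
by rewrite big_ord_recr /= IHL; lia.
Qed.

Lemma count_eq (c L : nat) : (\sum_(j < L) (j == c :> nat) = (c < L))%N.
Proof.
elim: L => [|L IHL]; first by rewrite big_ord0.
by rewrite big_ord_recr /= IHL; lia.
Qed.

(** These counts are the Fejer weights. *)
Lemma count_diff (L : nat) d : (\sum_(j < L) \sum_(i < L) ((j%:Z - i%:Z)%R == d) = L - `|d|)%N.
Proof.
have H (p : nat) : (\sum_(i < L) \sum_(j < L) (j == i + p :> nat) = L - p)%N.
  under eq_bigr => i _ do rewrite count_eq.
  rewrite -[RHS](minn_idPl (leq_subr p L)) -count_lt; apply: eq_bigr => i _; congr nat_of_bool; lia.
case: (intP d) => [|n|n].
- rewrite -(H 0%N) exchange_big; apply: eq_bigr => i _; apply: eq_bigr => j _; congr nat_of_bool; lia.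
- rewrite -(H n.+1) exchange_big; apply: eq_bigr => i _; apply: eq_bigr => j _; congr nat_of_bool; lia.
- rewrite abszN absz_nat -(H n.+1); apply: eq_bigr => i _; apply: eq_bigr => j _; congr nat_of_bool; lia.
Qed.

End RootSums.

(** * Discrete Fourier coefficients and Fejer means *)

Section Averaging.
Variables (R : realType) (T : rtCstarPrecat R) (K : fam T).
Arguments K : clear implicits.
Hypothesis IK : is_ideal K.
Variables (O : cstarAlg R) (pi : forall n m, T n m -> O).
Arguments pi : clear implicits.
Hypothesis piK : is_rep K pi.
Hypothesis gen : forall S : set O, is_subcstar S -> rep_image K pi `<=` S -> S = setT.
Variable gamma : R[i] -> O -> O.
Hypothesis gammaP : is_gauge K pi gamma.
Implicit Types (x y : O) (k d : int).

Local Notation w s i := (droot R s ^+ i).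

Lemma w_norm s i : `|w s i| = 1. Proof. by rewrite normrX droot_norm expr1n. Qed.

Let gH s i : is_starhom (gamma (w s i)). Proof. by have [] := gammaP (w_norm s i). Qed.

(** The Fourier coefficient of degree k, with the integral over the circle replaced by an average
    over roots of unity. It is exact on elements whose degree differs from k by less than
    2^(s+1). *)
Definition coef (s : nat) k x : O :=
  (2 ^ s.+1)%:R^-1 *: \sum_(i < 2 ^ s.+1) (w s i) ^ (- k) *: gamma (w s i) x.

Let M0 s : (2 ^ s.+1)%:R != 0 :> R[i]. Proof. by rewrite pnatr_eq0 -lt0n expn_gt0. Qed.
Let cabsM s : cabs ((2 ^ s.+1)%:R^-1 : R[i]) * (2 ^ s.+1)%:R = 1.
Proof.
have -> : ((2 ^ s.+1)%:R : R) = cabs ((2 ^ s.+1)%:R : R[i]).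
  by apply: (@complexI R); rewrite cabsE normr_nat rmorph_nat.
by rewrite -cabsM mulVf ?cabs1.
Qed.

Lemma coefD s k x y : coef s k (x + y) = coef s k x + coef s k y.
Proof.
rewrite /coef -scalerDr -big_split; congr (_ *: _); apply: eq_bigr => i _ /=.
by rewrite starhomDD // scalerDr.
Qed.
Lemma coefB s k x y : coef s k (x - y) = coef s k x - coef s k y.
Proof.
rewrite /coef -scalerBr -sumrB; congr (_ *: _); apply: eq_bigr => i _ /=.
by rewrite starhomB // scalerBr.
Qed.
Lemma coef0 s k : coef s k 0 = 0.
Proof. by have := coefB s k 0 0; rewrite subr0 subrr. Qed.

Lemma nrm_coef s k x : nrm (coef s k x) <= nrm x.
Proof.
rewrite /coef nrmZ; apply: le_trans (ler_wpM2l (cabs_ge0 _) (nrm_sum _ _)) _.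
have H : \sum_(i < 2 ^ s.+1) nrm ((w s i) ^ (- k) *: gamma (w s i) x) <= (2 ^ s.+1)%:R * nrm x.
  rewrite -[X in X%:R * _](card_ord (2 ^ s.+1)) mulr_natl -sumr_const; apply: ler_sum => i _.
  rewrite nrmZ (normC1_cabs (norm1_exprz _ (w_norm s i))) mul1r.
  exact: starhom_contr.
by apply: le_trans (ler_wpM2l (cabs_ge0 _) H) _; rewrite mulrA cabsM mul1r.
Qed.

Lemma coef_ideal (P : set O) s k x : is_cideal P ->
  (forall z : R[i], `|z| = 1 -> gamma z @` P `<=` P) -> P x -> P (coef s k x).
Proof.
move=> PI gP Px; have PL := cidealD PI; have P0 := cideal0 PI.
apply: (lin_scale P0 PL); apply: (big_ind P) => //; first exact: (lin_add PL).
by move=> i _; apply: (lin_scale P0 PL); apply: (gP _ (w_norm s i)); exists x.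
Qed.

Lemma coef_rep s k n m (a : T n m) : K n m a ->
  coef s k (pi n m a) = ((2 ^ s.+1)%:R^-1 * rootsum R s (n%:Z - m%:Z - k)) *: pi n m a.
Proof.
move=> Ka; rewrite -scalerA; congr (_ *: _); rewrite /rootsum scaler_suml; apply: eq_bigr => i _.
have [_ ->] := gammaP (w_norm s i) => //.
by rewrite scalerA -expfzDr ?norm1_neq0 ?w_norm // addrC.
Qed.

Lemma coef_rep_eq s n m (a : T n m) : K n m a -> coef s (n%:Z - m%:Z) (pi n m a) = pi n m a.
Proof. by move=> Ka; rewrite coef_rep // subrr rootsum0 mulVf // scale1r. Qed.

Lemma coef_rep_neq s k n m (a : T n m) : K n m a -> n%:Z - m%:Z != k ->
  (`|(n%:Z - m%:Z - k)%R| < 2 ^ s.+1)%N -> coef s k (pi n m a) = 0.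
Proof.
by move=> Ka nk nks; rewrite coef_rep // rootsum_neq0 ?mulr0 ?scale0r // subr_eq0.
Qed.

Lemma coef_gspan y : gspan K pi y -> exists D : nat, forall s k,
  (`|k| + D < 2 ^ s.+1)%N -> hspan K pi k (coef s k y).
Proof.
elim=> [|n m a x Ka _ [D HD]]; first by exists 0%N => s k _; rewrite coef0; exact: hspan0.
exists (D + n + m)%N => s k ks; rewrite coefD; apply: hspan_add; last by apply: HD; lia.
have [<-|nk] := eqVneq (n%:Z - m%:Z) k; first by rewrite coef_rep_eq //; exact: hspan_rep.
by rewrite coef_rep_neq //; [exact: hspan0|lia].
Qed.

(** Summing over pairs i, j < L gives degree k the weight (L - |k|)/L; in this form the kernel is
    visibly the squared modulus of a geometric sum, divided by L. *)
Definition fejer (L s : nat) x : O :=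
  (L%:R^-1 : R[i]) *: \sum_(j < L) \sum_(i < L) coef s (j%:Z - i%:Z) x.

Lemma fejerD L s x y : fejer L s (x + y) = fejer L s x + fejer L s y.
Proof.
rewrite /fejer -scalerDr -big_split; congr (_ *: _); apply: eq_bigr => j _ /=.
by rewrite -big_split; apply: eq_bigr => i _; rewrite coefD.
Qed.
Lemma fejerB L s x y : fejer L s (x - y) = fejer L s x - fejer L s y.
Proof.
rewrite /fejer -scalerBr -sumrB; congr (_ *: _); apply: eq_bigr => j _ /=.
by rewrite -sumrB; apply: eq_bigr => i _; rewrite coefB.
Qed.

(* the Fejer kernel at the points w^i *)
Let ker L s (t : nat) : R[i] := L%:R^-1 * \sum_(j < L) \sum_(i < L) (w s t) ^ (- (j%:Z - i%:Z)).

Let ker_ge0 L s t : 0 <= ker L s t.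
Proof.
apply: mulr_ge0; first by rewrite invr_ge0 ler0n.
set z := w s t; have z1 : `|z| = 1 := w_norm s t.
have -> : \sum_(j < L) \sum_(i < L) z ^ (- (j%:Z - i%:Z)) =
    (\sum_(i < L) z ^ i%:Z) * (\sum_(i < L) z ^ i%:Z)^*.
  rewrite rmorph_sum mulr_sumr; apply: eq_bigr => j _; rewrite mulr_suml; apply: eq_bigr => i _.
  by rewrite /= norm1_conj_exprz // -expfzDr ?norm1_neq0 // opprB.
exact: mul_conjC_ge0.
Qed.

Let ker_sum L s : (0 < L)%N -> (L < 2 ^ s.+1)%N -> \sum_(t < 2 ^ s.+1) ker L s t = (2 ^ s.+1)%:R.
Proof.
move=> L0 Ls; have LR : (L%:R : R[i]) != 0 by rewrite pnatr_eq0 -lt0n.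
rewrite /ker -mulr_sumr exchange_big /=.
have -> : \sum_(j < L) \sum_(t < 2 ^ s.+1) \sum_(i < L) (w s t) ^ (- (j%:Z - i%:Z)) =
    \sum_(j < L) (2 ^ s.+1)%:R :> R[i].
  apply: eq_bigr => j _; rewrite exchange_big /= (bigD1 j) //= -/(rootsum R s _).
  rewrite subrr oppr0 rootsum0 big1 ?addr0 // => i ij.
  rewrite -/(rootsum R s _) rootsum_neq0 //; last by have := ltn_ord i; have := ltn_ord j; lia.
  by rewrite oppr_eq0 subr_eq0; apply: contra ij => /eqP [ij]; apply/eqP/val_inj.
by rewrite sumr_const card_ord -[X in _ * X]mulr_natl mulrA mulVf // mul1r.
Qed.

(** The kernel is nonnegative with mean 1, so the bound is uniform in L; sharp truncation in the
    degree would have no uniform bound. *)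
Lemma nrm_fejer L s x : (0 < L)%N -> (L < 2 ^ s.+1)%N -> nrm (fejer L s x) <= nrm x.
Proof.
move=> L0 Ls.
have -> : fejer L s x = (2 ^ s.+1)%:R^-1 *: \sum_(t < 2 ^ s.+1) ker L s t *: gamma (w s t) x.
  rewrite /fejer /coef /ker.
  under eq_bigr => j _ do rewrite -scaler_sumr exchange_big /=.
  rewrite -scaler_sumr exchange_big /= !scalerA mulrC -scalerA; congr (_ *: _).
  rewrite scaler_sumr; apply: eq_bigr => t _; rewrite -scalerA; congr (_ *: _).
  by rewrite scaler_suml; apply: eq_bigr => j _; rewrite scaler_suml.
rewrite nrmZ; apply: le_trans (ler_wpM2l (cabs_ge0 _) (nrm_sum _ _)) _.
have H : \sum_(t < 2 ^ s.+1) nrm (ker L s t *: gamma (w s t) x) <= (2 ^ s.+1)%:R * nrm x.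
  have -> : ((2 ^ s.+1)%:R : R) = \sum_(t < 2 ^ s.+1) cabs (ker L s t).
    apply: (@complexI R); rewrite rmorph_nat -(ker_sum L0 Ls) rmorph_sum; apply: eq_bigr => t _ /=.
    by rewrite cabsE ger0_norm.
  rewrite mulr_suml; apply: ler_sum => t _; rewrite nrmZ ler_wpM2l ?cabs_ge0 //.
  exact: starhom_contr.
by apply: le_trans (ler_wpM2l (cabs_ge0 _) H) _; rewrite mulrA cabsM mul1r.
Qed.

Lemma fejer_rep L s n m (a : T n m) : K n m a -> (L + n + m < 2 ^ s.+1)%N ->
  fejer L s (pi n m a) = ((L - `|n%:Z - m%:Z|)%:R / L%:R) *: pi n m a.
Proof.
move=> Ka Ls; rewrite mulrC -scalerA; congr (_ *: _).
rewrite -(count_diff L (n%:Z - m%:Z)) natr_sum scaler_suml; apply: eq_bigr => j _.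
rewrite natr_sum scaler_suml; apply: eq_bigr => i _.
have [ji|ji] := eqVneq (j%:Z - i%:Z) (n%:Z - m%:Z); first by rewrite ji coef_rep_eq // scale1r.
rewrite scale0r coef_rep_neq //; first by rewrite eq_sym.
by have := ltn_ord i; have := ltn_ord j; lia.
Qed.

Lemma fejer_gspan y : gspan K pi y -> exists C : R, exists D : nat, forall L s,
  (0 < L)%N -> (L + D < 2 ^ s.+1)%N -> nrm (fejer L s y - y) <= C / L%:R.
Proof.
elim=> [|n m a x Ka _ [C [D HD]]].
  exists 0, 0%N => L s _ _; have -> : fejer L s 0 = 0 by have := fejerB L s 0 0; rewrite subr0 subrr.
  by rewrite subr0 nrm0 mul0r.
exists ((n + m)%:R * nrm (pi n m a) + C), (D + n + m)%N => L s L0 Ls.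
rewrite fejerD opprD addrACA (le_trans (nrmD _ _)) // mulrDl lerD //; last by apply: HD => //; lia.
rewrite fejer_rep //; last by lia.
have LR : (L%:R : R[i]) != 0 by rewrite pnatr_eq0 -lt0n.
rewrite -[X in _ - X]scale1r -scalerBl nrmZ mulrAC ler_wpM2r ?nrm_ge0 //.
have -> : (L - `|n%:Z - m%:Z|)%:R / L%:R - 1 = - ((minn L `|n%:Z - m%:Z|)%:R / L%:R) :> R[i].
  apply: (mulIf LR); rewrite mulrBl mul1r mulNr !mulfVK //.
  have {2}-> : L = (L - `|n%:Z - m%:Z| + minn L `|n%:Z - m%:Z|)%N by lia.
  by rewrite natrD opprD addrA subrr add0r.
rewrite cabsN.
have -> : ((minn L `|n%:Z - m%:Z|)%:R / L%:R : R[i]) = ((minn L `|n%:Z - m%:Z|)%:R / L%:R : R)%:C%C.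
  by rewrite rmorphM /= fmorphV !rmorph_nat.
rewrite cabs_real ger0_norm ?divr_ge0 // ler_wpM2r ?invr_ge0 // ler_nat; lia.
Qed.

(* Fejer sums of x in P approximate x, and are combinations of Fourier
   coefficients of x, which lie in P and are close to homogeneous elements. *)
Lemma gauge_ideal_le (P P0 : set O) : is_cideal P -> is_cideal P0 ->
  (forall z : R[i], `|z| = 1 -> gamma z @` P `<=` P) ->
  (forall k y, hspan K pi k y -> qnorm P0 y <= qnorm P y) -> P `<=` P0.
Proof.
move=> PI PI0 gP HP x Px.
have P00 := cideal0 PI0; have PL0 := cidealD PI0; have P0' := cideal0 PI; have PL := cidealD PI.
apply: (qnorm_eq0 P00 (cideal_closed PI0)); apply/eqP.
rewrite eq_le (qnorm_ge0 P00 PL0) andbT; apply/ler_addgt0Pr => e e0; rewrite add0r.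
have e4 : 0 < e / 4 by rewrite divr_gt0.
have [y gy xy] := gspan_dense IK piK gen x e4.
have [C [D HD]] := fejer_gspan gy.
have [L0 HL0] := @inv_small R (e / 4 / (`|C| + 1)) (divr_gt0 e4 (ltr_wpDl (normr_ge0 _) ltr01)).
pose L := L0.+1; have LR : 0 < L%:R :> R by rewrite ltr0n.
have CL : C / L%:R <= e / 4.
  have C1 : 0 < `|C| + 1 by rewrite ltr_wpDl.
  have := HL0 L0 (leqnn _); rewrite ler_pdivlMr // mulrC => H; apply: le_trans H.
  by rewrite ler_wpM2r ?invr_ge0 // (le_trans (ler_norm _)) // lerDl.
(* L is fixed by y, and the second approximant y' may depend on L. The L^2 coefficients carry an
   error 2d each and a factor 1/L, in all 2 L d = e/4. *)
pose d := e / 4 / (2 * L%:R); have d0 : 0 < d by rewrite !divr_gt0 // mulr_gt0.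
have [y' gy' xy'] := gspan_dense IK piK gen x d0.
have [D' HD'] := coef_gspan gy'.
pose s := (L + D + D')%N; have Ls : (L + D + D' < 2 ^ s.+1)%N.
  by apply: (ltn_trans (ltnSn _)); apply: ltn_expl.
have coefP (j i : 'I_L) : qnorm P0 (coef s (j%:Z - i%:Z) x) <= 2 * d.
  set k := j%:Z - i%:Z; have hk : hspan K pi k (coef s k y').
    by apply: HD'; have := ltn_ord i; have := ltn_ord j; lia.
  have c1 : nrm (coef s k x - coef s k y') <= d.
    by rewrite -coefB (le_trans (nrm_coef _ _ _)).
  have q1 : qnorm P0 (coef s k x) <= d + qnorm P0 (coef s k y').
    rewrite -[coef s k x](subrK (coef s k y')) (le_trans (qnormD P00 PL0 _ _)) // lerD2r.
    exact: le_trans (qnorm_le_nrm P00 _) c1.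
  have q2 : qnorm P (coef s k y') <= d.
    rewrite (le_trans (qnorm_le _ (coef_ideal s k PI gP Px))) // nrmC //.
  by apply: le_trans q1 _; have := HP _ _ hk; move: q2; lra.
have fx : qnorm P0 (fejer L s x) <= e / 4.
  rewrite /fejer (qnormZ P00 PL0).
  have -> : cabs (L%:R^-1 : R[i]) = L%:R^-1.
    have -> : (L%:R^-1 : R[i]) = (L%:R^-1 : R)%:C%C by rewrite fmorphV rmorph_nat.
    by rewrite cabs_real ger0_norm // invr_ge0.
  rewrite ler_pdivrMl //.
  have qsum (F : 'I_L -> O) (t : R) : (forall i, qnorm P0 (F i) <= t) ->
      qnorm P0 (\sum_i F i) <= L%:R * t.
    move=> Ft; rewrite mulr_natl -[X in _ *+ X](card_ord L) -sumr_const.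
    apply: (big_ind2 (fun y r => qnorm P0 y <= r)) => //; first by rewrite (qnorm_in P00 PL0).
    by move=> y1 r1 y2 r2 h1 h2; apply: le_trans (qnormD P00 PL0 _ _) (lerD h1 h2).
  have H : qnorm P0 (\sum_(j < L) \sum_(i < L) coef s (j%:Z - i%:Z) x) <= L%:R * (L%:R * (2 * d)).
    by apply: (qsum _ _ _) => j; apply: (qsum _ _ _) => i; exact: coefP.
  apply: le_trans H _; rewrite ler_pM2l // mulrA -(mulrC 2) -(mulrC d).
  by rewrite /d mulfVK // gt_eqF // mulr_gt0.
have xf : nrm (x - fejer L s x) <= e / 4 + e / 4 + e / 4.
  have -> : x - fejer L s x = (x - y) + (y - fejer L s y) + fejer L s (y - x).
    by rewrite fejerB !addrA !subrK.
  apply: le_trans (nrmD _ _) _; apply: lerD.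
    apply: le_trans (nrmD _ _) _; apply: lerD => //.
    by rewrite nrmC; apply: le_trans CL; apply: HD => //; lia.
  have Ls' : (L < 2 ^ s.+1)%N by move: Ls; clear; lia.
  by apply: le_trans (nrm_fejer (y - x) (ltn0Sn L0 : 0 < L)%N Ls') _; rewrite nrmC.
rewrite -[x](subrK (fejer L s x)) (le_trans (qnormD P00 PL0 _ _)) //.
have := qnorm_le_nrm P00 (x - fejer L s x); move: xf fx; lra.
Qed.

End Averaging.

(** * Quotient norms of homogeneous elements *)

Section Homogeneous.
Variables (R : realType) (T : rtCstarPrecat R) (K J : fam T).
Arguments K : clear implicits.
Arguments J : clear implicits.
Hypotheses (IK : is_ideal K) (JK : fam_le J (Jof K)) (red : reducible K J).
Variables (O : cstarAlg R) (pi : forall n m, T n m -> O).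
Arguments pi : clear implicits.
Hypotheses (piK : is_rep K pi) (piJ : coisometric J pi).
Variables P P0 : set O.
Hypotheses (PI : is_cideal P) (PI0 : is_cideal P0).
Hypothesis PP0 : forall n m (a : T n m), K n m a -> P (pi n m a) -> P0 (pi n m a).

(** By [starhom_on_kernel] the distance from pi(a) to P is approached by |a - w| with w in K(n,n)
    and pi(w) in P; such pi(w) lie in P0. *)
Lemma qnorm_rep_le n (a : T n n) : K n n a -> qnorm P0 (pi n n a) <= qnorm P (pi n n a).
Proof.
move=> Ka; apply/ler_addgt0Pr => e e0.
have [w [Kw Pw aw]] := starhom_on_kernel (ideal_subcstar n IK) (rep_starhom_on piK n) PI Ka e0.
apply: le_trans aw; apply: le_trans (qnorm_le _ (PP0 Kw Pw)) _.
by rewrite -(repB piK) //; apply: (rep_contr IK piK); exact: (idealB IK).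
Qed.

(** Orthogonality persists in both quotients, where the norm of the sum is the maximum of the
    norms. *)
Lemma orth_le x y : ca_mul (ca_star x) y = 0 -> ca_mul x (ca_star y) = 0 ->
  qnorm P0 x <= qnorm P x -> qnorm P0 y <= qnorm P y -> qnorm P0 (x + y) <= qnorm P (x + y).
Proof.
move=> xy xy' x0 y0.
have [Q [q [qH qn]]] := quotient_exists PI; have [Q0 [q0 [qH0 qn0]]] := quotient_exists PI0.
have yx : ca_mul (ca_star y) x = 0 by rewrite -[LHS]ca_starK ca_starM ca_starK xy ca_star0.
rewrite -qn -qn0 (starhomDD qH) (starhomDD qH0); apply: nrm_orth_max.
- by rewrite -(starhom_star qH0) -(starhomM qH0) xy (starhom0 qH0).
- by rewrite -(starhom_star qH0) -(starhomM qH0) xy' (starhom0 qH0).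
- rewrite qn0 (le_trans x0) // -qn; apply: nrm_orth_ge.
  by rewrite -(starhom_star qH) -(starhomM qH) xy (starhom0 qH).
- rewrite qn0 (le_trans y0) // -qn addrC; apply: nrm_orth_ge.
  by rewrite -(starhom_star qH) -(starhomM qH) yx (starhom0 qH).
Qed.

(** Above level 0 every a in [K] is j (x) 1 with j in [J], and coisometry gives both the same image;
    descending, degree zero is exhausted by K(0,0). *)
Lemma hspan_pulls_down y : pulls_down K J -> hspan K pi 0 y -> exists2 a, K 0 0 a & y = pi 0 0 a.
Proof.
move=> [pull _]; elim=> [|n m a x Ka nm _ [b Kb ->]].
  by exists 0; [exact: (ideal0 IK)|rewrite (rep0 IK piK)].
have {nm} mn : m = n by move: nm; clear; lia.
subst m; suff [a' Ka' ->] : exists2 a', K 0 0 a' & pi n n a = pi 0 0 a'.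
  by exists (a' + b); [exact: (idealAdd IK)|rewrite (repDD piK)].
elim: n a Ka => [|n IHn] a Ka; first by exists a.
have [j Jj <-] := pull _ _ _ Ka; rewrite -(piJ Jj); apply: IHn.
by have [] := JK Jj.
Qed.

(** For case i): each c in K(i,i) with c (x) 1 = 0 multiplies all higher levels to 0, so the
    summands are mutually orthogonal, and orthogonal to the images of K(p,p) for p >= r. *)
Inductive csum : nat -> O -> Prop :=
| csum0 : csum 0 0
| csumS r y c : csum r y -> K r r c -> tens c = 0 -> csum r.+1 (y + pi r r c).

Lemma csum_zero r : csum r 0.
Proof.
elim: r => [|r IHr]; first exact: csum0.
have t0 : tens (0 : T r r) = 0 by rewrite tens0.
by have := csumS IHr (ideal0 IK r r) t0; rewrite (rep0 IK piK) addr0.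
Qed.

Lemma csum_add r y z : csum r y -> csum r z -> csum r (y + z).
Proof.
move=> hy; elim: hy z => [|{}r {}y c _ IH Kc tc] z hz.
  by inversion hz; subst; rewrite addr0; exact: csum0.
inversion hz as [|r' z' c' hz' Kc' tc' rr' zz']; subst r'; subst z.
rewrite addrACA -(repDD piK) //; apply: csumS; [exact: IH|exact: (idealAdd IK)|].
by rewrite tensD tc tc' addr0.
Qed.

Lemma csum_star r y : csum r y -> csum r (ca_star y).
Proof.
elim=> [|{}r {}y c _ IH Kc tc]; first by rewrite ca_star0; exact: csum0.
rewrite ca_starBD (rep_star piK) //; apply: csumS => //; first exact: (ideal_star IK).
by rewrite tens_star tc astar0.
Qed.

Lemma csum_mul r y p (k : T p p) : csum r y -> (r <= p)%N -> K p p k -> ca_mul y (pi p p k) = 0.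
Proof.
move=> hy; elim: hy p k => [|{}r {}y c _ IH Kc tc] p k rp Kk; first by rewrite ca_mul0l.
rewrite ca_mulBDl IH ?(ltnW rp) // add0r {IH}.
have tz d : (0 < d)%N -> tensn d c = 0.
  by case: d => // d _; elim: d => [|d /= ->]; rewrite ?tens0.
move: k Kk; rewrite -(subnK (ltnW rp)) => k Kk.
by rewrite (repM piK) // tz ?subn_gt0 // acomp0l (rep0 IK piK).
Qed.

Lemma csum_le r y : csum r y -> qnorm P0 y <= qnorm P y.
Proof.
elim=> [|{}r {}y c hy IH Kc tc].
  have q0 (Q : set O) (QI : is_cideal Q) : qnorm Q 0 = 0.
    exact: (qnorm_in (cideal0 QI) (cidealD QI) (cideal0 QI)).
  by rewrite !q0.
apply: orth_le => //; last exact: qnorm_rep_le.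
  exact: csum_mul (csum_star hy) (leqnn _) Kc.
by rewrite (rep_star piK) //; apply: csum_mul hy (leqnn _) (ideal_star IK Kc).
Qed.

(** With k = j + c as in case i), pi(j) = pi(j (x) 1) rises one level while pi(c) joins the
    orthogonal sum. *)
Lemma csum_raise : fam_le K (famD J (ker_tens T)) ->
  forall r s y (k : T r r), csum r y -> K r r k -> (r <= s)%N ->
  exists y' (k' : T s s), [/\ csum s y', K s s k' & y + pi r r k = y' + pi s s k'].
Proof.
move=> Ki r s y k hy Kk /subnK <-; elim: (s - r)%N => [|d [y' [k' [hy' Kk' ->]]]]; first by exists y, k.
have [j Jj [c tc kE]] := Ki _ _ _ Kk'; have [Kj Ktj] := JK Jj.
have Kc : K _ _ c by have := idealB IK Kk' Kj; rewrite -kE addrC addKr.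
exists (y' + pi _ _ c), (tens j); split=> //; first exact: csumS.
by rewrite -(piJ Jj) -kE (repDD piK) // [pi _ _ j + _]addrC addrA.
Qed.

Lemma hspan_csum y : fam_le K (famD J (ker_tens T)) -> hspan K pi 0 y ->
  exists r y' (k : T r r), [/\ csum r y', K r r k & y = y' + pi r r k].
Proof.
move=> Ki; elim=> [|n m a x Ka nm _ [r [y' [k [hy' Kk ->]]]]].
  by exists 0%N, 0, 0; split; [exact: csum0|exact: (ideal0 IK)|rewrite (rep0 IK piK) addr0].
have {nm} mn : m = n by move: nm; clear; lia.
subst m; have [y1 [k1 [hy1 Kk1 E1]]] := csum_raise Ki hy' Kk (leq_maxr n r).
have [y2 [k2 [hy2 Kk2 E2]]] := csum_raise Ki (csum_zero n) Ka (leq_maxl n r).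
exists (maxn n r), (y2 + y1), (k2 + k1); split; [exact: csum_add|exact: (idealAdd IK)|].
by rewrite E1 -[pi n n a]add0r E2 addrACA (repDD piK).
Qed.

(** By the C*-identity in both quotients y may be replaced by y^*y, which has degree zero. *)
Lemma hspan_le d y : hspan K pi d y -> qnorm P0 y <= qnorm P y.
Proof.
move=> hy; rewrite -(@ler_sqr _ (qnorm P0 y)) ?nnegrE ?(qnorm_ge0 (cideal0 PI) (cidealD PI)) ?(qnorm_ge0 (cideal0 PI0) (cidealD PI0)) //.
rewrite -!qnorm_cstar //.
have := hspan_mul IK piK (hspan_star IK piK hy) hy; rewrite addNr.
move: (ca_mul _ _) => {hy d}y hy; case: red => [Ki|pd].
  have [r [y' [k [hy' Kk ->]]]] := hspan_csum Ki hy; apply: orth_le.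
  - by apply: csum_mul (csum_star hy') (leqnn _) Kk.
  - by rewrite (rep_star piK) //; apply: csum_mul hy' (leqnn _) (ideal_star IK Kk).
  - exact: csum_le hy'.
  - exact: qnorm_rep_le.
by have [a Ka ->] := hspan_pulls_down pd hy; exact: qnorm_rep_le.
Qed.

Hypothesis gen : forall S : set O, is_subcstar S -> rep_image K pi `<=` S -> S = setT.
Variable gamma : R[i] -> O -> O.
Hypothesis gammaP : is_gauge K pi gamma.
Hypothesis gP : forall z : R[i], `|z| = 1 -> gamma z @` P `<=` P.

Theorem gauge_ideal_incl : P `<=` P0.
Proof. exact: (gauge_ideal_le IK piK gen gammaP PI PI0 gP (@hspan_le)). Qed.

End Homogeneous.

(** * The Fock representation modulo an invariant ideal *)

Section AdjointableOperators.
Variables (R : realType) (E V : lmodType (Cx R)) (X : Type).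
Variables (ip : E -> E -> V) (vstar : V -> V).
Hypothesis ipD : forall (c : R[i]) x y z, ip x (c *: y + z) = c *: ip x y + ip x z.
Hypothesis ip_star : forall x y, vstar (ip x y) = ip y x.
Hypothesis vstarD : forall (c : R[i]) v w, vstar (c *: v + w) = c^* *: vstar v + vstar w.
Hypothesis ip_nondeg : forall y, (forall x, ip x y = 0) -> y = 0.
Variables (s : bool -> X -> E -> R) (tail : nat -> set E).
Hypothesis sP : forall b i, is_rseminorm (s b i).
(* the Cauchy-Schwarz inequality for <x,y> = <z,z> *)
Hypothesis s_cs : forall b i x y z, ip z z = ip x y -> s b i z ^+ 2 <= s b i x * s b i y.
Hypothesis tailD : forall r (c : R[i]) x y, tail r x -> tail r y -> tail r (c *: x + y).
Hypothesis tail_le : forall r r', (r <= r')%N -> tail r' `<=` tail r.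
Implicit Types (f g h : E -> E) (x y z : E).

Let s_ge0 b i x : 0 <= s b i x. Proof. by have [_ _] := sP b i. Qed.
Let sD b i x y : s b i (x + y) <= s b i x + s b i y. Proof. by have [+ _ _] := sP b i. Qed.
Let sZ b i (c : R[i]) x : s b i (c *: x) = cabs c * s b i x.
Proof. by have [_ + _] := sP b i. Qed.

Definition adj f g : Prop := forall x y, ip (f x) y = ip x (g y).

Lemma adjC f g : adj f g -> adj g f.
Proof. by move=> fg x y; rewrite -ip_star -fg ip_star. Qed.

Lemma adj_linear f g : adj f g -> forall (c : R[i]) x y, f (c *: x + y) = c *: f x + f y.
Proof.
move/adjC => gf c x y; apply/eqP; rewrite -subr_eq0; apply/eqP/ip_nondeg => z.
rewrite -scaleN1r addrC ipD -gf !ipD -!gf.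
by rewrite scaleN1r addNr.
Qed.

Lemma adj_uniq f g g' : adj f g -> adj f g' -> g = g'.
Proof.
move=> fg fg'; apply/funext => x; apply/eqP; rewrite -subr_eq0; apply/eqP/ip_nondeg => z.
by rewrite -scaleN1r addrC ipD -fg -fg' scaleN1r addNr.
Qed.

Lemma adj_lin (c : R[i]) f f' g g' : adj f g -> adj f' g' -> adj (c *: f + f') (c^* *: g + g').
Proof.
move=> /adjC fg /adjC fg' x y; rewrite -ip_star -[_ x]/(c *: f x + f' x) ipD vstarD !ip_star.
by rewrite -[(_ + _) y]/(c^* *: g y + g' y) ipD -!(adjC fg) -!(adjC fg').
Qed.

Lemma adj_comp f f' g g' : adj f g -> adj f' g' -> adj (f \o f') (g' \o g).
Proof. by move=> fg fg' x y; rewrite /= fg fg'. Qed.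

(** Continuity for the filtration by tails; it lets bounds that hold only far out be composed. *)
Definition tail_pres f : Prop := forall r', exists r, forall x, tail r x -> tail r' (f x).

Lemma tail_pres_lin (c : R[i]) f g : tail_pres f -> tail_pres g -> tail_pres (c *: f + g).
Proof.
move=> ft gt r'; have [r fr] := ft r'; have [t gr] := gt r'; exists (maxn r t) => x xr.
apply: tailD; first by apply: fr; apply: tail_le xr; rewrite leq_maxl.
by apply: gr; apply: tail_le xr; rewrite leq_maxr.
Qed.

Lemma tail_pres_comp f g : tail_pres f -> tail_pres g -> tail_pres (f \o g).
Proof.
by move=> ft gt r'; have [r fr] := ft r'; have [t gr] := gt r; exists t => x /gr/fr.
Qed.

(** The tail is uniform in the index i but may depend on c, so the infimum in [op_norm] need not be
    attained. *)
Definition good (c : R) f : Prop := (forall i x, s true i (f x) <= c * s true i x) /\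
  exists r, forall i x, tail r x -> s false i (f x) <= c * s false i x.

Lemma good_lin (k : R[i]) c d f g : good c f -> good d g -> good (cabs k * c + d) (k *: f + g).
Proof.
have H b i x : s b i (f x) <= c * s b i x -> s b i (g x) <= d * s b i x ->
    s b i ((k *: f + g) x) <= (cabs k * c + d) * s b i x.
  move=> fx gx; rewrite -[_ x]/(k *: f x + g x) (le_trans (sD _ _ _ _)) // sZ mulrDl lerD //.
  by rewrite -mulrA ler_wpM2l ?cabs_ge0.
move=> [f1 [r fr]] [g1 [t gr]]; split=> [i x|]; first exact: H.
exists (maxn r t) => i x xr; apply: H; first by apply: fr; apply: tail_le xr; rewrite leq_maxl.
by apply: gr; apply: tail_le xr; rewrite leq_maxr.
Qed.

Lemma good_comp c d f g : 0 <= c -> good c f -> good d g -> tail_pres g -> good (c * d) (f \o g).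
Proof.
move=> c0 [f1 [r fr]] [g1 [t gr]] gt; split=> [i x|].
  by rewrite (le_trans (f1 _ _)) // -mulrA ler_wpM2l.
have [t' gt'] := gt r; exists (maxn t t') => i x xr.
rewrite (le_trans (fr _ _ _)) //; first by apply: gt'; apply: tail_le xr; rewrite leq_maxr.
by rewrite -mulrA ler_wpM2l //; apply: gr; apply: tail_le xr; rewrite leq_maxl.
Qed.

(** Cauchy-Schwarz for <gx, gx> = <x, f(gx)> gives s(gx)^2 <= s(x) s(f(gx)) <= c s(x) s(gx); for the
    asymptotic part g has to carry a tail into the one on which f is bounded. *)
Lemma good_adj c f g : 0 <= c -> good c f -> adj f g -> tail_pres g -> good c g.
Proof.
move=> c0 [f1 [r fr]] fg gt.
have H b i x : s b i (f (g x)) <= c * s b i (g x) -> s b i (g x) <= c * s b i x.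
  move=> fgx; have H := s_cs b i (adjC fg x (g x)).
  apply: sqr_le_mul => //; first by rewrite mulr_ge0.
  by apply: le_trans H _; rewrite [c * s b i x]mulrC -mulrA ler_wpM2l.
split=> [i x|]; first exact: H.
by have [t gr] := gt r; exists t => i x /gr xr; apply: H; exact: fr.
Qed.

(** Cauchy-Schwarz for <fx, fx> = <x, g(fx)>; this is the nontrivial half of the C*-identity for
    [op_norm]. *)
Lemma good_sq c f g : 0 <= c -> good c (g \o f) -> adj f g -> good (Num.sqrt c) f.
Proof.
move=> c0 [f1 [r fr]] fg.
have H b i x : s b i (g (f x)) <= c * s b i x -> s b i (f x) <= Num.sqrt c * s b i x.
  move=> gfx; have H := s_cs b i (fg x (f x)).
  rewrite -(@ler_sqr _ (s b i _)) ?nnegrE ?mulr_ge0 ?sqrtr_ge0 // exprMn sqr_sqrtr //.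
  by apply: le_trans H _; rewrite mulrC expr2 mulrA; exact: ler_wpM2r.
by split=> [i x|]; [apply: H; exact: f1|exists r => i x xr; apply: H; exact: fr].
Qed.

Definition bounded_adj f : Prop := [/\ tail_pres f, exists2 c, 0 <= c & good c f &
  exists2 g, tail_pres g & adj f g].

Lemma bounded_adj_lin (k : R[i]) f g : bounded_adj f -> bounded_adj g -> bounded_adj (k *: f + g).
Proof.
move=> [f1 [c c0 fc] [f' f'1 ff']] [g1 [d d0 gd] [g' g'1 gg']].
split; first exact: tail_pres_lin.
  by exists (cabs k * c + d); [rewrite addr_ge0 // mulr_ge0 ?cabs_ge0|exact: good_lin].
by exists (k^* *: f' + g'); [exact: tail_pres_lin|exact: adj_lin].
Qed.

Definition oppred : {pred (E -> E)} := fun f => `[< bounded_adj f >].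

Fact oppred_submod : submod_closed oppred.
Proof.
split=> [|k f g /asboolP fP /asboolP gP]; apply/asboolP; last exact: bounded_adj_lin.
have t0 : tail_pres (0 : E -> E).
  by move=> r; exists r => x xr; have := tailD (-1) xr xr; rewrite scaleN1r addNr.
have i0 x : ip x 0 = 0 by have := ipD (-1) x 0 0; rewrite scaler0 addr0 scaleN1r addNr.
have v0 : vstar 0 = 0 by have := vstarD (-1) 0 0; rewrite scaler0 addr0 rmorphN1 scaleN1r addNr.
split=> //; last by exists 0 => // x y; rewrite i0 -ip_star i0 v0.
have s0 b i : s b i 0 = 0 by rewrite -(scale0r 0) sZ cabs0 mul0r.
by exists 0 => //; split=> [i x|]; [|exists 0%N => i x _]; rewrite mul0r s0.
Qed.

HB.instance Definition _ := GRing.isSubmodClosed.Build (Cx R) (E -> E) oppred oppred_submod.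

Record op : Type := MkOp { op_fun :> E -> E; opP : op_fun \in oppred }.
HB.instance Definition _ := [isSub for op_fun].
HB.instance Definition _ := [Choice of op by <:].
HB.instance Definition _ := [SubChoice_isSubLmodule of op by <:].
Implicit Types a b : op.

Lemma opE a : bounded_adj a. Proof. by case: a => f /= /asboolP. Qed.
Definition mkop f (fP : bounded_adj f) : op := MkOp (asboolT fP).

Lemma bounded_adj_comp f g : bounded_adj f -> bounded_adj g -> bounded_adj (f \o g).
Proof.
move=> [f1 [c c0 fc] [f' f'1 ff']] [g1 [d d0 gd] [g' g'1 gg']]; split.
- exact: tail_pres_comp.
- by exists (c * d); [rewrite mulr_ge0|exact: good_comp].
- by exists (g' \o f'); [exact: tail_pres_comp|exact: adj_comp].
Qed.

Lemma bounded_adj_adj f g : bounded_adj f -> adj f g -> bounded_adj g.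
Proof.
move=> [f1 [c c0 fc] [f' f'1 ff']] fg; have gf' := adj_uniq fg ff'; subst f'.
by split=> //; [exists c => //; exact: good_adj fg _|exists f => //; exact: adjC].
Qed.

Let adj_ex a : exists b, adj a b.
Proof.
have aP := opE a; have [_ _ [g _ ag]] := aP.
by exists (mkop (bounded_adj_adj aP ag)).
Qed.

Definition op_mul a b : op := mkop (bounded_adj_comp (opE a) (opE b)).
Definition op_star a : op := projT1 (cid (adj_ex a)).
Lemma op_starP a : adj a (op_star a). Proof. exact: (projT2 (cid (adj_ex a))). Qed.
Lemma op_star_uniq a b : adj a b -> op_star a = b.
Proof. by move=> ab; apply: val_inj; apply: adj_uniq (op_starP a) ab. Qed.

Definition op_norm a : R := inf [set c | 0 <= c /\ good c a].

Lemma op_norm_le a c : 0 <= c -> good c a -> op_norm a <= c.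
Proof. by move=> c0 ac; apply: ge_inf => //; exists 0 => d []. Qed.

Lemma op_norm_ge0 a : 0 <= op_norm a.
Proof.
have [_ [c c0 ac] _] := opE a.
by apply: lb_le_inf => [|d []//]; exists c.
Qed.

Lemma op_norm_ex a (e : R) : 0 < e -> exists c, [/\ 0 <= c, good c a & c <= op_norm a + e].
Proof.
move=> e0; have [_ [c c0 ac] _] := opE a.
have : has_inf [set c | 0 <= c /\ good c a] by split; [exists c|exists 0 => d []].
by move/(inf_adherent e0) => [d [d0 ad] /ltW de]; exists d.
Qed.

Lemma op_norm_mul a b : op_norm (op_mul a b) <= op_norm a * op_norm b.
Proof.
set A := op_norm a; set B := op_norm b; have A0 : 0 <= A := op_norm_ge0 a; have B0 : 0 <= B := op_norm_ge0 b.
apply/ler_addgt0Pr => e e0; pose d := Num.min 1 (e / (A + B + 1)).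
have AB : 0 < A + B + 1 by rewrite ltr_wpDl // addr_ge0.
have d0 : 0 < d by rewrite lt_min ltr01 divr_gt0.
have d1 : d <= 1 by rewrite ge_min lexx.
have de : d * (A + B + 1) <= e by rewrite -ler_pdivlMr // ge_min lexx orbT.
have [c [c0 ac cA]] := op_norm_ex a d0; have [c' [c'0 bc cB]] := op_norm_ex b d0.
have bt : tail_pres b by have [] := opE b.
apply: le_trans (@op_norm_le (op_mul a b) _ (mulr_ge0 c0 c'0) (good_comp c0 ac bc bt)) _.
by apply: le_trans (ler_pM c0 c'0 cA cB) _; move: de; rewrite -/A -/B; nra.
Qed.

Lemma op_norm_star_le a : op_norm (op_star a) <= op_norm a.
Proof.
apply/ler_addgt0Pr => e e0; have [c [c0 ac ca]] := op_norm_ex a e0.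
apply: le_trans ca; apply: op_norm_le => //; apply: good_adj (op_starP a) _ => //.
by have [] := opE (op_star a).
Qed.

Lemma op_precstar : is_precstar op_mul op_star op_norm.
Proof.
have lin a : forall (c : R[i]) x y, a (c *: x + y) = c *: a x + a y by exact: adj_linear (op_starP a).
split.
- split=> [a b|k a|a]; last exact: op_norm_ge0.
    apply/ler_addgt0Pr => e e0; have e2 : 0 < e / 2 by rewrite divr_gt0.
    have [c [c0 ac cA]] := op_norm_ex a e2; have [d [d0 bd dB]] := op_norm_ex b e2.
    apply: (@le_trans _ _ (c + d)); last by move: cA dB; lra.
    apply: op_norm_le; first exact: addr_ge0.
    by have := good_lin 1 ac bd; rewrite cabs1 mul1r scale1r.
  have H (k' : R[i]) a' : op_norm (k' *: a') <= cabs k' * op_norm a'.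
    apply/ler_addgt0Pr => e e0; have K0 : 0 < cabs k' + 1 by rewrite ltr_wpDl ?cabs_ge0.
    have [c [c0 ac cA]] := op_norm_ex a' (divr_gt0 e0 K0).
    have g0 : good 0 (0 : E -> E).
      have s0 (t : bool) i : s t i 0 = 0 by rewrite -(scale0r 0) sZ cabs0 mul0r.
      by split=> [i x|]; [|exists 0%N => i x _]; rewrite mul0r s0.
    apply: (@le_trans _ _ (cabs k' * c)).
      apply: op_norm_le; first by rewrite mulr_ge0 ?cabs_ge0.
      by have := good_lin k' ac g0; rewrite !addr0.
    rewrite (le_trans (ler_wpM2l (cabs_ge0 _) cA)) // mulrDr lerD2l mulrA ler_pdivrMr //.
    by rewrite mulrC ler_wpM2l ?(ltW e0) // lerDl.
  rewrite -/(cabs k); have [->|k0] := eqVneq k 0.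
    rewrite scale0r cabs0 mul0r; apply/eqP; rewrite eq_le op_norm_ge0 andbT.
    by have := H 0 0; rewrite scale0r cabs0 mul0r.
  apply/eqP; rewrite eq_le H /=.
  have := H k^-1 (k *: a); rewrite scalerA mulVf // scale1r => H'.
  apply: le_trans (ler_wpM2l (cabs_ge0 _) H') _.
  by rewrite mulrA -cabsM mulfV // cabs1 mul1r.
- by move=> c a a' b; apply: val_inj; apply/funext => x.
- by move=> c a b b'; apply: val_inj; apply/funext => x; exact: lin.
- by move=> a b c; apply: val_inj; apply/funext => x.
- by move=> c a b; apply: op_star_uniq; apply: adj_lin; exact: op_starP.
- by move=> a; apply: op_star_uniq; apply: adjC; exact: op_starP.
- by move=> a b; apply: op_star_uniq; apply: adj_comp; exact: op_starP.
- exact: op_norm_mul.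
- move=> a; apply/eqP; rewrite eq_le; apply/andP; split.
    apply: le_trans (op_norm_mul _ _) _; rewrite expr2 ler_wpM2r ?op_norm_ge0 //.
    exact: op_norm_star_le.
  apply/ler_addgt0Pr => e e0; have [c [c0 ac cA]] := op_norm_ex (op_mul (op_star a) a) e0.
  apply: le_trans cA; rewrite -[c]sqr_sqrtr // ler_sqr ?nnegrE ?op_norm_ge0 ?sqrtr_ge0 //.
  apply: op_norm_le; first exact: sqrtr_ge0.
  exact: good_sq ac (op_starP a).
Qed.

Theorem op_algebra : exists (B : cstarAlg R) (k : (E -> E) -> B),
  [/\ forall (c : R[i]) f g, bounded_adj f -> bounded_adj g -> k (c *: f + g) = c *: k f + k g,
      forall f g, bounded_adj f -> bounded_adj g -> k (f \o g) = ca_mul (k f) (k g),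
      forall f g, bounded_adj f -> adj f g -> ca_star (k f) = k g,
      forall c f, bounded_adj f -> 0 <= c -> good c f -> nrm (k f) <= c &
      forall (e : R) f, bounded_adj f -> 0 < e -> exists c, [/\ 0 <= c, good c f & c <= nrm (k f) + e]].
Proof.
have [B [k [kD kM ks kn]]] := completion_exists op_precstar.
(* Extended by 0 to all functions, so that the result speaks of plain functions and not of bundled
   operators. *)
pose k' f := if pselect (bounded_adj f) is left fP then k (mkop fP) else 0.
have k'E f (fP : bounded_adj f) : k' f = k (mkop fP).
  by rewrite /k'; case: pselect => [fP'|//]; congr k; apply: val_inj.
exists B, k'; split=> [c f g fP gP|f g fP gP|f g fP fg|c f fP c0 fc|e f fP e0].
- have fgP : bounded_adj (c *: f + g) := opE (c *: mkop fP + mkop gP).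
  by rewrite !k'E -kD; congr k; apply: val_inj.
- rewrite (k'E _ (bounded_adj_comp fP gP)) !k'E -kM.
  by congr k; apply: val_inj.
- rewrite (k'E _ (bounded_adj_adj fP fg)) k'E -ks; congr k.
  exact: op_star_uniq.
- by rewrite k'E kn; exact: op_norm_le.
- by rewrite k'E kn; exact: (op_norm_ex (mkop fP) e0).
Qed.

End AdjointableOperators.

Section CauchySchwarz.
Variables (R : realType) (A : cstarAlg R).
Implicit Types x y b : A.

Lemma qnorm_mono (P : set A) x y : is_cideal P -> pos (uin x) -> pos (uin (y - x)) ->
  qnorm P x <= qnorm P y.
Proof.
move=> PI px pyx; have [Q [q [qH qn]]] := quotient_exists PI.
rewrite -!qn -!un_uin; apply: pos_le_un; first exact: (uhom_pos qH px).
by rewrite -uinB -(starhomB qH); exact: (uhom_pos qH pyx).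
Qed.

(* the hypothesis is the positivity of <tx - yb, tx - yb>, with X = <x,x>,
   Y = <y,y> and b = <y,x> *)
Lemma cauchy_schwarz X Y b : pos (uin X) -> pos (uin Y) ->
  (forall t : R, 0 < t -> pos (rz (t ^+ 2) (uin X) - rz t (uin (ca_mul (ca_star b) b)) *+ 2 +
     uin (ca_mul (ca_star b) (ca_mul Y b)))) ->
  nrm b ^+ 2 <= nrm X * nrm Y.
Proof.
move=> pX pY H.
(* For t >= |Y| the term b^*Yb is at most t b^*b, which leaves t^2 X >= t b^*b; dividing by t gives
   the bound. *)
have H1 (t : R) : 0 < t -> nrm Y <= t -> nrm b ^+ 2 <= t * nrm X.
  move=> t0 Yt; rewrite -ca_nrm_cstar -!un_uin.
  have -> : t * un (uin X) = un (rz t (uin X)) by rewrite un_rz gtr0_norm.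
  apply: pos_le_un; first exact: pos_uin_star.
  have pY' : pos (ur A t - uin Y) by apply: pos_ur_sub; [exact: pY.1|rewrite un_uin].
  have := posD (H t t0) (pos_conj (uin b) pY').
  rewrite mulrBr mulrBl urMr rzMl uin_star -!uinM ca_mulA mulr2n opprD addrA.
  set Z := uin (ca_mul (ca_mul _ _) b); set B := uin (ca_mul (ca_star b) b) => HH.
  have {}HH : pos (rz t (rz t (uin X) - B)).
    have -> : rz t (rz t (uin X) - B) = rz (t ^+ 2) (uin X) - rz t B - rz t B + Z + (rz t B - Z).
      by rewrite [rz t B - Z]addrC addrA addrK subrK rzBr rzA expr2.
    by rewrite addrA -(addrA (rz (t ^+ 2) (uin X))).
  by have := pos_rz (ltW (_ : 0 < t^-1)) HH; rewrite invr_gt0 rzA mulVf ?gt_eqF // rz1; apply.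
apply/ler_addgt0Pr => e e0; have X1 : 0 < nrm X + 1 by rewrite ltr_wpDl ?nrm_ge0.
have d0 : 0 < e / (nrm X + 1) by rewrite divr_gt0.
apply: le_trans (H1 (nrm Y + e / (nrm X + 1)) _ _) _.
- by rewrite ltr_wpDl ?nrm_ge0.
- by rewrite lerDl ltW.
- rewrite mulrDl mulrC lerD2l mulrAC ler_pdivrMr // ler_wpM2l ?(ltW e0) //.
  by rewrite lerDl.
Qed.

End CauchySchwarz.

Section FiniteSums.
Variable V : zmodType.
Implicit Type F : nat -> V.

(** The cut-off is some bound of the support; by [fsumE] its choice does not matter. *)
Definition fsum F : V :=
  \sum_(0 <= k < xget 0%N [set D | forall k, (D <= k)%N -> F k = 0]) F k.

Lemma fsumE F D : (forall k, (D <= k)%N -> F k = 0) -> fsum F = \sum_(0 <= k < D) F k.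
Proof.
have ext (C C' : nat) : (C <= C')%N -> (forall k, (C <= k)%N -> F k = 0) ->
    \sum_(0 <= k < C') F k = \sum_(0 <= k < C) F k.
  move=> CC' F0; rewrite (big_cat_nat (n := C)) //= [X in _ + X]big_nat [X in _ + X]big1 ?addr0 //.
  by move=> k /andP[Ck _]; exact: F0.
move=> FD; rewrite /fsum; case: xgetP => [C _ FC|/(_ D)//].
by have [CD|/ltnW DC] := leqP C D; [rewrite (ext _ _ CD)|rewrite (ext _ _ DC)].
Qed.

End FiniteSums.

(** * The inner product on Fock columns *)

Section InnerProduct.
Variables (R : realType) (T : rtCstarPrecat R) (K : ideal T).
Let IK := idealP K.

(** Column l of such a matrix is a finitely supported sequence of entries of K(i,l), an element of a
    pre-Hilbert module over T(l,l). All columns are treated at once, so inner products become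
    matrices. *)
Definition finrow : {pred mat T} := fun x =>
  `[< (forall i j, K i j (x i j)) /\ exists r, forall i l, (r <= i)%N -> x i l = 0 >].

Fact finrow_submod : submod_closed finrow.
Proof.
split=> [|c x y /asboolP[xK [r xr]] /asboolP[yK [t yt]]]; apply/asboolP; split.
- by move=> i j; exact: (ideal0 IK).
- by exists 0%N.
- by move=> i j; exact: (idealD IK).
- exists (maxn r t) => i l; rewrite geq_max => /andP[ri ti].
  by rewrite -[LHS]/(c *: x i l + y i l) xr // yt // scaler0 addr0.
Qed.

HB.instance Definition _ := GRing.isSubmodClosed.Build (Cx R) (mat T) finrow finrow_submod.

Record fock : Type := MkFock { fock_mat : mat T; fockP : fock_mat \in finrow }.
HB.instance Definition _ := [isSub for fock_mat].
HB.instance Definition _ := [Choice of fock by <:].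
HB.instance Definition _ := [SubChoice_isSubLmodule of fock by <:].
Definition entry (x : fock) : forall i j : nat, T i j := fock_mat x.
Coercion entry : fock >-> Funclass.
Arguments entry : simpl never.
Implicit Types x y z : fock.

Lemma fockK x i j : K i j (x i j). Proof. by rewrite /entry; case: x => x /= /asboolP[]. Qed.
Lemma fock_fin x : exists r, forall i l, (r <= i)%N -> x i l = 0.
Proof. by rewrite /entry; case: x => x /= /asboolP[]. Qed.
Lemma fock_linE (c : R[i]) x y i l : (c *: x + y) i l = c *: x i l + y i l. Proof. by []. Qed.
Lemma fock_eqP x y : (forall i l, x i l = y i l) -> x = y.
Proof. by move=> xy; apply: val_inj; exact: mat_eqP. Qed.

Definition mkfock (M : mat T) (MK : forall i j, K i j (M i j))
    (Mr : exists r, forall i l, (r <= i)%N -> M i l = 0) : fock := MkFock (asboolT (conj MK Mr)).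

Definition ip x y : mat T := fun l l' => fsum (fun i => acomp (astar (x i l)) (y i l')).
Definition mstar (M : mat T) : mat T := fun l l' => astar (M l' l).

Lemma ipE x y r l l' : (forall i l, (r <= i)%N -> x i l = 0) ->
  ip x y l l' = \sum_(0 <= i < r) acomp (astar (x i l)) (y i l').
Proof. by move=> xr; apply: fsumE => i ri; rewrite xr // astar0 acomp0l. Qed.

Lemma ipD (c : R[i]) x y z : ip x (c *: y + z) = c *: ip x y + ip x z.
Proof.
have [r xr] := fock_fin x; apply: mat_eqP => l l'.
rewrite -[RHS]/(c *: ip x y l l' + ip x z l l') !(ipE _ _ _ xr) scaler_sumr -big_split /=.
by apply: eq_bigr => i _; rewrite acompDr acompZr.
Qed.

Lemma ip_star x y : mstar (ip x y) = ip y x.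
Proof.
have [r xr] := fock_fin x; have [t yt] := fock_fin y; apply: mat_eqP => l l'.
have xr' i k : (maxn r t <= i)%N -> x i k = 0 by rewrite geq_max => /andP[/xr].
have yt' i k : (maxn r t <= i)%N -> y i k = 0 by rewrite geq_max => /andP[_ /yt].
rewrite /mstar (ipE _ _ _ xr') (ipE _ _ _ yt').
rewrite (big_morph (fun u => astar u) (fun u v => astarD u v) (astar0 _ _ _)).
by apply: eq_bigr => i _; rewrite astarM astarK.
Qed.

Lemma mstarD (c : R[i]) (M M' : mat T) : mstar (c *: M + M') = c^* *: mstar M + mstar M'.
Proof. by apply: mat_eqP => l l'; rewrite /mstar mat_addE astarD astarZ. Qed.

Lemma ipDl x y z : ip (x + y) z = ip x z + ip y z.
Proof.
have := mstarD 1 (ip z x) (ip z y); rewrite !scale1r -(ip_star z (x + y)) => E.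
by have := ipD 1 z x y; rewrite !scale1r => ->; rewrite E rmorph1 scale1r !ip_star.
Qed.

Lemma ipDr x y z : ip x (y + z) = ip x y + ip x z.
Proof. by have := ipD 1 x y z; rewrite !scale1r. Qed.

Lemma ipZr (c : R[i]) x y : ip x (c *: y) = c *: ip x y.
Proof.
have i0 : ip x 0 = 0 by have := ipD (-1) x 0 0; rewrite scaler0 addr0 scaleN1r addNr.
by have := ipD c x y 0; rewrite i0 !addr0.
Qed.

Lemma ipZl (c : R[i]) x z : ip (c *: x) z = c^* *: ip x z.
Proof.
have m0 : mstar 0 = 0 by apply: mat_eqP => l l'; rewrite /mstar astar0.
by rewrite -(ip_star z (c *: x)) ipZr -[_ *: _]addr0 mstarD m0 addr0 ip_star.
Qed.

Lemma pos_sum (I : Type) (A : cstarAlg R) (r : seq I) (F : I -> A) :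
  (forall i, pos (uin (F i))) -> pos (uin (\sum_(i <- r) F i)).
Proof.
move=> pF; apply: (big_ind (fun a => pos (uin a))) => //; first exact: pos0.
by move=> a b pa pb; rewrite uinD; exact: posD.
Qed.

Lemma ip_pos x l : pos (uin (ip x x l l : TA T l)).
Proof.
have [r xr] := fock_fin x; rewrite (ipE _ _ _ xr).
by apply: (@pos_sum _ (TA T l)) => i; exact: pos_acstar.
Qed.

Lemma ip_term x l k : pos (uin (ip x x l l - acomp (astar (x k l)) (x k l) : TA T l)).
Proof.
have [r xr] := fock_fin x; have xr' i l' : (maxn r k.+1 <= i)%N -> x i l' = 0.
  by rewrite geq_max => /andP[/xr].
rewrite (ipE _ _ _ xr') (big_cat_nat (n := k)) //=; last by rewrite leq_max leqnSn orbT.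
rewrite [\sum_(k <= i < _) _]big_ltn ?leq_max ?leqnn ?orbT // addrCA [X in uin X]addrC addKr.
rewrite (@uinD _ (TA T l)); apply: posD; apply: (@pos_sum _ (TA T l)) => i; exact: pos_acstar.
Qed.

Lemma ip_nondeg y : (forall x, ip x y = 0) -> y = 0.
Proof.
move=> y0; apply: fock_eqP => i l; apply: nrm_eq0; apply/eqP; rewrite -sqrf_eq0 -nrm_acstar.
rewrite eq_le nrm_ge0 andbT -un_uin_TA.
have le := @pos_le_un _ (TA T l) _ (uin (ip y y l l : TA T l)) (pos_acstar (y i l)).
apply: le_trans (le _) _; first by rewrite -uinB; exact: ip_term.
by rewrite y0 [uin _](_ : _ = 0) // un0.
Qed.

Section Seminorms.
Variables (I : fam T).
Arguments I : clear implicits.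
Hypothesis II : is_ideal I.

(** [cauchy_schwarz] in the quotient of T(l,l) by I(l,l); the positivity it asks for is that of a
    sum of squares in T(l,l), mapped to the quotient. *)
Lemma ip_cs x y l : qnorm (I l l) (ip x y l l) ^+ 2 <=
  qnorm (I l l) (ip x x l l) * qnorm (I l l) (ip y y l l).
Proof.
have [Q [q [qH qn]]] := quotient_exists (ideal_cideal II l).
have -> : qnorm (I l l) (ip x y l l) = qnorm (I l l) (ip y x l l).
  by rewrite -(ip_star x y); apply/esym; exact: (qnorm_star (ideal_cideal II l)).
have qn' (b : T l l) : qnorm (I l l) b = nrm (q b) by rewrite qn.
rewrite !qn'; apply: cauchy_schwarz; try exact: (uhom_pos qH (ip_pos _ _)).
move=> t t0; set b := ip y x l l.
have [r xr] := fock_fin x; have [s ys] := fock_fin y.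
have xr' i k : (maxn r s <= i)%N -> x i k = 0 by rewrite geq_max => /andP[/xr].
have ys' i k : (maxn r s <= i)%N -> y i k = 0 by rewrite geq_max => /andP[_ /ys].
(* Column l of the vector t x - y b with b = <y,x>. *)
pose zz i := t%:C%C *: x i l - acomp (y i l) b.
pose Z : TA T l := \sum_(0 <= i < maxn r s) acomp (astar (zz i)) (zz i).
have pZ : pos (uin Z) by apply: pos_sum => i; exact: pos_acstar.
suff ZE : Z = (t ^+ 2)%:C%C *: ip x x l l - t%:C%C *: acomp (astar b) b *+ 2 +
    acomp (astar b) (acomp (ip y y l l) b).
  have := uhom_pos qH pZ; rewrite uhom_uin ZE (starhomDD qH) (starhomB qH) mulr2n (starhomDD qH) !(starhomZ qH).
  rewrite -![acomp _ _]/(ca_mul (_ : TA T l) (_ : TA T l)) !(starhomM qH).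
  rewrite -[astar b]/(ca_star (b : TA T l)) (starhom_star qH).
  by rewrite uinD uinB uinD !uinZ -mulr2n.
have bs : astar b = ip x y l l by rewrite -(ip_star y x).
set S := index_iota 0 (maxn r s).
have sB (F G : nat -> T l l) : \sum_(i <- S) (F i - G i) = \sum_(i <- S) F i - \sum_(i <- S) G i.
  by rewrite sumrB.
have sl (G : nat -> T l l) : \sum_(i <- S) acomp (G i) b = acomp (\sum_(i <- S) G i) b.
  by rewrite (big_morph (fun u => acomp u b) (fun u v => acompDl u v b) (acomp0l _ _)).
have sr (G : nat -> T l l) : \sum_(i <- S) acomp (astar b) (G i) = acomp (astar b) (\sum_(i <- S) G i).
  by rewrite (big_morph (fun u => acomp (astar b) u) (fun u v => acompDr (astar b) u v) (acomp0r _ _)).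
have -> : Z = \sum_(i <- S) ((t ^+ 2)%:C%C *: acomp (astar (x i l)) (x i l) -
    t%:C%C *: acomp (acomp (astar (x i l)) (y i l)) b -
    t%:C%C *: acomp (astar b) (acomp (astar (y i l)) (x i l)) +
    acomp (astar b) (acomp (acomp (astar (y i l)) (y i l)) b)).
  apply: eq_bigr => i _; rewrite /zz astarB astarZ conjC_ofreal astarM acompBl !acompBr.
  rewrite !acompZl !acompZr !acompA scalerA -rmorphM -expr2 opprB addrA addrAC.
  by rewrite -!addrA; congr (_ + _); rewrite addrCA.
rewrite big_split /= !sB sr sl -!scaler_sumr sl sr.
by rewrite -!(ipE _ _ _ xr') -!(ipE _ _ _ ys') -bs mulr2n opprD addrA.
Qed.

End Seminorms.
End InnerProduct.

Section TensorPowers.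
Variables (R : realType) (T : rtCstarPrecat R).

Lemma acompNl n m l (a : T n m) (b : T m l) : acomp (- a) b = - acomp a b.
Proof. by rewrite -sub0r acompBl acomp0l sub0r. Qed.
Lemma acompNr n m l (a : T n m) (b : T m l) : acomp a (- b) = - acomp a b.
Proof. by rewrite -sub0r acompBr acomp0r sub0r. Qed.

Lemma tensnD k n m (c : R[i]) (a b : T n m) : tensn k (c *: a + b) = c *: tensn k a + tensn k b.
Proof. by elim: k => //= k ->; rewrite tensD tensZ. Qed.
Lemma tensnM k n m l (a : T n m) (b : T m l) : tensn k (acomp a b) = acomp (tensn k a) (tensn k b).
Proof. by elim: k => //= k ->; rewrite tensM. Qed.
Lemma tensn_star k n m (a : T n m) : tensn k (astar a) = astar (tensn k a).
Proof. by elim: k => //= k ->; rewrite tens_star. Qed.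
Lemma nrm_tensn k n m (a : T n m) : nrm (tensn k a) <= nrm a.
Proof. by elim: k => //= k; apply: le_trans; exact: nrm_tens. Qed.

Lemma diag_iota_tensn n m (a : T n m) s i j : (n <= i)%N ->
  diag_sum (iotaM a) (s + i)%N (s + j)%N = tensn s (diag_sum (iotaM a) i j).
Proof.
move=> ni; elim: s => //= s IHs.
have si : (n != (s + i).+1)%N by move: ni; clear; lia.
by rewrite diag_sumS iotaM_out ?si // add0r IHs.
Qed.

End TensorPowers.

(** * Weighted shifts on the Fock space *)

Section FockOperators.
Variables (R : realType) (T : rtCstarPrecat R) (K : ideal T).
Let IK := idealP K.
Local Notation E := (fock K).
Local Notation D a := (diag_sum (iotaM a)).
Implicit Types x y : E.

(** On the diagonal of (n,m) [D a i j] is a (x) 1^(i - n) for i >= n, and it is 0 for i < n; one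
    formula without casts thus covers all rows, and for i < n the column index is immaterial. *)
Definition Wmat n m (a : T n m) x : mat T := fun i l => acomp (D a i (i + m - n)%N) (x (i + m - n)%N l).

Fact WmatK n m (a : T n m) x i j : K i j (Wmat a x i j).
Proof. by apply: (idealMl IK); exact: fockK. Qed.
Fact Wmat_fin n m (a : T n m) x : exists r, forall i l, (r <= i)%N -> Wmat a x i l = 0.
Proof.
have [r xr] := fock_fin x; exists (r + n)%N => i l ri.
have ri' : (r <= i + m - n)%N by move: ri; clear; lia.
by rewrite /Wmat xr ?acomp0r.
Qed.

(* W a maps row s + m of x to row s + n, multiplying it by a (x) 1^s. *)
Definition W n m (a : T n m) x : E := mkfock (WmatK a x) (Wmat_fin a x).

Arguments W : simpl never.

Lemma WE n m (a : T n m) x i j l : (i + m = n + j)%N -> W a x i l = acomp (D a i j) (x j l).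
Proof. by move=> ij; rewrite -[LHS]/(Wmat a x i l) /Wmat; have -> : (i + m - n = j)%N by lia. Qed.

Lemma W_out n m (a : T n m) x i l : (i < n)%N -> W a x i l = 0.
Proof. by move=> ni; rewrite -[LHS]/(Wmat a x i l) /Wmat diag_sum_iota_out ?ni // acomp0l. Qed.

Lemma W_in n m (a : T n m) x s l : W a x (s + n)%N l = acomp (tensn s a) (x (s + m)%N l).
Proof. by rewrite (@WE _ _ _ _ _ (s + m)) ?diag_iota_tensn ?diag_sum_iota //; lia. Qed.

Lemma W_eqP n m (a : T n m) x (M : mat T) : (forall i l, (i < n)%N -> M i l = 0) ->
  (forall s l, M (s + n)%N l = acomp (tensn s a) (x (s + m)%N l)) -> forall i l, W a x i l = M i l.
Proof.
move=> M0 Ms i l; have [ni|ni] := ltnP i n; first by rewrite W_out ?M0.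
by rewrite -(subnK ni) W_in Ms.
Qed.

Lemma W_linear (c : R[i]) n m (a b : T n m) : W (c *: a + b) = c *: W a + W b.
Proof.
apply/funext => x; apply: fock_eqP.
apply: (@W_eqP _ _ _ _ (fun i l => c *: W a x i l + W b x i l)) => [i l ni|s l].
  by rewrite !W_out // scaler0 addr0.
by rewrite !W_in tensnD acompDl acompZl.
Qed.

Lemma W_mul n m k l (a : T n m) (b : T (k + m)%N l) :
  W a \o W b = W (acomp (tensn k a) b).
Proof.
apply/funext => x; apply: fock_eqP => i u; apply/esym; move: i u.
apply: (@W_eqP _ _ _ _ (fun i u => W a (W b x) i u)) => [i u ik|s u].
  have [ni|ni] := ltnP i n; first by rewrite W_out.
  by rewrite -(subnK ni) W_in W_out ?acomp0r //; lia.
rewrite (@WE _ _ a _ _ (s + (k + m))); last by lia.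
rewrite W_in diag_iota_tensn ?leq_addl // diag_iota_tensn // diag_sum_iota.
by rewrite tensnM acompA.
Qed.

Lemma ip_W_l n m (a : T n m) x y r l l' : (forall i l, (r <= i)%N -> x i l = 0) ->
  ip (W a x) y l l' = \sum_(0 <= s < r) acomp (astar (acomp (tensn s a) (x (s + m)%N l))) (y (s + n)%N l').
Proof.
move=> xr; rewrite (@ipE _ _ _ _ _ (n + r)); last first.
  by move=> i u ri; rewrite (@WE _ _ _ _ _ (i + m - n)) ?xr ?acomp0r //; lia.
rewrite (big_cat_nat (n := n)) ?leq_addr // big_nat big1 ?Monoid.mul1m; last first.
  by move=> i /andP[_ ni]; rewrite W_out // astar0 acomp0l.
rewrite -{1}[n]add0n big_addn addKn; apply: eq_bigr => s _.
by rewrite W_in.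
Qed.

Lemma W_adj n m (a : T n m) : adj (@ip R T K) (W a) (W (astar a)).
Proof.
move=> x y; rewrite -[RHS]ip_star.
have [r xr] := fock_fin x; have [t yt] := fock_fin y; apply: mat_eqP => l l'.
have xr' i k : (maxn r t <= i)%N -> x i k = 0 by rewrite geq_max => /andP[/xr].
have yt' i k : (maxn r t <= i)%N -> y i k = 0 by rewrite geq_max => /andP[_ /yt].
rewrite /mstar (ip_W_l _ _ _ _ xr') (ip_W_l _ _ _ _ yt').
rewrite (big_morph (fun u => astar u) (fun u v => astarD u v) (astar0 _ _ _)).
apply: eq_bigr => s _; rewrite !astarM !astarK tensn_star acompA.
by rewrite ?acompA.
Qed.

Definition ftail (r : nat) : set E := [set x | forall i l, (i < r)%N -> x i l = 0].

Lemma ftailD r (c : R[i]) x y : ftail r x -> ftail r y -> ftail r (c *: x + y).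
Proof. by move=> xr yr i l ir; rewrite fock_linE xr // yr // scaler0 addr0. Qed.
Lemma ftail_le r r' : (r <= r')%N -> ftail r' `<=` ftail r.
Proof. by move=> rr x xr i l ir; apply: xr; exact: leq_trans rr. Qed.

Lemma W_tail n m (a : T n m) : tail_pres ftail (W a).
Proof.
move=> r; exists (r + m)%N => x xr i l ir.
by have [ni|ni] := ltnP i n; [rewrite W_out|rewrite -(subnK ni) W_in xr ?acomp0r //; lia].
Qed.

(** t^2 - b^*b = w^*w with w = k + u in the unitization of T(m,m). Although w need not be a
    morphism, y = kz + uz is one, and y^*y is the stated difference. *)
Lemma pos_contraction n m l (b : T n m) (z : T m l) (t : R) : nrm b <= t ->
  pos (uin ((t ^+ 2)%:C%C *: acomp (astar z) z - acomp (astar (acomp b z)) (acomp b z) : TA T l)).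
Proof.
move=> bt; have t0 := le_trans (nrm_ge0 b) bt.
pose h := ur (TA T m) (t ^+ 2) - uin (acomp (astar b) b : TA T m).
have ph : pos h.
  apply: pos_ur_sub; first exact: (pos_acstar b).1.
  by rewrite un_uin_TA nrm_acstar ler_sqr ?nnegrE ?nrm_ge0.
have [w [sw _ wh _]] := pos_sqrt ph; rewrite -{1}sw in wh.
have w1 : w.1^* * w.1 = (t ^+ 2)%:C%C.
  by have := congr1 fst wh; rewrite /= subr0 [X in _ = X -> _]/GRing.scale /= mulr1.
have w2 : w.1^* *: (w.2 : T m m) + w.1 *: astar w.2 + acomp (astar w.2) w.2 = - acomp (astar b) b.
  by have := congr1 snd wh; rewrite /= scaler0 sub0r.
move: w1 w2; move: (w.1) (w.2 : T m m) => k u w1 w2 {w sw wh ph h}.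
pose y : T m l := k *: z + acomp u z.
suff -> : (t ^+ 2)%:C%C *: acomp (astar z) z - acomp (astar (acomp b z)) (acomp b z) = acomp (astar y) y.
  exact: pos_acstar.
have -> : acomp (astar (acomp b z)) (acomp b z) = acomp (astar z) (acomp (acomp (astar b) b) z).
  by rewrite astarM !acompA.
have -> : - acomp (astar z) (acomp (acomp (astar b) b) z) = acomp (astar z) (acomp (- acomp (astar b) b) z).
  by rewrite acompNl acompNr.
rewrite -w2 -w1 /y astarD astarZ astarM !acompDl !acompDr !acompZl !acompZr -!acompA.
by rewrite -scalerA -!addrA.
Qed.

Section Seminorm.
Variables (I : fam T).
Arguments I : clear implicits.
Hypothesis II : is_ideal I.

Definition col_norm l x : R := Num.sqrt (qnorm (I l l) (ip x x l l)).

Let I0 l := ideal0 II l l.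
Let IL l := @idealD _ _ _ II l l.
Let q0 l (a : T l l) : 0 <= qnorm (I l l) a. Proof. exact: (qnorm_ge0 (I0 l) (@IL l)). Qed.

Lemma col_norm_cs l x y z : ip z z = ip x y -> col_norm l z ^+ 2 <= col_norm l x * col_norm l y.
Proof.
move=> zxy; rewrite sqr_sqrtr // zxy -sqrtrM //.
rewrite -[leLHS]ger0_norm // -sqrtr_sqr ler_sqrt ?mulr_ge0 //.
exact: ip_cs.
Qed.

Lemma col_norm_seminorm l : is_rseminorm (col_norm l).
Proof.
split=> [x y|c x|x]; last exact: sqrtr_ge0.
- rewrite -(@ler_sqr _ (col_norm l _)) ?nnegrE ?addr_ge0 ?sqrtr_ge0 // sqr_sqrtr // ipDl !ipDr.
  have cs u v : qnorm (I l l) (ip u v l l) <= col_norm l u * col_norm l v.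
    rewrite -sqrtrM // -[leLHS]ger0_norm // -sqrtr_sqr ler_sqrt ?mulr_ge0 //.
    exact: ip_cs.
  rewrite !mat_addE; set a := col_norm l x; set b := col_norm l y.
  apply: (@le_trans _ _ (a * a + a * b + (b * a + b * b))); last by rewrite sqrrD; nra.
  apply: le_trans (qnormD (I0 l) (@IL l) _ _) (lerD _ _).
    by apply: le_trans (qnormD (I0 l) (@IL l) _ _) (lerD _ _); exact: cs.
  by apply: le_trans (qnormD (I0 l) (@IL l) _ _) (lerD _ _); exact: cs.
- rewrite -/(cabs c) /col_norm ipZl ipZr !mat_scaleE !(qnormZ (I0 l) (@IL l)) cabs_conj mulrA -expr2.
  by rewrite sqrtrM ?sqr_ge0 // sqrtr_sqr ger0_norm ?cabs_ge0.
Qed.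

Lemma col_norm0 l x : I l l (ip x x l l) -> col_norm l x = 0.
Proof. by move=> Ix; rewrite /col_norm (qnorm_in (I0 l) (@IL l) Ix) sqrtr0. Qed.

Lemma ip_ideal l x : (forall i, I i l (x i l)) -> I l l (ip x x l l).
Proof.
move=> xI; have [r xr] := fock_fin x; rewrite (ipE _ _ _ xr).
apply: (big_ind (I l l)) => [|a b|i _]; [exact: ideal0|exact: idealAdd|exact: idealMl].
Qed.

Lemma col_norm_term l x k : qnorm (I k l) (x k l) <= col_norm l x.
Proof.
rewrite -[leLHS]ger0_norm; last exact: (qnorm_ge0 (ideal0 II k l) (@idealD _ _ _ II k l)).
rewrite -sqrtr_sqr ler_sqrt // -(iqnorm_cstar II).
apply: (@qnorm_mono _ (TA T l) _ _ _ (ideal_cideal II l)); first exact: pos_acstar.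
exact: ip_term.
Qed.

(** Rows of x with index below m are lost and contribute positively to <x,x>; every other row is
    contracted by [pos_contraction]. *)
Lemma col_norm_W n m (a : T n m) l x : col_norm l (W a x) <= nrm a * col_norm l x.
Proof.
have -> : nrm a * col_norm l x = Num.sqrt (qnorm (I l l) ((nrm a ^+ 2)%:C%C *: ip x x l l)).
  rewrite (qnormZ (I0 l) (@IL l)) cabs_real ger0_norm ?sqr_ge0 //.
  by rewrite sqrtrM ?sqr_ge0 // sqrtr_sqr ger0_norm ?nrm_ge0.
rewrite /col_norm ler_sqrt //; apply: (@qnorm_mono _ (TA T l) _ _ _ (ideal_cideal II l)).
  exact: ip_pos.
have [r xr] := fock_fin x.
have xr' i k : (m + r <= i)%N -> x i k = 0 by move=> ri; apply: xr; lia.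
rewrite (ip_W_l _ _ _ _ xr) (ipE _ _ _ xr') (big_cat_nat (n := m)) ?leq_addr //=.
have shiftS (F : nat -> T l l) : \sum_(m <= i < m + r) F i = \sum_(0 <= s < r) F (s + m)%N.
  by rewrite -{1}[m]add0n big_addn addKn.
rewrite shiftS scalerDr -addrA (@uinD _ (TA T l)); apply: posD.
  rewrite (@uinZ _ (TA T l)); apply: pos_rz; first exact: sqr_ge0.
  by apply: (@pos_sum _ _ (TA T l)) => i; exact: pos_acstar.
rewrite scaler_sumr -sumrB; apply: (@pos_sum _ _ (TA T l)) => s.
rewrite -[Wmat a x _ l]/(W a x (s + n)%N l) W_in; exact: (pos_contraction (x (s + m)%N l) (nrm_tensn s a)).
Qed.

End Seminorm.

Variables (J N : fam T).
Arguments J : clear implicits.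
Arguments N : clear implicits.
Hypotheses (IJ : is_ideal J) (JK : fam_le J (Jof K)) (NL : Lat J K N) (red : reducible K J).

Let IN : is_ideal N. Proof. by case: NL. Qed.
Let NK : fam_le N K. Proof. by case: NL. Qed.
Let IJN : is_ideal (famD J N). Proof. exact: famD_ideal. Qed.
Let N_JN : fam_le N (famD J N).
Proof. by move=> n m a Na; exists 0; [exact: (ideal0 IJ)|exists a; rewrite ?add0r]. Qed.
Let J_JN : fam_le J (famD J N).
Proof. by move=> n m a Ja; exists a => //; exists 0; [exact: (ideal0 IN)|rewrite addr0]. Qed.

(* For b = true this is the norm of x modulo J + N; for b = false only its values
   on the far tails of the Fock space matter, where it is taken modulo N. *)
Definition fnorm (b : bool) : nat -> E -> R := col_norm (if b then famD J N else N).

Let Iif b : is_ideal (if b then famD J N else N). Proof. by case: b. Qed.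

Lemma fnorm0 b l x : (forall i, (if b then famD J N else N) i l (x i l)) -> fnorm b l x = 0.
Proof. by move=> xI; apply: (col_norm0 (Iif b)); apply: (ip_ideal (Iif b)). Qed.

Local Notation bounded := (bounded_adj (@ip R T K) fnorm ftail).
Local Notation good := (good fnorm ftail).

Lemma good_W n m (a : T n m) : good (nrm a) (W a).
Proof.
by split=> [l x|]; [exact: col_norm_W|exists 0%N => l x _; exact: col_norm_W].
Qed.

Lemma bounded_W n m (a : T n m) : bounded (W a).
Proof.
split; [exact: W_tail|exists (nrm a); [exact: nrm_ge0|exact: good_W]|].
by exists (W (astar a)); [exact: W_tail|exact: W_adj].
Qed.

Lemma good_W_J n m (a : T n m) : J n m a -> good 0 (W a - W (tens a)).
Proof.
move=> Ja; have E1 x i l : i != n -> (W a - W (tens a)) x i l = 0.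
  move=> i_n; rewrite -[LHS]/(W a x i l - W (tens a) x i l).
  have [ni|ni|ni] := ltngtP i n; [by rewrite !W_out ?subrr //; lia| |by rewrite ni eqxx in i_n].
  rewrite -(subnK ni) W_in.
  rewrite (@WE _ _ a _ _ (i - n.+1 + m.+1)); last by lia.
  by rewrite diag_iota_tensn ?diag_sum_iotaS ?subrr.
have E2 x l : (W a - W (tens a)) x n l = acomp a (x m l).
  rewrite -[LHS]/(W a x n l - W (tens a) x n l) [X in _ - X]W_out // subr0.
  exact: (W_in a x 0).
split=> [l x|]; [|exists m.+1 => l x xr]; rewrite mul0r fnorm0 // => i.
- have [->|/E1 ->] := eqVneq i n; last exact: (ideal0 IJN).
  by rewrite E2; apply: J_JN; exact: (Defs.idealMr IJ).
- have [->|/E1 ->] := eqVneq i n; last exact: (ideal0 IN).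
  by rewrite E2 xr // acomp0r; exact: (ideal0 IN).
Qed.

Lemma tensn_ideal n m l (a : T n m) s (x : T (s + m)%N l) : N n m a -> K (s + m)%N l x ->
  N (s + n)%N l (acomp (tensn s a) x).
Proof.
move=> Na Kx; rewrite -[a]iotaM_id -shiftE; apply: (shift_right IK JK NL red) => // i j.
exact: iota_entries.
Qed.

Lemma good_W_N n m (a : T n m) : N n m a -> good 0 (W a).
Proof.
move=> Na; have H x i l : N i l (W a x i l).
  have [ni|ni] := ltnP i n; first by rewrite W_out //; exact: (ideal0 IN).
  rewrite -(subnK ni) W_in; apply: tensn_ideal => //; exact: fockK.
by split=> [l x|]; [|exists 0%N => l x xr]; rewrite mul0r fnorm0 // => i; apply: N_JN.
Qed.

Lemma unit_vector j l (x : T j l) : K j l x -> exists y : E,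
  [/\ y j l = x, forall i k, i != j -> y i k = 0 & forall b, fnorm b l y <= nrm x].
Proof.
move=> Kx; have yK i k : K i k (iotaM x i k) by exact: iota_entries.
have y0 i k : i != j -> iotaM x i k = 0 by move=> ij; rewrite iotaM_out // eq_sym ij.
have yr : exists r, forall i k, (r <= i)%N -> iotaM x i k = 0.
  by exists j.+1 => i k ji; apply: y0; rewrite gtn_eqF.
exists (mkfock yK yr); split=> [|//|b]; first exact: iotaM_id.
rewrite /fnorm /col_norm -[leRHS]ger0_norm ?nrm_ge0 // -sqrtr_sqr ler_sqrt ?sqr_ge0 //.
rewrite (@ipE _ _ _ _ _ j.+1); last by move=> i k ji; apply: y0; rewrite gtn_eqF.
rewrite big_nat_recr //= big_nat big1 ?add0r; last first.
  by move=> i /andP[_ ij]; rewrite y0 ?astar0 ?acomp0l // ltn_eqF.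
rewrite -nrm_acstar iotaM_id.
by apply: qnorm_le_nrm; exact: (ideal0 (Iif b)).
Qed.

(** Tested on vectors with a single nonzero row, placed far out for the asymptotic bound. *)
Lemma good_entry n m (b : T n m) (e : R) : 0 <= e -> good e (W b) ->
  (forall i j l (x : T j l), (i + m = n + j)%N -> K j l x ->
     qnorm (famD J N i l) (acomp (D b i j) x) <= e * nrm x) /\
  exists r, forall i j l (x : T j l), (i + m = n + j)%N -> (r <= j)%N -> K j l x ->
     qnorm (N i l) (acomp (D b i j) x) <= e * nrm x.
Proof.
move=> e0 [g1 [r g2]]; split; [|exists r].
- move=> i j l x ij Kx; have [y [yx _ yn]] := unit_vector Kx.
  rewrite -[X in acomp _ X]yx -WE // (le_trans (col_norm_term IJN _ _ _)) // (le_trans (g1 l y)) // ler_wpM2l //.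
- move=> i j l x ij rj Kx; have [y [yx y0 yn]] := unit_vector Kx.
  rewrite -[X in acomp _ X]yx -WE // (le_trans (col_norm_term IN _ _ _)) // (le_trans (g2 l y _)) //.
    by move=> i' k ri; apply: y0; rewrite ltn_eqF // (leq_trans ri).
  by rewrite ler_wpM2l //; exact: (yn false).
Qed.

Let on_diagonal n m i j : (n <= i)%N -> (i + m = n + j)%N ->
  exists2 s, i = (s + n)%N & j = (s + m)%N.
Proof. by move=> ni ij; exists (i - n)%N; lia. Qed.

Lemma diag_iota_sub n m (a b : T n m) i j : (n <= i)%N -> (i + m = n + j)%N ->
  D (a - b) i j = D a i j - D b i j.
Proof.
move=> ni ij; have [s si sj] := on_diagonal ni ij; subst i j.
rewrite !diag_iota_tensn // !diag_sum_iota.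
by rewrite -scaleN1r addrC tensnD scaleN1r addrC.
Qed.

(** Climbs to level r, d bounding the number of steps left. At each level b is congruent modulo [N]
    to some j in [J] and is replaced by j (x) 1, which lies in [K] although b (x) 1 need not. By
    [qnorm_tens] the distance to [N] does not drop, and the products with [K] are unchanged modulo
    [N]. *)
Lemma qnorm_chain (e : R) (r d : nat) : 0 <= e -> forall n m (b : T n m), K n m b -> (r <= m + d)%N ->
  (forall i j l (x : T j l), (n <= i)%N -> (i + m = n + j)%N -> K j l x -> famD J N i l (acomp (D b i j) x)) ->
  (forall i j l (x : T j l), (n <= i)%N -> (i + m = n + j)%N -> (r <= j)%N -> K j l x ->
     qnorm (N i l) (acomp (D b i j) x) <= e * nrm x) ->
  qnorm (N n m) b <= e.
Proof.
move=> e0; elim: d => [|d IHd] n m b Kb rm bJN bN.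
  apply/ler_addgt0Pr => t t0; have [c [Kc _ c1 _ bc]] := ideal_right_unit IK Kb t0.
  rewrite -[b](subrK (acomp b c)) (le_trans (qnormD (ideal0 IN n m) (@idealD _ _ _ IN n m) _ _)) //.
  rewrite addrC lerD //; last by apply: le_trans (qnorm_le_nrm (ideal0 IN n m) _) bc.
  have := bN n m m c (leqnn n) (erefl _) _ Kc; rewrite diag_sum_iota => H.
  apply: le_trans (H _) _; first by rewrite -[m]addn0.
  by rewrite -[leRHS]mulr1 ler_wpM2l.
have : famD J N n m b.
  apply: (ideal_lim IJN) => t t0; have [c [Kc _ _ _ bc]] := ideal_right_unit IK Kb t0.
  exists (acomp b c) => //; have := bJN n m m c (leqnn n) (erefl _) Kc.
  by rewrite diag_sum_iota.
move=> [j Jj [n0 Nn0 bE]].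
have N0 := ideal0 IN n m; have NL' := @idealD _ _ _ IN n m.
have -> : qnorm (N n m) b = qnorm (N n m) j.
  by apply: (qnorm_congr N0 NL'); rewrite -bE addrC addKr.
apply: le_trans (qnorm_tens IJ NL Jj) _; have [_ Ktj] := JK Jj.
have DE i k : (n.+1 <= i)%N -> (i + m.+1 = n.+1 + k)%N -> D (tens j) i k = D b i k - D n0 i k.
  move=> ni ik; rewrite -diag_iota_sub; try lia.
  rewrite -bE addrK; have [s si sk] := on_diagonal ni ik; subst i k.
  by rewrite !diag_iota_tensn // diag_sum_iota diag_sum_iotaS.
have Dn0 i k l (x : T k l) : (n.+1 <= i)%N -> (i + m.+1 = n.+1 + k)%N -> K k l x -> N i l (acomp (D n0 i k) x).
  move=> ni ik; have ni' : (n <= i)%N by lia.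
  have ik' : (i + m = n + k)%N by lia.
  have [s si sk] := on_diagonal ni' ik'; subst i k => Kx.
  by rewrite diag_iota_tensn // diag_sum_iota; exact: tensn_ideal.
apply: IHd => [//||i k l x ni ik Kx|i k l x ni ik rk Kx]; first by rewrite addSnnS.
- rewrite DE // acompBl; apply: (idealB IJN); last by apply: N_JN; exact: Dn0.
  by apply: bJN => //; lia.
- have -> : qnorm (N i l) (acomp (D (tens j) i k) x) = qnorm (N i l) (acomp (D b i k) x).
    apply: (qnorm_congr (ideal0 IN i l) (@idealD _ _ _ IN i l)).
    by rewrite -acompBl DE // addrC addKr acompNl; apply: (idealN IN); exact: Dn0.
  by apply: bN => //; lia.
Qed.


Theorem fock_representation : exists (B : cstarAlg R) (pi : forall n m, T n m -> B),
  [/\ is_rep K pi, coisometric J pi, forall n m (a : T n m), N n m a -> pi n m a = 0 &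
      forall n m (b : T n m), K n m b -> pi n m b = 0 -> N n m b].
Proof.
have sP b l : is_rseminorm (fnorm b l) by exact: (col_norm_seminorm (Iif b)).
have cs b l (x y z : E) : ip z z = ip x y -> fnorm b l z ^+ 2 <= fnorm b l x * fnorm b l y.
  exact: (col_norm_cs (Iif b)).
have [B [k [kD kM ks kn kg]]] :=
  op_algebra (@ipD R T K) (@ip_star R T K) (@mstarD R T) (@ip_nondeg R T K) sP cs ftailD ftail_le.
have bW n m (a : T n m) := bounded_W a.
have k0 f : bounded f -> good 0 f -> k f = 0.
  move=> bf gf; apply: nrm_eq0; apply/eqP; rewrite eq_le nrm_ge0 andbT.
  exact: kn.
exists B, (fun n m a => k (W a)); split.
- split=> [n m c a b _ _|n m a _|n m u l a b _ _].
  + by rewrite W_linear kD.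
  + by apply: ks => //; exact: W_adj.
  + by rewrite -kM // W_mul.
- move=> n m a Ja; apply/eqP; rewrite -subr_eq0; apply/eqP.
  have E : k (W a) - k (W (tens a)) = k (W a - W (tens a)).
    by rewrite -scaleN1r addrC -kD // scaleN1r addrC.
  rewrite E; apply: k0; last exact: good_W_J.
  rewrite -scaleN1r addrC; apply: bounded_adj_lin => //.
  + exact: (@ipD R T K).
  + exact: (@ip_star R T K).
  + exact: (@mstarD R T).
  + exact: ftailD.
  + exact: ftail_le.
- by move=> n m a Na; apply: k0 => //; exact: good_W_N.
move=> n m b Kb kb0.
have gW (e : R) : 0 < e -> good e (W b).
  move=> e0; have [c [c0 [g1 [r g2]] ce]] := kg e _ (bW _ _ b) e0.
  have {}ce : c <= e by rewrite kb0 nrm0 add0r in ce.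
  have fn0 t l x : 0 <= fnorm t l x by have [_ _] := sP t l; apply.
  split=> [l x|]; first by rewrite (le_trans (g1 _ _)) // ler_wpM2r.
  by exists r => l x xr; rewrite (le_trans (g2 _ _ xr)) // ler_wpM2r.
apply: (qnorm_eq0 (ideal0 IN n m) (ideal_closed IN (n:=n) (m:=m))); apply/eqP.
rewrite eq_le (qnorm_ge0 (ideal0 IN n m) (@idealD _ _ _ IN n m)) andbT.
apply/ler_addgt0Pr => e e0; rewrite add0r.
have [_ [r Hr]] := good_entry (ltW e0) (gW e e0).
(* r steps reach level r from any m. *)
apply: (@qnorm_chain e r r (ltW e0)) => //; first exact: leq_addl.
- move=> i j l x ni ij Kx.
  apply: (qnorm_eq0 (ideal0 IJN i l) (ideal_closed IJN (n:=i) (m:=l))); apply/eqP.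
  rewrite eq_le (qnorm_ge0 (ideal0 IJN i l) (@idealD _ _ _ IJN i l)) andbT.
  apply/ler_addgt0Pr => t t0; rewrite add0r.
  have x1 : 0 < nrm x + 1 by rewrite ltr_wpDl ?nrm_ge0.
  have tx : 0 < t / (nrm x + 1) by rewrite divr_gt0.
  have [H _] := good_entry (ltW tx) (gW _ tx).
  apply: le_trans (H i j l x ij Kx) _.
  by rewrite mulrAC ler_pdivrMr // ler_wpM2l ?(ltW t0) // lerDl.
- by move=> i j l x ni ij rj Kx; exact: Hr.
Qed.

End FockOperators.

(** * Gauge-invariant ideals *)

Section LatticeTransport.
Variables (A B : Type) (leA : A -> A -> Prop) (leB : B -> B -> Prop).
Variables (X : set A) (Y : set B) (f : A -> B) (g : B -> A).
Hypotheses (fY : forall x, X x -> Y (f x)) (gX : forall y, Y y -> X (g y)).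
Hypotheses (gf : forall x, X x -> g (f x) = x) (fg : forall y, Y y -> f (g y) = y).
Hypothesis fle : forall x x', X x -> X x' -> leA x x' -> leB (f x) (f x').
Hypothesis gle : forall y y', Y y -> Y y' -> leB y y' -> leA (g y) (g y').

Lemma glb_transport x y z : X x -> X y -> is_glb leA X x y z -> is_glb leB Y (f x) (f y) (f z).
Proof.
move=> Xx Xy [Xz zx zy zm]; split; [exact: fY|exact: fle|exact: fle|].
move=> w Yw wx wy; rewrite -(fg Yw); apply: fle => //; first exact: gX.
apply: zm; first exact: gX.
  by rewrite -(gf Xx); apply: gle => //; exact: fY.
by rewrite -(gf Xy); apply: gle => //; exact: fY.
Qed.

Lemma lub_transport x y z : X x -> X y -> is_lub leA X x y z -> is_lub leB Y (f x) (f y) (f z).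
Proof.
move=> Xx Xy [Xz zx zy zm]; split; [exact: fY|exact: fle|exact: fle|].
move=> w Yw wx wy; rewrite -(fg Yw); apply: fle => //; first exact: gX.
apply: zm; first exact: gX.
  by rewrite -(gf Xx); apply: gle => //; exact: fY.
by rewrite -(gf Xy); apply: gle => //; exact: fY.
Qed.

Lemma lattice_iso_of : is_lattice leA X -> lattice_iso leA leB X Y f.
Proof.
move=> XL; split=> //.
- move=> y y' Yy Yy'; have [[z zP] [w wP]] := XL _ _ (gX Yy) (gX Yy').
  rewrite -(fg Yy) -(fg Yy'); split; [exists (f z)|exists (f w)].
    by apply: glb_transport => //; exact: gX.
  by apply: lub_transport => //; exact: gX.
- split=> [x Xx|x x' /set_mem Xx /set_mem Xx' E|y Yy]; first exact: fY.
    by rewrite -(gf Xx) E gf.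
  by exists (g y); [exact: gX|exact: fg].
- by move=> x y z Xx Xy; split; [exact: glb_transport|exact: lub_transport].
Qed.

End LatticeTransport.

Section InvariantLattice.
Variables (R : realType) (T : rtCstarPrecat R) (K J : ideal T).
Hypothesis JK : fam_le J (Jof K).
Let IK := idealP K.

(** The clause on [K] keeps the intersection of an empty family inside [K]. Joins are intersections
    of all upper bounds. *)
Definition capL (F : set (fam T)) : fam T :=
  fun n m => [set a | K n m a /\ forall N, F N -> N n m a].
Arguments capL F n m : clear implicits.

Lemma capL_Lat (F : set (fam T)) : F `<=` Lat J K -> Lat J K (capL F).
Proof.
move=> FL; have FI N : F N -> is_ideal N by move/FL => [].
split; [split| | |].
- move=> n m; apply/closed_nrm => a al; split.
    by apply: (ideal_lim IK) => e e0; have [y [Ky _] ay] := al e e0; exists y.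
  move=> N FN; apply: (ideal_lim (FI _ FN)) => e e0; have [y [_ Fy] ay] := al e e0.
  by exists y => //; exact: Fy.
- by move=> n m; split=> [|N FN]; [exact: (ideal0 IK)|exact: (ideal0 (FI _ FN))].
- move=> n m c a b [Ka Fa] [Kb Fb]; split=> [|N FN]; first exact: (idealD IK).
  by apply: (idealD (FI _ FN)); [exact: Fa|exact: Fb].
- move=> n m l a b [Kb Fb]; split=> [|N FN]; first exact: (idealMl IK).
  by apply: (idealMl (FI _ FN)); exact: Fb.
- move=> n m l a b [Ka Fa]; split=> [|N FN]; first exact: (Defs.idealMr IK).
  by apply: (Defs.idealMr (FI _ FN)); exact: Fa.
- by move=> n m a [].
- move=> n m l a b [Ka Fa] Kb; split=> [|N FN]; first exact: (idealMl IK).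
  by have [_ _ Ni _] := FL _ FN; apply: Ni => //; exact: Fa.
- move=> n m a [Ja [Kta Fta]]; split=> [|N FN]; first by have [] := JK Ja.
  by have [_ _ _ Ns] := FL _ FN; apply: Ns; split=> //; exact: Fta.
Qed.

Lemma Lat_lattice : is_lattice (@fam_le R T) (Lat J K).
Proof.
move=> N1 N2 L1 L2; split.
  exists (capL [set N | N = N1 \/ N = N2]); split.
  - by apply: capL_Lat => N [->|->].
  - by move=> n m a [_ Fa]; apply: Fa; left.
  - by move=> n m a [_ Fa]; apply: Fa; right.
  - move=> w Lw w1 w2 n m a wa; have [_ wK _ _] := Lw; split; first exact: wK.
    by move=> N [->|->]; [exact: w1|exact: w2].
have [_ N1K _ _] := L1; have [_ N2K _ _] := L2.
exists (capL [set N | [/\ Lat J K N, fam_le N1 N & fam_le N2 N]]); split.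
- by apply: capL_Lat => N [].
- by move=> n m a Na; split=> [|N [_ + _]]; [exact: N1K|apply].
- by move=> n m a Na; split=> [|N [_ _ +]]; [exact: N2K|apply].
- by move=> w Lw w1 w2 n m a [_ Fa]; apply: Fa.
Qed.

End InvariantLattice.

Lemma closed_lipschitz (R : realType) (V V' : normedModType (Cx R)) (F : V -> V') (C : R)
    (S : set V') u : 0 <= C -> (forall w w', nrm (F w - F w') <= C * nrm (w - w')) -> closed S ->
  (forall e : R, 0 < e -> exists2 w, S (F w) & nrm (u - w) <= e) -> S (F u).
Proof.
move=> C0 Fl /closed_nrm cS ul; apply: cS => e e0.
have C1 : 0 < C + 1 by rewrite ltr_wpDl.
have [w Sw uw] := ul _ (divr_gt0 e0 C1); exists (F w) => //.
apply: le_trans (Fl _ _) _; apply: le_trans (ler_wpM2l C0 uw) _.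
by rewrite mulrCA ler_piMr ?(ltW e0) // ler_pdivrMr // mul1r lerDl.
Qed.

Section StarSubalgebras.
Variables (R : realType) (A B : cstarAlg R).

Lemma cideal_gen_cideal (S : set A) : is_cideal (cideal_gen S).
Proof.
split=> [|P [PI _]|c a b Sa Sb P PS|a b Sb P PS|a b Sa P PS].
- by apply: closed_bigI => P [PI _]; exact: (cideal_closed PI).
- exact: (cideal0 PI).
- by case: (PS) => PI _; apply: (cidealD PI); [exact: Sa|exact: Sb].
- by case: (PS) => PI _; apply: (cidealMl PI); exact: Sb.
- by case: (PS) => PI _; apply: (cidealMr PI); exact: Sa.
Qed.

Lemma cideal_gen_sub (S P : set A) : is_cideal P -> S `<=` P -> cideal_gen S `<=` P.
Proof. by move=> PI SP a; apply. Qed.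

Lemma sub_cideal_gen (S : set A) : S `<=` cideal_gen S.
Proof. by move=> a Sa P [_]; apply. Qed.

Lemma zero_cideal : is_cideal [set 0 : A].
Proof.
split=> [|//|c a b /= -> ->|a b /= ->|a b /= ->].
- apply/closed_nrm => x xl /=; apply/nrm_eq0/eqP; rewrite eq_le nrm_ge0 andbT.
  by apply/ler_addgt0Pr => e /xl[y /= ->]; rewrite subr0 add0r.
- by rewrite scaler0 addr0.
- by rewrite ca_mul0r.
- by rewrite ca_mul0l.
Qed.

Lemma cideal_subcstar (P : set A) : is_cideal P -> is_subcstar P.
Proof.
move=> PI; split; [exact: cideal_closed|exact: cideal0|exact: (cidealD PI)| |].
  by move=> a b Pa _; exact: (cidealMr PI).
by move=> a; exact: cideal_star.
Qed.

Lemma cideal_of_cstar (P : set A) a : is_cideal P -> P (ca_mul (ca_star a) a) -> P a.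
Proof.
move=> PI Paa; have P0 := cideal0 PI; have PL := cidealD PI.
apply: (qnorm_eq0 P0 (cideal_closed PI)); apply/eqP.
by rewrite -sqrf_eq0 -(qnorm_cstar PI) (qnorm_in P0 PL Paa).
Qed.

Variable f : A -> B.
Hypothesis fH : is_starhom f.

Lemma preim_closed (S : set B) : closed S -> closed (f @^-1` S).
Proof.
move=> /closed_nrm cS; apply/closed_nrm => x xl; apply: cS => e e0.
have [y Sy xy] := xl e e0; exists (f y) => //.
by rewrite -(starhomB fH) (le_trans (starhom_contr fH _)).
Qed.

Lemma preim_cideal (P : set B) : is_cideal P -> is_cideal (f @^-1` P).
Proof.
move=> PI; split=> [||c a b|a b|a b]; rewrite /preimage /=.
- exact: preim_closed (cideal_closed PI).
- by rewrite (starhom0 fH); exact: cideal0.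
- by rewrite (starhomD fH); exact: (cidealD PI).
- by rewrite (starhomM fH); exact: (cidealMl PI).
- by rewrite (starhomM fH); exact: (cidealMr PI).
Qed.

Lemma preim_subcstar (S : set B) : is_subcstar S -> is_subcstar (f @^-1` S).
Proof.
move=> SP; split=> [||c a b|a b|a]; rewrite /preimage /=.
- exact: preim_closed (subcstar_closed SP).
- by rewrite (starhom0 fH); exact: subcstar0.
- by rewrite (starhomD fH); exact: (subcstarD SP).
- by rewrite (starhomM fH); exact: (subcstarM SP).
- by rewrite (starhom_star fH); exact: (subcstar_star SP).
Qed.

Lemma equalizer_subcstar (g : A -> B) : is_starhom g -> is_subcstar [set x | f x = g x].
Proof.
move=> gH; split=> [||c a b /= fa fb|a b /= fa fb|a /= fa] /=.
- apply/closed_nrm => x xl; apply/eqP; rewrite -subr_eq0; apply/eqP/nrm_eq0/eqP.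
  rewrite eq_le nrm_ge0 andbT; apply/ler_addgt0Pr => e e0.
  have e2 : 0 < e / 2 by rewrite divr_gt0.
  have [y /= fy xy] := xl _ e2.
  have -> : f x - g x = f (x - y) - g (x - y).
    by rewrite (starhomB fH) (starhomB gH) fy opprB addrA subrK.
  rewrite add0r (le_trans (nrmB _ _)) // [leRHS]splitr lerD //.
    exact: le_trans (starhom_contr fH _) xy.
  exact: le_trans (starhom_contr gH _) xy.
- by rewrite (starhom0 fH) (starhom0 gH).
- by rewrite (starhomD fH) (starhomD gH) fa fb.
- by rewrite (starhomM fH) (starhomM gH) fa fb.
- by rewrite (starhom_star fH) (starhom_star gH) fa.
Qed.

Hypothesis finj : forall x, f x = 0 -> x = 0.

Lemma starhom_isometry x : nrm x <= nrm (f x).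
Proof.
apply: le_trans (qnorm_kernel fH x); apply/ler_addgt0Pr => e e0.
have [w /= w0 xw] := qnorm_ex (cideal0 (kernel_cideal fH)) x e0.
by rewrite (finj w0) subr0 in xw.
Qed.

Lemma starhom_range_closed : closed (range f).
Proof.
apply/closed_nrm => y yl; have h0 k : 0 < 2^-1 ^+ k :> R by rewrite exprn_gt0 // invr_gt0.
have xP k : exists x, nrm (y - f x) <= 2^-1 ^+ k.
  by have [_ [x _ <-] yx] := yl _ (h0 k); exists x.
pose u k := projT1 (cid (xP k)); have uP k : nrm (y - f (u k)) <= 2^-1 ^+ k := projT2 (cid (xP k)).
have uc : seq_cauchy u.
  apply: (@geometric_cauchy _ _ _ 2) => k; apply: le_trans (starhom_isometry _) _.
  rewrite (starhomB fH) (le_trans (nrm_tri y _ _)) // nrmC.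
  by have := uP k; have := uP k.+1; have := half_expS_sum R k; have := h0 k.+1; lra.
have [x ux] := ca_seq_complete uc; exists x => //; apply/eqP; rewrite -subr_eq0; apply/eqP/nrm_eq0/eqP.
rewrite eq_le nrm_ge0 andbT; apply/ler_addgt0Pr => e e0; rewrite add0r.
have e2 : 0 < e / 2 by rewrite divr_gt0.
have [M uM] := ux _ e2; have [M' dM] := half_exp_small e2.
set k := maxn M M'; rewrite (le_trans (nrm_tri (f (u k)) _ _)) // [leRHS]splitr lerD //.
  rewrite nrmC -(starhomB fH) (le_trans (starhom_contr fH _)) //.
  by apply: uM; rewrite leq_maxl.
by rewrite nrmC; apply: le_trans (uP k) (dM _ _); rewrite leq_maxr.
Qed.

Lemma range_subcstar : is_subcstar (range f).
Proof.
split=> [||c _ _ [x _ <-] [y _ <-]|_ _ [x _ <-] [y _ <-]|_ [x _ <-]].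
- exact: starhom_range_closed.
- by exists 0 => //; rewrite (starhom0 fH).
- by exists (c *: x + y) => //; rewrite (starhomD fH).
- by exists (ca_mul x y) => //; rewrite (starhomM fH).
- by exists (ca_star x) => //; rewrite (starhom_star fH).
Qed.

End StarSubalgebras.

Section UniversalAlgebra.
Variables (R : realType) (T : rtCstarPrecat R) (K J : ideal T).
Hypotheses (JK : fam_le J (Jof K)) (red : reducible K J).
Variables (O : cstarAlg R) (iota : forall n m, T n m -> O).
Arguments iota : clear implicits.
Hypothesis univ : is_universal K J iota.
Let IK := idealP K.
Let IJ := idealP J.
Let iK := univ_rep univ.
Let iJ := univ_coisometric univ.
Let gen := univ_generated univ.

Definition rep_preim (P : set O) : fam T := fun n m => [set a | K n m a /\ P (iota n m a)].
Arguments rep_preim P n m : clear implicits.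

(** The product rule for iota says nothing about factors outside [K]. A product y = ab with b in the
    preimage is handled through y^*y = (y^*a) b, a product of two elements of [K], and
    [cideal_of_cstar]; the other side uses yy^*. *)
Lemma rep_preim_ideal P : is_cideal P -> is_ideal (rep_preim P).
Proof.
move=> PI; split.
- move=> n m; apply/closed_nrm => a al; have Ka : K n m a.
    by apply: (ideal_lim IK) => e /al[y [Ky _] ay]; exists y.
  split=> //; move/closed_nrm: (cideal_closed PI); apply=> e e0.
  have [y [Ky Py] ay] := al e e0; exists (iota n m y) => //.
  by rewrite -(repB iK) // (le_trans (rep_contr IK iK _)) //; exact: idealB.
- by move=> n m; split; [exact: (ideal0 IK)|rewrite (rep0 IK iK); exact: cideal0].
- move=> n m c a b [Ka Pa] [Kb Pb]; split; first exact: (idealD IK).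
  by rewrite (repD iK) //; exact: (cidealD PI).
- move=> n m l a b [Kb Pb]; have Kab : K n l (acomp a b) by exact: (idealMl IK).
  split=> //; apply: (cideal_of_cstar PI); rewrite (rep_star iK) //.
  rewrite (repM0 iK) //; last exact: (ideal_star IK).
  rewrite acompA -(repM0 iK) //; first exact: (cidealMl PI).
  by rewrite astarM; apply: (Defs.idealMr IK); apply: (Defs.idealMr IK); exact: (ideal_star IK).
- move=> n m l a b [Ka Pa]; have Kab : K n l (acomp a b) by exact: (Defs.idealMr IK).
  have sKab := ideal_star IK Kab.
  split=> //; rewrite -[iota _ _ _]ca_starK; apply: (cideal_star PI).
  apply: (cideal_of_cstar PI); rewrite ca_starK (rep_star iK) // (repM0 iK) //.
  rewrite -acompA -(repM0 iK) //; first exact: (cidealMr PI).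
  by rewrite astarM acompA; apply: (idealMl IK); exact: (ideal_star IK).
Qed.

Lemma rep_preim_Lat P : is_cideal P -> Lat J K (rep_preim P).
Proof.
move=> PI; split; [exact: rep_preim_ideal|by move=> n m a []| |].
- move=> n m l a b [Ka Pa] Kb; split; first exact: (idealMl IK).
  by rewrite -(@repM _ _ _ _ _ iK n m 1 l a b) //; exact: (cidealMr PI).
- move=> n m a [Ja [Kta Pta]]; have [Ka _] := JK Ja.
  by split=> //; rewrite (iJ Ja).
Qed.

(** The Fock representation modulo N factors through O, and the kernel of the factor map is a closed
    ideal containing iota(N), hence the generated ideal. *)
Lemma rep_in_gen N n m (a : T n m) : Lat J K N -> K n m a ->
  cideal_gen (rep_image N iota) (iota n m a) -> N n m a.
Proof.
move=> NL Ka Na; have [B [pi [piK piJ piN piK']]] := fock_representation IJ JK NL red.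
have [phi phiH phiE] := univ_factor univ piK piJ.
have [_ NK _ _] := NL; apply: piK' => //; rewrite -phiE //.
apply: (cideal_gen_sub (kernel_cideal phiH) _ Na) => _ [k _ [l _ [b Nb <-]]] /=.
by rewrite phiE ?piN //; exact: NK.
Qed.

Lemma rep_preim_gen N : Lat J K N -> rep_preim (cideal_gen (rep_image N iota)) = N.
Proof.
move=> NL; have [_ NK _ _] := NL; apply: functional_extensionality_dep => n; apply: functional_extensionality_dep => m; apply/seteqP; split=> a.
  by move=> [Ka Ga]; exact: rep_in_gen Ga.
by move=> Na; split; [exact: NK|apply: sub_cideal_gen; exists n => //; exists m => //; exists a].
Qed.

Variable gamma : R[i] -> O -> O.
Hypothesis gammaP : is_gauge K iota gamma.

Lemma gen_rep_preim P : Lat_gauge gamma P -> cideal_gen (rep_image (rep_preim P) iota) = P.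
Proof.
move=> [PI gP]; apply/seteqP; split.
  by apply: cideal_gen_sub => // _ [n _ [m _ [a [Ka Pa] <-]]].
apply: (gauge_ideal_incl IK JK red iK iJ PI (cideal_gen_cideal _) _ gen gammaP gP) => n m a Ka Pa.
by apply: sub_cideal_gen; exists n => //; exists m => //; exists a.
Qed.

Lemma gen_gauge N : fam_le N K -> is_ideal N -> Lat_gauge gamma (cideal_gen (rep_image N iota)).
Proof.
move=> NK IN; split=> [|z z1 _ [x Gx <-]]; first exact: cideal_gen_cideal.
have [gH gE] := gammaP z1; have GI := cideal_gen_cideal (rep_image N iota).
apply: (cideal_gen_sub (preim_cideal gH GI) _ Gx) => _ [n _ [m _ [a Na <-]]].
rewrite /preimage /= gE; last exact: NK.
apply: (lin_scale (cideal0 GI) (cidealD GI)); apply: sub_cideal_gen.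
by exists n => //; exists m => //; exists a.
Qed.

Lemma gen_mono N N' : fam_le N N' ->
  cideal_gen (rep_image N iota) `<=` cideal_gen (rep_image N' iota).
Proof.
move=> NN'; apply: cideal_gen_sub; first exact: cideal_gen_cideal.
move=> _ [n _ [m _ [a Na <-]]]; apply: sub_cideal_gen; exists n => //; exists m => //.
by exists a => //; exact: NN'.
Qed.

Lemma rep_preim_mono P P' : P `<=` P' -> fam_le (rep_preim P) (rep_preim P').
Proof. by move=> PP' n m a [Ka Pa]; split=> //; exact: PP'. Qed.

End UniversalAlgebra.

Section Gauge.
Variables (R : realType) (T : rtCstarPrecat R) (K J : fam T).
Variables (O : cstarAlg R) (iota : forall n m, T n m -> O).
Hypothesis univ : is_universal K J iota.
Arguments K : clear implicits.
Arguments iota : clear implicits.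
Let iK := univ_rep univ.

Lemma gauge_rep (z : R[i]) : `|z| = 1 ->
  is_rep K (fun n m (a : T n m) => z ^ (n%:Z - m%:Z) *: iota n m a).
Proof.
move=> z1; have z0 := norm1_neq0 z1; split=> [n m c a b Ka Kb|n m a Ka|n m k l a b Ka Kb].
- by rewrite (repD iK) // scalerDr !scalerA mulrC.
- by rewrite ca_starZ norm1_conj_exprz // opprB (rep_star iK).
- rewrite ca_mulZl ca_mulZr scalerA (repM iK) // -expfzDr //; congr (z ^ _ *: _).
  by lia.
Qed.

(** Supplies a gauge action on the algebra of N, which is given only by its universality: rescaling
    iota by powers of z gives again a coisometric representation. Off the unit circle the value is
    arbitrary. *)
Lemma gauge_exists : exists gamma, is_gauge K iota gamma.
Proof.
have H z : exists g : O -> O, `|z : R[i]| = 1 -> is_starhom g /\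
    forall n m (a : T n m), K n m a -> g (iota n m a) = z ^ (n%:Z - m%:Z) *: iota n m a.
  have [z1|z1] := pselect (`|z| = 1); last by exists id => /z1.
  have [|g gH gE] := univ_factor univ (gauge_rep z1); last by exists g.
  by move=> n m a Ja; rewrite (univ_coisometric univ Ja) !intS opprD addrACA subrr add0r.
by exists (fun z => projT1 (cid (H z))) => z z1; exact: (projT2 (cid (H z)) z1).
Qed.

Lemma starhom_ext (B : cstarAlg R) (f g : O -> B) : is_starhom f -> is_starhom g ->
  (forall n m (a : T n m), K n m a -> f (iota n m a) = g (iota n m a)) -> f = g.
Proof.
move=> fH gH fg; apply/funext => x.
suff S : [set x | f x = g x] = setT by have : [set: O] x by []; rewrite -S.
apply: (univ_generated univ); first exact: equalizer_subcstar.
by move=> _ [n _ [m _ [a Ka <-]]]; exact: fg.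
Qed.

Lemma univ_ind (S : set O) : is_subcstar S -> (forall n m (a : T n m), K n m a -> S (iota n m a)) ->
  forall x, S x.
Proof.
move=> SP Si x; suff -> : S = setT by [].
by apply: (univ_generated univ) => // _ [n _ [m _ [a Ka <-]]]; exact: Si.
Qed.

End Gauge.

(** * A gauge-invariant ideal as the algebra of its preimage in K *)

Section GaugeIdeals.
Variables (R : realType) (T : rtCstarPrecat R) (K J : ideal T).
Hypotheses (JK : fam_le J (Jof K)) (red : reducible K J).
Variables (O : cstarAlg R) (iota : forall n m, T n m -> O).
Arguments iota : clear implicits.
Hypothesis univ : is_universal K J iota.
Variable gamma : R[i] -> O -> O.
Hypothesis gammaP : is_gauge K iota gamma.
Let IK := idealP K.
Let IJ := idealP J.
Let iK := univ_rep univ.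
Let iJ := univ_coisometric univ.

Variable P : set O.
Hypothesis PL : Lat_gauge gamma P.
Let N : fam T := rep_preim K iota P.
Arguments N : clear implicits.
Let NL : Lat J K N. Proof. by apply: (rep_preim_Lat JK univ); case: PL. Qed.
Let IN : is_ideal N. Proof. by case: NL. Qed.
Let NK : fam_le N K. Proof. by case: NL. Qed.

Let JN := famI J N.
Let IJN : is_ideal JN. Proof. exact: famI_ideal. Qed.

Lemma sub_Jof : fam_le JN (Jof N).
Proof.
move=> n m a [Ja Na]; split=> //.
by apply: (tens_in_N IK NL) => //; have [] := JK Ja.
Qed.

(** The dichotomy passes to N and [JN], so the comparison of ideals applies to the algebra of N: in
    case i) by approximate units of N and closedness of the sum, in case ii) because saturation puts
    the element of [J] found below into N. *)
Lemma sub_reducible : reducible N JN.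
Proof.
have [_ _ _ Nsat] := NL; case: red => [Ki|[pull inj]]; [left|right; split].
- move=> n m a Na; apply: (ideal_lim (famD_ideal IJN (ker_tens_ideal T))) => e e0.
  have [c [Nc _ _ _ ac]] := ideal_left_unit IN Na e0; exists (acomp c a) => //.
  have [j Jj [k kk <-]] := Ki _ _ _ (NK Na); rewrite acompDr.
  exists (acomp c j); first by split; [exact: (idealMl IJ)|exact: (Defs.idealMr IN)].
  by exists (acomp c k) => //; apply: (idealMl (ker_tens_ideal T)).
- move=> n m a Na; have [b Jb bE] := pull _ _ _ (NK Na); exists b => //; split=> //.
  by apply: Nsat; split=> //; rewrite /tens_preim /= bE.
- by move=> n m a [Ja _]; exact: inj.
Qed.

Variables (O' : cstarAlg R) (iota' : forall n m, T n m -> O').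
Arguments iota' : clear implicits.
Hypothesis univ' : is_universal N JN iota'.
Let iK' := univ_rep univ'.

(** Relative to N and [JN] this is a preimage as before, so invariant under N. Approximate units of
    N extend invariance to [K], and saturation of N gives saturation for [J]; the Fock
    representation of [K] modulo this family is then available. *)
Lemma kernel_Lat : Lat J K (fun n m => [set a | N n m a /\ iota' n m a = 0]).
Proof.
pose KN := Ideal IN; pose KJN := Ideal IJN.
have [ZI _ ZN _] : Lat KJN KN (rep_preim KN iota' [set 0]).
  apply: (@rep_preim_Lat _ _ KN KJN sub_Jof _ _ univ'); exact: zero_cideal.
have [_ _ Ninv Nsat] := NL.
split=> [//|n m a [Na _]|n m l a b Za Kb|n m a [Ja [Nta ta0]]]; first exact: NK.
- have Nx : N n.+1 l (acomp (tens a) b) by apply: Ninv => //; case: Za.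
  apply: (ideal_lim ZI) => e e0; have [c [Nc _ _ _ xc]] := ideal_right_unit IN Nx e0.
  exists (acomp (acomp (tens a) b) c) => //.
  by rewrite -acompA; apply: ZN => //; exact: (idealMl IN).
- have Na : N n m a by apply: Nsat.
  by split=> //; rewrite (univ_coisometric univ') //; split.
Qed.

(** 0 lies in the ideal of O generated by the family of [kernel_Lat], so by [rep_in_gen] an a with
    iota(a) = 0 belongs to that family. *)
Lemma sub_kernel n m (a : T n m) : N n m a -> iota n m a = 0 -> iota' n m a = 0.
Proof.
move=> Na a0; have [|_ //] := rep_in_gen JK red univ kernel_Lat (NK Na).
by rewrite a0; apply: cideal0; exact: cideal_gen_cideal.
Qed.

Let tensn_N := @tensn_ideal _ _ K J N JK NL red.

Lemma rep_image_mul p q n m (b : T p q) (a : T n m) : K p q b -> N n m a ->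
  rep_image N iota (ca_mul (iota p q b) (iota n m a)) /\
  rep_image N iota (ca_mul (iota n m a) (iota p q b)).
Proof.
have im r s (c : T r s) : N r s c -> rep_image N iota (iota r s c).
  by move=> Nc; exists r => //; exists s => //; exists c.
have ims x : rep_image N iota x -> rep_image N iota (ca_star x).
  move=> [r _ [s _ [c Nc <-]]]; rewrite (rep_star iK); last exact: NK.
  by apply: im; exact: (ideal_star IN).
have right r s u v (x : T r s) (y : T u v) : N r s x -> K u v y ->
    rep_image N iota (ca_mul (iota r s x) (iota u v y)).
  move=> Nx; have [su|/ltnW us] := leqP s u.
    move: y; rewrite -(subnK su) => y Ky; rewrite (repM iK) //; last exact: NK.
    by apply: im; exact: tensn_N.
  move=> Ky; rewrite -[ca_mul _ _]ca_starK; apply: ims.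
  have Nx' := ideal_star IN Nx; have Ky' := ideal_star IK Ky.
  rewrite ca_starM !(rep_star iK) //; last exact: NK.
  move: (astar x) Nx' (astar y) Ky'; rewrite -(subnK us) => x' Nx' y' Ky'.
  rewrite (repM iK) //; last exact: NK.
  by apply: im; exact: (idealMl IN).
move=> Kb Na; split; last exact: right.
rewrite -[ca_mul _ _]ca_starK; apply: ims.
rewrite ca_starM !(rep_star iK) //; last exact: NK.
by apply: right; [exact: (ideal_star IN)|exact: (ideal_star IK)].
Qed.

(** Universality of O' extends iota on N to phi. Its kernel is gauge invariant and meets iota'(N)
    only in 0, so the comparison of ideals with P0 = 0 makes phi injective. Its range is then
    closed, is an ideal, and contains the generators iota(N) of P. *)
Theorem gauge_ideal_universal : star_isomorphic O' P.
Proof.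
have [PI gP] := PL.
have rN : is_rep N iota.
  split=> [n m c a b Na Nb|n m a Na|n m k l a b Na Nb].
  - by apply: (repD iK); exact: NK.
  - by apply: (rep_star iK); exact: NK.
  - by apply: (repM iK); exact: NK.
have cN : coisometric JN iota by move=> n m a [Ja _]; exact: iJ.
have [phi phiH phiE] := univ_factor univ' rN cN.
have [gamma' gammaP'] := gauge_exists univ'.
have inj x : phi x = 0 -> x = 0.
  apply: (gauge_ideal_incl IN sub_Jof sub_reducible iK' (univ_coisometric univ')
    (kernel_cideal phiH) (zero_cideal O') _ (univ_generated univ') gammaP').
    by move=> n m a Na /=; rewrite phiE //; exact: sub_kernel.
  move=> z z1 _ [x' /= x0 <-]; have [g'H g'E] := gammaP' z z1; have [gH gE] := gammaP z1.
  have comm : phi \o gamma' z = gamma z \o phi.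
    apply: (starhom_ext univ').
    - by split=> [c u v|u v|u] /=; [rewrite (starhomD g'H) (starhomD phiH)|
        rewrite (starhomM g'H) (starhomM phiH)|rewrite (starhom_star g'H) (starhom_star phiH)].
    - by split=> [c u v|u v|u] /=; [rewrite (starhomD phiH) (starhomD gH)|
        rewrite (starhomM phiH) (starhomM gH)|rewrite (starhom_star phiH) (starhom_star gH)].
    - move=> n m a Na /=; rewrite g'E // (starhomZ phiH) !phiE // gE //.
      exact: NK.
  by rewrite -[LHS]/((phi \o gamma' z) x') comm /= x0 (starhom0 gH).
have imP := range_subcstar phiH inj.
have inP x : P (phi x).
  apply: (univ_ind univ' (S := phi @^-1` P)); first exact: preim_subcstar (cideal_subcstar PI).
  by move=> n m a Na; rewrite /preimage /= phiE //; case: Na.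
(* The range absorbs the generators of O: on generators of O' this is [rep_image_mul], and the x
   with this property form a C*-subalgebra. The same device then replaces the generators of O by all
   of O. *)
have mulK x p q (b : T p q) : K p q b ->
    range phi (ca_mul (iota p q b) (phi x)) /\ range phi (ca_mul (phi x) (iota p q b)).
  move: p q b; apply: (univ_ind univ' (S := [set x | forall p q (b : T p q), K p q b ->
    range phi (ca_mul (iota p q b) (phi x)) /\ range phi (ca_mul (phi x) (iota p q b))])) => /=.
    split=> [||c u v Su Sv|u v Su Sv|u Su] /=.
    - apply/closed_nrm => u ul p q b Kb.
      split.
        apply: (@closed_lipschitz R O' O (fun w => ca_mul (iota p q b) (phi w)) _ (range phi) u (nrm_ge0 (iota p q b))).
        + move=> w w'; rewrite -ca_mulBr -(starhomB phiH) (le_trans (ca_nrmM _ _)) //.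
          by rewrite ler_wpM2l ?nrm_ge0 // starhom_contr.
        + exact: (subcstar_closed imP).
        + by move=> e /ul[w Sw uw]; exists w => //; have [] := Sw _ _ _ Kb.
      apply: (@closed_lipschitz R O' O (fun w => ca_mul (phi w) (iota p q b)) _ (range phi) u (nrm_ge0 (iota p q b))).
      + move=> w w'; rewrite -ca_mulBl -(starhomB phiH) (le_trans (ca_nrmM _ _)) // mulrC.
        by rewrite ler_wpM2l ?nrm_ge0 // starhom_contr.
      + exact: (subcstar_closed imP).
      + by move=> e /ul[w Sw uw]; exists w => //; have [] := Sw _ _ _ Kb.
    - move=> p q b _; rewrite (starhom0 phiH) ca_mul0l ca_mul0r.
      by split; exact: (subcstar0 imP).
    - move=> p q b Kb; have [x1 x2] := Su _ _ _ Kb; have [y1 y2] := Sv _ _ _ Kb.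
      rewrite (starhomD phiH) ca_mulDr ca_mulDl.
      by split; exact: (subcstarD imP).
    - move=> p q b Kb; have [x1 _] := Su _ _ _ Kb; have [_ y2] := Sv _ _ _ Kb.
      rewrite (starhomM phiH) -ca_mulA ca_mulA.
      by split; apply: (subcstarM imP).
    - move=> p q b Kb; have [x1 x2] := Su _ _ _ (ideal_star IK Kb).
      rewrite (starhom_star phiH) -[iota p q b]ca_starK (rep_star iK) // -!ca_starM.
      by split; exact: (subcstar_star imP).
  move=> n m a Na p q b Kb; rewrite phiE //.
  have imN y : rep_image N iota y -> range phi y.
    by move=> [r _ [s _ [c Nc <-]]]; exists (iota' r s c) => //; rewrite phiE.
  by have [/imN ? /imN ?] := rep_image_mul Kb Na.
have imI : is_cideal (range phi).
  have H : forall y : O, forall x, range phi (ca_mul y (phi x)) /\ range phi (ca_mul (phi x) y).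
    apply: (univ_ind univ (S := [set y | forall x,
      range phi (ca_mul y (phi x)) /\ range phi (ca_mul (phi x) y)])) => /=; last first.
      by move=> p q b Kb x; exact: mulK.
    split=> [||c u v Su Sv|u v Su Sv|u Su] /=.
    - apply/closed_nrm => u ul x.
      split.
        apply: (@closed_lipschitz R O O (fun w => ca_mul w (phi x)) _ (range phi) u (nrm_ge0 (phi x))).
        + by move=> w w'; rewrite -ca_mulBl (le_trans (ca_nrmM _ _)) // mulrC.
        + exact: (subcstar_closed imP).
        + by move=> e /ul[w Sw uw]; exists w => //; have [] := Sw x.
      apply: (@closed_lipschitz R O O (fun w => ca_mul (phi x) w) _ (range phi) u (nrm_ge0 (phi x))).
      + by move=> w w'; rewrite -ca_mulBr (le_trans (ca_nrmM _ _)).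
      + exact: (subcstar_closed imP).
      + by move=> e /ul[w Sw uw]; exists w => //; have [] := Sw x.
    - move=> x; rewrite ca_mul0l ca_mul0r.
      by split; exact: (subcstar0 imP).
    - move=> x; have [x1 x2] := Su x; have [y1 y2] := Sv x.
      rewrite ca_mulDr ca_mulDl.
      by split; exact: (subcstarD imP).
    - move=> x; rewrite -(ca_mulA u v) (ca_mulA (phi x) u).
      have [[x1 _ <-] _] := Sv x; have [_ [x2 _ <-]] := Su x.
      by split; [have [] := Su x1|have [] := Sv x2].
    - move=> x; have [x1 x2] := Su (ca_star x); move: x1 x2; rewrite (starhom_star phiH) => x1 x2.
      rewrite -[phi x]ca_starK -!ca_starM.
      by split; exact: (subcstar_star imP).
  split; [exact: (subcstar_closed imP)|exact: (subcstar0 imP)|exact: (subcstarD imP)| |].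
    by move=> a _ [x _ <-]; have [] := H a x.
  by move=> _ b [x _ <-]; have [] := H b x.
exists phi => //; split=> [x _|x y _ _ xy|y Py]; first exact: inP.
  by apply/eqP; rewrite -subr_eq0; apply/eqP/inj; rewrite (starhomB phiH) xy subrr.
suff [x _ <-] : range phi y by exists x.
move: Py; rewrite -(gen_rep_preim JK red univ gammaP PL); apply: cideal_gen_sub => //.
by move=> _ [n _ [m _ [a Na <-]]]; exists (iota' n m a) => //; rewrite phiE.
Qed.

End GaugeIdeals.

Theorem theorem7p8 (R : realType) (T : rtCstarPrecat R) (K J : ideal T)
    (O : cstarAlg R) (iota : forall n m : nat, T n m -> O)
    (gamma : R[i] -> O -> O) :
  fam_le J (Jof K) ->
  is_universal K J iota ->
  is_gauge K iota gamma ->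
  (fam_le K (famD J (ker_tens T)) \/
   (admits_transfer K /\
    exists2 P : fam T, is_annihilator (ker_tens T) P &
      forall n m, J n m = famI (Jof K) P n m)) ->
  [/\ (forall N' : fam (KJ K J), Lat_self N' ->
         exists2 N : fam T, Lat J K N & is_NJ N N'),
      (exists2 f : fam T -> fam (KJ K J),
         lattice_iso (@fam_le R T) (@fam_le R (KJ K J)) (Lat J K) (@Lat_self R (KJ K J)) f &
         forall N : fam T, Lat J K N -> is_NJ N (f N)),
      (exists g : fam (KJ K J) -> set O,
         lattice_iso (@fam_le R (KJ K J)) (@subset O)
           (@Lat_self R (KJ K J)) (Lat_gauge gamma) g) &
      forall P : set O, Lat_gauge gamma P ->
        exists N : fam T,
          [/\ is_ideal N, fam_le N K, Kinvariant K N,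
              P = cideal_gen (rep_image N iota) &
              forall (O' : cstarAlg R) (iota' : forall n m : nat, T n m -> O'),
                is_universal N (famI J N) iota' -> star_isomorphic O' P]].
Proof.
move=> JK univ gammaP cond.
have red : reducible K J by apply: reducible_of => //; exact: idealP.
have fL N : Lat J K N -> Lat_self (@NJ R T K J N) by move=> NL; exact: NJ_Lat_self.
have gL N' : Lat_self N' -> Lat J K (@diag_part R T K J N') by exact: diag_part_Lat.
have gf N : Lat J K N -> @diag_part R T K J (@NJ R T K J N) = N by exact: diag_part_NJ.
have fg N' : Lat_self N' -> @NJ R T K J (@diag_part R T K J N') = N' by move=> NL; exact: NJ_diag_part.
have fle N1 N2 : Lat J K N1 -> Lat J K N2 -> fam_le N1 N2 ->
    fam_le (@NJ R T K J N1) (@NJ R T K J N2).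
  by move=> _ _ N12 n m _ [a [aM aN] <-]; exists a => //; split=> // i j; exact: N12.
have gle N1 N2 : Lat_self N1 -> Lat_self N2 -> fam_le N1 N2 ->
    fam_le (@diag_part R T K J N1) (@diag_part R T K J N2).
  by move=> _ _ N12 n m a [Ka Na]; split=> //; exact: N12.
(* Mutually inverse monotone maps transport meets and joins, so the lattice property of one side
   gives that of the other. *)
have iso := lattice_iso_of fL gL gf fg fle gle (Lat_lattice JK).
have pL P : Lat_gauge gamma P -> Lat J K (rep_preim K iota P).
  by move=> [PI _]; exact: (rep_preim_Lat JK univ).
split.
- by move=> N' NL'; exists (diag_part N'); [exact: gL|rewrite -{2}(fg _ NL'); apply: is_NJ_NJ => //; exact: gL].
- by exists (@NJ R T K J) => // N NL; exact: is_NJ_NJ.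
- exists (fun N' => cideal_gen (rep_image (@diag_part R T K J N') iota)).
  apply: (@lattice_iso_of _ _ _ _ _ _ _ (fun P => @NJ R T K J (rep_preim K iota P))).
  + by move=> N' /gL[IN NK _ _]; exact: (gen_gauge gammaP NK IN).
  + by move=> P /pL/fL.
  + by move=> N' NL'; rewrite (rep_preim_gen JK red univ (gL _ NL')) fg.
  + move=> P PL; rewrite (gf _ (pL _ PL)); exact: (gen_rep_preim JK red univ gammaP PL).
  + by move=> N1 N2 L1 L2 /(gle _ _ L1 L2); exact: gen_mono.
  + by move=> P1 P2 L1 L2 P12; apply: fle; [exact: pL|exact: pL|exact: rep_preim_mono].
  + by case: iso.
- move=> P PL; exists (rep_preim K iota P); have [IN NK Ni _] := pL _ PL; split=> //.
    exact/esym/(gen_rep_preim JK red univ gammaP PL).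
  by move=> O' iota' univ'; exact: (gauge_ideal_universal JK red univ gammaP PL univ').
Qed.
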